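(* Let $(X,\mathcal{F},\mu)$ be a $\sigma$-finite measure space, let $1<p<\infty$, and let $T$ be a bounded positive invertible operator on $L^p(X,\mathcal{F},\mu)$ with positive inverse. Then the following conditions are equivalent: (i) There exists a constant $C>0$ such that for all $f\in L^p(X,\mathcal{F},\mu)$ $$\sup_{N\ge0}\int_X|A_N^+(T)(f)(x)|^p\,d\mu(x)\le C\int_X|f(x)|^p\,d\mu(x).$$ (ii) For any $2<q<\infty$ (or equivalently, for one $2<q<\infty$) there exists a constant $C>0$ such that for all $f\in L^p(X,\mathcal{F},\mu)$ $$\int_X\big(\mathcal{V}_q\mathcal{A}^+(T)(f)(x)\big)^p\,d\mu(x)\le C\int_X|f(x)|^p\,d\mu(x).$$
   Context: A linear operator $S$ on $L^p$ is positive if $S(f)\ge0$ whenever $f\ge0$. The ergodic averages of $T$ are $A_N^+(T)(f)=\frac1{N+1}\sum_{n=0}^NT^n(f)$, $N\ge0$, and $\mathcal{A}^+(T)(f)(x)=\{A_N^+(T)(f)(x)\}_{N\ge0}$. For a sequence $a=\{a_N\}_{N\ge0}$ of complex numbers, $\|a\|_{v_q}=\sup\big(\sum_{j=0}^\infty|a_{N_j}-a_{N_{j+1}}|^q\big)^{1/q}$, the supremum over all increasing sequences $\{N_j\}$ of nonnegative integers. $\mathcal{V}_q\mathcal{A}^+(T)(f)(x)=\|\mathcal{A}^+(T)(f)(x)\|_{v_q}$. *)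

(* Defs.v *)
From HB Require Import structures.
From mathcomp Require Import all_boot all_order all_algebra.
From mathcomp Require Import all_classical all_reals all_analysis.
From mathcomp Require Import complex.

Set Implicit Arguments.
Unset Strict Implicit.
Unset Printing Implicit Defensive.

Import Order.TTheory GRing.Theory Num.Theory.
Import ComplexField.

Local Open Scope classical_set_scope.
Local Open Scope ring_scope.

(* Complex scalars are [R[i]] from real-closed, with real-valued modulus
   [normc]. On [R[i]] the order [0 <= z] means [Re z >= 0] and [Im z = 0]. *)

Section complex_Lp.
Context d (X : measurableType d) (R : realType).
Variables (mu : {measure set X -> \bar R}) (p : R).
Implicit Types (f g : X -> R[i]) (T S : (X -> R[i]) -> (X -> R[i])).

Definition cmod f : X -> R := fun x => Normc.normc (f x).

Definition cLp : set (X -> R[i]) := [set f |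
  [/\ measurable_fun [set: X] (fun x => complex.Re (f x)),
      measurable_fun [set: X] (fun x => complex.Im (f x))
    & finite_norm mu p%:E (cmod f)]].

Definition cLp_norm f : \bar R := 'N[mu]_p%:E [EFin \o cmod f]%E.

(* A bounded linear operator on the Banach space L^p(X; C) of classes modulo
   a.e. equality, presented through its action on representatives: all
   identities between functions hold a.e., and nothing is required of [T]
   outside L^p. *)
Definition Lp_operator T :=
  [/\ forall f, cLp f -> cLp (T f),
      forall f g, cLp f -> cLp g ->
        {ae mu, forall x, f x = g x} -> {ae mu, forall x, T f x = T g x},
      forall (a : R[i]) f g, cLp f -> cLp g ->
        {ae mu, forall x, T (fun y => a * f y + g y) x = a * T f x + T g x}
    & exists M : R, forall f, cLp f -> (cLp_norm (T f) <= M%:E * cLp_norm f)%E].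

Definition Lp_positive T := forall f, cLp f ->
  {ae mu, forall x, 0 <= f x} -> {ae mu, forall x, 0 <= T f x}.

Definition Lp_inverse T S :=
  [/\ Lp_operator S,
      forall f, cLp f -> {ae mu, forall x, S (T f) x = f x}
    & forall f, cLp f -> {ae mu, forall x, T (S f) x = f x}].

End complex_Lp.

Section ergodic_averages.
Context (X : Type) (R : realType).

Definition ergodic_avg (T : (X -> R[i]) -> (X -> R[i])) (N : nat)
    (f : X -> R[i]) : X -> R[i] :=
  fun x => (N.+1%:R)^-1 * \sum_(0 <= n < N.+1) iter n T f x.

Definition vnorm (q : R) (a : nat -> R[i]) : \bar R :=
  ereal_sup [set ((\sum_(0 <= j <oo)
      (Normc.normc (a (N j) - a (N j.+1)) `^ q)%:E) `^ q^-1)%E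
    | N in [set N : nat -> nat | {homo N : i j / (i < j)%N}]].

Definition ergodic_variation (q : R) (T : (X -> R[i]) -> (X -> R[i]))
    (f : X -> R[i]) : X -> \bar R :=
  fun x => vnorm q (fun N => ergodic_avg T N f x).

End ergodic_averages.

Section inequalities.
Context d (X : measurableType d) (R : realType).
Variables (mu : {measure set X -> \bar R}) (p : R).
Variable T : (X -> R[i]) -> (X -> R[i]).

Definition mean_bounded := exists2 C : R, 0 < C &
  forall f, cLp mu p f ->
    (ereal_sup [set \int[mu]_x (cmod (ergodic_avg T N f) x `^ p)%:E
       | N in [set: nat]]
     <= C%:E * \int[mu]_x (cmod f x `^ p)%:E)%E.

Definition variation_bounded (q : R) := exists2 C : R, 0 < C &
  forall f, cLp mu p f ->
    (\int[mu]_x (ergodic_variation q T f x `^ p)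
     <= C%:E * \int[mu]_x (cmod f x `^ p)%:E)%E.

End inequalities.

(* Main.v *)
(* Since T and its inverse S are positive, T preserves f |-> (|f|^p + |g|^p)^(1/p)
   and hence there are weights om_i > 0 with int |T^i g|^p = int |g|^p om_i.
   Testing the mean bound on functions sum_k H_k, with the H_k chosen from the
   weights, shows that for a.e. x the sequence i |-> om_i(x) satisfies the
   one-sided Muckenhoupt condition A_p (with the orientation of i reversed).
   On the integers, the q-variation of forward averages is bounded on l^p(w) for
   such w: a weak (1,1) estimate in the unweighted case (martingale oscillation
   plus short variation, then a Calderon-Zygmund decomposition) and a good-lambda
   inequality against the one-sided maximal function.  By transference, a
   variation V_L over indices up to L satisfies V_L(f) <= T^i V_L(S^i f), so that
   averaging over i in [L, 2L] reduces the L^p bound for V_L(f) to the integers,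
   uniformly in L; let L tend to infinity.
   Conversely A_0 f = f, hence |A_N f| <= |f| + V_q f. *)
Require Import Defs.
From HB Require Import structures.
From mathcomp Require Import all_boot all_order all_algebra.
From mathcomp Require Import all_classical all_reals all_analysis.
From mathcomp Require Import measurable_realfun complex zify ring lra.

Set Implicit Arguments.
Unset Strict Implicit.
Unset Printing Implicit Defensive.

Import Order.TTheory GRing.Theory Num.Theory.

Local Open Scope ring_scope.

(** * Variation of finite sequences *)

(** No point transformation underlies $T$, so the passage to the integers rests on order alone: the
    norm [theta] is a supremum of countably many linear forms, finite variations are built from it,
    and for such norms the norm of the images under a positive operator is at most the image of the
    norm. On the integers the obstacle is that a one-sided weight need not be doubling. A sparse
    subset of $[a,b]$ is controlled only by the weight of a longer interval $[a,c]$, with the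
    sparsity measured against $c-b$. This is why the components of $\{V>\lambda\}$ are cut according
    to the distance to their right endpoint. The condition $q>2$ enters through jump counting: jumps
    of height about $2^{-i}\lambda$ are counted with a cost of order $4^i/\lambda^2$ and contribute
    $2^{-qi}\lambda^q$ each, so the series in $i$ has ratio $4\cdot2^{-q}<1$. Finally, the variation
    is a supremum over uncountably many sequences and is not shown to be measurable; its integral is
    only compared with integrals of measurable functions above or below it. *)

Section variation.
Context {R : realType}.
Implicit Types (q s : R) (c h : nat -> R).

(** No root is taken, so that sums along consecutive pieces of a path add up: [vq] is the q-th power
    of the usual variation. *)
Fixpoint vsum q c (x : nat) (l : seq nat) : R :=
  if l is y :: l' then `|c x - c y| `^ q + vsum q c y l' else 0.

Definition vlist q c l : R := if l is x :: l' then vsum q c x l' else 0.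

(* The maximum over the subsets of {0, ..., L}, encoded as bit masks. *)
Definition vq q c (L : nat) : R :=
  \big[Num.max/0]_(m : L.+1.-tuple bool) vlist q c (mask m (iota 0 L.+1)).

Lemma vsum_ge0 q c x l : 0 <= vsum q c x l.
Proof. by elim: l x => //= y l IH x; rewrite addr_ge0 ?powR_ge0. Qed.

Lemma vq_ge0 q c L : 0 <= vq q c L.
Proof. exact: bigmax_ge_id. Qed.

Lemma path_leq_last x l : path leq x l -> (x <= last x l)%N.
Proof. by elim: l x => //= y l IH x /andP[xy /IH]; exact: leq_trans. Qed.

Lemma path_ltn_last x l : path ltn x l -> (x <= last x l)%N.
Proof.
by move=> pl; apply: path_leq_last; apply: sub_path pl => a b; exact: ltnW.
Qed.

Lemma le_vq q c L x l : path ltn x l -> (last x l <= L)%N ->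
  vsum q c x l <= vq q c L.
Proof.
move=> pxl lL.
have xl_le : {in x :: l, forall y, (y <= L)%N}.
  move=> y yl; apply: leq_trans lL.
  have : path leq x l by apply: sub_path pxl => a b; exact: ltnW.
  move: yl; elim: l x {pxl} => [x|z l IH x] /=; first by rewrite inE => /eqP->.
  rewrite inE => /orP[/eqP-> /andP[xz zl]|yl /andP[_ zl]]; last exact: IH.
  exact: leq_trans xz (path_leq_last zl).
have : subseq (x :: l) (iota 0 L.+1).
  (* An increasing list is recovered from the full range by testing membership, hence is one of the
     masks. *)
  have ->: x :: l = [seq y <- iota 0 L.+1 | y \in x :: l].
    apply: (@irr_sorted_eq _ ltn) => //; [exact: ltn_trans|exact: ltnn| |].
      by apply: sorted_filter; [exact: ltn_trans|exact: iota_ltn_sorted].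
    move=> y; rewrite mem_filter mem_iota add0n /=.
    by case: (boolP (y \in x :: l)) => // /xl_le; rewrite ltnS => ->.
  exact: filter_subseq.
case/subseqP => m sm e.
have sm' : size m == L.+1 by rewrite sm size_iota.
have := @le_bigmax _ _ _ (0 : R)
  (fun m : L.+1.-tuple bool => vlist q c (mask m (iota 0 L.+1))) (Tuple sm').
by rewrite /= -e /=.
Qed.

Lemma vq_le q c L (S : R) : 0 <= S ->
  (forall x l, path ltn x l -> (last x l <= L)%N -> vsum q c x l <= S) ->
  vq q c L <= S.
Proof.
move=> S0 H; apply/bigmax_leP; split => // m _.
have := @iota_ltn_sorted 0 L.+1 => /(subseq_sorted ltn_trans (mask_subseq m _)).
have : {subset mask m (iota 0 L.+1) <= iota 0 L.+1} by move=> y /mem_mask.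
case: (mask m _) => [|x l]; rewrite /sorted/vlist // => sub pl.
apply: H => //; have := sub _ (mem_last x l).
by rewrite mem_iota add0n ltnS.
Qed.

(** The intervals between consecutive indices of a path are disjoint, so a control that is additive
    over intervals bounds all paths at once. *)
Lemma vsum_control q c h L :
  (forall i, 0 <= h i) ->
  (forall x y, (x < y <= L)%N -> `|c x - c y| `^ q <= \sum_(x <= i < y) h i) ->
  forall x l, path ltn x l -> (last x l <= L)%N ->
  vsum q c x l <= \sum_(x <= i < last x l) h i.
Proof.
move=> h0 H x l; elim: l x => [x _ _|y l IH x] /=; first by rewrite big_geq.
move=> /andP[xy yl] lL.
have yL := path_ltn_last yl.
rewrite (big_cat_nat (ltnW xy) yL) /= lerD ?IH ?H // xy /=.
exact: leq_trans yL lL.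
Qed.

Lemma le_sum_nat_sub h a b a' b' : (forall i, 0 <= h i) ->
  (a <= a')%N -> (b' <= b)%N ->
  \sum_(a' <= i < b') h i <= \sum_(a <= i < b) h i.
Proof.
move=> h0 aa bb; case: (leqP a' b') => [ab|/ltnW ab]; last first.
  by rewrite [leLHS]big_geq // sumr_ge0.
rewrite (big_cat_nat aa (leq_trans ab bb)) /= (big_cat_nat ab bb) /=.
have := sumr_ge0 (index_iota a a') (P := xpredT) (F := h) (fun i _ => h0 i).
have := sumr_ge0 (index_iota b' b) (P := xpredT) (F := h) (fun i _ => h0 i).
lra.
Qed.

(* [X^s <= T^(s-1) X] for [0 <= X <= T] makes the control additive. *)
Lemma vq_control q s c h L : 1 <= s -> (forall i, 0 <= h i) ->
  (forall x y, (x < y <= L)%N ->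
     `|c x - c y| `^ q <= (\sum_(x <= i < y) h i) `^ s) ->
  vq q c L <= (\sum_(0 <= i < L) h i) `^ s.
Proof.
move=> s1 h0 H; set T := \sum_(0 <= i < L) h i.
have T0 : 0 <= T by apply: sumr_ge0.
apply: vq_le => [|x l pl lL]; first exact: powR_ge0.
apply: le_trans (@vsum_control q c (fun i => T `^ (s - 1) * h i) L _ _ x l pl lL) _.
- by move=> i; rewrite mulr_ge0 ?powR_ge0.
- move=> y z yz; apply: le_trans (H _ _ yz) _; rewrite -mulr_sumr.
  set X := \sum_(_ <= i < _) _.
  have X0 : 0 <= X by apply: sumr_ge0.
  have XT : X <= T by apply: le_sum_nat_sub => //; case/andP: yz.
  rewrite -mulr_powRB1 //; last lra.
  by rewrite mulrC ler_wpM2r // ge0_ler_powR ?nnegrE //; lra.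
- rewrite -mulr_sumr -[leRHS](mulr_powRB1 T0); last lra.
  by rewrite mulrC ler_wpM2r ?powR_ge0 // le_sum_nat_sub.
Qed.

Lemma powRD_le q (a b : R) : 0 <= q -> 0 <= a -> 0 <= b ->
  (a + b) `^ q <= 2 `^ q * (a `^ q + b `^ q).
Proof.
move=> q0; wlog ab : a b / a <= b.
  move=> W a0 b0; case: (leP a b) => [|/ltW] ab; first exact: W.
  by rewrite addrC [X in _ * X]addrC; apply: W.
move=> a0 b0.
have : (a + b) `^ q <= (2 * b) `^ q by rewrite ge0_ler_powR ?nnegrE //; lra.
move=> /le_trans; apply; rewrite powRM // ler_wpM2l ?powR_ge0 // lerDr.
exact: powR_ge0.
Qed.

Lemma vsumD q c c' x l : 0 <= q ->
  vsum q (fun i => c i + c' i) x l <= 2 `^ q * (vsum q c x l + vsum q c' x l).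
Proof.
move=> q0; elim: l x => [|y l IH] x /=; first by rewrite addr0 mulr0.
have := IH y; have := @powRD_le q `|c x - c y| `|c' x - c' y| q0 (normr_ge0 _) (normr_ge0 _).
have : `|c x + c' x - (c y + c' y)| `^ q <= (`|c x - c y| + `|c' x - c' y|) `^ q.
  rewrite ge0_ler_powR ?nnegrE ?addr_ge0 //.
  by apply: le_trans (ler_normD _ _); rewrite le_eqVlt; apply/orP; left; apply/eqP; congr `|_|; ring.
lra.
Qed.

Lemma vqD q c c' L : 0 <= q ->
  vq q (fun i => c i + c' i) L <= 2 `^ q * (vq q c L + vq q c' L).
Proof.
move=> q0; apply: vq_le => [|x l pl lL].
  by rewrite mulr_ge0 ?powR_ge0 ?addr_ge0 ?vq_ge0.
apply: le_trans (vsumD _ _ _ _ q0) _.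
by rewrite ler_wpM2l ?powR_ge0 // lerD // le_vq.
Qed.

Lemma vsum_leq q c L x l : 0 < q -> path leq x l -> (last x l <= L)%N ->
  vsum q c x l <= vq q c L.
Proof.
move=> q0 pl lL.
suff [l' [p' [e1 e2]]] : exists l', path ltn x l' /\ last x l' = last x l /\
    vsum q c x l' = vsum q c x l.
  by rewrite -e2; apply: le_vq => //; rewrite e1.
elim: l x pl {lL} => [|y l IH] x /=; first by exists [::].
move=> /andP[xy /IH[l' [pl' [e1 e2]]]].
move: xy; rewrite leq_eqVlt => /orP[/eqP e|xy].
  by exists l'; subst y; rewrite subrr normr0 powR0 ?gt_eqF // add0r.
by exists (y :: l'); rewrite /= xy pl' e1 e2.
Qed.

Lemma vq_reparam q c (phi : nat -> nat) L L' : 0 < q ->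
  {homo phi : x y / (x <= y)%N} -> (phi L <= L')%N ->
  vq q (fun i => c (phi i)) L <= vq q c L'.
Proof.
move=> q0 mphi pL; apply: vq_le => [|x l pl lL]; first exact: vq_ge0.
have -> : vsum q (fun i => c (phi i)) x l = vsum q c (phi x) (map phi l).
  by elim: l x {pl lL} => //= y l IH x; rewrite IH.
apply: vsum_leq => //.
  elim: l x pl {lL} => //= y l IH x /andP[/ltnW/mphi -> /IH]; exact.
by rewrite last_map; apply: leq_trans pL; exact: mphi.
Qed.

Lemma eq_vsum q c c' L x l : (forall i, (i <= L)%N -> c i = c' i) ->
  path ltn x l -> (last x l <= L)%N -> vsum q c x l = vsum q c' x l.
Proof.
move=> e; elim: l x => //= y l IH x /andP[xy pl] lL.
have yL : (y <= L)%N.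
  exact: leq_trans (path_ltn_last pl) lL.
by rewrite IH // e ?e // (leq_trans _ yL) // ltnW.
Qed.

Lemma eq_vq q c c' L : (forall i, (i <= L)%N -> c i = c' i) ->
  vq q c L = vq q c' L.
Proof.
move=> e; apply/eqP; rewrite eq_le; apply/andP; split;
 apply: vq_le => [|x l pl lL]; rewrite ?vq_ge0 //.
  by rewrite (eq_vsum q e pl lL) le_vq.
by rewrite -(eq_vsum q e pl lL) le_vq.
Qed.

End variation.

(** * Inequalities for finite sums and controls glued from blocks *)

Section finite_sums.
Context {R : realType}.
Implicit Types (f g h F G : nat -> R).

(** Cauchy-Schwarz with free weights: geometric [rho] will allow summation over dyadic scales at the
    price of a part of the exponential decay. *)
Lemma cauchy_weighted (I : Type) (r : seq I) (rho x : I -> R) :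
  (forall i, 0 < rho i) ->
  (\sum_(i <- r) x i) ^+ 2 <= (\sum_(i <- r) rho i) * \sum_(i <- r) x i ^+ 2 / rho i.
Proof.
move=> rho0.
elim: r => [|i r IH]; first by rewrite !big_nil expr0n mulr0.
rewrite !big_cons.
set S := \sum_(j <- r) x j in IH *; set P := \sum_(j <- r) rho j in IH *.
set Q := \sum_(j <- r) _ in IH *.
have P0 : 0 <= P by apply: sumr_ge0 => j _; exact: ltW.
have Q0 : 0 <= Q by apply: sumr_ge0 => j _; rewrite divr_ge0 ?sqr_ge0 // ltW.
have ri := rho0 i.
suff H : 2 * S * x i <= P * (x i ^+ 2 / rho i) + rho i * Q.
  have -> : (rho i + P) * (x i ^+ 2 / rho i + Q) =
     x i ^+ 2 + P * (x i ^+ 2 / rho i) + rho i * Q + P * Q by field; rewrite gt_eqF.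
  nra.
move: P0; rewrite le_eqVlt => /orP[/eqP P0|P0].
  have : S = 0 by apply/eqP; rewrite -sqrf_eq0 eq_le sqr_ge0 andbT; move: IH; rewrite -P0 mul0r.
  by move=> ->; rewrite -P0 !(mulr0, mul0r) add0r mulr_ge0 // ltW.
rewrite -(ler_pM2l P0) -subr_ge0.
(* Completing the square leaves the induction hypothesis multiplied by [rho i]. *)
have -> : P * (P * (x i ^+ 2 / rho i) + rho i * Q) - P * (2 * S * x i) =
   (P * x i - rho i * S) ^+ 2 / rho i + rho i * (P * Q - S ^+ 2).
  by field; rewrite gt_eqF.
by rewrite addr_ge0 ?divr_ge0 ?sqr_ge0 ?mulr_ge0 ?subr_ge0 // ltW.
Qed.

Lemma cauchy_nat f a b :
  (\sum_(a <= i < b) f i) ^+ 2 <= (b - a)%:R * \sum_(a <= i < b) f i ^+ 2.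
Proof.
have := @cauchy_weighted _ (index_iota a b) (fun=> 1) f (fun=> ltr01).
rewrite sumr_const_nat => /le_trans; apply; rewrite -mulr_natr mul1r ler_wpM2l //.
by apply: ler_sum => i _; rewrite divr1.
Qed.

Lemma sqrrD_le (a b : R) : (a + b) ^+ 2 <= 2 * a ^+ 2 + 2 * b ^+ 2.
Proof. have := sqr_ge0 (a - b); nra. Qed.

Lemma sqrrB_le (a b : R) : (a - b) ^+ 2 <= 2 * a ^+ 2 + 2 * b ^+ 2.
Proof. have := sqr_ge0 (a + b); nra. Qed.

Lemma sum_from G a n : \sum_(a <= i < a + n) G i = \sum_(0 <= i < n) G (a + i)%N.
Proof.
rewrite addnC -{1}(add0n a) big_addn addnK.
by apply: eq_bigr => i _; rewrite addnC.
Qed.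

Lemma sum_succ G a b : \sum_(a <= i < b) G i.+1 = \sum_(a.+1 <= i < b.+1) G i.
Proof. by rewrite [RHS]big_add1. Qed.

Lemma sum_nat_blocks G a b s : \sum_(a * s <= k < b * s) G k =
  \sum_(a <= j < b) \sum_(0 <= i < s) G (j * s + i)%N.
Proof.
case: (leqP a b) => [ab|/ltnW ba]; last first.
  by rewrite !big_geq // leq_mul2r ba orbT.
elim: b ab => [|b IH]; first by rewrite leqn0 => /eqP->; rewrite !big_geq.
rewrite leq_eqVlt => /orP[/eqP->|]; first by rewrite !big_geq.
rewrite ltnS => ab; rewrite big_nat_recr //= -IH //.
rewrite (@big_cat_nat _ _ _ (b * s)) /= ?leq_mul2r ?ab ?orbT ?leqnSn ?orbT //.
by rewrite mulSn [(s + _)%N]addnC sum_from.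
Qed.

Lemma sum_shift_le F n i : (forall k, 0 <= F k) -> (forall k, (n <= k)%N -> F k = 0) ->
  \sum_(0 <= k < n) F (k + i)%N <= \sum_(0 <= k < n) F k.
Proof.
move=> F0 Fn; have -> : \sum_(0 <= k < n) F (k + i)%N = \sum_(i <= k < n + i) F k.
  by rewrite -{2}(add0n i) big_addn addnK.
apply: (@le_trans _ _ (\sum_(0 <= k < n + i) F k)).
  exact: le_sum_nat_sub.
rewrite (@big_cat_nat _ _ _ n) /= ?leq_addr // gerDl le_eqVlt; apply/orP; left.
by rewrite big_nat_cond big1 // => k /andP[/andP[nk _] _]; exact: Fn.
Qed.

Lemma sum_geo_le (r : R) n : 0 <= r < 1 -> \sum_(0 <= i < n) r ^+ i <= (1 - r)^-1.
Proof.
move=> /andP[r0 r1]; have r10 : 0 < 1 - r by lra.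
rewrite -[leRHS]mul1r ler_pdivlMr // mulrC.
elim: n => [|n IH]; first by rewrite big_geq // mulr0.
suff -> : (1 - r) * \sum_(0 <= i < n.+1) r ^+ i = 1 - r ^+ n.+1.
  by rewrite gerBl exprn_ge0.
elim: n {IH} => [|n IH]; first by rewrite big_nat1 expr0 mulr1 expr1.
by rewrite big_nat_recr //= mulrDr IH; rewrite !exprS; ring.
Qed.

Definition ndist (m n : nat) : nat := ((m - n) + (n - m))%N.

Lemma ndistC m n : ndist m n = ndist n m.
Proof. by rewrite /ndist addnC. Qed.

Lemma sum_geo_dist_le (r : R) n a b : 0 <= r < 1 ->
  \sum_(a <= m < b) r ^+ ndist m n <= 2 / (1 - r).
Proof.
move=> /[dup] r01 /andP[r0 r1].
apply: (@le_trans _ _ (\sum_(0 <= m < b + n) r ^+ ndist m n)).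
  by apply: le_sum_nat_sub => [i||]; rewrite ?exprn_ge0 ?leq_addr.
rewrite (@big_cat_nat _ _ _ n) /= ?leq_addl // mulr_natl mulr2n lerD //.
  rewrite big_nat_rev /= add0n.
  apply: le_trans (sum_geo_le n r01); apply: ler_sum_nat => i /andP[_ ni].
  have -> : ndist (n - i.+1) n = i.+1 by rewrite /ndist; lia.
  by rewrite exprS ler_piMl ?exprn_ge0 // ltW.
rewrite -{1}(add0n n) big_addn addnK.
apply: le_trans (sum_geo_le b r01); apply: ler_sum_nat => i _.
by have -> : ndist (i + n) n = i by rewrite /ndist; lia.
Qed.

Lemma exit_index (pi : nat -> nat) x y : (x < y)%N -> pi x != pi y ->
  exists2 l, (x <= l < y)%N & pi l = pi x /\ pi l.+1 != pi x.
Proof.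
elim: y => // y IH; rewrite ltnS leq_eqVlt => /orP[/eqP->|xy] ne.
  by exists y; rewrite ?leqnn //; split => //; rewrite eq_sym.
have [e|ne'] := eqVneq (pi x) (pi y).
  by exists y; [rewrite (ltnW xy) /=|split; rewrite // eq_sym].
have [l /andP[xl ly] H] := IH xy ne'.
by exists l => //; rewrite xl ltnS ltnW.
Qed.

Lemma enter_index (pi : nat -> nat) x y : (x < y)%N -> pi x != pi y ->
  exists2 l, (x <= l < y)%N & pi l.+1 = pi y /\ pi l != pi y.
Proof.
elim: y => // y IH; rewrite ltnS leq_eqVlt => /orP[/eqP->|xy] ne.
  by exists y; rewrite ?leqnn.
have [e|ne'] := eqVneq (pi y) (pi y.+1).
  have ney : pi x != pi y by rewrite e.
  have [l /andP[xl ly] [H1 H2]] := IH xy ney.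
  by exists l; [rewrite xl ltnS ltnW|rewrite -e].
by exists y => //; rewrite (ltnW xy) /=.
Qed.

Lemma le_sum_term F x y l : (forall i, 0 <= F i) -> (x <= l < y)%N ->
  F l <= \sum_(x <= i < y) F i.
Proof.
move=> F0 /andP[xl ly].
rewrite (@big_cat_nat _ _ _ l) //= ?(ltnW ly) // [X in _ <= _ + X]big_ltn //.
have := sumr_ge0 (index_iota x l) (P := xpredT) (F := F) (fun i _ => F0 i).
have := sumr_ge0 (index_iota l.+1 y) (P := xpredT) (F := F) (fun i _ => F0 i).
lra.
Qed.

(** If [x] and [y] lie in one block, [h] suffices. Otherwise the difference is bounded by the sizes
    of [c] on the two blocks, and between [x] and [y] the block of [x] is left and that of [y] is
    entered; each boundary step therefore carries the bounds of both adjacent blocks, the first one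
    paying for an exit and the second for an entry. *)
Lemma block_control (c : nat -> R) (pi : nat -> nat) h (mB : nat -> R) lo hi :
  (forall i, 0 <= h i) -> (forall B, 0 <= mB B) ->
  (forall x y, (lo <= x)%N -> (x < y < hi)%N -> pi x = pi y ->
     (c x - c y) ^+ 2 <= \sum_(x <= l < y) h l) ->
  (forall x, (lo <= x < hi)%N -> c x ^+ 2 <= mB (pi x)) ->
  forall x y, (lo <= x)%N -> (x < y < hi)%N ->
  (c x - c y) ^+ 2 <= \sum_(x <= l < y) (h l +
     (if pi l == pi l.+1 then 0 else 2 * mB (pi l) + 2 * mB (pi l.+1))).
Proof.
move=> h0 m0 H1 H2 x y lox /andP[xy yhi]; rewrite big_split /=.
set F := fun l => if pi l == pi l.+1 then 0 else 2 * mB (pi l).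
set F' := fun l => if pi l == pi l.+1 then 0 else 2 * mB (pi l.+1).
have -> : \sum_(x <= l < y) (if pi l == pi l.+1 then 0 else 2 * mB (pi l) + 2 * mB (pi l.+1))
    = \sum_(x <= l < y) F l + \sum_(x <= l < y) F' l.
  by rewrite -big_split /=; apply: eq_bigr => i _; rewrite /F /F'; case: ifP => _; rewrite ?addr0.
have F0 i : 0 <= F i by rewrite /F; case: ifP => // _; rewrite mulr_ge0.
have F0' i : 0 <= F' i by rewrite /F'; case: ifP => // _; rewrite mulr_ge0.
have s0 := sumr_ge0 (index_iota x y) (P := xpredT) (F := h) (fun i _ => h0 i).
have [e|ne] := eqVneq (pi x) (pi y).
  have s1 := sumr_ge0 (index_iota x y) (P := xpredT) (F := F) (fun i _ => F0 i).
  have s2 := sumr_ge0 (index_iota x y) (P := xpredT) (F := F') (fun i _ => F0' i).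
  apply: (@le_trans _ _ (\sum_(x <= l < y) h l)); first by apply: H1 => //; rewrite xy.
  lra.
have [l lxy [e1 e2]] := exit_index xy ne.
have [l' lxy' [e1' e2']] := enter_index xy ne.
have := le_sum_term F0 lxy; rewrite {1}/F e1 eq_sym (negbTE e2).
have := le_sum_term F0' lxy'; rewrite {1}/F' e1' (negbTE e2').
have := sqrrB_le (c x) (c y).
have := H2 x; have := H2 y; rewrite lox (ltn_trans xy yhi) yhi (leq_trans lox (ltnW xy)).
move=> /(_ isT) A /(_ isT) B; lra.
Qed.

End finite_sums.

(** * Forward averages and dyadic conditional expectations *)

Section averages.
Context {R : realType}.
Implicit Types (f g phi : nat -> R).

Definition wavg f k l : R := (\sum_(0 <= i < l) f (k + i)%N) / l%:R.

Definition grid n k : nat := (k %/ 2 ^ n * 2 ^ n)%N.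

(** The conditional expectation of [f] on the partition into dyadic intervals of length [2 ^ n];
    [grid_const n] below is measurability with respect to this partition. *)
Definition dyavg f n k : R := (\sum_(0 <= i < 2 ^ n) f (grid n k + i)%N) / 2 ^+ n.

Definition grid_const n phi := forall k, phi (grid n k) = phi k.

Lemma grid_le n k : (grid n k <= k)%N. Proof. exact: leq_divM. Qed.

Lemma lt_grid n k : (k < grid n k + 2 ^ n)%N.
Proof. by rewrite /grid addnC -mulSn ltn_ceil // expn_gt0. Qed.

Lemma grid_add n j i : (i < 2 ^ n)%N -> grid n (j * 2 ^ n + i) = (j * 2 ^ n)%N.
Proof. by move=> i2; rewrite /grid divnMDl ?expn_gt0 // divn_small // addn0. Qed.

Lemma grid_grid m n k : (m <= n)%N -> grid n (grid m k) = grid n k.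
Proof.
move=> mn; rewrite /grid -(subnKC mn) expnD.
by rewrite !divnMA mulnK ?expn_gt0.
Qed.

Lemma gridgrid m n k : (m <= n)%N -> grid m (grid n k) = grid n k.
Proof.
move=> mn; rewrite /grid -(subnK mn) expnD mulnA mulnK //; by rewrite expn_gt0.
Qed.

Lemma grid_constW m n phi : (m <= n)%N -> grid_const n phi -> grid_const m phi.
Proof. by move=> mn H k; rewrite -H grid_grid // H. Qed.

Lemma dyavg_const f n : grid_const n (dyavg f n).
Proof. by move=> k; rewrite /dyavg grid_grid. Qed.

Lemma grid_same n k i : (i < 2 ^ n)%N -> grid n (grid n k + i) = grid n k.
Proof. by move=> i2; rewrite {2}/grid grid_add. Qed.

Lemma dyavg_id n m phi : (m <= n)%N -> grid_const n phi -> dyavg phi m =1 phi.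
Proof.
move=> mn H k; rewrite /dyavg.
under eq_big_nat => i /andP[_ i2].
  rewrite -(grid_constW mn H) grid_same // (grid_constW mn H); over.
by rewrite sumr_const_nat subn0 -[phi k *+ _]mulr_natr natrX mulfK // expf_neq0.
Qed.

Lemma exp2_gt0 n : (0 : R) < 2 ^+ n. Proof. exact: exprn_gt0. Qed.

(** The defining property of conditional expectation, from which the orthogonality arguments below
    are drawn. *)
Lemma sum_dyavg_mul f phi n M : (n <= M)%N -> grid_const n phi ->
  \sum_(0 <= k < 2 ^ M) f k * phi k = \sum_(0 <= k < 2 ^ M) dyavg f n k * phi k.
Proof.
move=> nM H; rewrite -(subnK nM) expnD -(mul0n (2 ^ n)%N) !sum_nat_blocks.
apply: eq_bigr => j _.
have E i : (i < 2 ^ n)%N -> phi (j * 2 ^ n + i)%N = phi (j * 2 ^ n)%N.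
  by move=> i2; rewrite -H grid_add.
under eq_big_nat => i /andP[_ i2] do rewrite E //.
under [RHS]eq_big_nat => i /andP[_ i2] do rewrite E // /dyavg grid_add //.
rewrite -mulr_suml sumr_const_nat subn0 -[RHS]mulr_natr natrX.
by field; rewrite expf_neq0 ?pnatr_eq0.
Qed.

Lemma sum_dyavg f n M : (n <= M)%N ->
  \sum_(0 <= k < 2 ^ M) f k = \sum_(0 <= k < 2 ^ M) dyavg f n k.
Proof.
move=> nM; have := @sum_dyavg_mul f (fun=> 1) n M nM (fun=> erefl).
by under eq_bigr do rewrite mulr1; under [in RHS]eq_bigr do rewrite mulr1.
Qed.

Lemma dyavgB f g n k : dyavg (fun i => f i - g i) n k = dyavg f n k - dyavg g n k.
Proof. by rewrite /dyavg sumrB mulrBl. Qed.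

Lemma dyavg_tower f m n : (m <= n)%N -> dyavg (dyavg f m) n =1 dyavg f n.
Proof.
move=> mn k; set F := dyavg f m; rewrite /dyavg; congr (_ / _).
rewrite -!(sum_from _ (grid n k)).
set a := (k %/ 2 ^ n * 2 ^ (n - m))%N.
have ga : grid n k = (a * 2 ^ m)%N by rewrite /grid /a -mulnA -expnD subnK.
have -> : (grid n k + 2 ^ n = (a + 2 ^ (n - m)) * 2 ^ m)%N.
  by rewrite ga mulnDl -expnD subnK.
rewrite ga !sum_nat_blocks; apply: eq_bigr => j _.
under eq_big_nat => i /andP[_ i2] do rewrite /F /dyavg grid_add //.
by rewrite sumr_const_nat subn0 -[LHS]mulr_natr natrX sum_from divfK // expf_neq0.
Qed.

Lemma dyavg_vanish f n M : (n <= M)%N -> (forall k, (2 ^ M <= k)%N -> f k = 0) ->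
  forall k, (2 ^ M <= k)%N -> dyavg f n k = 0.
Proof.
move=> nM H k Mk; rewrite /dyavg big1_seq ?mul0r // => i _; apply: H.
apply: leq_trans (leq_addr _ _); rewrite /grid -{1}(subnK nM) expnD leq_mul2r.
by rewrite leq_divRL ?expn_gt0 // -expnD subnK // Mk orbT.
Qed.

End averages.

(** * Short variation and oscillation *)

Section short_variation.
Context {R : realType}.
Implicit Types (f g : nat -> R).

Definition sumsq g N : R := \sum_(0 <= k < N) g k ^+ 2.

Lemma sumsq_ge0 g N : 0 <= sumsq g N.
Proof. by apply: sumr_ge0 => i _; exact: sqr_ge0. Qed.

Lemma sum_ge0_nat (F : nat -> R) a b : (forall i, 0 <= F i) -> 0 <= \sum_(a <= i < b) F i.
Proof. by move=> F0; apply: sumr_ge0. Qed.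

Lemma wavg_sum g k l : \sum_(0 <= i < l) g (k + i)%N = l%:R * wavg g k l.
Proof.
case: l => [|l]; first by rewrite big_geq // mul0r.
by rewrite /wavg mulrC divfK // pnatr_eq0.
Qed.

Lemma wavg_sqr_le g k l : wavg g k l ^+ 2 <= wavg (fun i => g i ^+ 2) k l.
Proof.
case: l => [|l]; first by rewrite /wavg !big_geq // !mul0r expr0n.
have l0 : (0 : R) < l.+1%:R by rewrite ltr0n.
rewrite /wavg expr_div_n ler_pdivrMr ?exprn_gt0 // expr2 mulrA divfK ?gt_eqF //.
by rewrite -expr2 mulrC; have := cauchy_nat (fun i => g (k + i)%N) 0 l.+1; rewrite subn0.
Qed.

Lemma sum_wavg_le (F : nat -> R) N l : (forall k, 0 <= F k) ->
  (forall k, (N <= k)%N -> F k = 0) ->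
  \sum_(0 <= k < N) wavg F k l <= \sum_(0 <= k < N) F k.
Proof.
move=> F0 FN; case: l => [|l].
  rewrite big1 ?sum_ge0_nat // => i _.
  by rewrite /wavg big_geq // mul0r.
have l0 : (0 : R) < l.+1%:R by rewrite ltr0n.
rewrite /wavg -mulr_suml ler_pdivrMr // exchange_big /=.
apply: le_trans (_ : \sum_(0 <= i < l.+1) \sum_(0 <= k < N) F k <= _).
  by apply: ler_sum => i _; exact: sum_shift_le.
by rewrite sumr_const_nat subn0 mulr_natr.
Qed.

Lemma sum_wavg_sqr_le g N l : (forall k, (N <= k)%N -> g k = 0) ->
  \sum_(0 <= k < N) wavg g k l ^+ 2 <= sumsq g N.
Proof.
move=> gN; apply: (@le_trans _ _ (\sum_(0 <= k < N) wavg (fun i => g i ^+ 2) k l)).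
  by apply: ler_sum => k _; exact: wavg_sqr_le.
apply: (@sum_wavg_le (fun i => g i ^+ 2)) => k; first exact: sqr_ge0.
by move=> /gN->; rewrite expr0n.
Qed.

Definition wstep g k l : R := wavg g k l.+1 - wavg g k l.

Lemma wstepE g k l : wstep g k l = (g (k + l)%N - wavg g k l) / l.+1%:R.
Proof.
rewrite /wstep {1}/wavg big_nat_recr //= wavg_sum.
have : (l.+1%:R : R) != 0 by rewrite pnatr_eq0.
by rewrite -(natr1 l); move=> ?; field.
Qed.

Lemma sum_wstep_sqr_le g N l : (0 < l)%N -> (forall k, (N <= k)%N -> g k = 0) ->
  \sum_(0 <= k < N) wstep g k l ^+ 2 <= 4 * sumsq g N / l%:R ^+ 2.
Proof.
move=> l0 gN.
have l0' : (0 : R) < l%:R by rewrite ltr0n.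
have ll : (l%:R : R) <= l.+1%:R by rewrite ler_nat.
apply: (@le_trans _ _ (\sum_(0 <= k < N) (2 * g (k + l)%N ^+ 2 + 2 * wavg g k l ^+ 2) / l%:R ^+ 2)).
  apply: ler_sum => k _; rewrite wstepE expr_div_n.
  apply: (@le_trans _ _ ((2 * g (k + l)%N ^+ 2 + 2 * wavg g k l ^+ 2) / l.+1%:R ^+ 2)).
    by rewrite ler_pM2r ?sqrrB_le // invr_gt0 exprn_gt0 // ltr0n.
  apply: ler_wpM2l; first by rewrite addr_ge0 // mulr_ge0 ?sqr_ge0.
  rewrite lef_pV2 ?posrE ?exprn_gt0 ?ltr0n //.
  by rewrite lerXn2r ?nnegrE ?ler0n.
rewrite -mulr_suml ler_pM2r ?invr_gt0 ?exprn_gt0 // big_split /= -!mulr_sumr.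
have := sum_wavg_sqr_le l gN.
have : \sum_(0 <= k < N) g (k + l)%N ^+ 2 <= sumsq g N.
  apply: (@sum_shift_le R (fun k => g k ^+ 2) N l (fun k => sqr_ge0 _)).
  by move=> k /gN->; rewrite expr0n.
lra.
Qed.

Lemma wavg_telescope g k x y : (x <= y)%N ->
  wavg g k y - wavg g k x = \sum_(x <= l < y) wstep g k l.
Proof. by move=> xy; rewrite telescope_sumr. Qed.

Lemma wavg_diff_sqr g k x y : (x <= y)%N ->
  (wavg g k x - wavg g k y) ^+ 2 <= (y - x)%:R * \sum_(x <= l < y) wstep g k l ^+ 2.
Proof.
by move=> xy; rewrite -sqrrN opprB wavg_telescope //; exact: cauchy_nat.
Qed.

(** Since the primitive [P] vanishes at the multiples of [2 ^ m], a window sum only involves the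
    incomplete blocks at its two ends. This gains the factor [2 ^+ m / l] over the trivial bound. *)
Lemma sum_wavg_cancel g m M l : (m <= M)%N -> (0 < l)%N ->
  (forall k, (2 ^ M <= k)%N -> g k = 0) ->
  (forall j, \sum_(0 <= i < 2 ^ m) g (j * 2 ^ m + i)%N = 0) ->
  \sum_(0 <= k < 2 ^ M) wavg g k l ^+ 2 <=
    4 * (2 ^+ m) ^+ 2 / l%:R ^+ 2 * sumsq g (2 ^ M).
Proof.
move=> mM l0 gN g0.
have l0' : (0 : R) < l%:R by rewrite ltr0n.
pose P x := \sum_(0 <= i < x) g i.
pose F := dyavg (fun i => g i ^+ 2) m.
have F0 k : 0 <= F k.
  by rewrite /F /dyavg divr_ge0 ?exprn_ge0 // sum_ge0_nat // => i; exact: sqr_ge0.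
have FN k : (2 ^ M <= k)%N -> F k = 0.
  by apply: dyavg_vanish => // i /gN ->; rewrite expr0n.
have PE x : P x ^+ 2 <= (2 ^+ m) ^+ 2 * F x.
  have -> : P x = \sum_(grid m x <= i < x) g i.
    rewrite /P (@big_cat_nat _ _ _ (grid m x)) //= ?grid_le //.
    by rewrite /grid -(mul0n (2 ^ m)%N) sum_nat_blocks big1 ?add0r.
  apply: le_trans (cauchy_nat _ _ _) _.
  rewrite /F /dyavg -(sum_from (fun i => g i ^+ 2)).
  have -> (t : R) : (2 ^+ m) ^+ 2 * (t / 2 ^+ m) = 2 ^+ m * t.
    by field; rewrite expf_neq0.
  rewrite ler_pM ?ler0n ?sum_ge0_nat //; first by move=> i; exact: sqr_ge0.
    by rewrite -natrX ler_nat leq_subLR ltnW // lt_grid.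
  by apply: le_sum_nat_sub => //; [move=> i; exact: sqr_ge0|rewrite ltnW // lt_grid].
have FE : \sum_(0 <= k < 2 ^ M) F k = sumsq g (2 ^ M).
  by rewrite /F /sumsq [RHS](@sum_dyavg _ _ m).
apply: (@le_trans _ _ (\sum_(0 <= k < 2 ^ M) (2 * (2 ^+ m) ^+ 2 / l%:R ^+ 2) * (F (k + l)%N + F k))).
  apply: ler_sum => k _.
  have -> : wavg g k l = (P (k + l)%N - P k) / l%:R.
    have -> : P (k + l)%N = P k + \sum_(k <= i < k + l) g i.
      by rewrite /P -big_cat_nat ?leq_addr.
    by rewrite addrAC subrr add0r sum_from.
  rewrite expr_div_n [leRHS]mulrAC ler_pM2r ?invr_gt0 ?exprn_gt0 //.
  apply: le_trans (sqrrB_le _ _) _; have := PE k; have := PE (k + l)%N; lra.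
rewrite -mulr_sumr big_split /= -FE.
have C0 : 0 <= 2 * (2 ^+ m) ^+ 2 / l%:R ^+ 2 :> R.
  by rewrite divr_ge0 ?mulr_ge0 ?sqr_ge0.
have := ler_wpM2l C0 (sum_shift_le l F0 FN); lra.
Qed.

Lemma sum_last_le (F : nat -> R) s c : (0 < s)%N ->
  (forall i, (i.+1 < s)%N -> F i = 0) -> F s.-1 <= c -> \sum_(0 <= i < s) F i <= c.
Proof.
case: s => // s _ F0 Fs; rewrite big_nat_recr //= big_nat_cond big1 ?add0r //.
by move=> i /andP[/andP[_ is_] _]; apply: F0; rewrite ltnS.
Qed.

(** An additive control is asked for, rather than a bound on the variation, so that different
    martingale differences and different scales can be superposed. The factor [tau] records the
    decay when the scale of [g] is far from [n]. *)
Definition short_control g M n (tau : R) := exists h : nat -> nat -> R,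
  [/\ forall k l, 0 <= h k l,
      forall k x y, (2 ^ n <= x)%N -> (x < y < 2 ^ n.+1)%N ->
        (wavg g k x - wavg g k y) ^+ 2 <= \sum_(x <= l < y) h k l,
      \sum_(0 <= k < 2 ^ M) \sum_(2 ^ n <= l < 2 ^ n.+1) h k l <= tau * sumsq g (2 ^ M) &
      \sum_(0 <= k < 2 ^ M) (wavg g k (2 ^ n) - dyavg g n k) ^+ 2 <= tau * sumsq g (2 ^ M)].

(** The window lengths are cut into blocks of [2 ^ m] consecutive values. Inside a block,
    Cauchy-Schwarz on the increments costs only [2 ^ m]; from block to block the averages are small
    by cancellation, and [block_control] joins the two. With [a / b] the ratio of the scales, the
    inner part contributes [4 * (a / b)] and the boundaries [64 * (a / b) ^+ 2] for each of the
    [b / a] blocks, whence 68. *)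
Lemma short_control_fine g m n M : (m <= n)%N -> (m <= M)%N ->
  (forall k, (2 ^ M <= k)%N -> g k = 0) ->
  (forall j, \sum_(0 <= i < 2 ^ m) g (j * 2 ^ m + i)%N = 0) ->
  short_control g M n (68 * 2 ^+ m / 2 ^+ n).
Proof.
move=> mn mM gN g0; rewrite /short_control; set N := sumsq g _.
have N0 : 0 <= N := sumsq_ge0 _ _.
set a : R := 2 ^+ m; set b : R := 2 ^+ n.
have a0 : 0 < a := exp2_gt0 m.
have b0 : 0 < b := exp2_gt0 n.
have ab : a <= b by rewrite /a /b -!natrX ler_nat leq_exp2l.
pose D k l := wstep g k l ^+ 2.
have D0 k l : 0 <= D k l by exact: sqr_ge0.
pose mB k r := 2 * wavg g k (r * 2 ^ m) ^+ 2 +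
               2 * (a * \sum_(0 <= i < 2 ^ m) D k (r * 2 ^ m + i)%N).
have mB0 k r : 0 <= mB k r.
  apply: addr_ge0; apply: mulr_ge0 => //; first exact: sqr_ge0.
  by apply: mulr_ge0; [exact: ltW|apply: sum_ge0_nat => i; exact: D0].
pose p l := (l %/ 2 ^ m)%N.
have m2 : (0 < 2 ^ m)%N by rewrite expn_gt0.
have pE j i : (i < 2 ^ m)%N -> p (j * 2 ^ m + i)%N = j.
  by move=> im; rewrite /p divnMDl // divn_small // addn0.
pose bd k l := if p l == p l.+1 then 0 else 2 * mB k (p l) + 2 * mB k (p l.+1).
have bd0 k l : 0 <= bd k l by rewrite /bd; case: ifP => // _; rewrite addr_ge0 ?mulr_ge0.
have natb l : (2 ^ n <= l)%N -> b <= l%:R by rewrite /b -natrX ler_nat.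
have a0' := ltW a0; have b0' := ltW b0.
have invb l : (2 ^ n <= l)%N -> l%:R ^- 2 <= b ^- 2 :> R.
  move=> /natb bl; have l0 : 0 < l%:R :> R by exact: lt_le_trans bl.
  by rewrite lef_pV2 ?posrE ?exprn_gt0 // lerXn2r ?nnegrE // ltW.
have sumD l : (2 ^ n <= l)%N -> \sum_(0 <= k < 2 ^ M) D k l <= 4 * N / b ^+ 2.
  move=> nl; have l0 : (0 < l)%N by apply: leq_trans nl; rewrite expn_gt0.
  by apply: le_trans (sum_wstep_sqr_le l0 gN) _; rewrite ler_wpM2l ?mulr_ge0 ?invb.
have sumW l : (2 ^ n <= l)%N ->
    \sum_(0 <= k < 2 ^ M) wavg g k l ^+ 2 <= 4 * a ^+ 2 / b ^+ 2 * N.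
  move=> nl; have l0 : (0 < l)%N by apply: leq_trans nl; rewrite expn_gt0.
  apply: le_trans (sum_wavg_cancel mM l0 gN g0) _; rewrite ler_wpM2r // -/a.
  by rewrite ler_wpM2l ?invb // mulr_ge0 // exprn_ge0.
have ab1 : a / b <= 1 by rewrite ler_pdivrMr // mul1r.
have ab0 : 0 <= a / b by rewrite divr_ge0 // ltW.
have summB r : (2 ^ (n - m) <= r)%N -> \sum_(0 <= k < 2 ^ M) mB k r <= 16 * (a / b) ^+ 2 * N.
  move=> nr; have nr' : (2 ^ n <= r * 2 ^ m)%N by rewrite -(subnK mn) expnD leq_mul2r nr orbT.
  rewrite big_split /= -!mulr_sumr exchange_big /=.
  have H1 := sumW _ nr'.
  have H2 : \sum_(0 <= j < 2 ^ m) \sum_(0 <= i < 2 ^ M) D i (r * 2 ^ m + j)%N <=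
     a * (4 * N / b ^+ 2).
    apply: (@le_trans _ _ (\sum_(0 <= j < 2 ^ m) (4 * N / b ^+ 2))).
      by apply: ler_sum => j _; apply: sumD; apply: leq_trans nr' (leq_addr _ _).
    by rewrite sumr_const_nat subn0 -[leLHS]mulr_natl natrX.
  have := ler_wpM2l (ltW a0) H2; rewrite expr_div_n.
  have -> : a * (a * (4 * N / b ^+ 2)) = 4 * (a ^+ 2 / b ^+ 2 * N) by ring.
  move: H1; have -> : 4 * a ^+ 2 / b ^+ 2 * N = 4 * (a ^+ 2 / b ^+ 2 * N) by ring.
  have -> : 16 * (a ^+ 2 / b ^+ 2) * N = 16 * (a ^+ 2 / b ^+ 2 * N) by ring.
  lra.
exists (fun k l => a * D k l + bd k l); split.
- by move=> k l; apply: addr_ge0 => //; exact: mulr_ge0.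
- move=> k x y nx xy.
  apply: (@block_control R (wavg g k) p (fun l => a * D k l) (mB k) (2 ^ n) (2 ^ n.+1)) => //.
  + by move=> i; exact: mulr_ge0.
  + move=> {nx xy}x {}y nx /andP[xy yn] e.
    apply: le_trans (wavg_diff_sqr _ _ (ltnW xy)) _; rewrite -mulr_sumr.
    apply: ler_wpM2r; first by apply: sum_ge0_nat => i; exact: D0.
    rewrite /a -natrX ler_nat leq_subLR ltnW //.
    have := lt_grid m y; rewrite /grid -/(p y) -e => /leq_trans; apply.
    by rewrite leq_add2r; exact: grid_le.
  + move=> {nx xy}x /andP[nx xn].
    have gx : (grid m x <= x)%N := grid_le m x.
    have -> : wavg g k x = wavg g k (p x * 2 ^ m) + \sum_(grid m x <= l < x) wstep g k l.
      by rewrite -wavg_telescope // addrC subrK.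
    apply: le_trans (sqrrD_le _ _) _; rewrite /mB lerD2l ler_wpM2l //.
    apply: le_trans (cauchy_nat _ _ _) _.
    rewrite -(sum_from (D k)); apply: ler_pM; rewrite ?ler0n //.
    * by apply: sum_ge0_nat => i; exact: D0.
    * by rewrite /a -natrX ler_nat leq_subLR ltnW // lt_grid.
    * apply: le_sum_nat_sub => //; first by move=> i; exact: D0.
      by rewrite ltnW // lt_grid.
- under eq_bigr do rewrite big_split /=.
  rewrite big_split /=.
  have H1 : \sum_(0 <= k < 2 ^ M) \sum_(2 ^ n <= l < 2 ^ n.+1) a * D k l <= 4 * (a / b) * N.
    rewrite exchange_big /=.
    apply: (@le_trans _ _ (\sum_(2 ^ n <= l < 2 ^ n.+1) a * (4 * N / b ^+ 2))).
      apply: ler_sum_nat => l /andP[nl _]; by rewrite -mulr_sumr ler_wpM2l ?sumD.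
    rewrite sumr_const_nat -[leLHS]mulr_natl expnS mul2n -addnn addnK natrX -/b.
    by rewrite le_eqVlt; apply/orP; left; apply/eqP; field; rewrite gt_eqF.
  have H2 : \sum_(0 <= k < 2 ^ M) \sum_(2 ^ n <= l < 2 ^ n.+1) bd k l <= 64 * (a / b) * N.
    apply: (@le_trans _ _ (\sum_(0 <= k < 2 ^ M)
      \sum_(2 ^ (n - m) <= j < 2 ^ (n.+1 - m)) (2 * mB k j + 2 * mB k j.+1))).
      apply: ler_sum => k _; rewrite -{1}(subnK mn) -{1}(subnK (leqW mn)) !expnD sum_nat_blocks.
      apply: ler_sum => j _; apply: sum_last_le => // [i im|].
        by rewrite /bd pE ?(ltnW im) // -addnS pE // eqxx.
      rewrite /bd pE ?ltn_predL // -addnS prednK // addnC -mulSn {1 2}/p mulnK //.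
      by case: ifP => // _; apply: addr_ge0; apply: mulr_ge0.
    rewrite exchange_big /=.
    apply: (@le_trans _ _ (\sum_(2 ^ (n - m) <= j < 2 ^ (n.+1 - m)) 64 * (a / b) ^+ 2 * N)).
      apply: ler_sum_nat => j /andP[nj _]; rewrite big_split /= -!mulr_sumr.
      have := summB _ nj; have := summB _ (leqW nj); lra.
    rewrite sumr_const_nat subSn // expnS mul2n -addnn addnK -[leLHS]mulr_natl natrX.
    have -> : (2 ^+ (n - m) : R) = b / a.
      by rewrite /a /b -{2}(subnK mn) exprD mulfK // gt_eqF // exp2_gt0.
    by rewrite le_eqVlt; apply/orP; left; apply/eqP; field; rewrite !gt_eqF.
  have -> : 68 * a / b * N = 4 * (a / b) * N + 64 * (a / b) * N by field; rewrite gt_eqF.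
  exact: lerD.
- have E k : dyavg g n k = 0.
    rewrite -(dyavg_tower _ mn) /dyavg big1 ?mul0r // => i _.
    by rewrite -/(dyavg g m _) /dyavg g0 mul0r.
  under eq_bigr do rewrite E subr0.
  apply: le_trans (sumW _ (leqnn _)) _; rewrite ler_wpM2r //.
  have -> : 4 * a ^+ 2 / b ^+ 2 = 4 * ((a / b) * (a / b)) by field; rewrite gt_eqF.
  have -> : 68 * a / b = 68 * (a / b) by ring.
  nra.
Qed.

(** A shift by less than [2 ^ s] changes a function constant on blocks only at the last [i] points
    of each block; for larger shifts the trivial bound is enough. *)
Lemma sum_translate_le g s i M : (s <= M)%N -> (forall k, (2 ^ M <= k)%N -> g k = 0) ->
  grid_const s g ->
  \sum_(0 <= k < 2 ^ M) (g (k + i)%N - g k) ^+ 2 <= 4 * i%:R / 2 ^+ s * sumsq g (2 ^ M).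
Proof.
move=> sM gN gs; set N := sumsq _ _; set a : R := 2 ^+ s.
have N0 : 0 <= N := sumsq_ge0 _ _.
have a0 : 0 < a := exp2_gt0 s.
have trivial_bound (F G : nat -> R) n : \sum_(0 <= k < n) (F k - G k) ^+ 2 <=
   2 * \sum_(0 <= k < n) F k ^+ 2 + 2 * \sum_(0 <= k < n) G k ^+ 2.
  by rewrite !mulr_sumr -big_split /=; apply: ler_sum => k _; exact: sqrrB_le.
have g20 k : (2 ^ M <= k)%N -> g k ^+ 2 = 0 by move=> /gN->; rewrite expr0n.
have [si|/ltnW is_] := leqP (2 ^ s) i.
  have : a <= i%:R by rewrite /a -natrX ler_nat.
  move=> ai; apply: (@le_trans _ _ (4 * N)).
    apply: le_trans (trivial_bound (fun k => g (k + i)%N) g _) _; rewrite -/N.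
    have := @sum_shift_le R (fun k => g k ^+ 2) _ i (fun k => sqr_ge0 _) g20.
    rewrite -/(sumsq g _) -/N; lra.
  by rewrite ler_wpM2r // ler_pdivlMr // ler_wpM2l.
pose G j := g (j * 2 ^ s)%N.
have gG j r : (r < 2 ^ s)%N -> g (j * 2 ^ s + r)%N = G j.
  by move=> r2; rewrite -gs grid_add.
have NG : N = a * \sum_(0 <= j < 2 ^ (M - s)) G j ^+ 2.
  rewrite /N /sumsq -(subnK sM) expnD -(mul0n (2 ^ s)%N) sum_nat_blocks addnK mulr_sumr.
  apply: eq_bigr => j _; under eq_big_nat => r /andP[_ r2] do rewrite gG //.
  by rewrite sumr_const_nat subn0 -mulr_natl natrX.
rewrite -(subnK sM) expnD -(mul0n (2 ^ s)%N) sum_nat_blocks.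
apply: (@le_trans _ _ (\sum_(0 <= j < 2 ^ (M - s)) i%:R * (G j.+1 - G j) ^+ 2)).
  apply: ler_sum => j _.
  rewrite (@big_cat_nat _ _ _ (2 ^ s - i)) ?leq_subr //= big_nat_cond big1 ?add0r; last first.
    move=> r /andP[/andP[_ r2] _]; rewrite -addnA !gG ?subrr ?expr0n //; lia.
  rewrite (eq_big_nat _ _ (F2 := fun=> (G j.+1 - G j) ^+ 2)); last first.
    move=> r /andP[r1 r2]; rewrite gG //.
    have -> : (j * 2 ^ s + r + i = j.+1 * 2 ^ s + (r + i - 2 ^ s))%N by rewrite mulSn; lia.
    by rewrite gG //; lia.
  by rewrite sumr_const_nat subKn // mulr_natl.
rewrite -mulr_sumr NG -/a.
have -> t : 4 * i%:R / a * (a * t) = i%:R * (4 * t) by field; rewrite gt_eqF.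
rewrite ler_wpM2l //; apply: le_trans (trivial_bound (fun j => G j.+1) G _) _.
have := @sum_shift_le R (fun k => G k ^+ 2) (2 ^ (M - s)) 1 (fun k => sqr_ge0 _).
have H j : (2 ^ (M - s) <= j)%N -> G j ^+ 2 = 0.
  by move=> Mj; rewrite g20 // -{1}(subnK sM) expnD leq_mul2r Mj orbT.
move=> /(_ H); under eq_bigr do rewrite addn1; lra.
Qed.

(** Averages over windows shorter than the blocks of [g] differ little from [g] itself, by
    [sum_translate_le]. The constant 68 is taken to match the fine case. *)
Lemma short_control_coarse g s n M : (n <= s)%N -> (s <= M)%N ->
  (forall k, (2 ^ M <= k)%N -> g k = 0) -> grid_const s g ->
  short_control g M n (68 * 2 ^+ n / 2 ^+ s).
Proof.
move=> ns sM gN gs; rewrite /short_control; set N := sumsq g _.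
have N0 : 0 <= N := sumsq_ge0 _ _.
set a : R := 2 ^+ s; set b : R := 2 ^+ n.
have a0 : 0 < a := exp2_gt0 s.
have b0 : 0 < b := exp2_gt0 n.
have ba0 : 0 <= b / a by rewrite divr_ge0 // ltW.
have T l : \sum_(0 <= k < 2 ^ M) (g (k + l)%N - g k) ^+ 2 <= 4 * l%:R / a * N.
  exact: sum_translate_le.
have W l : (0 < l)%N ->
    \sum_(0 <= k < 2 ^ M) (wavg g k l - g k) ^+ 2 <= 4 * l%:R / a * N.
  move=> l0; have l0' : (0 : R) < l%:R by rewrite ltr0n.
  apply: (@le_trans _ _ (\sum_(0 <= k < 2 ^ M)
      (\sum_(0 <= i < l) (g (k + i)%N - g k) ^+ 2) / l%:R)).
    apply: ler_sum => k _.
    have -> : wavg g k l - g k = (\sum_(0 <= i < l) (g (k + i)%N - g k)) / l%:R.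
      rewrite sumrB sumr_const_nat subn0 /wavg -mulr_natl.
      by field; rewrite gt_eqF.
    exact: (wavg_sqr_le (fun j => g j - g k)).
  rewrite -mulr_suml ler_pdivrMr // exchange_big /=.
  apply: (@le_trans _ _ (\sum_(0 <= i < l) 4 * l%:R / a * N)).
    apply: ler_sum_nat => i /andP[_ il]; apply: le_trans (T i) _.
    by rewrite ler_wpM2r // ler_pM2r ?invr_gt0 // ler_wpM2l // ler_nat ltnW.
  by rewrite sumr_const_nat subn0 -[leLHS]mulr_natr.
pose D k l := wstep g k l ^+ 2.
have D0 k l : 0 <= D k l by exact: sqr_ge0.
have natb l : (2 ^ n <= l)%N -> b <= l%:R by rewrite /b -natrX ler_nat.
have sumD l : (2 ^ n <= l < 2 ^ n.+1)%N ->
    \sum_(0 <= k < 2 ^ M) D k l <= 32 * (b / a) / b ^+ 2 * N.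
  move=> /andP[nl ln]; have l0 : (0 < l)%N by apply: leq_trans nl; rewrite expn_gt0.
  have l2 : l%:R <= 2 * b by rewrite /b -exprS -natrX ler_nat ltnW.
  have bl := natb _ nl.
  apply: (@le_trans _ _ (\sum_(0 <= k < 2 ^ M)
     (2 * (g (k + l)%N - g k) ^+ 2 + 2 * (wavg g k l - g k) ^+ 2) / b ^+ 2)).
    apply: ler_sum => k _; rewrite /D wstepE expr_div_n.
    have -> : g (k + l)%N - wavg g k l = (g (k + l)%N - g k) - (wavg g k l - g k) by ring.
    apply: ler_pM; rewrite ?sqr_ge0 ?invr_ge0 ?sqr_ge0 ?sqrrB_le //.
    rewrite lef_pV2 ?posrE ?exprn_gt0 ?ltr0n // lerXn2r ?nnegrE ?ler0n ?(ltW b0) //.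
    by apply: le_trans bl _; rewrite ler_nat.
  rewrite -mulr_suml [leRHS]mulrAC ler_pM2r ?invr_gt0 ?exprn_gt0 //.
  rewrite big_split /= -!mulr_sumr.
  have := T l; have := W _ l0.
  have : 4 * l%:R / a * N <= 4 * (2 * b) / a * N.
    by rewrite ler_wpM2r // ler_pM2r ?invr_gt0 // ler_wpM2l.
  have -> : 4 * (2 * b) / a * N = 8 * (b / a * N) by ring.
  have -> : 32 * (b / a) * N = 32 * (b / a * N) by ring.
  lra.
exists (fun k l => b * D k l); split.
- by move=> k l; apply: mulr_ge0 => //; exact: ltW.
- move=> k x y nx /andP[xy yn].
  apply: le_trans (wavg_diff_sqr _ _ (ltnW xy)) _; rewrite -mulr_sumr.
  apply: ler_wpM2r; first by apply: sum_ge0_nat => i; exact: D0.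
  by rewrite /b -natrX ler_nat; move: yn nx; rewrite expnS; lia.
- rewrite exchange_big /=.
  apply: (@le_trans _ _ (\sum_(2 ^ n <= l < 2 ^ n.+1) b * (32 * (b / a) / b ^+ 2 * N))).
    apply: ler_sum_nat => l /sumD H; rewrite -mulr_sumr ler_wpM2l //; exact: ltW.
  rewrite sumr_const_nat -[leLHS]mulr_natl expnS mul2n -addnn addnK natrX -/b.
  have -> : b * (b * (32 * (b / a) / b ^+ 2 * N)) = 32 * (b / a * N).
    by field; rewrite !gt_eqF.
  have -> : 68 * b / a * N = 68 * (b / a * N) by ring.
  have : 0 <= b / a * N by rewrite mulr_ge0.
  lra.
- under eq_bigr do rewrite (dyavg_id ns gs).
  apply: le_trans (W _ _) _; first by rewrite expn_gt0.
  rewrite natrX -/b.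
  have -> : 4 * b / a * N = 4 * (b / a * N) by ring.
  have -> : 68 * b / a * N = 68 * (b / a * N) by ring.
  have : 0 <= b / a * N by rewrite mulr_ge0.
  lra.
Qed.

End short_variation.

(** * Square function of the short oscillations *)

Section short_energy.
Context {R : realType}.
Implicit Types (f g : nat -> R).

Lemma wavg_sumf (n : nat) (d : nat -> nat -> R) k l :
  wavg (fun y => \sum_(0 <= i < n) d i y) k l = \sum_(0 <= i < n) wavg (d i) k l.
Proof. by rewrite /wavg exchange_big /= mulr_suml. Qed.

Lemma dyavg_sumf (n : nat) (d : nat -> nat -> R) m k :
  dyavg (fun y => \sum_(0 <= i < n) d i y) m k = \sum_(0 <= i < n) dyavg (d i) m k.
Proof. by rewrite /dyavg exchange_big /= mulr_suml. Qed.

Lemma dyavg0 f : dyavg f 0 =1 f.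
Proof. by move=> k; apply: (@dyavg_id _ 0) => // {}k; rewrite /grid expn0 divn1 muln1. Qed.

(* Martingale differences along the dyadic filtration, coarsest one included. *)
Definition dydiff f M i k : R :=
  if (i < M)%N then dyavg f i k - dyavg f i.+1 k else dyavg f M k.

Lemma sum_dydiff f M k : f k = \sum_(0 <= i < M.+1) dydiff f M i k.
Proof.
rewrite big_nat_recr //= {2}/dydiff ltnn.
under eq_big_nat => i /andP[_ iM] do rewrite /dydiff iM -opprB.
rewrite sumrN (telescope_sumr (fun i => dyavg f i k)) // dyavg0; ring.
Qed.

(** Pythagoras along the filtration: a martingale difference is orthogonal to the next coarser
    average. *)
Lemma sumsq_dydiff f M :
  \sum_(0 <= i < M.+1) sumsq (dydiff f M i) (2 ^ M) = sumsq f (2 ^ M).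
Proof.
suff H m : (m <= M)%N -> sumsq f (2 ^ M) =
    \sum_(0 <= i < m) sumsq (dydiff f M i) (2 ^ M) + sumsq (dyavg f m) (2 ^ M).
  rewrite (H M) // big_nat_recr //=; congr (_ + _).
  by apply: eq_bigr => k _; rewrite /dydiff ltnn.
elim: m => [_|m IH mM].
  by rewrite big_geq // add0r; apply: eq_bigr => k _; rewrite dyavg0.
rewrite IH ?(ltnW mM) // big_nat_recr //= -addrA; congr (_ + _).
have := @sum_dyavg_mul _ (dyavg f m) (dyavg f m.+1) m.+1 M mM (dyavg_const _ _).
under [X in _ = X]eq_bigr do rewrite dyavg_tower //.
move=> E; rewrite /sumsq -big_split /=; apply/eqP; rewrite -subr_eq0 -sumrB.
have -> : \sum_(0 <= i < 2 ^ M) (dyavg f m i ^+ 2 -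
    (dydiff f M m i ^+ 2 + dyavg f m.+1 i ^+ 2)) =
    2 * (\sum_(0 <= i < 2 ^ M) dyavg f m i * dyavg f m.+1 i -
    \sum_(0 <= i < 2 ^ M) dyavg f m.+1 i * dyavg f m.+1 i).
  rewrite -sumrB mulr_sumr; apply: eq_bigr => k _; rewrite /dydiff mM; ring.
by rewrite E subrr mulr0.
Qed.

Lemma dydiff_vanish f M i : (i <= M)%N -> (forall k, (2 ^ M <= k)%N -> f k = 0) ->
  forall k, (2 ^ M <= k)%N -> dydiff f M i k = 0.
Proof.
move=> iM fN k Mk; rewrite /dydiff; case: ltnP => [im|_].
  by rewrite !(@dyavg_vanish _ f _ M) ?subrr.
exact: (@dyavg_vanish _ f _ M).
Qed.

(** The difference of index [i] is constant on blocks of length [2 ^ i] and, for [i < M], has mean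
    zero on blocks of length [2 ^ i.+1]. The coarse estimate covers [n <= i], the fine one [i < n];
    the shift from [i] to [i.+1] doubles 68. *)
Lemma short_control_dydiff f M n i : (n <= M)%N -> (i <= M)%N ->
  (forall k, (2 ^ M <= k)%N -> f k = 0) ->
  short_control (dydiff f M i) M n (136 * 2^-1 ^+ ndist i n).
Proof.
move=> nM iM fN; have v0 := dydiff_vanish iM fN.
case: (leqP n i) => [ni|i_n].
  have c : grid_const i (dydiff f M i).
    move=> k; rewrite /dydiff; case: ltnP => im.
      by rewrite !(grid_constW _ (dyavg_const f _)).
    by rewrite (grid_constW _ (dyavg_const f _)).
  have [h [h0 h1 h2 h3]] := short_control_coarse ni iM v0 c.
  have N0 := sumsq_ge0 (dydiff f M i) (2 ^ M).
  have le : 68 * 2 ^+ n / 2 ^+ i <= 136 * 2^-1 ^+ ndist i n :> R.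
    have -> : ndist i n = (i - n)%N by rewrite /ndist; lia.
    rewrite exprVn -{1}(subnK ni) exprD -mulrA.
    have -> : 2 ^+ n / (2 ^+ (i - n) * 2 ^+ n) = (2 ^+ (i - n))^-1 :> R.
      by field; rewrite !expf_neq0.
    by rewrite ler_wpM2r ?ler_nat // invr_ge0 exprn_ge0.
  exists h; split => //.
    by apply: le_trans h2 _; rewrite ler_wpM2r.
  by apply: le_trans h3 _; rewrite ler_wpM2r.
have iM' : (i < M)%N := leq_trans i_n nM.
have z j : \sum_(0 <= a < 2 ^ i.+1) dydiff f M i (j * 2 ^ i.+1 + a)%N = 0.
  have : dyavg (dydiff f M i) i.+1 (j * 2 ^ i.+1)%N = 0.
    rewrite (_ : dydiff f M i = fun k => dyavg f i k - dyavg f i.+1 k); last first.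
      by apply/funext => k; rewrite /dydiff iM'.
    by rewrite dyavgB dyavg_tower // dyavg_tower // subrr.
  rewrite /dyavg /grid mulnK ?expn_gt0 // => /eqP.
  by rewrite mulf_eq0 invr_eq0 (gt_eqF (exp2_gt0 _)) orbF => /eqP.
have [h [h0 h1 h2 h3]] := short_control_fine i_n iM' v0 z.
have N0 := sumsq_ge0 (dydiff f M i) (2 ^ M).
have le : 68 * 2 ^+ i.+1 / 2 ^+ n = 136 * 2^-1 ^+ ndist i n :> R.
  have -> : ndist i n = (n - i)%N by rewrite /ndist; lia.
  rewrite exprVn -{1}(subnK (ltnW i_n)) exprD exprS.
  by field; rewrite !expf_neq0.
by exists h; split => //; rewrite -le.
Qed.

Definition tlog (l : nat) : nat := trunc_log 2 l.

Lemma tlogE n l : (2 ^ n <= l < 2 ^ n.+1)%N -> tlog l = n.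
Proof. by move=> H; apply: trunc_log_eq. Qed.

Lemma sum_dyadic_ranges (G : nat -> R) M : \sum_(1 <= l < 2 ^ M) G l =
  \sum_(0 <= n < M) \sum_(2 ^ n <= l < 2 ^ n.+1) G l.
Proof.
elim: M => [|M IH]; first by rewrite !big_geq.
rewrite big_nat_recr //= -IH -big_cat_nat ?expn_gt0 //.
by rewrite leq_exp2l.
Qed.

Lemma scale_control : exists2 C : R, 0 < C & forall f M n, (n <= M)%N ->
  (forall k, (2 ^ M <= k)%N -> f k = 0) -> exists h : nat -> nat -> R,
  let S := C * \sum_(0 <= i < M.+1) (3 / 4) ^+ ndist i n * sumsq (dydiff f M i) (2 ^ M) in
  [/\ forall k l, 0 <= h k l,
      forall k x y, (2 ^ n <= x)%N -> (x < y < 2 ^ n.+1)%N ->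
        (wavg f k x - wavg f k y) ^+ 2 <= \sum_(x <= l < y) h k l,
      \sum_(0 <= k < 2 ^ M) \sum_(2 ^ n <= l < 2 ^ n.+1) h k l <= S &
      \sum_(0 <= k < 2 ^ M) (wavg f k (2 ^ n) - dyavg f n k) ^+ 2 <= S].
Proof.
have [C CE] : exists C : R, C = 6 * 136 by eexists.
exists C => [|f M n nM fN]; first by rewrite CE mulr_gt0 ?ltr0n.
have /choice[H HP] : forall i, exists h : nat -> nat -> R, (i <= M)%N ->
  [/\ forall k l, 0 <= h k l,
      forall k x y, (2 ^ n <= x)%N -> (x < y < 2 ^ n.+1)%N ->
        (wavg (dydiff f M i) k x - wavg (dydiff f M i) k y) ^+ 2 <= \sum_(x <= l < y) h k l,
      \sum_(0 <= k < 2 ^ M) \sum_(2 ^ n <= l < 2 ^ n.+1) h k l <=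
         136 * 2^-1 ^+ ndist i n * sumsq (dydiff f M i) (2 ^ M) &
      \sum_(0 <= k < 2 ^ M) (wavg (dydiff f M i) k (2 ^ n) - dyavg (dydiff f M i) n k) ^+ 2 <=
         136 * 2^-1 ^+ ndist i n * sumsq (dydiff f M i) (2 ^ M)].
  move=> i; have [iM|iM] := leqP i M; last by exists (fun _ _ => 0).
  by have [h ?] := short_control_dydiff nM iM fN; exists h.
(* The decay [2^-1] splits as [2 / 3] times [3 / 4]: the first factor makes Cauchy-Schwarz over [i]
   summable, with total at most 6, and the second survives for the sum over scales. *)
pose rho i : R := (2 / 3) ^+ ndist i n.
have rho0 i : 0 < rho i by rewrite exprn_gt0.
have rho6 : \sum_(0 <= i < M.+1) rho i <= 6.
  have r01 : 0 <= (2 / 3 : R) < 1 by apply/andP; split; lra.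
  by apply: le_trans (sum_geo_dist_le n 0 M.+1 r01) _; rewrite le_eqVlt; apply/orP; left; apply/eqP; field.
have comb (x : nat -> R) : (\sum_(0 <= i < M.+1) x i) ^+ 2 <=
    6 * \sum_(0 <= i < M.+1) x i ^+ 2 / rho i.
  apply: le_trans (cauchy_weighted _ _ rho0) _; rewrite ler_wpM2r // sum_ge0_nat // => i.
  by rewrite divr_ge0 ?sqr_ge0 // ltW.
have geo i : 6 * (136 * 2^-1 ^+ ndist i n / rho i) = C * (3 / 4) ^+ ndist i n :> R.
  rewrite CE -!mulrA /rho -expr_div_n; have -> : 2^-1 / (2 / 3) = 3 / 4 :> R by field.
  by [].
exists (fun k l => 6 * \sum_(0 <= i < M.+1) H i k l / rho i) => S.
have fE := sum_dydiff f M.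
have sumS (A : nat -> R) :
    (forall i, (i <= M)%N -> A i <= 136 * 2^-1 ^+ ndist i n * sumsq (dydiff f M i) (2 ^ M)) ->
    6 * \sum_(0 <= i < M.+1) A i / rho i <= S.
  move=> AH; rewrite /S !mulr_sumr; apply: ler_sum_nat => i /andP[_ iM].
  rewrite [leRHS]mulrA -geo.
  have -> a b c : 6 * (a / b) * c = 6 * (a * c / b) :> R by ring.
  by rewrite ler_wpM2l // ler_pM2r ?invr_gt0 // AH.
split.
- move=> k l; rewrite mulr_ge0 // big_nat_cond sumr_ge0 // => i /andP[/andP[_ iM] _].
  by rewrite divr_ge0 ?(ltW (rho0 i)) //; have [] := HP _ iM.
- move=> k x y nx xy.
  have E l : wavg f k l = \sum_(0 <= i < M.+1) wavg (dydiff f M i) k l.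
    by rewrite -wavg_sumf; congr wavg; apply/funext.
  rewrite !E -sumrB; apply: le_trans (comb _) _; rewrite -mulr_sumr ler_wpM2l //.
  rewrite exchange_big /=; apply: ler_sum_nat => i /andP[_ iM].
  rewrite -mulr_suml ler_pM2r ?invr_gt0 //; have [_ HH _ _] := HP _ iM; exact: HH.
- under eq_bigr do rewrite -mulr_sumr exchange_big /=.
  rewrite -mulr_sumr exchange_big /=.
  under eq_bigr => i _.
    under eq_bigr do rewrite -mulr_suml.
    rewrite -mulr_suml; over.
  by apply: sumS => i iM; have [] := HP _ iM.
- have E k : wavg f k (2 ^ n) - dyavg f n k = \sum_(0 <= i < M.+1)
       (wavg (dydiff f M i) k (2 ^ n) - dyavg (dydiff f M i) n k).
    rewrite sumrB -wavg_sumf -dyavg_sumf; congr (wavg _ _ _ - dyavg _ _ _);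
    exact/funext.
  apply: (@le_trans _ _ (\sum_(0 <= k < 2 ^ M) 6 * \sum_(0 <= i < M.+1)
     (wavg (dydiff f M i) k (2 ^ n) - dyavg (dydiff f M i) n k) ^+ 2 / rho i)).
    by apply: ler_sum => k _; rewrite E; exact: comb.
  rewrite -mulr_sumr exchange_big /=.
  under eq_bigr => i _ do rewrite -mulr_suml.
  by apply: sumS => i iM; have [] := HP _ iM.
Qed.

Definition osc f k l : R := wavg f k l - dyavg f (tlog l) k.

(** Each dyadic range of lengths has its own control, and [block_control] glues the ranges, the size
    of [osc] on a range being bounded by its value at [2 ^ n] and the mass of the control. Summing
    the decay [3 / 4] over scales gives 8; the factor 17 counts the control inside the ranges once
    and each of the two boundary charges 8 times. *)
Lemma osc_control : exists2 C : R, 0 < C & forall f M,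
  (forall k, (2 ^ M <= k)%N -> f k = 0) -> exists h : nat -> nat -> R,
  [/\ forall k l, 0 <= h k l,
      forall k x y, (1 <= x)%N -> (x < y < 2 ^ M)%N ->
        (osc f k x - osc f k y) ^+ 2 <= \sum_(x <= l < y) h k l &
      \sum_(0 <= k < 2 ^ M) \sum_(1 <= l < 2 ^ M) h k l <= C * sumsq f (2 ^ M)].
Proof.
have [C C0 SC] := scale_control.
exists (17 * (C * 8)); first by rewrite mulr_gt0 ?ltr0n // mulr_gt0 // ltr0n.
move=> f M fN.
have /choice[H HP] : forall n, exists h : nat -> nat -> R, (n <= M)%N ->
  let S := C * \sum_(0 <= i < M.+1) (3 / 4) ^+ ndist i n * sumsq (dydiff f M i) (2 ^ M) in
  [/\ forall k l, 0 <= h k l,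
      forall k x y, (2 ^ n <= x)%N -> (x < y < 2 ^ n.+1)%N ->
        (wavg f k x - wavg f k y) ^+ 2 <= \sum_(x <= l < y) h k l,
      \sum_(0 <= k < 2 ^ M) \sum_(2 ^ n <= l < 2 ^ n.+1) h k l <= S &
      \sum_(0 <= k < 2 ^ M) (wavg f k (2 ^ n) - dyavg f n k) ^+ 2 <= S].
  move=> n; have [nM|nM] := leqP n M; last by exists (fun _ _ => 0).
  by have [h ?] := SC f M n nM fN; exists h.
pose S n := C * \sum_(0 <= i < M.+1) (3 / 4) ^+ ndist i n * sumsq (dydiff f M i) (2 ^ M).
have S0 n : 0 <= S n.
  apply: mulr_ge0; first exact: ltW.
  by apply: sum_ge0_nat => i; apply: mulr_ge0; rewrite ?sumsq_ge0 // exprn_ge0.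
have sumS : \sum_(0 <= n < M) S n <= C * 8 * sumsq f (2 ^ M).
  rewrite -mulr_sumr -mulrA ler_wpM2l ?(ltW C0) // exchange_big /= -sumsq_dydiff mulr_sumr.
  apply: ler_sum => i _; rewrite -mulr_suml ler_wpM2r ?sumsq_ge0 //.
  under eq_bigr do rewrite ndistC.
  have r01 : 0 <= (3 / 4 : R) < 1 by apply/andP; split; lra.
  by apply: le_trans (sum_geo_dist_le i 0 M r01) _; rewrite le_eqVlt; apply/orP; left; apply/eqP; field.
pose hh k l := if (tlog l < M)%N then H (tlog l) k l else 0.
have hh0 k l : 0 <= hh k l.
  by rewrite /hh; case: ifP => // /ltnW nM; have [] := HP _ nM.
pose mB k n := if (n < M)%N then 2 * (wavg f k (2 ^ n) - dyavg f n k) ^+ 2 +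
   2 * \sum_(2 ^ n <= l < 2 ^ n.+1) H n k l else 0.
have mB0 k n : 0 <= mB k n.
  rewrite /mB; case: ifP => // /ltnW nM; have [h0 _ _ _] := HP _ nM.
  by apply: addr_ge0; apply: mulr_ge0 => //; [exact: sqr_ge0|exact: sum_ge0_nat].
have summB n : \sum_(0 <= k < 2 ^ M) mB k n <= if (n < M)%N then 4 * S n else 0.
  rewrite /mB; case: ifP => [/ltnW nM|_]; last by rewrite big1.
  have [_ _ h2 h3] := HP _ nM; rewrite big_split /= -!mulr_sumr.
  move: h2 h3; rewrite -/(S n); lra.
pose bd k l := if tlog l == tlog l.+1 then 0 else 2 * mB k (tlog l) + 2 * mB k (tlog l.+1).
have tl l : (0 < l)%N -> (2 ^ tlog l <= l < 2 ^ (tlog l).+1)%N.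
  by move=> l0; rewrite /tlog trunc_logP // trunc_log_ltn.
have tlM l : (0 < l < 2 ^ M)%N -> (tlog l < M)%N.
  move=> /andP[l0 lM]; have /andP[t1 _] := tl _ l0.
  by have := leq_ltn_trans t1 lM; rewrite ltn_exp2l.
exists (fun k l => hh k l + bd k l); split.
- by move=> k l; rewrite addr_ge0 // /bd; case: ifP => // _; rewrite addr_ge0 ?mulr_ge0.
- move=> k x y x1 xy.
  apply: (@block_control R (osc f k) tlog (hh k) (mB k) 1 (2 ^ M)) => //.
  + move=> {x1 xy}x {}y x1 /andP[xy yM] e.
    have x0M : (0 < x < 2 ^ M)%N by rewrite x1 (ltn_trans xy).
    have y0M : (0 < y < 2 ^ M)%N by rewrite yM (ltn_trans _ xy).
    have nM := ltnW (tlM _ x0M).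
    rewrite /osc e opprB addrA subrK.
    have [_ h1 _ _] := HP _ nM.
    have /andP[tx _] := tl _ x1.
    have /andP[_ ty] := tl _ (ltn_trans x1 xy); rewrite -e in ty.
    apply: le_trans (h1 k x y tx _) _; first by rewrite xy.
    rewrite le_eqVlt; apply/orP; left; apply/eqP; apply: eq_big_nat => l /andP[xl ly].
    rewrite /hh (@tlogE (tlog x) l) ?(tlM _ x0M) //.
    by rewrite (leq_trans tx xl) (ltn_trans ly ty).
  + move=> {x1 xy}x /[dup] x0M /andP[x1 xM].
    have nM := tlM _ x0M; have [h0 h1 _ _] := HP _ (ltnW nM).
    have /andP[tx tx'] := tl _ x1.
    rewrite /mB nM.
    have -> : osc f k x = (wavg f k (2 ^ tlog x) - dyavg f (tlog x) k) -
       (wavg f k (2 ^ tlog x) - wavg f k x) by rewrite /osc; ring.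
    apply: le_trans (sqrrB_le _ _) _; rewrite lerD2l ler_wpM2l //.
    move: tx; rewrite leq_eqVlt => /orP[/eqP e|tx].
      by rewrite e subrr expr0n sum_ge0_nat.
    apply: le_trans (h1 k _ x (leqnn _) _) _; first by rewrite tx.
    by apply: le_sum_nat_sub => //; exact: ltnW.
- under eq_bigr do rewrite big_split /=.
  rewrite big_split /=.
  have H1 : \sum_(0 <= k < 2 ^ M) \sum_(1 <= l < 2 ^ M) hh k l <= \sum_(0 <= n < M) S n.
    under eq_bigr do rewrite sum_dyadic_ranges.
    rewrite exchange_big /=; apply: ler_sum_nat => n /andP[_ nM].
    have [_ _ h2 _] := HP _ (ltnW nM); apply: le_trans h2.
    apply: ler_sum => k _; rewrite le_eqVlt; apply/orP; left; apply/eqP.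
    by apply: eq_big_nat => l lH; rewrite /hh (tlogE lH) nM.
  have H2 : \sum_(0 <= k < 2 ^ M) \sum_(1 <= l < 2 ^ M) bd k l <=
      \sum_(0 <= n < M) (8 * S n + if (n.+1 < M)%N then 8 * S n.+1 else 0).
    under eq_bigr do rewrite sum_dyadic_ranges.
    rewrite exchange_big /=; apply: ler_sum_nat => n /andP[_ nM].
    apply: (@le_trans _ _ (\sum_(0 <= k < 2 ^ M) (2 * mB k n + 2 * mB k n.+1))).
      apply: ler_sum => k _.
      rewrite expnS mul2n -addnn sum_from; apply: sum_last_le; first by rewrite expn_gt0.
        move=> i iN; rewrite /bd.
        have N2 : (2 ^ n.+1 = 2 ^ n + 2 ^ n)%N by rewrite expnS mul2n addnn.
        by rewrite !(@tlogE n) ?eqxx //; lia.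
      have N2 : (2 ^ n.+1 = 2 ^ n + 2 ^ n)%N by rewrite expnS mul2n addnn.
      have N3 : (0 < 2 ^ n)%N by rewrite expn_gt0.
      have N4 : (2 ^ n.+2 = 2 ^ n.+1 + 2 ^ n.+1)%N by rewrite [in LHS]expnS mul2n addnn.
      have t1 : tlog (2 ^ n + (2 ^ n).-1) = n by apply: tlogE; lia.
      have t2 : tlog (2 ^ n + (2 ^ n).-1).+1 = n.+1 by apply: tlogE; lia.
      rewrite /bd t1 t2.
      by case: ifP => // _; rewrite addr_ge0 ?mulr_ge0.
    rewrite big_split /= -!mulr_sumr.
    have := summB n; have := summB n.+1; rewrite nM.
    by case: ifP => _; lra.
  have H3 : \sum_(0 <= n < M) (if (n.+1 < M)%N then 8 * S n.+1 else 0) <=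
      8 * \sum_(0 <= n < M) S n.
    case: (M) => [|m]; first by rewrite !big_geq // mulr0.
    rewrite big_nat_recr //= ltnn addr0 [in leRHS]big_ltn // big_add1 /= mulrDr.
    apply: (@le_trans _ _ (8 * \sum_(0 <= i < m) S i.+1)).
      rewrite mulr_sumr; apply: ler_sum_nat => i /andP[_ im].
      by rewrite ltnS im.
    by rewrite lerDr mulr_ge0.
  move: H2; rewrite big_split /= -mulr_sumr; lra.
Qed.

End short_energy.

(** * Weak type estimates on the integers *)

Section weak_type_22.
Context {R : realType}.
Implicit Types (f g : nat -> R) (t : R).

(* Greedy stopping along the dyadic averages, from the coarsest scale [M] to
   the finest: [stopval f t M j] is the value at the last stop among the [j]
   coarsest scales. *)
Fixpoint stopval f (t : R) M (j : nat) (k : nat) : R :=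
  if j is j'.+1 then
    if t <= `|dyavg f (M - j') k - stopval f t M j' k| then dyavg f (M - j') k
    else stopval f t M j' k
  else 0.

Definition stopat f (t : R) M n k : bool :=
  t <= `|dyavg f n k - stopval f t M (M - n) k|.

Lemma stopvalE f t M n k : (n <= M)%N -> stopval f t M (M.+1 - n) k =
  if stopat f t M n k then dyavg f n k else stopval f t M (M - n) k.
Proof. by move=> nM; rewrite subSn //= subKn. Qed.

Lemma stopval_const f t M j : (j <= M.+1)%N -> grid_const (M.+1 - j) (stopval f t M j).
Proof.
elim: j => [//|j IH jM] k /=.
have IH' : grid_const (M - j) (stopval f t M j).
  by apply: grid_constW (IH (ltnW jM)); rewrite leq_sub2r.
by rewrite subSS IH' dyavg_const.
Qed.

Lemma stopval_near f t M n k : (n <= M)%N -> 0 < t ->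
  `|dyavg f n k - stopval f t M (M.+1 - n) k| < t.
Proof.
move=> nM t0; rewrite stopvalE //; case: ifPn => [_|].
  by rewrite subrr normr0.
by rewrite /stopat -ltNge.
Qed.

Lemma stopval_eq f t M x y k : (x <= y <= M.+1)%N ->
  (forall n, (x <= n < y)%N -> ~~ stopat f t M n k) ->
  stopval f t M (M.+1 - x) k = stopval f t M (M.+1 - y) k.
Proof.
move=> /andP[xy yM]; elim: y xy yM => [|y IH]; first by rewrite leqn0 => /eqP->.
rewrite leq_eqVlt => /orP[/eqP->//|]; rewrite ltnS => xy yM H.
rewrite IH // ?(ltnW yM) // => [|n /andP[xn ny]]; last by apply: H; rewrite xn ltnS ltnW.
by rewrite stopvalE // (negbTE (H y _)) ?xy ?ltnSn // subSS.
Qed.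

(** Without a stop in between, both averages are within [t] of one and the same stopped value. *)
Lemma jump_has_stop f t M x y k : 0 < t -> (x < y <= M)%N ->
  2 * t <= `|dyavg f x k - dyavg f y k| ->
  exists2 n, (x <= n < y)%N & stopat f t M n k.
Proof.
move=> t0 /andP[xy yM] big; apply: contrapT => H.
have E : stopval f t M (M.+1 - x) k = stopval f t M (M.+1 - y) k.
  apply: stopval_eq; first by rewrite (ltnW xy) (leqW yM).
  by move=> n xn; apply/negP => st; apply: H; exists n.
have := @stopval_near f t M x k (ltnW (leq_trans xy yM)) t0.
have := @stopval_near f t M y k yM t0; rewrite -E.
set r := stopval _ _ _ _ _ => h1 h2.
have : `|dyavg f x k - dyavg f y k| <= `|dyavg f x k - r| + `|dyavg f y k - r|.
  have -> : dyavg f x k - dyavg f y k = (dyavg f x k - r) - (dyavg f y k - r) by ring.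
  exact: ler_normB.
lra.
Qed.

Lemma large_has_stop f t M x k : 0 < t -> (x <= M)%N -> t <= `|dyavg f x k| ->
  exists2 n, (x <= n < M.+1)%N & stopat f t M n k.
Proof.
move=> t0 xM big; apply: contrapT => H.
have E : stopval f t M (M.+1 - x) k = stopval f t M (M.+1 - M.+1) k.
  apply: stopval_eq; first by rewrite (leqW xM) /=.
  by move=> n xn; apply/negP => st; apply: H; exists n.
have := @stopval_near f t M x k xM t0.
by rewrite E subnn /= subr0 ltNge big.
Qed.

(** The squared distance [P n] from [f] to the stopped values is used as an energy. When a new stop
    replaces the old value by the average, the energy drops by the square of their difference, by
    orthogonality, hence by at least [t ^+ 2] at each stopped point. *)
Lemma sum_stopat_le f t M : 0 < t ->
  t ^+ 2 * \sum_(0 <= k < 2 ^ M) \sum_(0 <= n < M.+1) (stopat f t M n k)%:R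
    <= sumsq f (2 ^ M).
Proof.
move=> t0.
pose P n := \sum_(0 <= k < 2 ^ M) (f k - stopval f t M (M.+1 - n) k) ^+ 2.
suff H n : (n <= M.+1)%N ->
    P 0%N + t ^+ 2 * \sum_(0 <= k < 2 ^ M) \sum_(0 <= i < n) (stopat f t M i k)%:R <= P n.
  have := H M.+1 (leqnn _); rewrite {2}/P subnn /=.
  under [in leRHS]eq_bigr do rewrite subr0.
  have : 0 <= P 0%N by apply: sum_ge0_nat => k; exact: sqr_ge0.
  by rewrite /sumsq; lra.
elim: n => [_|n IH nM].
  by rewrite [X in _ * X]big1 ?mulr0 ?addr0 // => k _; rewrite big_geq.
have step : P n + t ^+ 2 * \sum_(0 <= k < 2 ^ M) (stopat f t M n k)%:R <= P n.+1.
  pose phi k := (stopat f t M n k)%:R * (dyavg f n k - stopval f t M (M - n) k).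
  have phic : grid_const n phi.
    move=> k; have c : grid_const n (stopval f t M (M - n)).
      by apply: grid_constW (stopval_const _ _ _); rewrite ?subSn ?subKn ?leq_subr // ltnW // ltnS leq_subr.
    by rewrite /phi /stopat dyavg_const c.
  have nM' : (n <= M)%N by [].
  have E := sum_dyavg_mul f nM' phic.
  rewrite mulr_sumr -lerBrDl -sumrB.
  apply: (@le_trans _ _ (\sum_(0 <= k < 2 ^ M) phi k ^+ 2)).
    apply: ler_sum => k _; rewrite /phi /stopat; case: (leP t) => [h|_].
      rewrite mulr1 mul1r -[leRHS]real_normK ?num_real //.
      by rewrite lerXn2r ?nnegrE // ltW.
    by rewrite mulr0 mul0r expr0n.
  have -> : \sum_(0 <= k < 2 ^ M) phi k ^+ 2 =
     \sum_(0 <= k < 2 ^ M) (phi k ^+ 2 + 2 * (f k * phi k) - 2 * (dyavg f n k * phi k)).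
    by rewrite sumrB big_split /= -!mulr_sumr E addrK.
  rewrite le_eqVlt; apply/orP; left; apply/eqP; apply: eq_bigr => k _.
  rewrite subSS stopvalE // /phi; case: (stopat f t M n k) => /=; ring.
apply: le_trans step; move: (IH (ltnW nM)).
have -> : \sum_(0 <= k < 2 ^ M) \sum_(0 <= i < n.+1) (stopat f t M i k)%:R =
   \sum_(0 <= k < 2 ^ M) \sum_(0 <= i < n) (stopat f t M i k)%:R +
   \sum_(0 <= k < 2 ^ M) (stopat f t M n k)%:R :> R.
  by rewrite -big_split /=; apply: eq_bigr => k _; rewrite big_nat_recr.
lra.
Qed.

Lemma exp_small (u x : R) : 0 <= u <= 2^-1 -> 0 < x -> exists I, u ^+ I <= x.
Proof.
move=> /andP[u0 u2] x0; have [I xI] : exists I : nat, x^-1 <= I%:R.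
  by exists (Num.bound x^-1); apply/ltW/archi_boundP; rewrite invr_ge0 ltW.
exists I.+1; apply: (@le_trans _ _ (2^-1 ^+ I.+1)); first by rewrite lerXn2r ?nnegrE.
rewrite exprVn -[leRHS]invrK lef_pV2 ?posrE ?exprn_gt0 ?invr_gt0 //.
apply: le_trans xI _; rewrite -natrX ler_nat; apply: ltnW; apply: ltn_trans (ltnSn I) _.
exact: ltn_expl.
Qed.

Lemma powR_exprn (a q : R) n : 0 <= a -> (a ^+ n) `^ q = (a `^ q) ^+ n.
Proof.
move=> a0; elim: n => [|n IH]; first by rewrite !expr0 powR1.
by rewrite !exprS powRM ?exprn_ge0 // IH.
Qed.

Lemma powR_half_lt (q : R) : 2 < q -> 2^-1 `^ q < 4^-1.
Proof.
move=> q2; have -> : q = 2 + (q - 2) by ring.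
rewrite powRD; last by apply/implyP => _; rewrite invr_eq0 pnatr_eq0.
have -> : (2^-1 : R) `^ 2 = 4^-1 by rewrite (powR_mulrn 2) ?invr_ge0 // exprVn -natrX.
have : (2^-1 : R) `^ (q - 2) < 1 `^ (q - 2).
  by rewrite gt0_ltr_powR ?nnegrE //; lra.
rewrite powR1; lra.
Qed.

(** Points having a stop at threshold [lam] are few by Chebyshev. At the others all averages are
    below [lam]; jumps are sorted by height, and a jump of height about [2 * t i] contains a stop at
    threshold [t i]. The stops at [t i] cost [4 ^+ i] and weigh [u ^+ i], so the total is a
    geometric series of ratio [th]. *)
Lemma martingale_weak22 (q : R) : 2 < q -> exists2 C : R, 0 < C &
  forall f M (lam : R), 0 < lam ->
  lam ^+ 2 * \sum_(0 <= k < 2 ^ M) (lam `^ q < vq q (fun n => dyavg f n k) M)%R%:R <=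
    C * sumsq f (2 ^ M).
Proof.
move=> q2; set u : R := 2^-1 `^ q.
have u4 : u < 4^-1 := powR_half_lt q2.
have u0 : 0 <= u := powR_ge0 _ _.
pose th := 4 * u.
have th01 : 0 <= th < 1 by apply/andP; split; rewrite /th; lra.
have th1 : 0 < 1 - th by case/andP: th01; lra.
set c : R := 2 `^ q.
have c0 : 0 < c by apply: powR_gt0.
exists (1 + 8 * c / (1 - th)); first by rewrite addr_gt0 // divr_gt0 ?mulr_gt0.
move=> f M lam lam0; set N := sumsq f _.
have N0 : 0 <= N := sumsq_ge0 _ _.
have lq0 : 0 < lam `^ q by apply: powR_gt0.
(* Jumps below the last level [I] are not counted by stops; there are few scales, and with this [I]
   all such jumps together use at most half of the threshold. *)
have [I HI] : exists I, u ^+ I <= (2 * c * M.+1%:R)^-1.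
  apply: exp_small; first by apply/andP; split; lra.
  by rewrite invr_gt0 !mulr_gt0 // ltr0Sn.
pose t i := lam * 2^-1 ^+ i.+1.
have t0 i : 0 < t i by rewrite mulr_gt0 // exprn_gt0 // invr_gt0.
pose J i k : R := \sum_(0 <= n < M.+1) (stopat f (t i) M n k)%:R.
have J0 i k : 0 <= J i k by apply: sum_ge0_nat => n; exact: ler0n.
pose J' k : R := \sum_(0 <= n < M.+1) (stopat f lam M n k)%:R.
have J0' k : 0 <= J' k by apply: sum_ge0_nat => n; exact: ler0n.
pose w i : R := c * lam `^ q * u ^+ i.
have w0 i : 0 <= w i by rewrite !mulr_ge0 ?exprn_ge0 // ltW.
have wE i : (2 * lam * 2^-1 ^+ i) `^ q = w i.
  rewrite !powRM ?mulr_ge0 ?exprn_ge0 ?invr_ge0 // ?(ltW lam0) //.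
  by rewrite powR_exprn ?invr_ge0.
have pointwise k : (lam `^ q < vq q (fun n => dyavg f n k) M)%R%:R <=
    J' k + 2 / lam `^ q * \sum_(0 <= i < I) w i * J i k.
  have rhs0 : 0 <= 2 / lam `^ q * \sum_(0 <= i < I) w i * J i k.
    rewrite mulr_ge0 ?divr_ge0 ?(ltW lq0) // sum_ge0_nat // => i; exact: mulr_ge0.
  case: ltP => big; last by rewrite addr_ge0.
  rewrite -[true%:R]/(1 : R).
  have [[n nM st]|nost] := pselect (exists2 n, (n < M.+1)%N & stopat f lam M n k).
    have : 1 <= J' k.
      have := @le_sum_term R (fun n => (stopat f lam M n k)%:R) 0 M.+1 n (fun=> ler0n _ _) nM.
      by rewrite /= st -[true%:R]/(1 : R).
    lra.
  have small n : (n <= M)%N -> `|dyavg f n k| < lam.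
    move=> nM; rewrite ltNge; apply/negP => /(large_has_stop lam0 nM)[n' /andP[_ nM'] st].
    by apply: nost; exists n'.
  suff : lam `^ q <= 2 * \sum_(0 <= i < I) w i * J i k.
    move=> H; rewrite -[leLHS]add0r lerD //.
    by rewrite mulrAC ler_pdivlMr // mul1r.
  (* An additive control of the q-th powers: a stop of level [i] pays for the jumps of that level
     across it, and [w I] for the tiny ones. *)
  pose h n := \sum_(0 <= i < I) w i * (stopat f (t i) M n k)%:R + w I.
  have h0 n : 0 <= h n.
    by rewrite addr_ge0 // sum_ge0_nat // => i; rewrite mulr_ge0.
  have hc x y : (x < y <= M)%N -> `|dyavg f x k - dyavg f y k| `^ q <= (\sum_(x <= i < y) h i) `^ 1.
    move=> /andP[xy yM]; rewrite powRr1 ?sum_ge0_nat //.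
    set d : R := `|_ - _|.
    have d0 : 0 <= d := normr_ge0 _.
    have dl : d < 2 * lam * 2^-1 ^+ 0.
      rewrite expr0 mulr1; have := small x (leq_trans (ltnW xy) yM); have := small y yM.
      have := ler_normB (dyavg f x k) (dyavg f y k); rewrite -/d; lra.
    have q0 : 0 <= q by lra.
    have [H|[i [iI H1 H2]]] : d <= 2 * lam * 2^-1 ^+ I \/
        (exists i, [/\ (i < I)%N, 2 * t i <= d & d <= 2 * lam * 2^-1 ^+ i]).
      elim: (I) => [|j [IH|[i [ij A B]]]]; first by left; exact: ltW.
        have [A|A] := leP d (2 * lam * 2^-1 ^+ j.+1); first by left.
        by right; exists j; split => //; rewrite /t mulrA; exact: ltW.
      by right; exists i; split => //; exact: leqW.
      have : d `^ q <= w I.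
        rewrite -wE ge0_ler_powR ?nnegrE //.
        by rewrite !mulr_ge0 ?exprn_ge0 ?invr_ge0 // ltW.
      move=> /le_trans; apply; have := le_sum_term h0 (_ : (x <= x < y)%N).
      rewrite leqnn xy => /(_ isT); apply: le_trans.
      by rewrite lerDr sum_ge0_nat // => i; rewrite mulr_ge0.
    have xyM : (x < y <= M)%N by rewrite xy.
    have [n nxy st] := jump_has_stop (t0 i) xyM H1.
    have : d `^ q <= w i.
      rewrite -wE ge0_ler_powR ?nnegrE //.
      by rewrite !mulr_ge0 ?exprn_ge0 ?invr_ge0 // ltW.
    move=> /le_trans; apply; apply: le_trans (le_sum_term h0 nxy).
    have : w i <= \sum_(0 <= i0 < I) w i0 * (stopat f (t i0) M n k)%:R.
      have := @le_sum_term R (fun i => w i * (stopat f (t i) M n k)%:R) 0 I i.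
      by rewrite /= st mulr1; apply => // j; rewrite mulr_ge0.
    by rewrite /h; have := w0 I; lra.
  have := @vq_control R q 1 _ h M (lexx 1) h0 hc.
  rewrite powRr1 ?sum_ge0_nat // => vle.
  have : \sum_(0 <= n < M) h n <= \sum_(0 <= i < I) w i * J i k + M.+1%:R * w I.
    apply: (@le_trans _ _ (\sum_(0 <= n < M.+1) h n)); first exact: le_sum_nat_sub.
    rewrite big_split /= sumr_const_nat subn0 [M.+1%:R * _]mulr_natl lerD2r exchange_big /=.
    by apply: ler_sum => i _; rewrite -mulr_sumr.
  have : M.+1%:R * w I <= lam `^ q / 2.
    have -> : lam `^ q / 2 = M.+1%:R * (c * lam `^ q * (2 * c * M.+1%:R)^-1).
      have M0 : (M.+1%:R : R) != 0 by rewrite pnatr_eq0.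
      by move: (M.+1%:R : R) M0 => m M0; field; rewrite M0 gt_eqF.
    rewrite ler_wpM2l // /w ler_wpM2l // mulr_ge0 // ltW //.
  lra.
have sumJ (s : R) : 0 < s -> \sum_(0 <= k < 2 ^ M) \sum_(0 <= n < M.+1) (stopat f s M n k)%:R <= N / s ^+ 2.
  by move=> s0; rewrite ler_pdivlMr ?exprn_gt0 // mulrC; exact: sum_stopat_le.
apply: (@le_trans _ _ (lam ^+ 2 * \sum_(0 <= k < 2 ^ M)
   (J' k + 2 / lam `^ q * \sum_(0 <= i < I) w i * J i k))).
  by rewrite ler_wpM2l ?sqr_ge0 //; apply: ler_sum => k _; exact: pointwise.
have swapJ : \sum_(0 <= k < 2 ^ M) \sum_(0 <= i < I) w i * J i k =
    \sum_(0 <= i < I) w i * \sum_(0 <= k < 2 ^ M) J i k.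
  by rewrite exchange_big; apply: eq_bigr => i _; rewrite mulr_sumr.
rewrite big_split /= -mulr_sumr swapJ.
have H2 : \sum_(0 <= i < I) w i * \sum_(0 <= k < 2 ^ M) J i k <=
    4 * c * lam `^ q * (N / lam ^+ 2) / (1 - th).
  apply: (@le_trans _ _ (\sum_(0 <= i < I) 4 * c * lam `^ q * (N / lam ^+ 2) * th ^+ i)).
    apply: ler_sum => i _; apply: (@le_trans _ _ (w i * (N / t i ^+ 2))).
      by rewrite ler_wpM2l ?sumJ.
    rewrite le_eqVlt; apply/orP; left; apply/eqP.
    have -> : t i ^+ 2 = lam ^+ 2 / (4 * 4 ^+ i).
      rewrite /t exprMn -exprM mulnC exprM.
      have -> : (2^-1 : R) ^+ 2 = 4^-1 by rewrite exprVn -natrX.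
      by rewrite exprVn [4 ^+ i.+1]exprS.
    rewrite /w /th exprMn.
    have E4 : (4 : R) ^+ i != 0 by rewrite expf_neq0 // pnatr_eq0.
    by field; rewrite E4 gt_eqF.
  rewrite -mulr_sumr ler_wpM2l ?sum_geo_le // !mulr_ge0 ?invr_ge0 ?sqr_ge0 // ltW //.
have : lam ^+ 2 * \sum_(0 <= k < 2 ^ M) J' k <= N.
  by rewrite mulrC -ler_pdivlMr ?exprn_gt0 //; exact: sumJ.
have : lam ^+ 2 * (2 / lam `^ q * \sum_(0 <= i < I) w i * \sum_(0 <= k < 2 ^ M) J i k) <=
   8 * c / (1 - th) * N.
  have -> : 8 * c / (1 - th) * N = lam ^+ 2 * (2 / lam `^ q * (4 * c * lam `^ q * (N / lam ^+ 2) / (1 - th))).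
    by field; rewrite !gt_eqF.
  by rewrite ler_wpM2l ?sqr_ge0 // ler_wpM2l // divr_ge0 // ltW.
lra.
Qed.

End weak_type_22.

(** * Weak type (2,2) and (1,1) of the variation of forward averages *)

Section weak_type_11.
Context {R : realType}.
Implicit Types (f g : nat -> R) (q lam : R).

Lemma sum_single (G : nat -> R) n N : (n < N)%N -> (forall i, i != n -> G i = 0) ->
  \sum_(0 <= i < N) G i = G n.
Proof.
move=> nN H; rewrite (big_cat_nat (leq0n n) (ltnW nN)) /= [X in _ + X]big_ltn //.
rewrite big_nat_cond big1 ?add0r => [|i /andP[/andP[_ i_n] _]]; last first.
  by rewrite H // ltn_eqF.
rewrite big_nat_cond big1 ?addr0 // => i /andP[/andP[ni _] _].
by rewrite H // gtn_eqF.
Qed.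

Definition wvar q f L k : R := vq q (fun N => wavg f k N.+1) L.

Lemma powR_norm_sqr q (x : R) : `|x| `^ q = (x ^+ 2) `^ (q / 2).
Proof.
rewrite -real_normK ?num_real // -(powR_mulrn 2) // -powRrM mulrCA divff ?mulr1 //.
Qed.

Lemma vq_sqr_control q (c h : nat -> R) L : 2 <= q -> (forall i, 0 <= h i) ->
  (forall x y, (x < y <= L)%N -> (c x - c y) ^+ 2 <= \sum_(x <= i < y) h i) ->
  vq q c L <= (\sum_(0 <= i < L) h i) `^ (q / 2).
Proof.
move=> q2 h0 H; apply: vq_control => //; first by lra.
move=> x y xy; rewrite powR_norm_sqr ge0_ler_powR ?nnegrE ?sqr_ge0 ?sum_ge0_nat ?H //.
lra.
Qed.

Lemma powR_sqr q (x : R) : 0 <= x -> x `^ q = (x ^+ 2) `^ (q / 2).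
Proof. by move=> x0; rewrite -powR_norm_sqr ger0_norm. Qed.

Lemma vqD_split q (c c' : nat -> R) L lam : 1 <= q -> 0 < lam ->
  lam `^ q < vq q (fun i => c i + c' i) L ->
  (lam / 4) `^ q < vq q c L \/ (lam / 4) `^ q < vq q c' L.
Proof.
move=> q1 l0 big; case: (ltP ((lam / 4) `^ q) (vq q c L)) => [|A]; first by left.
right; rewrite ltNge; apply/negP => B.
have := @vqD R q c c' L; rewrite (le_trans _ q1) // => /(_ isT) D.
have E : lam `^ q = 2 `^ q * (2 `^ q * (lam / 4) `^ q).
  rewrite -!powRM ?mulr_ge0 ?invr_ge0 ?(ltW l0) //.
  by congr (_ `^ _); field.
have p0 : 0 <= (lam / 4) `^ q := powR_ge0 _ _.
have q2 : 2 <= 2 `^ q :> R.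
  by rewrite -{1}[2]powRr1 // ler_powR // ler1n.
have : 2 * (lam / 4) `^ q <= 2 `^ q * (lam / 4) `^ q by rewrite ler_wpM2r.
have : 2 `^ q * (vq q c L + vq q c' L) <= 2 `^ q * (2 * (lam / 4) `^ q).
  by rewrite ler_wpM2l ?powR_ge0 //; lra.
move=> H1 /(ler_wpM2l (powR_ge0 2 q)) H2.
have := le_trans D (le_trans H1 H2); rewrite -E.
by rewrite leNgt big.
Qed.

(** An average over [l] terms is the martingale at scale [tlog l] plus [osc]. The first is a
    reparametrised martingale; the variation of the second is dominated by a square function, to
    which Chebyshev applies. *)
Lemma variation_weak22 q : 2 < q -> exists2 C : R, 0 < C &
  forall f M L lam, (forall k, (2 ^ M <= k)%N -> f k = 0) -> (L.+1 < 2 ^ M)%N -> 0 < lam ->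
  lam ^+ 2 * \sum_(0 <= k < 2 ^ M) (lam `^ q < wvar q f L k)%R%:R <= C * sumsq f (2 ^ M).
Proof.
move=> q2; have [C1 C10 H1] := @martingale_weak22 R q q2.
have [C2 C20 H2] := @osc_control R.
exists (16 * (C1 + C2)); first by rewrite mulr_gt0 ?addr_gt0.
move=> f M L lam fN LM l0.
have l40 : 0 < lam / 4 by rewrite divr_gt0.
have [h [h0 h1 h2]] := H2 f M fN.
have pointwise k : (lam `^ q < wvar q f L k)%R%:R <=
    ((lam / 4) `^ q < vq q (fun n => dyavg f n k) M)%R%:R +
    (\sum_(1 <= l < 2 ^ M) h k l) / (lam / 4) ^+ 2.
  have r0 : 0 <= (\sum_(1 <= l < 2 ^ M) h k l) / (lam / 4) ^+ 2.
    by rewrite divr_ge0 ?sqr_ge0 // sum_ge0_nat.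
  case: (ltP (lam `^ q)) => big; last by rewrite addr_ge0.
  rewrite -[true%:R]/(1 : R).
  have : lam `^ q < vq q (fun N => dyavg f (tlog N.+1) k + osc f k N.+1) L.
    by under eq_fun do rewrite /osc addrC subrK.
  move=> /(vqD_split _ l0)[|A|B]; first lra.
    have -> : (lam / 4) `^ q < vq q (fun n => dyavg f n k) M.
      apply: lt_le_trans A _.
      apply: (@vq_reparam R q (fun n => dyavg f n k) (fun N => tlog N.+1)); first lra.
        by move=> x y xy; rewrite /tlog leq_trunc_log.
      have := leq_ltn_trans (@trunc_logP 2 L.+1 isT isT) LM.
      by rewrite ltn_exp2l // => /ltnW.
    by rewrite -[true%:R]/(1 : R) lerDl.
  apply: (@le_trans _ _ ((\sum_(1 <= l < 2 ^ M) h k l) / (lam / 4) ^+ 2)); last by rewrite lerDr.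
  rewrite ler_pdivlMr ?exprn_gt0 // mul1r leNgt; apply/negP => C.
  move: B; apply/negP; rewrite -leNgt.
  apply: le_trans (@vq_sqr_control q _ (fun i => h k i.+1) L _ _ _) _; [lra|by []| |].
    move=> x y /andP[xy yL]; rewrite (sum_succ (h k)); apply: h1 => //.
    by rewrite ltnS xy (leq_ltn_trans _ LM).
  rewrite (sum_succ (h k)) [leRHS]powR_sqr ?(ltW l40) //.
  rewrite ge0_ler_powR ?nnegrE ?sqr_ge0 ?sum_ge0_nat //; first lra.
  by apply: le_trans (ltW C); apply: le_sum_nat_sub => //; exact: ltnW.
have l20 : 0 < (lam / 4) ^+ 2 by rewrite exprn_gt0.
have -> : lam ^+ 2 = 16 * (lam / 4) ^+ 2 by field.
rewrite -[leLHS]mulrA -[leRHS]mulrA ler_wpM2l // mulrDl.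
apply: (@le_trans _ _ ((lam / 4) ^+ 2 * \sum_(0 <= k < 2 ^ M)
   (((lam / 4) `^ q < vq q (fun n => dyavg f n k) M)%R%:R +
    (\sum_(1 <= l < 2 ^ M) h k l) / (lam / 4) ^+ 2))).
  by apply: ler_wpM2l; [exact: ltW|apply: ler_sum => k _; exact: pointwise].
rewrite big_split /= -mulr_suml mulrDr mulrCA divff ?gt_eqF // mulr1 lerD //.
exact: H1.
Qed.

(** Telescoping of [1 / (m * (m + 1))]; the strengthened induction statement keeps the current
    endpoint as long as [N] is at distance at least [s] from [l]. *)
Lemma inv_sqr_sum_le s l N : (0 < s)%N ->
  \sum_(0 <= k < N) (if (k + s < l)%N then (l - k)%:R ^- 2 else 0) <= s%:R^-1 :> R.
Proof.
move=> s0; have s0' : (0 : R) < s%:R by rewrite ltr0n.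
suff H : \sum_(0 <= k < N) (if (k + s < l)%N then (l - k)%:R ^- 2 else 0) <=
    if (N + s <= l)%N then (l - N)%:R^-1 else s%:R^-1 :> R.
  apply: le_trans H _; case: ifP => // H.
  by rewrite lef_pV2 ?posrE ?ltr0n ?ler_nat //; lia.
elim: N => [|N IH].
  by rewrite big_geq //; case: ifP => _; rewrite invr_ge0.
rewrite big_nat_recr //=; case: (leqP (N.+1 + s) l) => H.
  move: IH; rewrite ifT; last lia.
  have [m lm] : exists m, (l - N)%N = m.+2 by exists (l - N - 2)%N; lia.
  have -> : (l - N.+1)%N = m.+1 by lia.
  rewrite lm => IH.
  have a0 : (0 : R) < m.+1%:R by rewrite ltr0n.
  have -> : m.+1%:R^-1 = m.+2%:R^-1 + (m.+1%:R * m.+2%:R)^-1 :> R.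
    rewrite -[m.+2%:R]natr1; move: (m.+1%:R : R) a0 => a a0.
    by field; rewrite !gt_eqF // addr_gt0.
  apply: lerD => //; rewrite lef_pV2 ?posrE ?exprn_gt0 ?mulr_gt0 ?ltr0n //.
  by rewrite expr2 ler_wpM2r // ler_nat.
rewrite addr0; apply: le_trans IH _; case: ifP => // H3.
by rewrite lef_pV2 ?posrE ?ltr0n ?ler_nat; lia.
Qed.

Lemma dyavg_norm_le f n k : `|dyavg f n k| <= dyavg (fun i => `|f i|) n k.
Proof.
rewrite /dyavg normrM normfV [`|2 ^+ n|]ger0_norm ?exprn_ge0 //.
by rewrite ler_pM2r ?invr_gt0 ?exprn_gt0 // ler_norm_sum.
Qed.

Lemma dyavg_double_le g n k : (forall i, 0 <= g i) -> dyavg g n k <= 2 * dyavg g n.+1 k.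
Proof.
move=> g0; rewrite /dyavg exprS invfM mulrCA [2 * (_ / _)]mulrA divff // mul1r.
rewrite ler_wpM2r ?invr_ge0 ?exprn_ge0 // -!sum_from; apply: le_sum_nat_sub => //.
  by rewrite -{1}(grid_grid k (leqnSn n)) grid_le.
have /dvdnP[a ea] : (2 ^ n %| grid n k)%N by rewrite /grid dvdn_mull.
have := lt_grid n.+1 k; have := grid_le n k; move: ea => ->.
have -> : grid n.+1 k = (k %/ 2 ^ n.+1 * 2 * 2 ^ n)%N by rewrite /grid expnS mulnA.
rewrite expnS -!mulnDl => A B; have := leq_ltn_trans A B.
rewrite ltn_pmul2r ?expn_gt0 // => C.
by rewrite -{2}[(2 ^ n)%N]mul1n -mulnDl leq_mul2r; apply/orP; right; lia.
Qed.

Section calderon_zygmund.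
Variables (f : nat -> R) (M : nat) (lam : R).
Hypotheses (lam0 : 0 < lam) (fM : forall k, (2 ^ M <= k)%N -> f k = 0).
Let F n := dyavg (fun i => `|f i|) n.
(** It guarantees that a maximal interval of large average is strictly finer than the scale [M], so
    that its parent has average at most [lam]. When it fails, the weak type bound is trivial. *)
Hypothesis top : forall k, F M k <= lam.

Let F0 n k : 0 <= F n k.
Proof. by rewrite divr_ge0 ?exprn_ge0 // sum_ge0_nat. Qed.

(* [bad n k]: the maximal dyadic interval containing [k] on which the average
   of [|f|] exceeds [lam] has length [2 ^ n]. *)
Definition bad n k : bool :=
  (n < M)%N && (lam < F n k) && [forall m : 'I_M.+1, (n < m)%N ==> (F m k <= lam)].

Let badP n k : reflect [/\ (n < M)%N, lam < F n k &
  forall m, (n < m <= M)%N -> F m k <= lam] (bad n k).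
Proof.
apply: (iffP idP) => [/andP[/andP[nM nk] /forallP H]|[nM nk H]].
  split => // m /andP[nm mM].
  by have := H (Ordinal (mM : (m < M.+1)%N)); rewrite nm.
rewrite /bad nM nk; apply/forallP => m; apply/implyP => nm; apply: H.
by rewrite nm -ltnS ltn_ord.
Qed.

Lemma bad_const n k k' : grid n k = grid n k' -> bad n k = bad n k'.
Proof.
move=> e; have E m : (n <= m)%N -> F m k = F m k'.
  by move=> nm; rewrite /F /dyavg -(grid_grid k nm) e grid_grid.
rewrite /bad (E n) //; congr (_ && _); apply: eq_forallb => m.
by case: (ltnP n m) => //= /ltnW nm; rewrite E.
Qed.

Lemma bad_grid n k : bad n (grid n k) = bad n k.
Proof. by apply: bad_const; rewrite gridgrid. Qed.

Lemma bad_uniq n m k : bad n k -> bad m k -> n = m.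
Proof.
move=> /badP[nM nk Hn] /badP[mM mk Hm]; case: (ltngtP n m) => // h.
  by have := Hn m; rewrite h ltnW // leNgt mk => /(_ isT).
by have := Hm n; rewrite h ltnW // leNgt nk => /(_ isT).
Qed.

Lemma not_bad_le k : (forall n, ~~ bad n k) -> `|f k| <= lam.
Proof.
move=> nb; rewrite -[`|f k|]/((fun i => `|f i|) k) -dyavg0 -/(F 0 k).
suff H j : (j <= M)%N -> F (M - j) k <= lam by rewrite -(subnn M); exact: H.
elim/ltn_ind: j => -[_ _|j IH jM]; first by rewrite subn0.
rewrite leNgt; apply/negP => b; have := nb (M - j.+1)%N; apply/negP; rewrite negbK.
apply/badP; split => //; first by lia.
move=> m /andP[h1 h2]; have := IH (M - m)%N; rewrite subKn //; apply; lia.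
Qed.

Definition czbad n k : R := (bad n k)%:R * (f k - dyavg f n k).
Definition czb k : R := \sum_(0 <= n < M) czbad n k.
Definition czg k : R := f k - czb k.

Lemma czb_bad n k : bad n k -> czb k = f k - dyavg f n k.
Proof.
move=> b; have nM : (n < M)%N by case/badP: b.
rewrite /czb (sum_single nM) ?/czbad ?b ?mul1r // => i ine.
case: (boolP (bad i k)) => [/(bad_uniq b) e|_]; last by rewrite mul0r.
by rewrite e eqxx in ine.
Qed.

Lemma czb_good k : (forall n, ~~ bad n k) -> czb k = 0.
Proof. by move=> nb; rewrite /czb big1 // => n _; rewrite /czbad (negbTE (nb n)) mul0r. Qed.

Lemma bad_dec k : (exists n, bad n k) \/ (forall n, ~~ bad n k).
Proof.
case: (pselect (exists n, bad n k)) => [|H]; [by left|right => n].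
by apply/negP => b; apply: H; exists n.
Qed.

Lemma bad_avg_le n k : bad n k -> F n k <= 2 * lam.
Proof.
move=> /badP[nM _ H]; apply: le_trans (dyavg_double_le _ _ _) _ => //.
by rewrite ler_wpM2l // H // ltnSn.
Qed.

Lemma czg_le k : `|czg k| <= 2 * lam.
Proof.
rewrite /czg; case: (bad_dec k) => [[n b]|nb].
  rewrite (czb_bad b) opprB addrC subrK.
  by apply: le_trans (dyavg_norm_le _ _ _) _; exact: bad_avg_le.
by rewrite czb_good // subr0; apply: le_trans (not_bad_le nb) _; move: lam0; lra.
Qed.

Lemma bad_vanish n k : (2 ^ M <= k)%N -> bad n k = false.
Proof.
move=> Mk; apply/negP => /badP[nM nk _]; move: nk.
by rewrite /F (@dyavg_vanish _ _ n M) ?ltNge ?(ltW lam0) // ?(ltnW nM) // => i /fM->; rewrite normr0.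
Qed.

Let S : R := \sum_(0 <= k < 2 ^ M) `|f k|.

Definition nbad : R := \sum_(0 <= k < 2 ^ M) \sum_(0 <= n < M) (bad n k)%:R.

Lemma sum_bad_avg n (phi : nat -> R) : (n < M)%N -> grid_const n phi ->
  \sum_(0 <= k < 2 ^ M) `|f k| * ((bad n k)%:R * phi k) =
  \sum_(0 <= k < 2 ^ M) F n k * ((bad n k)%:R * phi k).
Proof.
move=> nM pc; apply: sum_dyavg_mul; first exact: ltnW.
by move=> k; rewrite pc bad_grid.
Qed.

Lemma sum_bad_le1 k : \sum_(0 <= n < M) (bad n k)%:R <= 1 :> R.
Proof.
case: (bad_dec k) => [[n b]|nb]; last by rewrite big1 // => n _; rewrite (negbTE (nb n)).
have nM : (n < M)%N by case/badP: b.
rewrite (sum_single nM) ?b // => i ine.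
case: (boolP (bad i k)) => [/(bad_uniq b) e|//].
by rewrite e eqxx in ine.
Qed.

Lemma nbad_le : lam * nbad <= S.
Proof.
rewrite /nbad exchange_big /= mulr_sumr.
apply: (@le_trans _ _ (\sum_(0 <= n < M) \sum_(0 <= k < 2 ^ M) `|f k| * ((bad n k)%:R * 1))).
  apply: ler_sum_nat => n /andP[_ nM]; rewrite sum_bad_avg // mulr_sumr.
  apply: ler_sum => k _; rewrite mulr1; case: (boolP (bad n k)) => [/badP[_ h _]|_].
    by rewrite !mulr1 ltW.
  by rewrite !mulr0.
rewrite exchange_big /=; apply: ler_sum => k _; rewrite -mulr_sumr.
under eq_bigr do rewrite mulr1.
by rewrite ler_piMr // sum_bad_le1.
Qed.

Lemma sum_czg_le : \sum_(0 <= k < 2 ^ M) `|czg k| <= S.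
Proof.
apply: (@le_trans _ _ (\sum_(0 <= k < 2 ^ M) (`|f k| + \sum_(0 <= n < M)
   (F n k * ((bad n k)%:R * 1) - `|f k| * ((bad n k)%:R * 1))))).
  apply: ler_sum => k _; rewrite /czg; case: (bad_dec k) => [[n b]|nb].
    rewrite (czb_bad b) opprB addrC subrK.
    have nM : (n < M)%N by case/badP: b.
    rewrite (sum_single nM) ?b => [|i ine]; last first.
      case: (boolP (bad i k)) => [/(bad_uniq b) e|_]; last by rewrite !mul0r !mulr0 subrr.
      by rewrite e eqxx in ine.
    by rewrite !mulr1 addrC subrK dyavg_norm_le.
  rewrite czb_good // subr0 lerDl big1 // => n _.
  by rewrite (negbTE (nb n)) !mul0r !mulr0 subrr.
rewrite big_split /= exchange_big /= gerDl le_eqVlt; apply/orP; left; apply/eqP.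
rewrite big_nat_cond big1 // => n /andP[/andP[_ nM] _].
by rewrite sumrB -sum_bad_avg // subrr.
Qed.

Lemma sumsq_czg_le : sumsq czg (2 ^ M) <= 2 * lam * S.
Proof.
apply: (@le_trans _ _ (\sum_(0 <= k < 2 ^ M) 2 * lam * `|czg k|)).
  apply: ler_sum => k _; rewrite -[leLHS]real_normK ?num_real // expr2.
  by rewrite ler_wpM2r // czg_le.
rewrite -mulr_sumr ler_wpM2l ?sum_czg_le // mulr_ge0 // ltW //.
Qed.

Lemma czg_vanish k : (2 ^ M <= k)%N -> czg k = 0.
Proof.
move=> Mk; rewrite /czg fM // czb_good ?subr0 // => n; by rewrite bad_vanish.
Qed.

(** Bad intervals enlarged by their left neighbours of equal length. Forward averages look only to
    the right, so no enlargement on the other side is called for. *)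
Definition badstar k : bool := has (fun n => bad n k || bad n (k + 2 ^ n)%N) (iota 0 M).

Lemma sum_badstar_le : \sum_(0 <= k < 2 ^ M) (badstar k)%:R <= 2 * nbad.
Proof.
apply: (@le_trans _ _ (\sum_(0 <= k < 2 ^ M) \sum_(0 <= n < M)
   ((bad n k)%:R + (bad n (k + 2 ^ n)%N)%:R))).
  apply: ler_sum => k _; case: (boolP (badstar k)) => [/hasP[n]|_]; last first.
    by rewrite sum_ge0_nat // => n; rewrite addr_ge0.
  rewrite mem_iota => nM b.
  apply: le_trans (@le_sum_term R (fun n => (bad n k)%:R + (bad n (k + 2 ^ n)%N)%:R) 0 M n _ nM).
    by case/orP: b => -> /=; rewrite ?lerDl ?lerDr.
  by move=> i; rewrite addr_ge0.
rewrite exchange_big /= /nbad [in leRHS]exchange_big /= mulr_sumr; apply: ler_sum => n _.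
rewrite big_split /= mulr_natl mulr2n lerD //.
apply: (@sum_shift_le R (fun k => (bad n k)%:R)) => k // Mk.
by rewrite bad_vanish.
Qed.

Let P x := \sum_(0 <= y < x) czb y.

Lemma czbad_cancel n j : (n < M)%N -> \sum_(0 <= i < 2 ^ n) czbad n (j * 2 ^ n + i)%N = 0.
Proof.
move=> nM; under eq_big_nat => i /andP[_ i2].
  rewrite /czbad (bad_const (_ : grid n _ = grid n (j * 2 ^ n)%N)); last first.
    by rewrite !grid_add // -[X in grid n X]addn0 grid_add // expn_gt0.
  rewrite [dyavg f n _](_ : _ = dyavg f n (j * 2 ^ n)%N); last first.
    by rewrite /dyavg grid_add // -[X in grid n X]addn0 grid_add // expn_gt0.
  over.
rewrite -mulr_sumr sumrB sumr_const_nat subn0 /dyavg.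
have -> : grid n (j * 2 ^ n) = (j * 2 ^ n)%N by rewrite -[X in grid n X]addn0 grid_add // expn_gt0.
by rewrite -[X in _ - X]mulr_natr natrX divfK ?subrr ?mulr0 // gt_eqF // exp2_gt0.
Qed.

(** Each completed bad interval has sum zero; what remains is the initial part of the one containing
    [x], if there is one. *)
Lemma sum_czb x : P x = \sum_(0 <= n < M) (bad n x)%:R * \sum_(grid n x <= y < x) czb y.
Proof.
rewrite /P /czb exchange_big /=; apply: eq_big_nat => n /andP[_ nM].
rewrite (big_cat_nat (leq0n (grid n x)) (grid_le n x)) /=.
rewrite {1}/grid -{1}(mul0n (2 ^ n)%N) sum_nat_blocks big1 ?add0r; last first.
  by move=> j _; exact: czbad_cancel.
case: (boolP (bad n x)) => [b|nb].
  rewrite mul1r exchange_big /=.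
  have gx y : (grid n x <= y < x)%N -> bad n y.
    move=> /andP[gy yx]; rewrite -(bad_const (_ : grid n x = grid n y)) //.
    have {1}-> : y = (x %/ 2 ^ n * 2 ^ n + (y - grid n x))%N by rewrite subnKC.
    by rewrite grid_add //; have := lt_grid n x; lia.
  have z i : (i != n) -> \sum_(grid n x <= j < x) czbad i j = 0.
    move=> ine; rewrite big_nat_cond big1 // => y /andP[/gx b' _].
    rewrite /czbad; case: (boolP (bad i y)) => [/bad_uniq/(_ b') e|_]; last by rewrite mul0r.
    by rewrite e eqxx in ine.
  by rewrite (sum_single nM).
rewrite mul0r big_nat_cond big1 // => y /andP[/andP[gy yx] _].
rewrite /czbad -(bad_const (_ : grid n x = grid n y)) ?(negbTE nb) ?mul0r //.
have {1}-> : y = (x %/ 2 ^ n * 2 ^ n + (y - grid n x))%N by rewrite subnKC.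
by rewrite grid_add //; have := lt_grid n x; lia.
Qed.

Lemma czb_after x : (forall n, ~~ bad n x) -> P x = 0.
Proof. by move=> nb; rewrite sum_czb big1 // => n _; rewrite (negbTE (nb n)) mul0r. Qed.

Lemma czb_start n x : bad n x -> P (grid n x) = 0.
Proof.
move=> b; have nM : (n < M)%N by case/badP: b.
rewrite sum_czb (sum_single nM) ?gridgrid // => [|i ine]; first by rewrite big_geq ?mulr0.
rewrite -bad_grid in b; case: (boolP (bad i (grid n x))) => [/(bad_uniq b) e|_].
  by rewrite e eqxx in ine.
by rewrite mul0r.
Qed.

Lemma czb_stop n x : bad n x -> P (grid n x + 2 ^ n) = 0.
Proof.
move=> b; have nM : (n < M)%N by case/badP: b.
rewrite /P (big_cat_nat (leq0n (grid n x)) (leq_addr _ _)) /= -/(P _) czb_start // add0r sum_from.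
rewrite -[RHS](czbad_cancel (x %/ 2 ^ n) nM); apply: eq_big_nat => i /andP[_ i2].
rewrite -/(grid n x) (@czb_bad n) ?/czbad.
  by rewrite (bad_const (grid_same _ i2)) b mul1r.
by rewrite (bad_const (grid_same _ i2)).
Qed.

Lemma sum_bad_abs_le n (phi : nat -> R) : (n < M)%N -> grid_const n phi -> (forall k, 0 <= phi k) ->
  \sum_(0 <= k < 2 ^ M) (bad n k)%:R * (`|czb k| * phi k) <=
  4 * lam * \sum_(0 <= k < 2 ^ M) (bad n k)%:R * phi k.
Proof.
move=> nM pc p0.
apply: (@le_trans _ _ (\sum_(0 <= k < 2 ^ M)
   (`|f k| * ((bad n k)%:R * phi k) + F n k * ((bad n k)%:R * phi k)))).
  apply: ler_sum => k _; case: (boolP (bad n k)) => [b|_]; last by rewrite !mul0r !mulr0 addr0.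
  rewrite (czb_bad b) !mul1r -mulrDl ler_wpM2r //.
  by apply: le_trans (ler_normB _ _) _; rewrite lerD2l dyavg_norm_le.
rewrite big_split /= sum_bad_avg // -big_split /= mulr_sumr; apply: ler_sum => k _.
case: (boolP (bad n k)) => [/bad_avg_le b|_]; last by rewrite !mul0r !mulr0 addr0.
have : F n k * phi k <= 2 * lam * phi k by rewrite ler_wpM2r.
rewrite !mul1r; lra.
Qed.

Let Q n e := \sum_(grid n e <= y < grid n e + 2 ^ n) (`|czb y|).

Lemma bad_mass_le n e : bad n e -> Q n e <= 4 * lam * 2 ^+ n.
Proof.
move=> b; rewrite /Q sum_from.
apply: (@le_trans _ _ (\sum_(0 <= i < 2 ^ n) (`|f (grid n e + i)%N| + F n e))).
  apply: ler_sum_nat => i /andP[_ i2].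
  rewrite (@czb_bad n) ?(bad_const (grid_same _ i2)) //.
  apply: le_trans (ler_normB _ _) _; rewrite lerD2l.
  by apply: le_trans (dyavg_norm_le _ _ _) _; rewrite /F /dyavg grid_same.
rewrite big_split /= sumr_const_nat subn0 -[X in _ + X]mulr_natr natrX.
have := bad_avg_le b; have := exp2_gt0 (R := R) n.
have -> : \sum_(0 <= i < 2 ^ n) `|f (grid n e + i)%N| = F n e * 2 ^+ n.
  by rewrite /F /dyavg divfK // gt_eqF // exp2_gt0.
nra.
Qed.

Lemma czb_prim_le n e : bad n e -> `|P e| <= 4 * lam * 2 ^+ n.
Proof.
move=> b; apply: le_trans (bad_mass_le b).
have -> : P e = \sum_(grid n e <= y < e) czb y.
  by rewrite /P (big_cat_nat (leq0n _) (grid_le n e)) /= -/(P _) czb_start // add0r.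
apply: le_trans (ler_norm_sum _ _ _) _.
by apply: le_sum_nat_sub => //; rewrite ltnW // lt_grid.
Qed.

Section off_badstar.
Variable k : nat.
Hypothesis kgood : ~~ badstar k.

Let c l := wavg czb k l.

Let good_k n : ~~ bad n k.
Proof.
apply/negP => b; move/hasPn: kgood => /(_ n); rewrite mem_iota b => H.
have nM : (n < M)%N by case/badP: b.
by have := H nM.
Qed.

Let far n e : bad n e -> (k <= e)%N -> (k + 2 ^ n < grid n e)%N.
Proof.
move=> b ke; have nM : (n < M)%N by case/badP: b.
have nb2 : ~~ bad n (k + 2 ^ n).
  by move/hasPn: kgood => /(_ n); rewrite mem_iota negb_or => /(_ nM) /andP[].
rewrite ltnNge; apply/negP => H.
have ge := grid_le n e; have eg := lt_grid n e.
have sameQ y : (grid n e <= y < grid n e + 2 ^ n)%N -> bad n y.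
  move=> /andP[y1 y2]; rewrite (bad_const (_ : grid n y = grid n e)) //.
  have -> : y = (grid n e + (y - grid n e))%N by rewrite subnKC.
  by rewrite grid_same //; lia.
case: (leqP (grid n e) k) => gk.
  by move/negP: (good_k n); apply; apply: sameQ; rewrite gk (leq_ltn_trans ke).
by move/negP: nb2; apply; apply: sameQ; rewrite H ltn_add2r.
Qed.

Let cE l : c l = P (k + l) / l%:R.
Proof.
rewrite /c /wavg; congr (_ / _).
by rewrite -sum_from /P (big_cat_nat (leq0n k) (leq_addr l k)) /= -/(P k) czb_after ?add0r.
Qed.

(** At most one [n] contributes. With [D] the distance from [k] to the bad interval, an increment of
    the average is at most [(|czb| + 4 * lam) / D], and the increments over the whole interval sum
    to at most [8 * lam * 2 ^+ n / D]; the control is the product of these two bounds. *)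
Definition czcontrol l : R := \sum_(0 <= n < M) (bad n (k + l))%:R *
  (8 * lam * 2 ^+ n * (`|czb (k + l)| + 4 * lam) / (grid n (k + l) - k)%:R ^+ 2).

Lemma czcontrol_ge0 l : 0 <= czcontrol l.
Proof.
apply: sum_ge0_nat => n; apply: mulr_ge0 => //; apply: divr_ge0; last exact: sqr_ge0.
by rewrite !mulr_ge0 ?addr_ge0 ?exprn_ge0 ?mulr_ge0 // ltW.
Qed.

(** One factor of the square is kept as a sum of increments, the other is replaced by the total over
    the bad interval. *)
Lemma cz_within n e x y : bad n e -> (k <= e)%N -> (grid n e <= k + x)%N -> (x <= y)%N ->
  (k + y <= grid n e + 2 ^ n)%N -> (c x - c y) ^+ 2 <= \sum_(x <= l < y) czcontrol l.
Proof.
move=> b ke gx xy yg; have nM : (n < M)%N by case/badP: b.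
have kg := far b ke.
set D : R := (grid n e - k)%:R.
have D0 : 0 < D by rewrite ltr0n subn_gt0 (leq_ltn_trans (leq_addr _ _) kg).
have nD : 2 ^+ n <= D by rewrite -natrX ler_nat; lia.
have e0 := exp2_gt0 (R := R) n.
pose u l : R := (`|czb (k + l)%N| + 4 * lam) / D.
have lam0' := ltW lam0.
have u0 l : 0 <= u l by rewrite divr_ge0 ?addr_ge0 ?mulr_ge0 // ltW.
have sameQ l : (x <= l < y)%N -> grid n (k + l) = grid n e /\ bad n (k + l).
  move=> /andP[xl ly]; have E : grid n (k + l) = grid n e.
    have -> : (k + l = grid n e + (k + l - grid n e))%N by lia.
    by rewrite grid_same //; lia.
  by rewrite (bad_const E).
have ctl l : (x <= l < y)%N -> czcontrol l = 8 * lam * 2 ^+ n / D * u l.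
  move=> /sameQ[E bl]; rewrite /czcontrol (sum_single nM) => [|i ine].
    by rewrite bl mul1r E -/D /u; field; rewrite gt_eqF.
  case: (boolP (bad i (k + l))) => [/(bad_uniq bl) e'|_]; last by rewrite mul0r.
  by rewrite e' eqxx in ine.
rewrite (eq_big_nat _ _ ctl) -mulr_sumr.
have step : `|c x - c y| <= \sum_(x <= l < y) u l.
  rewrite distrC /c wavg_telescope //; apply: le_trans (ler_norm_sum _ _ _) _.
  apply: ler_sum_nat => l lxy; have [E bl] := sameQ l lxy.
  have Dl : D <= l.+1%:R by rewrite /D ler_nat; case/andP: lxy; lia.
  have Dl' : D <= l%:R by rewrite /D ler_nat; case/andP: lxy; lia.
  rewrite wstepE normrM normfV [`|l.+1%:R|]ger0_norm //.
  rewrite /u; apply: ler_pM; rewrite ?invr_ge0 //; last by rewrite lef_pV2 ?posrE ?ltr0Sn.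
  apply: le_trans (ler_normB _ _) _; rewrite lerD2l -/(c l) cE normrM normfV [`|l%:R|]ger0_norm //.
  have l0 : 0 < l%:R :> R by exact: lt_le_trans D0 Dl'.
  rewrite ler_pdivrMr //; apply: le_trans (czb_prim_le bl) _.
  by rewrite ler_wpM2l ?mulr_ge0 //; exact: le_trans nD Dl'.
have tot : \sum_(x <= l < y) u l <= 8 * lam * 2 ^+ n / D.
  rewrite /u -mulr_suml ler_pM2r ?invr_gt0 //.
  apply: (@le_trans _ _ (\sum_(x <= l < y) `|czb (k + l)%N| + (y - x)%:R * (4 * lam))).
    by rewrite big_split /= sumr_const_nat [(y - x)%:R * _]mulr_natl.
  have -> : 8 * lam * 2 ^+ n = 4 * lam * 2 ^+ n + 2 ^+ n * (4 * lam) by ring.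
  apply: lerD.
    apply: le_trans (bad_mass_le b).
    have -> : \sum_(x <= l < y) `|czb (k + l)%N| = \sum_(k + x <= l < k + y) `|czb l|.
      have -> : (k + y = k + x + (y - x))%N by lia.
      rewrite sum_from -{1}(subnKC xy) sum_from; apply: eq_bigr => i _.
      by rewrite addnA.
    exact: le_sum_nat_sub.
  by rewrite ler_wpM2r ?mulr_ge0 // -natrX ler_nat; lia.
rewrite -[leLHS]real_normK ?num_real // expr2.
by apply: ler_pM => //; apply: le_trans step tot.
Qed.

(** The average vanishes when the window ends outside the bad intervals or at an endpoint of one of
    them. Unless both windows end in the same bad interval, each value is thus a difference from a
    zero lying between [x] and [y]. *)
Lemma cz_control x y : (x < y)%N ->
  (c x - c y) ^+ 2 <= \sum_(x <= l < y) 4 * czcontrol l.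
Proof.
move=> xy; rewrite -mulr_sumr.
have s0 : 0 <= \sum_(x <= l < y) czcontrol l by apply: sum_ge0_nat; exact: czcontrol_ge0.
have sub x' y' : (x <= x')%N -> (y' <= y)%N ->
    \sum_(x' <= l < y') czcontrol l <= \sum_(x <= l < y) czcontrol l.
  by apply: le_sum_nat_sub; exact: czcontrol_ge0.
have c0 l : P (k + l) = 0 -> c l = 0 by rewrite cE => ->; rewrite mul0r.
case: (pselect (exists n, bad n (k + x) /\ (k + y <= grid n (k + x) + 2 ^ n)%N)) => [[n [b H]]|H].
  have := cz_within b (leq_addr _ _) (grid_le _ _) (ltnW xy) H; lra.
have Hx : c x ^+ 2 <= \sum_(x <= l < y) czcontrol l.
  case: (bad_dec (k + x)) => [[n b]|nb]; last by rewrite c0 ?expr0n // czb_after.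
  have gy : (grid n (k + x) + 2 ^ n < k + y)%N.
    by rewrite ltnNge; apply/negP => ?; apply: H; exists n.
  have ge := grid_le n (k + x); have eg := lt_grid n (k + x).
  pose z := (grid n (k + x) + 2 ^ n - k)%N.
  have kz : (k + z = grid n (k + x) + 2 ^ n)%N by rewrite /z; lia.
  have := cz_within b (leq_addr _ _) ge (_ : (x <= z)%N) (_ : (k + z <= _)%N).
  rewrite kz => /(_ _ (leqnn _)) W.
  have := W (_ : (x <= z)%N); rewrite (c0 z) ?subr0 => [H1|]; last by rewrite kz czb_stop.
  apply: le_trans (H1 _) (sub _ _ _ _) => //; lia.
have Hy : c y ^+ 2 <= \sum_(x <= l < y) czcontrol l.
  case: (bad_dec (k + y)) => [[n b]|nb]; last by rewrite c0 ?expr0n // czb_after.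
  have kg := far b (leq_addr _ _).
  have ge := grid_le n (k + y); have eg := lt_grid n (k + y).
  pose z := (grid n (k + y) - k)%N.
  have kz : (k + z = grid n (k + y))%N by rewrite /z; lia.
  have xz : (x <= z)%N.
    rewrite leqNgt; apply/negP => zx; apply: H; exists n.
    have E : grid n (k + x) = grid n (k + y).
      have -> : (k + x = grid n (k + y) + (k + x - grid n (k + y)))%N by lia.
      by rewrite grid_same //; lia.
    by rewrite (bad_const E) E; split => //; lia.
  have zy : (z <= y)%N by lia.
  have gz : (grid n (k + y) <= k + z)%N by rewrite kz.
  have := cz_within b (leq_addr _ _) gz zy (ltnW eg).
  rewrite (c0 z) ?kz ?czb_start // sub0r sqrrN => /le_trans; apply; exact: sub.
have := sqrrB_le (c x) (c y); lra.
Qed.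

End off_badstar.

(** For a fixed point of a bad interval of length [2 ^ n], the admissible [k] are at distance more
    than [2 ^ n] from its start, so the inverse squares sum to at most [2 ^- n]. The mass of [czb]
    there then gives [8 * lam * (4 * lam + 4 * lam)] per bad point. *)
Lemma sum_czcontrol_le L : \sum_(0 <= k < 2 ^ M) (~~ badstar k)%:R *
   \sum_(1 <= l < L) czcontrol k l <= 64 * lam ^+ 2 * nbad.
Proof.
pose inv n e k : R := if (k + 2 ^ n < grid n e)%N then (grid n e - k)%:R ^- 2 else 0.
have inv0 n e k : 0 <= inv n e k by rewrite /inv; case: ifP => // _; rewrite invr_ge0 sqr_ge0.
have lam0' := ltW lam0.
pose G n e : R := (bad n e)%:R * (8 * lam * 2 ^+ n * (`|czb e| + 4 * lam)).
have G0 n e : 0 <= G n e.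
  by rewrite !mulr_ge0 ?addr_ge0 ?exprn_ge0 ?mulr_ge0.
have G0N n e : (2 ^ M <= e)%N -> G n e = 0 by move=> Me; rewrite /G bad_vanish // mul0r.
apply: (@le_trans _ _ (\sum_(0 <= k < 2 ^ M) \sum_(0 <= n < M) \sum_(0 <= e < 2 ^ M) G n e * inv n e k)).
  apply: ler_sum => k _; case: (boolP (badstar k)) => kb; rewrite /= ?mul0r ?mul1r.
    by do 2! apply: sum_ge0_nat => ?; rewrite mulr_ge0.
  rewrite [leRHS]exchange_big /=.
  apply: (@le_trans _ _ (\sum_(k + 1 <= e < k + L) \sum_(0 <= n < M) G n e * inv n e k)).
    have [L0|L0] := leqP L 1.
      by rewrite [leLHS]big_geq // !big_geq // leq_add2l.
    have -> : (k + L = k + 1 + (L - 1))%N by lia.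
    rewrite sum_from -{1}(subnKC (ltnW L0)) sum_from; apply: ler_sum => l _.
    apply: ler_sum => n _; rewrite /G -addnA; case: (boolP (bad n _)) => b; rewrite ?mul0r //.
    rewrite !mul1r /inv ifT //.
    have nM : (n < M)%N by case/badP: b.
    move/hasPn: (kb) => /(_ n); rewrite mem_iota nM negb_or => /(_ isT) /andP[nb1 nb2].
    set e := (k + (1 + l))%N in b *.
    have ge := grid_le n e; have eg := lt_grid n e.
    have sameQ y : (grid n e <= y < grid n e + 2 ^ n)%N -> bad n y.
      move=> /andP[y1 y2]; rewrite (bad_const (_ : grid n y = grid n e)) //.
      have -> : y = (grid n e + (y - grid n e))%N by rewrite subnKC.
      by rewrite grid_same //; lia.
    rewrite ltnNge; apply/negP => H.
    case: (leqP (grid n e) k) => gk.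
      by move/negP: nb1; apply; apply: sameQ; rewrite gk /=; lia.
    by move/negP: nb2; apply; apply: sameQ; rewrite H ltn_add2r.
  have T0 e : 0 <= \sum_(0 <= n < M) G n e * inv n e k.
    by apply: sum_ge0_nat => n; rewrite mulr_ge0.
  apply: (@le_trans _ _ (\sum_(0 <= e < maxn (2 ^ M) (k + L)) \sum_(0 <= n < M) G n e * inv n e k)).
    by apply: le_sum_nat_sub => //; rewrite leq_max leqnn orbT.
  rewrite (big_cat_nat (leq0n (2 ^ M)) (leq_maxl _ _)) /= gerDl.
  rewrite big_nat_cond big1 // => e /andP[/andP[Me _] _].
  by rewrite big1 // => n _; rewrite G0N // mul0r.
rewrite exchange_big /= /nbad [in leRHS]exchange_big /= mulr_sumr.
apply: ler_sum_nat => n /andP[_ nM]; rewrite exchange_big /=.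
apply: (@le_trans _ _ (\sum_(0 <= e < 2 ^ M) G n e / 2 ^+ n)).
  apply: ler_sum => e _; rewrite -mulr_sumr ler_wpM2l // -natrX.
  by apply: inv_sqr_sum_le; rewrite expn_gt0.
apply: (@le_trans _ _ (8 * lam * (\sum_(0 <= k < 2 ^ M) (bad n k)%:R * (`|czb k| * 1) +
    4 * lam * \sum_(0 <= k < 2 ^ M) (bad n k)%:R))).
  rewrite mulr_sumr -big_split /= mulr_sumr; apply: ler_sum => e _.
  rewrite /G le_eqVlt; apply/orP; left; apply/eqP.
  by field; rewrite gt_eqF // exp2_gt0.
have := @sum_bad_abs_le n (fun=> 1) nM (fun=> erefl) (fun=> ler01).
under [X in _ <= 4 * lam * X -> _]eq_bigr do rewrite mulr1.
set A : R := \sum_(0 <= k < 2 ^ M) (bad n k)%:R * (`|czb k| * 1).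
set B : R := \sum_(0 <= k < 2 ^ M) (bad n k)%:R => AB.
have : 8 * lam * (A + 4 * lam * B) <= 8 * lam * (4 * lam * B + 4 * lam * B).
  by rewrite ler_wpM2l ?mulr_ge0 // lerD2r.
have -> : 64 * lam ^+ 2 * B = 8 * lam * (4 * lam * B + 4 * lam * B) by ring.
by [].
Qed.

End calderon_zygmund.

Lemma variation_weak11 q : 2 < q -> exists2 C : R, 0 < C &
  forall f M L lam, (forall k, (2 ^ M <= k)%N -> f k = 0) -> (L.+1 < 2 ^ M)%N -> 0 < lam ->
  lam * \sum_(0 <= k < 2 ^ M) (lam `^ q < wvar q f L k)%R%:R <=
    C * \sum_(0 <= k < 2 ^ M) `|f k|.
Proof.
move=> q2; have [C1 C10 H1] := variation_weak22 q2.
(* The terms come from the case where the top average exceeds [lam], the good part in [l^2], the set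
   [badstar], and Chebyshev for the control of the bad part. *)
exists (1 + (32 * C1 + 2 + 64 * 64)); first by rewrite !addr_gt0 ?mulr_gt0.
move=> f M L lam fN LM l0; set S := \sum_(0 <= k < 2 ^ M) `|f k|.
have S0 : 0 <= S by apply: sum_ge0_nat.
have [top|/existsNP[k /negP]] := pselect (forall k, dyavg (fun i => `|f i|) M k <= lam); last first.
  rewrite -ltNge => big.
  have [kM|Mk] := ltnP k (2 ^ M); last first.
    have fN' i : (2 ^ M <= i)%N -> `|f i| = 0 by move=> /fN ->; rewrite normr0.
    by move: big; rewrite (dyavg_vanish (leqnn M) fN') // ltNge (ltW l0).
  apply: (@le_trans _ _ S).
    apply: (@le_trans _ _ (lam * 2 ^+ M)).
      rewrite ler_wpM2l ?(ltW l0) //.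
      apply: (@le_trans _ _ (\sum_(0 <= k < 2 ^ M) 1)); last by rewrite sumr_const_nat subn0 natrX.
      by apply: ler_sum => i _; case: ltP.
    move: big; rewrite /dyavg /grid divn_small // mul0n ltr_pdivlMr ?exp2_gt0 //.
    exact: ltW.
  by rewrite ler_peMl // lerDl !addr_ge0 ?mulr_ge0 // ltW.
have l40 : 0 < lam / 4 by rewrite divr_gt0.
pose T k := \sum_(1 <= l < 2 ^ M) czcontrol f M lam k l.
have T0 k : 0 <= T k by apply: sum_ge0_nat => l; exact: czcontrol_ge0.
have pointwise k : (lam `^ q < wvar q f L k)%R%:R <=
    ((lam / 4) `^ q < wvar q (czg f M lam) L k)%R%:R + (badstar f M lam k)%:R +
    (~~ badstar f M lam k)%:R * T k * (64 / lam ^+ 2).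
  have r0 : 0 <= (~~ badstar f M lam k)%:R * T k * (64 / lam ^+ 2).
    by rewrite !mulr_ge0 ?invr_ge0 ?sqr_ge0.
  case: (ltP (lam `^ q)) => big; last by rewrite !addr_ge0.
  rewrite -[true%:R]/(1 : R).
  case: (boolP (badstar f M lam k)) r0 => kb r0.
    by rewrite -[true%:R]/(1 : R) mul0r mul0r addr0 lerDr.
  rewrite -[(~~ false)%:R]/(1 : R) mul1r in r0 *.
  have : lam `^ q < vq q (fun N => wavg (czg f M lam) k N.+1 + wavg (czb f M lam) k N.+1) L.
    apply: lt_le_trans big _; rewrite le_eqVlt; apply/orP; left; apply/eqP.
    apply: eq_vq => i _; rewrite /wavg -mulrDl -big_split /=.
    by congr (_ / _); apply: eq_bigr => j _; rewrite /czg subrK.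
  move=> /(vqD_split _ l0)[|A|B]; first lra.
    by rewrite /wvar A -[true%:R]/(1 : R) -addrA lerDl addr_ge0.
  apply: (@le_trans _ _ (T k * (64 / lam ^+ 2))); last first.
    by rewrite lerDr addr_ge0.
  rewrite mulrA ler_pdivlMr ?exprn_gt0 // mul1r.
  rewrite leNgt; apply/negP => C; move: B; apply/negP; rewrite -leNgt.
  have cc0 i : 0 <= 4 * czcontrol f M lam k i by rewrite mulr_ge0 // czcontrol_ge0.
  apply: le_trans (@vq_sqr_control q _ (fun i => 4 * czcontrol f M lam k i.+1) L _ _ _) _;
    [lra|by move=> i; exact: cc0| |].
    move=> x y /andP[xy yL]; rewrite (sum_succ (fun i => 4 * czcontrol f M lam k i)).
    exact: cz_control.
  rewrite (sum_succ (fun i => 4 * czcontrol f M lam k i)) [leRHS]powR_sqr ?(ltW l40) //.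
  rewrite ge0_ler_powR ?nnegrE ?sqr_ge0 ?sum_ge0_nat //; first lra.
  apply: (@le_trans _ _ (4 * T k)).
    rewrite /T mulr_sumr; apply: le_sum_nat_sub => //; exact: ltnW.
  have -> : (lam / 4) ^+ 2 = lam ^+ 2 / 16 by field.
  move: C; lra.
have b1 : lam * \sum_(0 <= k < 2 ^ M) ((lam / 4) `^ q < wvar q (czg f M lam) L k)%R%:R <= 32 * C1 * S.
  have gN := @czg_vanish f M lam l0 fN.
  have := H1 _ M L (lam / 4) gN LM l40.
  have := sumsq_czg_le l0 top; rewrite -/S.
  set X := \sum_(0 <= k < 2 ^ M) _; set Y := sumsq _ _ => h1 h2.
  have : (lam / 4) ^+ 2 * X <= C1 * (2 * lam * S).
    by apply: le_trans h2 _; rewrite ler_wpM2l // ltW.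
  have -> : (lam / 4) ^+ 2 * X = lam / 16 * (lam * X) by field.
  have -> : C1 * (2 * lam * S) = lam / 16 * (32 * C1 * S) by field.
  by rewrite ler_pM2l // divr_gt0.
have b2 : lam * \sum_(0 <= k < 2 ^ M) (badstar f M lam k)%:R <= 2 * S.
  have := sum_badstar_le l0 fN; have := @nbad_le f M lam; rewrite -/S.
  move=> h1 /(ler_wpM2l (ltW l0)); lra.
have b3 : lam * \sum_(0 <= k < 2 ^ M) (~~ badstar f M lam k)%:R * T k * (64 / lam ^+ 2) <= 64 * 64 * S.
  rewrite -mulr_suml.
  have := sum_czcontrol_le l0 fN (2 ^ M)%N; have := @nbad_le f M lam; rewrite -/S.
  set X := \sum_(0 <= k < 2 ^ M) _ => h1 h2.
  have -> : lam * (X * (64 / lam ^+ 2)) = 64 * X / lam by field; rewrite gt_eqF.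
  rewrite ler_pdivrMr //.
  have : 64 * X <= 64 * (64 * lam * (lam * nbad f M lam)).
    by rewrite ler_wpM2l //; apply: le_trans h2 _; rewrite le_eqVlt; apply/orP; left; apply/eqP; ring.
  move=> /le_trans; apply.
  have : 64 * lam * (lam * nbad f M lam) <= 64 * lam * S by rewrite ler_wpM2l // mulr_ge0 // ltW.
  lra.
apply: (@le_trans _ _ (lam * \sum_(0 <= k < 2 ^ M)
  (((lam / 4) `^ q < wvar q (czg f M lam) L k)%R%:R + (badstar f M lam k)%:R +
    (~~ badstar f M lam k)%:R * T k * (64 / lam ^+ 2)))).
  by apply: ler_wpM2l; [exact: ltW|apply: ler_sum => k _; exact: pointwise].
rewrite !big_split /= !mulrDr; move: b1 b2 b3 S0; lra.
Qed.

End weak_type_11.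

(** * One-sided weights *)

Section one_sided_weights.
Context {R : realType}.
Implicit Types (w f F : nat -> R) (e K : R).

Definition dualw e w i : R := w i `^ (- e^-1).

(* The one-sided Muckenhoupt condition on [0, n), with [e = p - 1]. *)
Definition Aplus e K n w := forall a b c, (a <= b <= c)%N -> (c < n)%N ->
  (\sum_(a <= i < b.+1) w i) * (\sum_(b <= i < c.+1) dualw e w i) `^ e <=
  K * ((c.+1 - a)%:R * (c.+1 - a)%:R `^ e).

Lemma geo_levels_le (z B Y : R) m : 0 < z -> 1 < B -> 0 <= Y ->
  \sum_(0 <= j < m) (z * B ^+ j < Y)%R%:R * (z * B ^+ j) <= Y * (B / (B - 1)).
Proof.
move=> z0 B1 Y0; have B0 : 0 < B - 1 by lra.
have H m' : \sum_(0 <= j < m') (z * B ^+ j < Y)%R%:R * (z * B ^+ j) <= z * B ^+ m' / (B - 1).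
  elim: m' => [|j IH]; first by rewrite big_geq // divr_ge0 ?mulr_ge0 ?exprn_ge0 //; lra.
  rewrite big_nat_recr //=.
  have -> : z * B ^+ j.+1 / (B - 1) = z * B ^+ j / (B - 1) + z * B ^+ j.
    by rewrite exprS; field; rewrite gt_eqF.
  apply: lerD => //; have zB : 0 <= z * B ^+ j by rewrite mulr_ge0 ?exprn_ge0 //; lra.
  by case: (_ < _); rewrite ?mul1r ?mul0r.
elim: m => [|m IH].
  by rewrite big_geq // mulr_ge0 // divr_ge0 //; lra.
case: (ltP (z * B ^+ m) Y) => [lt|ge].
  apply: le_trans (H m.+1) _; rewrite exprSr !mulrA ler_pM2r ?invr_gt0 //.
  by rewrite ler_wpM2r ?ltW //; lra.
by rewrite big_nat_recr //= ltNge ge mul0r addr0.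
Qed.

Lemma powR_le (x y s : R) : 0 <= s -> 0 <= x -> x <= y -> x `^ s <= y `^ s.
Proof. by move=> s0 x0 xy; rewrite ge0_ler_powR ?nnegrE // (le_trans x0). Qed.

Lemma powR_inv (x s : R) : x^-1 `^ s = (x `^ s)^-1.
Proof.
have [x0|x0] := leP 0 x; first by rewrite -powR_inv1 // -powRrM mulN1r powRN.
by rewrite !lt0_powR1 ?invr1 ?invr_lt0.
Qed.

Section height_bound.
Variables (e K : R) (n : nat) (w : nat -> R).
Hypotheses (e0 : 0 < e) (K0 : 0 < K) (w0 : forall i, 0 < w i) (A : Aplus e K n w).
Let be : R := (3 * K * 4 `^ e)^-1.

Let be0 : 0 < be.
Proof. by rewrite invr_gt0 !mulr_gt0 // powR_gt0. Qed.

Lemma dualw_gt0 i : 0 < dualw e w i. Proof. exact: powR_gt0. Qed.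

(** The left half has average above [lam]. If more than a quarter of the points, counted in the
    right half, had [w <= be * lam], the dual sum there would violate [Aplus]: the factor 3 in [be]
    turns this into [3 * m < h], impossible for the half length [m] of [h]. *)
Lemma heavy_interval a r (lam : R) : 0 < lam -> (a < r < n)%N ->
  (forall j, (a <= j < r)%N -> lam * (j.+1 - a)%:R < \sum_(a <= i < j.+1) w i) ->
  (r.+1 - a)%:R <= 4 * \sum_(a <= i < r.+1) (be * lam < w i)%R%:R :> R.
Proof.
move=> l0 /andP[ar rn] H.
pose h := (r.+1 - a)%N; pose m := h./2; pose mid := (a + m).-1.
have hm : (h <= m.*2.+1)%N by rewrite /m; have := odd_double_half h; case: (odd h); lia.
have hm2 : (m.*2 <= h)%N by rewrite /m; have := odd_double_half h; case: (odd h); lia.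
have m1 : (1 <= m)%N by rewrite /m; move: hm; rewrite /h -/m; lia.
have midE : mid.+1 = (a + m)%N by rewrite /mid; lia.
have arm : (a <= mid < r)%N by move: hm2; rewrite /mid /h; lia.
have wm : lam * m%:R < \sum_(a <= i < mid.+1) w i.
  by have := H mid arm; rewrite midE addKn.
pose N := \sum_(mid <= i < r.+1) (w i <= be * lam)%R%:R : R.
have h0 : 0 < h%:R :> R by rewrite ltr0n /h; lia.
have N4 : N <= h%:R / 4.
  rewrite leNgt; apply/negP => N4.
  have bl0 : 0 < be * lam by rewrite mulr_gt0.
  have sN : N * (be * lam) `^ (- e^-1) <= \sum_(mid <= i < r.+1) dualw e w i.
    rewrite mulr_suml; apply: ler_sum => i _; case: (leP (w i)) => wi; rewrite ?mul1r ?mul0r.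
      rewrite /dualw !powRN lef_pV2 ?posrE ?powR_gt0 //.
      by apply: powR_le; rewrite ?invr_ge0 ?(ltW e0) ?(ltW (w0 i)).
    exact: powR_ge0.
  have : (N * (be * lam) `^ (- e^-1)) `^ e <= (\sum_(mid <= i < r.+1) dualw e w i) `^ e.
    apply: powR_le => //; first exact: ltW.
    by rewrite mulr_ge0 ?powR_ge0 // sum_ge0_nat.
  have N0 : 0 <= N by apply: sum_ge0_nat.
  rewrite powRM ?powR_ge0 // -powRrM mulNr mulVf ?gt_eqF // powRN powRr1 ?(ltW bl0) // => P1.
  have P2 : (h%:R / 4) `^ e <= N `^ e.
    by apply: powR_le; rewrite ?divr_ge0 ?(ltW e0) ?(ltW h0) ?(ltW N4).
  have Ap := @A a mid r; rewrite (ltnW (andP arm).2) (andP arm).1 rn -/h in Ap.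
  have {}Ap := Ap isT isT.
  have q0 : 0 < (h%:R / 4) `^ e / (be * lam) by rewrite divr_gt0 // powR_gt0 // divr_gt0.
  have P3 : lam * m%:R * ((h%:R / 4) `^ e / (be * lam)) < K * (h%:R * h%:R `^ e).
    apply: lt_le_trans Ap; apply: (@lt_le_trans _ _ ((\sum_(a <= i < mid.+1) w i) * ((h%:R / 4) `^ e / (be * lam)))).
      by rewrite ltr_pM2r.
    rewrite ler_wpM2l ?sum_ge0_nat // => [i|]; first exact: ltW.
    by apply: le_trans P1; rewrite ler_pM2r ?invr_gt0.
  have he0 : 0 < h%:R `^ e :> R by apply: powR_gt0.
  have E : lam * m%:R * ((h%:R / 4) `^ e / (be * lam)) = K * h%:R `^ e * (3 * m%:R).
    rewrite powRM ?invr_ge0 ?(ltW h0) // powR_inv.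
    have p4 : 0 < 4 `^ e :> R by apply: powR_gt0.
    by rewrite /be; field; rewrite !gt_eqF.
  have E' : K * (h%:R * h%:R `^ e) = K * h%:R `^ e * h%:R by ring.
  have P4 : 3 * m%:R < h%:R :> R.
    rewrite -(ltr_pM2l (mulr_gt0 K0 he0)) -E -E'; exact: P3.
  have : (3 * m < h)%N by rewrite -(ltr_nat R) natrM; exact: P4.
  move: m1 hm; clearbody m h; clear; lia.
have cnt : \sum_(mid <= i < r.+1) (be * lam < w i)%R%:R + N = (r.+1 - mid)%:R.
  rewrite -big_split /= (eq_bigr (fun=> 1)) ?sumr_const_nat // => i _.
  by case: ltP => _; rewrite ?addr0 ?add0r.
have sub : \sum_(mid <= i < r.+1) (be * lam < w i)%R%:R <=
   \sum_(a <= i < r.+1) (be * lam < w i)%R%:R :> R.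
  by apply: le_sum_nat_sub => //; case/andP: arm.
have : h%:R <= 2 * (r.+1 - mid)%:R :> R.
  by rewrite -natrM ler_nat; move: hm2; rewrite /mid /h; lia.
rewrite -/h; lra.
Qed.

(* Greedy covering of the points of [a, b] where [w > lam] by intervals of
   average at most [lam] whose proper initial segments have larger average. *)
Lemma heavy_set_le b c (lam : R) a : 0 < lam -> (b < c < n)%N -> (a <= b.+1)%N ->
  \sum_(a <= i < c.+1) w i <= lam * (c - b)%:R ->
  \sum_(a <= i < b.+1) (lam < w i)%R%:R * w i <=
    4 * lam * \sum_(a <= i < c.+1) (be * lam < w i)%R%:R.
Proof.
move=> l0 /andP[bc cn].
move: {2}(b.+1 - a)%N (leqnn (b.+1 - a)) => d; elim: d a => [|d IH] a.
  rewrite leqn0 subn_eq0 => ba _ _; rewrite big_geq // !mulr_ge0 ?(ltW l0) //.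
  exact: sum_ge0_nat.
move=> dle ab small; have c0 i : 0 <= (be * lam < w i)%R%:R :> R by [].
have [ba|ab'] := leqP b.+1 a.
  by rewrite big_geq // !mulr_ge0 ?(ltW l0) // sum_ge0_nat.
have rest k : (a < k)%N -> (k <= b.+1)%N -> \sum_(k <= i < c.+1) w i <= lam * (c - b)%:R.
  move=> ak kb; apply: le_trans small; apply: le_sum_nat_sub => //; last exact: ltnW.
  by move=> i; exact: ltW.
have [wa|wa] := leP (w a) lam.
  rewrite big_ltn // ltNge wa mul0r add0r.
  apply: (@le_trans _ _ (4 * lam * \sum_(a.+1 <= i < c.+1) (be * lam < w i)%R%:R)).
    by apply: IH => //; [lia|exact: rest].
  rewrite ler_wpM2l ?mulr_ge0 ?(ltW l0) //; exact: le_sum_nat_sub.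
pose good r := (a <= r <= c)%N && (\sum_(a <= i < r.+1) w i <= lam * (r.+1 - a)%:R).
have exg : exists r, good r.
  exists c; rewrite /good leqnn andbT; apply/andP; split; first by lia.
  apply: le_trans small _; rewrite ler_wpM2l ?(ltW l0) // ler_nat; lia.
case: (ex_minnP exg) => r /andP[/andP[ar rc] gr] minr.
have ar' : (a < r)%N.
  rewrite ltn_neqAle ar andbT; apply/eqP => e'; move: gr; rewrite -e' big_nat1 subSnn mulr1.
  by rewrite leNgt wa.
have wJ : \sum_(a <= i < r.+1) w i <= 4 * lam * \sum_(a <= i < r.+1) (be * lam < w i)%R%:R.
  apply: (le_trans gr); rewrite [4 * lam]mulrC -[leRHS]mulrA ler_wpM2l ?(ltW l0) //.
    apply: heavy_interval => //; first by rewrite ar' (leq_ltn_trans rc cn).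
    move=> j /andP[aj jr]; rewrite ltNge; apply/negP => gj.
    have : good j by rewrite /good aj (leq_trans (ltnW jr) rc) gj.
    by move=> /minr; rewrite leqNgt jr.
have le1 i : (lam < w i)%R%:R * w i <= w i by case: ltP => _; rewrite ?mul1r // mul0r ltW.
have g0 i : 0 <= (lam < w i)%R%:R * w i by rewrite mulr_ge0 // ltW.
have [rb|br] := leqP r b.
  rewrite (@big_cat_nat _ _ _ r.+1) //=; last exact: leqW.
  rewrite [in leRHS](@big_cat_nat _ _ _ r.+1) //=; last exact: leqW.
  rewrite mulrDr; apply: lerD.
    by apply: le_trans wJ; apply: ler_sum => i _; exact: le1.
  by apply: IH; [lia|lia|apply: rest => //; exact: leqW].
apply: (@le_trans _ _ (\sum_(a <= i < r.+1) w i)).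
  apply: (@le_trans _ _ (\sum_(a <= i < r.+1) (lam < w i)%R%:R * w i)).
    by apply: le_sum_nat_sub => //; exact: leqW.
  by apply: ler_sum => i _; exact: le1.
apply: le_trans wJ _; rewrite ler_wpM2l ?mulr_ge0 ?(ltW l0) //.
by apply: le_sum_nat_sub.
Qed.

End height_bound.

(* Summing [heavy_set_le] over the dyadic levels [2 ^ j * lam] shows that the
   part of the mass of [w] carried by the set where [w] is large is small. *)
Lemma Aplus_inf e K (eps : R) : 0 < e -> 0 < K -> 0 < eps -> exists2 del : R, 0 < del &
  forall n w, (forall i, 0 < w i) -> Aplus e K n w ->
  forall (a b c : nat) (E : pred nat), (a <= b < c)%N -> (c < n)%N ->
  \sum_(a <= i < b.+1) (E i)%:R <= del * (c - b)%:R ->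
  \sum_(a <= i < b.+1) (E i)%:R * w i <= eps * \sum_(a <= i < c.+1) w i.
Proof.
move=> e0 K0 eps0; pose be : R := (3 * K * 4 `^ e)^-1.
have be0 : 0 < be by rewrite invr_gt0 !mulr_gt0 // powR_gt0.
have [N HN] : exists N : nat, 16 / (be * eps) <= N.+1%:R.
  exists (Num.bound (16 / (be * eps))); apply/ltW.
  apply: lt_le_trans (archi_boundP _) _; first by rewrite divr_ge0 // ltW // mulr_gt0.
  by rewrite ler_nat.
exists (eps / (2 * 2 ^+ N.+1)); first by rewrite divr_gt0 // mulr_gt0 ?exprn_gt0.
move=> n w w0 A a b c E /andP[ab bc] cn Esmall.
set W := \sum_(a <= i < c.+1) w i.
have cb0 : 0 < (c - b)%:R :> R by rewrite ltr0n subn_gt0.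
have W0 : 0 < W.
  have ac : (a < c.+1)%N by lia.
  by rewrite /W big_ltn // ltr_wpDr // sum_ge0_nat // => i; exact: ltW.
pose lam0 := W / (c - b)%:R.
have lam00 : 0 < lam0 by rewrite divr_gt0.
pose lam j := lam0 * 2 ^+ j.
have lamj j : lam0 <= lam j by rewrite ler_peMr ?(ltW lam00) // exprn_ege1 // ler1n.
have lamj0 j : 0 < lam j := lt_le_trans lam00 (lamj j).
pose g l := \sum_(a <= i < b.+1) (l < w i)%R%:R * w i.
have gle j : g (lam j) <= 4 * lam j * \sum_(a <= i < c.+1) (be * lam j < w i)%R%:R.
  apply: (heavy_set_le e0 K0 w0 A) => //; [by rewrite bc|exact: leqW|].
  rewrite -/W; have -> : W = lam0 * (c - b)%:R by rewrite /lam0 divfK // gt_eqF.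
  by rewrite ler_pM2r.
(* The part above the top level is counted in each of the [N.+1] lower levels, whose sum is bounded
   by a geometric series at each point; [N] is chosen so large that the part itself is at most half
   of [eps * W]. *)
have tail : N.+1%:R * g (lam N.+1) <= 8 / be * W.
  apply: (@le_trans _ _ (\sum_(0 <= j < N.+1) g (lam j))).
    rewrite mulr_natl -[N.+1]subn0 -sumr_const_nat subn0; apply: ler_sum_nat => j /andP[_ jN].
    apply: ler_sum => i _; rewrite ler_wpM2r ?(ltW (w0 i)) //.
    case: (ltP (lam N.+1)) => // h; rewrite (lt_trans _ h) //.
    by rewrite /lam ltr_pM2l // ltr_eXn2l // ?ltr1n.
  apply: (@le_trans _ _ (\sum_(0 <= j < N.+1) 4 * lam j *
     \sum_(a <= i < c.+1) (be * lam j < w i)%R%:R)).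
    by apply: ler_sum => j _; exact: gle.
  under eq_bigr do rewrite mulr_sumr.
  rewrite exchange_big /= mulr_sumr; apply: ler_sum => i _.
  have := @geo_levels_le lam0 2 (w i / be) N.+1 lam00 _ _.
  rewrite ltr1n divr_ge0 ?(ltW (w0 i)) ?(ltW be0) // => /(_ isT isT) G.
  have -> : \sum_(0 <= j < N.+1) 4 * lam j * (be * lam j < w i)%R%:R =
     4 * \sum_(0 <= j < N.+1) (lam0 * 2 ^+ j < w i / be)%R%:R * (lam0 * 2 ^+ j).
    rewrite mulr_sumr; apply: eq_bigr => j _.
    by rewrite ltr_pdivlMr // [_ * be]mulrC -/(lam j); ring.
  have -> : 8 / be * w i = 4 * (w i / be * (2 / (2 - 1))) by field; rewrite gt_eqF.
  by rewrite ler_wpM2l.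
have gN : g (lam N.+1) <= eps / 2 * W.
  have N0 : 0 < N.+1%:R :> R by rewrite ltr0n.
  rewrite -(ler_pM2l N0); apply: le_trans tail _; rewrite mulrA ler_pM2r //.
  move: HN; rewrite ler_pdivrMr ?mulr_gt0 // => HN.
  rewrite ler_pdivrMr //; move: HN; lra.
apply: (@le_trans _ _ (\sum_(a <= i < b.+1) ((E i)%:R * lam N.+1 + (lam N.+1 < w i)%R%:R * w i))).
  apply: ler_sum => i _; case: (E i); rewrite ?mul1r ?mul0r ?add0r.
    by case: (ltP (lam N.+1)) => h; rewrite ?mul1r ?mul0r ?addr0 // lerDr ltW.
  by rewrite mulr_ge0 // ltW.
rewrite big_split /= -mulr_suml -/(g _).
have : (\sum_(a <= i < b.+1) (E i)%:R) * lam N.+1 <= eps / 2 * W.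
  apply: (@le_trans _ _ (eps / (2 * 2 ^+ N.+1) * (c - b)%:R * lam N.+1)).
    by rewrite ler_pM2r.
  rewrite le_eqVlt; apply/orP; left; apply/eqP; rewrite /lam /lam0.
  have p2 : (2 : R) ^+ N.+1 != 0 by rewrite expf_neq0.
  by move: ((2 : R) ^+ N.+1) p2 => t t0; field; rewrite t0 gt_eqF.
lra.
Qed.

(** The integral of a power as a sum over geometric levels starting at [eta]. Values below [eta] and
    the term with [Y] are of order a power of [eta] and disappear as [eta] tends to 0; this lets an
    absorption argument lose a bounded term at the lowest level. *)
Lemma layer_cake (A r : R) n F w (Y Z : R) : 1 < A -> 0 < r ->
  (forall k, 0 <= F k) -> (forall k, 0 <= w k) -> 0 <= Y -> 0 <= Z ->
  (forall (eta : R) m, 0 < eta <= 1 -> \sum_(0 <= j < m) (eta * A ^+ j) `^ r *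
     \sum_(0 <= k < n) (eta * A ^+ j < F k)%R%:R * w k <= eta `^ r * Y + Z) ->
  \sum_(0 <= k < n) F k `^ r * w k <= A `^ r * Z.
Proof.
move=> A1 r0 F0 w0 Y0 Z0 H.
have A0 : 0 < A by lra.
set W := \sum_(0 <= k < n) w k; have W0 : 0 <= W by apply: sum_ge0_nat.
have pw (eta : R) m k : 0 < eta -> F k <= eta * A ^+ m -> F k `^ r <= eta `^ r +
    A `^ r * \sum_(0 <= j < m) (eta * A ^+ j) `^ r * (eta * A ^+ j < F k)%R%:R.
  move=> eta0; have t0 j : 0 <= (eta * A ^+ j) `^ r * (eta * A ^+ j < F k)%R%:R.
    by rewrite mulr_ge0 ?powR_ge0.
  elim: m => [|m IH] Fm.
    rewrite expr0 mulr1 in Fm; rewrite big_geq // mulr0 addr0.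
    by apply: powR_le => //; exact: ltW.
  rewrite big_nat_recr //= mulrDr; case: (ltP (eta * A ^+ m)) => h; last first.
    by rewrite mulr0 mulr0 addr0; exact: IH.
  rewrite mulr1 -powRM ?mulr_ge0 ?exprn_ge0 ?(ltW A0) ?(ltW eta0) //.
  have : F k `^ r <= (A * (eta * A ^+ m)) `^ r.
    by apply: powR_le => //; [exact: ltW|rewrite mulrCA -exprS].
  have : 0 <= eta `^ r by exact: powR_ge0.
  have : 0 <= A `^ r * \sum_(0 <= j < m) (eta * A ^+ j) `^ r * (eta * A ^+ j < F k)%R%:R.
    by rewrite mulr_ge0 ?powR_ge0 // sum_ge0_nat.
  lra.
have main (eta : R) : 0 < eta <= 1 ->
    \sum_(0 <= k < n) F k `^ r * w k <= eta `^ r * (W + A `^ r * Y) + A `^ r * Z.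
  move=> /[dup] eta1 /andP[eta0 _].
  have [m Hm] : exists m, forall k, (k < n)%N -> F k <= eta * A ^+ m.
    have sF k : (k < n)%N -> F k <= \sum_(0 <= i < n) F i by move=> kn; apply: le_sum_term.
    have [m Hm] : exists m, \sum_(0 <= i < n) F i <= eta * A ^+ m.
      set S := \sum_(_ <= _ < _) _.
      have S0 : 0 <= S by apply: sum_ge0_nat.
      have d0 : 0 < A - 1 by lra.
      exists (Num.bound (S / (eta * (A - 1)))); set m := Num.bound _.
      have : S / (eta * (A - 1)) < m%:R by apply: archi_boundP; rewrite divr_ge0 // mulr_ge0 // ltW.
      rewrite ltr_pdivrMr ?mulr_gt0 // => h; apply: (le_trans (ltW h)).
      rewrite mulrCA ler_pM2l //.
      elim: (m) => [|i IH]; first by rewrite mul0r exprn_ge0 // ltW.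
      rewrite exprS -natr1 mulrDl mul1r.
      have : 1 <= A ^+ i by rewrite exprn_ege1 // ltW.
      nra.
    by exists m => k /sF h; exact: le_trans h Hm.
  apply: (@le_trans _ _ (\sum_(0 <= k < n) (eta `^ r +
      A `^ r * \sum_(0 <= j < m) (eta * A ^+ j) `^ r * (eta * A ^+ j < F k)%R%:R) * w k)).
    by apply: ler_sum_nat => k /andP[_ kn]; rewrite ler_wpM2r // pw // Hm.
  under eq_bigr do rewrite mulrDl.
  rewrite big_split /= -mulr_sumr -/W.
  have -> : \sum_(0 <= i < n) A `^ r *
     (\sum_(0 <= j < m) (eta * A ^+ j) `^ r * (eta * A ^+ j < F i)%R%:R) * w i =
     A `^ r * \sum_(0 <= j < m) (eta * A ^+ j) `^ r *
     \sum_(0 <= k < n) (eta * A ^+ j < F k)%R%:R * w k.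
    under eq_bigr do rewrite -mulrA mulr_suml.
    rewrite -mulr_sumr exchange_big /=; congr (_ * _); apply: eq_bigr => j _.
    by rewrite mulr_sumr; apply: eq_bigr => k _; rewrite mulrA.
  have := ler_wpM2l (powR_ge0 A r) (H eta m eta1); lra.
have V0 : 0 <= W + A `^ r * Y by rewrite addr_ge0 // mulr_ge0 ?powR_ge0.
apply/ler_addgt0Pr => t t0.
pose V := W + A `^ r * Y + 1.
have V1 : 0 < V by rewrite /V; lra.
pose s := Num.min 1 (t / V).
have s0 : 0 < s by rewrite lt_min ltr01 divr_gt0.
have s1 : s <= 1 by rewrite ge_min lexx.
have sV : s <= t / V by rewrite ge_min lexx orbT.
have E : (s `^ r^-1) `^ r = s by rewrite -powRrM mulVf ?gt_eqF // powRr1 // ltW.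
have := main (s `^ r^-1); rewrite E powR_gt0 //= => /(_ _) M.
have : s `^ r^-1 <= 1.
  have : s `^ r^-1 <= 1 `^ r^-1.
    by apply: powR_le => //; [rewrite invr_ge0 ltW|exact: ltW].
  by rewrite powR1.
move=> /M /le_trans; apply; rewrite addrC lerD2l.
have : s * V <= t by rewrite -ler_pdivlMr.
rewrite /V; nra.
Qed.

End one_sided_weights.

(** * Weighted bounds for the one-sided maximal function *)

Section one_sided_maximal.
Context {R : realType}.
Implicit Types (w f F mu : nat -> R) (e K : R).

Lemma powR_lt (x y s : R) : 0 < s -> 0 <= x -> x < y -> x `^ s < y `^ s.
Proof. by move=> s0 x0 xy; rewrite gt0_ltr_powR ?nnegrE // (le_trans x0) // ltW. Qed.

Lemma powRD_gt0 (x r s : R) : 0 < x -> x `^ (r + s) = x `^ r * x `^ s.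
Proof. by move=> x0; rewrite powRD // (gt_eqF x0) implybT. Qed.

Definition maxav mu f n k : R := \big[Num.max/0]_(k <= c < n)
  ((\sum_(k <= i < c.+1) f i * mu i) / \sum_(k <= i < c.+1) mu i).

Lemma maxav_ge0 mu f n k : 0 <= maxav mu f n k.
Proof. exact: bigmax_ge_id. Qed.

Lemma le_maxav mu f n k c : (k <= c < n)%N ->
  (\sum_(k <= i < c.+1) f i * mu i) / (\sum_(k <= i < c.+1) mu i) <= maxav mu f n k.
Proof.
move=> kc; pose G c := (\sum_(k <= i < c.+1) f i * mu i) / (\sum_(k <= i < c.+1) mu i).
by apply: (@le_bigmax_seq _ _ _ (index_iota k n) 0 c xpredT G) => //; rewrite mem_index_iota.
Qed.

Lemma maxav_attained mu f n k : 0 < maxav mu f n k -> exists2 c, (k <= c < n)%N &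
  maxav mu f n k = (\sum_(k <= i < c.+1) f i * mu i) / \sum_(k <= i < c.+1) mu i.
Proof.
pose G c := (\sum_(k <= i < c.+1) f i * mu i) / (\sum_(k <= i < c.+1) mu i).
rewrite /maxav -[\big[_/_]_(k <= c < n) _]/(\big[Num.max/0]_(k <= c < n) G c).
have : forall c, c \in index_iota k n -> (k <= c < n)%N.
  by move=> c; rewrite mem_index_iota.
elim: (index_iota k n) => [|c s IH] H; first by rewrite big_nil ltxx.
rewrite big_cons; case: (leP (G c) (\big[Order.Def.max/0]_(j <- s) G j)) => h.
  by apply: IH => d ds; apply: H; rewrite inE ds orbT.
by move=> _; exists c; rewrite ?H ?mem_head.
Qed.

(** Scanning from the left, the first point of the level set selects an interval of large average
    starting there, and the scan resumes after it. The selected intervals are disjoint and cover, so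
    the constant is 1 for any measure. *)
Lemma maxav_weak11 mu f n lam a : (forall i, 0 < mu i) -> (forall i, 0 <= f i) ->
  0 <= lam ->
  lam * \sum_(a <= k < n) (lam < maxav mu f n k)%R%:R * mu k <= \sum_(a <= k < n) f k * mu k.
Proof.
move=> mu0 f0 l0; move: {2}(n - a)%N (leqnn (n - a)) => d; elim: d a => [|d IH] a.
  by rewrite leqn0 subn_eq0 => na; rewrite !big_geq // mulr0.
move=> dle; have [na|an] := leqP n a; first by rewrite !big_geq // mulr0.
have fm i : 0 <= f i * mu i by rewrite mulr_ge0 // ltW.
case: (leP (maxav mu f n a) lam) => h.
  rewrite big_ltn // ltNge h mul0r add0r (le_trans (IH _ _)) //; first by lia.
  exact: le_sum_nat_sub.
have [c /andP[ac cn] E] := maxav_attained (le_lt_trans l0 h).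
have S0 : 0 < \sum_(a <= i < c.+1) mu i.
  by rewrite big_ltn // ltr_wpDr // sum_ge0_nat // => i; exact: ltW.
move: h; rewrite E ltr_pdivlMr // => h.
rewrite (@big_cat_nat _ _ _ c.+1) //=; last exact: leqW.
rewrite [leRHS](@big_cat_nat _ _ _ c.+1) //=; last exact: leqW.
rewrite mulrDr lerD //; last by apply: IH; lia.
apply: le_trans (ltW h); rewrite ler_wpM2l //; apply: ler_sum => i _.
by case: (_ < _); rewrite ?mul1r // mul0r ltW.
Qed.

Lemma maxav_split mu f n lam k : (forall i, 0 < mu i) -> 0 < lam ->
  lam < maxav mu f n k ->
  lam / 2 < maxav mu (fun i => (lam / 2 < f i)%R%:R * f i) n k.
Proof.
move=> mu0 l0 h; have [c kc E] := maxav_attained (lt_trans l0 h).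
apply: lt_le_trans (le_maxav _ _ kc); case/andP: kc => kc cn.
have S0 : 0 < \sum_(k <= i < c.+1) mu i.
  by rewrite big_ltn // ltr_wpDr // sum_ge0_nat // => i; exact: ltW.
move: h; rewrite E !ltr_pdivlMr // => h.
have : \sum_(k <= i < c.+1) f i * mu i <=
   \sum_(k <= i < c.+1) (lam / 2 < f i)%R%:R * f i * mu i +
   lam / 2 * \sum_(k <= i < c.+1) mu i.
  rewrite mulr_sumr -big_split /=; apply: ler_sum => i _; rewrite -mulrDl ler_pM2r //.
  by case: ltP => g; rewrite ?mul1r ?mul0r; lra.
lra.
Qed.

(** Marcinkiewicz interpolation: at each level only the part of [f] above half of it matters. The
    constant does not depend on [mu], which will be both the weight and its dual. *)
Lemma maxav_strong r : 1 < r -> exists2 C : R, 0 < C & forall n mu f,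
  (forall i, 0 < mu i) -> (forall i, 0 <= f i) ->
  \sum_(0 <= k < n) maxav mu f n k `^ r * mu k <= C * \sum_(0 <= k < n) f k `^ r * mu k.
Proof.
move=> r1; have s0 : 0 < r - 1 by lra.
pose B : R := 2 `^ (r - 1).
have B1 : 1 < B by have := @powR_lt 1 2 (r - 1) s0 ler01; rewrite powR1 ltr1n => ->.
pose C1 : R := 2 * B * (B / (B - 1)).
have B10 : 0 < B - 1 by lra.
have B0 : 0 < B by lra.
have C10 : 0 < C1 by rewrite !mulr_gt0 // invr_gt0.
exists (2 `^ r * C1); first by rewrite mulr_gt0 // powR_gt0.
move=> n mu f mu0 f0; rewrite -mulrA.
have Z0 : 0 <= \sum_(0 <= k < n) f k `^ r * mu k.
  by apply: sum_ge0_nat => k; rewrite mulr_ge0 ?powR_ge0 // ltW.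
apply: (@layer_cake _ _ _ _ _ _ 0) => //; first by lra.
- lra.
- by move=> k; exact: maxav_ge0.
- by move=> k; exact: ltW.
- by rewrite mulr_ge0 // ltW.
move=> eta m /andP[eta0 _]; rewrite mulr0 add0r.
set lam := fun j => eta * 2 ^+ j.
have lam0 j : 0 < lam j by rewrite mulr_gt0 // exprn_gt0.
have lamB j : lam j `^ (r - 1) = eta `^ (r - 1) * B ^+ j.
  rewrite /lam powRM ?exprn_ge0 ?(ltW eta0) //; congr (_ * _).
  by rewrite -powR_mulrn // -powRrM mulrC powRrM powR_mulrn ?powR_ge0.
apply: (@le_trans _ _ (\sum_(0 <= j < m) 2 * lam j `^ (r - 1) *
    \sum_(0 <= k < n) (lam j / 2 < f k)%R%:R * f k * mu k)).
  apply: ler_sum => j _.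
  have := @maxav_weak11 mu (fun i => (lam j / 2 < f i)%R%:R * f i) n (lam j / 2) 0 mu0.
  have g0 i : 0 <= (lam j / 2 < f i)%R%:R * f i by rewrite mulr_ge0.
  have l2 : 0 <= lam j / 2 by rewrite divr_ge0 // ltW.
  move=> /(_ g0 l2) W.
  rewrite -/(lam j).
  have <- : lam j * lam j `^ (r - 1) = lam j `^ r by rewrite mulr_powRB1 // ?(ltW (lam0 j)) //; lra.
  have -> : 2 * lam j `^ (r - 1) * \sum_(0 <= k < n) (lam j / 2 < f k)%R%:R * f k * mu k
     = lam j `^ (r - 1) * (2 * \sum_(0 <= k < n) (lam j / 2 < f k)%R%:R * f k * mu k) by ring.
  rewrite [lam j * _]mulrC -mulrA ler_wpM2l ?powR_ge0 //.
  have : \sum_(0 <= k < n) (lam j < maxav mu f n k)%R%:R * mu k <=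
     \sum_(0 <= k < n) (lam j / 2 < maxav mu (fun i => (lam j / 2 < f i)%R%:R * f i) n k)%R%:R * mu k.
    apply: ler_sum => k _; rewrite ler_wpM2r ?(ltW (mu0 k)) //.
    by case: ltP => // /(maxav_split mu0 (lam0 j)) ->.
  move=> /(ler_wpM2l l2); move: W; rewrite -/(lam j).
  set X1 := \sum_(_ <= _ < _) _; set X2 := \sum_(_ <= _ < _) _; set X3 := \sum_(_ <= _ < _) _.
  lra.
under eq_bigr do rewrite mulr_sumr.
rewrite exchange_big /= mulr_sumr; apply: ler_sum => k _.
have := @geo_levels_le _ (eta `^ (r - 1)) B ((2 * f k) `^ (r - 1)) m (powR_gt0 _ eta0) B1
   (powR_ge0 _ _).
have -> : \sum_(0 <= j < m) 2 * lam j `^ (r - 1) * ((lam j / 2 < f k)%R%:R * f k * mu k) =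
   2 * f k * mu k * \sum_(0 <= j < m) (eta `^ (r - 1) * B ^+ j < (2 * f k) `^ (r - 1))%R%:R *
      (eta `^ (r - 1) * B ^+ j).
  rewrite mulr_sumr; apply: eq_bigr => j _; rewrite -lamB.
  have -> : (lam j `^ (r - 1) < (2 * f k) `^ (r - 1)) = (lam j / 2 < f k).
    rewrite ltr_pdivrMr // [f k * 2]mulrC; case: (ltP (lam j) (2 * f k)) => h.
      by rewrite powR_lt // (ltW (lam0 j)).
    by apply/negbTE; rewrite -leNgt; apply: powR_le => //; [exact: ltW|rewrite mulr_ge0].
  ring.
move=> /(@ler_wpM2l _ (2 * f k * mu k)) G.
apply: le_trans (G _) _; first by rewrite !mulr_ge0 // ltW.
rewrite powRM // -/B -(mulr_powRB1 (p := r) (f0 k)); last by lra.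
by rewrite /C1 le_eqVlt; apply/orP; left; apply/eqP; ring.
Qed.

(** Abel summation. *)
Lemma sum_mul_nonincr_ge0 (u phi : nat -> R) m :
  (forall z, (z < m)%N -> 0 <= \sum_(0 <= y < z.+1) u y) ->
  (forall y, 0 <= phi y) -> (forall y, phi y.+1 <= phi y) ->
  0 <= \sum_(0 <= y < m) u y * phi y.
Proof.
move=> U0 phi0 dec; case: m U0 => [|m] U0; first by rewrite big_geq.
apply: (@le_trans _ _ (phi m * \sum_(0 <= y < m.+1) u y)); first by rewrite mulr_ge0 // U0.
elim: m U0 => [|m IH] U0; first by rewrite !big_nat1 mulrC.
rewrite big_nat_recr //= [leRHS]big_nat_recr //= mulrDr [u _ * _]mulrC lerD2r.
apply: le_trans (IH _); last by move=> z zm; apply: U0; exact: ltnW.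
by rewrite ler_wpM2r // U0 // ltnW.
Qed.

Section one_sided_balance.
Variables (e K : R) (N : nat) (w : nat -> R).
Hypotheses (e0 : 0 < e) (K0 : 0 < K) (w0 : forall i, 0 < w i) (A : Aplus e K N w).

Let tau y : R := \sum_(y <= i < N) dualw e w i.

Let tau_ge0 y : 0 <= tau y.
Proof. by apply: sum_ge0_nat => i; exact: powR_ge0. Qed.

Let tau_gt0 y : (y < N)%N -> 0 < tau y.
Proof.
move=> yN; rewrite /tau big_ltn // ltr_wpDr ?dualw_gt0 // sum_ge0_nat // => i.
exact: powR_ge0.
Qed.

Let tau_le y z : (y <= z)%N -> tau z <= tau y.
Proof. by move=> yz; apply: le_sum_nat_sub => // i; exact: powR_ge0. Qed.

(* Cut [0, N) at the points where [tau] is successively halved; the condition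
   [A] is applied to each block followed by the next one. *)
Let block_sum s t : (s <= t <= N)%N -> 2 * tau t <= tau s ->
  (forall y, (s <= y < t)%N -> tau s < 2 * tau y) ->
  \sum_(s <= y < N) w y * tau y `^ e <=
    K * 4 `^ e * N%:R `^ e * ((N - s) + (N - t))%:R.
Proof.
have C0 : 0 <= K * 4 `^ e * N%:R `^ e by rewrite !mulr_ge0 ?powR_ge0 // ltW.
move: {2}(N - s)%N (leqnn (N - s)) => d; elim: d s t => [|d IH] s t.
  by rewrite leqn0 subn_eq0 => Ns _ _ _; rewrite big_geq // mulr_ge0 // ltW.
move=> dle /andP[st tN] t2 st2.
have [Ns|sN] := leqP N s; first by rewrite big_geq // mulr_ge0 // ltW.
have st' : (s < t)%N.
  rewrite ltn_neqAle st andbT; apply/eqP => E; move: t2; rewrite -E.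
  by have := tau_gt0 sN; lra.
pose good u := (t <= u <= N)%N && (2 * tau u <= tau t).
have exg : exists u, good u by exists N; rewrite /good tN leqnn /= {1}/tau big_geq // mulr0 tau_ge0.
case: (ex_minnP exg) => u /andP[/andP[tu uN] u2] minu.
have tu2 y : (t <= y < u)%N -> tau t < 2 * tau y.
  move=> /andP[ty yu]; rewrite ltNge; apply/negP => g.
  have : good y by rewrite /good ty g (leq_trans (ltnW yu) uN).
  by move=> /minu; rewrite leqNgt yu.
have := IH t u _ _ u2 tu2; rewrite tu uN => /(_ _ isT) IH'.
rewrite (@big_cat_nat _ _ _ t) //=.
have -> : ((N - s) + (N - t))%N = ((u - s) + ((N - t) + (N - u)))%N by lia.
rewrite natrD mulrDr; apply: lerD; last by apply: IH'; lia.
pose mid := t.-1.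
have midE : mid.+1 = t by rewrite /mid prednK // (leq_ltn_trans _ st').
have us0 : 0 < (u - s)%:R :> R by rewrite ltr0n; lia.
have Ap : (\sum_(s <= i < t) w i) * (tau s / 4) `^ e <= K * ((u - s)%:R * N%:R `^ e).
  have u1 : u.-1.+1 = u by lia.
  have := A (a := s) (b := mid) (c := u.-1); rewrite midE u1 => /(_ _ _) Ap.
  apply: (@le_trans _ _ (K * ((u - s)%:R * (u - s)%:R `^ e))); last first.
    rewrite ler_pM2l // ler_pM2l //; apply: powR_le; [exact: ltW|exact: ltW|].
    by rewrite ler_nat; lia.
  apply: le_trans (Ap _ _); [|clear -st' midE tu; lia|clear -sN tu st' uN; lia].
  rewrite ler_wpM2l ?sum_ge0_nat // => [i|]; first exact: ltW.
  apply: powR_le; [exact: ltW|by rewrite divr_ge0|].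
  have E : tau mid = \sum_(mid <= i < u) dualw e w i + tau u.
    by rewrite /tau -big_cat_nat //; lia.
  have := st2 mid; have -> : (s <= mid < t)%N by lia.
  by move=> /(_ isT); lra.
apply: (@le_trans _ _ ((\sum_(s <= i < t) w i) * tau s `^ e)).
  rewrite mulr_suml; apply: ler_sum_nat => i /andP[si _]; rewrite ler_wpM2l ?(ltW (w0 i)) //.
  by apply: powR_le; rewrite ?tau_le // ltW.
have p4 : 0 < 4 `^ e :> R by apply: powR_gt0.
have -> : tau s `^ e = (tau s / 4) `^ e * 4 `^ e by rewrite -powRM ?divr_ge0 // divfK.
rewrite mulrA; have -> : K * 4 `^ e * N%:R `^ e * (u - s)%:R = K * ((u - s)%:R * N%:R `^ e) * 4 `^ e.
  ring.
by rewrite ler_pM2r.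
Qed.

(** If every [z] failed, Abel summation against the nonincreasing powers of [tau] would give a lower
    bound for the sum of [w] times the power of [tau] that exceeds the one of [block_sum]; there
    [2 * N] is at most [4 * b.+1], hence the 4 in the constant. *)
Lemma one_sided_balance b : (b < N <= (b.+1).*2)%N ->
  exists2 z, (z <= b)%N & \sum_(0 <= y < z.+1) w y <=
   (4 * K * 4 `^ e + 1) * N%:R `^ e * \sum_(0 <= y < z.+1) (tau y `^ e)^-1.
Proof.
move=> /andP[bN Nb]; set C := 4 * K * 4 `^ e + 1.
have KK : 0 < 4 `^ e :> R by apply: powR_gt0.
have C0 : 0 < C by rewrite /C ltr_wpDl // !mulr_ge0 // ltW.
have N0 : 0 < N%:R :> R by rewrite ltr0n; lia.
have Ne0 : 0 < N%:R `^ e :> R by apply: powR_gt0.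
have b0 : 0 < b.+1%:R :> R by rewrite ltr0n.
case: (pselect (exists2 z, (z <= b)%N & \sum_(0 <= y < z.+1) w y <=
   C * N%:R `^ e * \sum_(0 <= y < z.+1) (tau y `^ e)^-1)) => // H; exfalso.
have := @sum_mul_nonincr_ge0 (fun y => w y - C * N%:R `^ e * (tau y `^ e)^-1)
  (fun y => tau y `^ e) b.+1.
have P z : (z < b.+1)%N -> 0 <= \sum_(0 <= y < z.+1) (w y - C * N%:R `^ e * (tau y `^ e)^-1).
  move=> zb; rewrite big_split /= sumrN -mulr_sumr subr_ge0 leNgt; apply/negP => h.
  by apply: H; exists z => //; exact: ltW.
move=> /(_ P (fun y => powR_ge0 _ _)) /(_ _)/wrap[y|].
  by apply: powR_le; rewrite ?tau_le // ltW.
have -> : \sum_(0 <= y < b.+1) (w y - C * N%:R `^ e * (tau y `^ e)^-1) * tau y `^ e =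
   \sum_(0 <= y < b.+1) w y * tau y `^ e - C * N%:R `^ e * b.+1%:R.
  under eq_big_nat => y /andP[_ yb].
    have ty : 0 < tau y `^ e by rewrite powR_gt0 // tau_gt0 // (leq_trans yb).
    rewrite mulrBl -(mulrA (C * _)) mulVf ?gt_eqF // mulr1; over.
  by rewrite big_split /= sumr_const_nat subn0 mulr_natr mulNrn.
apply/negP; rewrite -ltNge subr_lt0.
pose good u := (0 <= u <= N)%N && (2 * tau u <= tau 0).
have exg : exists u, good u by exists N; rewrite /good leqnn /= {1}/tau big_geq // mulr0 tau_ge0.
case: (ex_minnP exg) => u /andP[uN u2] minu.
have := block_sum uN u2 _; have H1 y : (0 <= y < u)%N -> tau 0 < 2 * tau y.
  move=> /andP[_ yu]; rewrite ltNge; apply/negP => g.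
  have : good y by rewrite /good g (leq_trans (ltnW yu)).
  by move=> /minu; rewrite leqNgt yu.
move=> /(_ H1) B.
apply: (@le_lt_trans _ _ (\sum_(0 <= y < N) w y * tau y `^ e)).
  by apply: le_sum_nat_sub => // y; rewrite mulr_ge0 ?powR_ge0 // ltW.
apply: (le_lt_trans B).
apply: (@le_lt_trans _ _ (K * 4 `^ e * N%:R `^ e * (4 * b.+1%:R))).
  rewrite ler_wpM2l ?mulr_ge0 ?powR_ge0 // ?(ltW K0) // -natrM ler_nat; lia.
have := mulr_gt0 Ne0 b0; rewrite /C; lra.
Qed.

End one_sided_balance.

Lemma sum_addl G x a b :
  \sum_(a <= i < b) G (x + i)%N = \sum_(x + a <= i < x + b) G i :> R.
Proof.
rewrite [in RHS]addnC big_addn addKn.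
by apply: eq_bigr => i _; rewrite addnC.
Qed.

Lemma Aplus_shift e K n w x N : (x + N <= n)%N ->
  Aplus e K n w -> Aplus e K N (fun i => w (x + i)%N).
Proof.
move=> xN A a b c /andP[ab bc] cN.
have := A (x + a)%N (x + b)%N (x + c)%N; rewrite !leq_add2l ab bc => /(_ isT).
rewrite (leq_trans _ xN) ?ltn_add2l // => /(_ isT).
by rewrite -!addnS -!sum_addl subnDl.
Qed.

(** An unweighted average is dominated by two maximal functions, each taken with respect to a
    measure for which it is bounded without any condition. On an initial part of the extremal
    interval, [G] is at least half the sum of [a] over [tau], and [one_sided_balance] says that the
    w-average of its power divided by [w] is large on a suitable initial part. *)
Lemma maxav_le_dual e K : 0 < e -> 0 < K -> exists2 C : R, 0 < C & forall n w a x,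
  (forall i, 0 < w i) -> (forall i, 0 <= a i) -> Aplus e K n w ->
  maxav (fun=> 1) a n x `^ e <=
  C * maxav w (fun y => maxav (dualw e w) (fun i => a i / dualw e w i) n y `^ e / w y) n x.
Proof.
move=> e0 K0; pose C := 4 * K * 4 `^ e + 1.
have C0 : 0 < C by rewrite /C ltr_wpDl // !mulr_ge0 ?powR_ge0 // ltW.
have p20 : 0 < 2 `^ e :> R by apply: powR_gt0.
exists (2 `^ e * C); first by rewrite mulr_gt0.
move=> n w a x w0 a0 A.
pose G y := maxav (dualw e w) (fun i => a i / dualw e w i) n y.
set M := maxav (fun=> 1) a n x.
have [M0|M0] := leP M 0.
  have -> : M = 0 by apply/le_anti; rewrite M0 maxav_ge0.
  by rewrite powR0 ?gt_eqF // !mulr_ge0 ?maxav_ge0 ?powR_ge0 // ltW.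
have [c /andP[xc cn] ME] := maxav_attained M0.
have sum1 b : \sum_(x <= i < b.+1) (1 : R) = (b.+1 - x)%:R by rewrite sumr_const_nat.
have suma b : \sum_(x <= i < b.+1) a i * 1 = \sum_(x <= i < b.+1) a i.
  by apply: eq_bigr => i _; rewrite mulr1.
pose N := (c.+1 - x)%N; pose S := \sum_(x <= i < c.+1) a i.
have N0 : 0 < N%:R :> R by rewrite ltr0n /N; lia.
have {}ME : S = M * N%:R by rewrite /M ME sum1 suma divfK // gt_eqF.
have S0 : 0 < S by rewrite ME mulr_gt0.
(* The last [b] after which at least half of the sum of [a] remains. *)
pose good b := (x <= b <= c)%N && (S <= 2 * \sum_(b <= i < c.+1) a i).
have exg : exists b, good b by exists x; rewrite /good leqnn xc /= -/S; lra.
have ubg b : good b -> (b <= c)%N by case/andP => /andP[].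
case: (ex_maxnP exg ubg) => b /andP[/andP[xb bc] Sb] maxb.
(* The part up to [b] has more than half of the sum while its average does not exceed the maximal
   one, so it has at least half of the length. *)
have Nb : (N <= (b - x).+1.*2)%N.
  have [cb|bc'] := leqP c b; first by rewrite /N; lia.
  have : ~~ good b.+1 by apply/negP => /maxb; rewrite ltnn.
  rewrite /good bc' (leqW xb) /= -ltNge => h.
  have : \sum_(x <= i < b.+1) a i <= M * (b.+1 - x)%:R.
    have := @le_maxav (fun=> 1) a n x b; rewrite xb (leq_ltn_trans bc cn) => /(_ isT).
    by rewrite sum1 suma ler_pdivrMr // ltr0n subn_gt0 ltnS.
  pose S1 := \sum_(x <= i < b.+1) a i; pose S2 := \sum_(b.+1 <= i < c.+1) a i.
  have SE : S = S1 + S2 by rewrite /S (@big_cat_nat _ _ _ b.+1 x c.+1) ?leqW.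
  move: h; rewrite -/S2 -/S1 => h1 h2.
  have : M * N%:R <= M * (2 * (b.+1 - x)%:R) by rewrite -ME SE; lra.
  by rewrite ler_pM2l // -natrM ler_nat; clear; lia.
have AN : Aplus e K N (fun i => w (x + i)%N).
  by apply: Aplus_shift A; rewrite /N; move: xc cn; clear; lia.
have bN : (b - x < N <= (b - x).+1.*2)%N by rewrite Nb /N; lia.
have [z zb W] := one_sided_balance e0 K0 (fun i => w0 (x + i)%N) AN bN.
pose tau i := \sum_(i <= j < c.+1) dualw e w j.
have xN : (x + N)%N = c.+1 by rewrite /N subnKC // leqW.
have tauE y : \sum_(y <= i < N) dualw e (fun i => w (x + i)%N) i = tau (x + y)%N.
  by rewrite /tau -xN -sum_addl.
have WE : \sum_(0 <= y < z.+1) w (x + y)%N = \sum_(x <= y < (x + z).+1) w y.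
  by rewrite sum_addl addn0 addnS.
have tau0 i : (i <= c)%N -> 0 < tau i.
  by move=> ic; rewrite /tau big_ltn // ltr_wpDr ?dualw_gt0 // sum_ge0_nat // => j; exact: powR_ge0.
have GE i : (x <= i <= x + z)%N -> (S / 2) `^ e * (tau i `^ e)^-1 <= G i `^ e / w i * w i.
  move=> /andP[xi iz]; have ic : (i <= c)%N.
    by rewrite (leq_trans iz) // (leq_trans _ bc) // -(subnKC xb) leq_add2l.
  rewrite divfK ?gt_eqF // -powR_inv -powRM; last 2 first.
  - by rewrite divr_ge0 // ltW.
  - by rewrite invr_ge0 ltW // tau0.
  apply: powR_le; [exact: ltW|by rewrite !mulr_ge0 ?invr_ge0 ?(ltW S0) // ltW // tau0|].
  have icn : (i <= c < n)%N by rewrite ic.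
  apply: le_trans (le_maxav _ _ icn); rewrite ler_wpM2r ?invr_ge0 ?(ltW (tau0 _ ic)) //.
  under eq_bigr do rewrite divfK ?gt_eqF ?dualw_gt0 //.
  have : \sum_(b <= j < c.+1) a j <= \sum_(i <= j < c.+1) a j.
    by apply: le_sum_nat_sub => //; apply: leq_trans iz _; rewrite -(subnKC xb) leq_add2l.
  lra.
have {W} W : \sum_(x <= y < (x + z).+1) w y <=
    C * N%:R `^ e * \sum_(x <= y < (x + z).+1) (tau y `^ e)^-1.
  rewrite -WE; apply: (le_trans W); rewrite -/C.
  rewrite (eq_bigr (fun y => (fun i => (tau i `^ e)^-1) (x + y)%N)) => [|y _]; last by rewrite tauE.
  have := sum_addl (fun i => (tau i `^ e)^-1) x 0 z.+1; rewrite addn0 addnS => ->.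
  exact: lexx.
have xz : (x <= x + z < n)%N by move: zb xb bc cn; clear; lia.
rewrite -mulrA; apply: (@le_trans _ _ (2 `^ e * (C * ((\sum_(x <= i < (x + z).+1)
   G i `^ e / w i * w i) / (\sum_(x <= i < (x + z).+1) w i))))); last first.
  by rewrite ler_pM2l // ler_pM2l // le_maxav.
have Ws0 : 0 < \sum_(x <= i < (x + z).+1) w i.
  rewrite big_ltn ?ltnS ?leq_addr //.
  by rewrite ltr_wpDr // sum_ge0_nat // => i; exact: ltW.
rewrite !mulrA ler_pdivlMr // -!mulrA.
apply: (@le_trans _ _ (M `^ e * (C * N%:R `^ e * \sum_(x <= y < (x + z).+1) (tau y `^ e)^-1))).
  by rewrite ler_wpM2l ?powR_ge0.
have : (S / 2) `^ e * \sum_(x <= y < (x + z).+1) (tau y `^ e)^-1 <=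
   \sum_(x <= i < (x + z).+1) G i `^ e / w i * w i.
  by rewrite mulr_sumr; apply: ler_sum_nat => i; rewrite ltnS => /GE.
set X := \sum_(_ <= _ < _) _; set Y := \sum_(_ <= _ < _) _ => /(ler_wpM2l (ltW (mulr_gt0 p20 C0))) XY.
rewrite [leRHS]mulrA; apply: le_trans XY.
rewrite le_eqVlt; apply/orP; left; apply/eqP.
have -> : (S / 2) `^ e = M `^ e * N%:R `^ e / 2 `^ e.
  by rewrite ME !powRM ?mulr_ge0 ?(ltW M0) ?(ltW N0) // powR_inv.
by field; rewrite gt_eqF.
Qed.

(** The outer maximal function is bounded in the conjugate exponent [r] with respect to [w], the
    inner one in the exponent [p] with respect to [dualw]; since [(p - 1) * r = p], the powers of
    the weight match. *)
Lemma maxav_weighted p K : 1 < p -> 0 < K -> exists2 C : R, 0 < C & forall n w a,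
  (forall i, 0 < w i) -> (forall i, 0 <= a i) -> Aplus (p - 1) K n w ->
  \sum_(0 <= k < n) maxav (fun=> 1) a n k `^ p * w k <= C * \sum_(0 <= k < n) a k `^ p * w k.
Proof.
move=> p1 K0; have e0 : 0 < p - 1 by lra.
have [C1 C10 H1] := maxav_le_dual e0 K0.
pose r := p / (p - 1).
have r1 : 1 < r by rewrite /r ltr_pdivlMr //; lra.
have [C2 C20 H2] := maxav_strong r1; have [C3 C30 H3] := maxav_strong p1.
exists (C1 `^ r * C2 * C3); first by rewrite !mulr_gt0 // powR_gt0.
move=> n w a w0 a0 A; set e := p - 1.
have er : e * r = p by rewrite /r mulrC divfK // gt_eqF.
pose G y := maxav (dualw e w) (fun i => a i / dualw e w i) n y.
have dw i := @dualw_gt0 _ e w w0 i.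
apply: (@le_trans _ _ (\sum_(0 <= k < n) C1 `^ r *
    (maxav w (fun y => G y `^ e / w y) n k `^ r * w k))).
  apply: ler_sum => k _; rewrite mulrA ler_wpM2r ?(ltW (w0 k)) // -powRM ?maxav_ge0 ?(ltW C10) //.
  by rewrite -er powRrM; apply: powR_le; [lra|exact: powR_ge0|exact: H1].
rewrite -mulr_sumr -!mulrA ler_wpM2l ?powR_ge0 //.
apply: le_trans (H2 _ _ _ w0 _) _.
  by move=> i; rewrite divr_ge0 ?powR_ge0 // ltW.
rewrite ler_pM2l //.
have E i : (G i `^ e / w i) `^ r * w i = G i `^ p * dualw e w i.
  rewrite powRM ?powR_ge0 ?invr_ge0 ?(ltW (w0 i)) // -powRrM er -mulrA; congr (_ * _).
  rewrite powR_inv -powRN -[X in _ * X = _](powRr1 (ltW (w0 i))) -powRD_gt0 //.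
  by rewrite /dualw; congr (_ `^ _); rewrite /r /e; field; rewrite gt_eqF.
under eq_bigr do rewrite E.
apply: le_trans (H3 _ _ _ dw _) _; first by move=> i; rewrite divr_ge0 // ltW.
rewrite ler_pM2l // le_eqVlt; apply/orP; left; apply/eqP; apply: eq_bigr => i _.
rewrite powRM ?invr_ge0 ?(ltW (dw i)) // -mulrA; congr (_ * _).
rewrite powR_inv /dualw -powRrM -powRN -powRD_gt0 //.
rewrite -[RHS](powRr1 (ltW (w0 i))); congr (_ `^ _).
by rewrite /e; field; rewrite gt_eqF.
Qed.

End one_sided_maximal.

(** * Localisation of the variation *)

Section good_lambda.
Context {R : realType}.
Implicit Types (w f g : nat -> R) (e K q lam gam mu : R).

Lemma vq_shift q (c : nat -> R) (a : R) L : vq q (fun N => c N + a) L = vq q c L.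
Proof.
have E x y : c x + a - (c y + a) = c x - c y by ring.
have H x l : vsum q (fun N => c N + a) x l = vsum q c x l.
  by elim: l x => //= y l IH x; rewrite E IH.
apply: eq_bigr => m _; rewrite /vlist.
by case: (mask _ _).
Qed.

(** The decrements of [Psi] telescope and dominate the increments, so even the total variation is at
    most [Psi 0]. *)
Lemma vq_potential q c (Psi : nat -> R) L : 1 <= q -> (forall N, 0 <= Psi N) ->
  (forall N, `|c N - c N.+1| <= Psi N - Psi N.+1) -> vq q c L <= Psi 0 `^ q.
Proof.
move=> q1 P0 H; pose h i := Psi i - Psi i.+1.
have h0 i : 0 <= h i by exact: le_trans (H i).
have tel x y : (x <= y)%N -> \sum_(x <= i < y) h i = Psi x - Psi y.
  move=> xy; rewrite -[LHS]opprK -sumrN (eq_bigr (fun i => Psi i.+1 - Psi i)).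
    by rewrite telescope_sumr // opprB.
  by move=> i _; rewrite opprB.
apply: (@le_trans _ _ ((\sum_(0 <= i < L) h i) `^ q)); last first.
  by apply: powR_le; [lra|exact: sum_ge0_nat|rewrite tel // gerBl].
apply: vq_control => // x y /andP[xy _]; apply: powR_le => //; first by lra.
rewrite (tel _ _ (ltnW xy)); elim: y xy => [|y IH]; first by rewrite ltn0.
rewrite ltnS leq_eqVlt => /orP[/eqP<-|xy].
  exact: H.
have := ler_normD (c x - c y) (c y - c y.+1); rewrite subrKA.
by have := IH xy; have := H y; lra.
Qed.

(* [T], [s] are the sums of a sequence over windows of length [l] and [D], and
   [m = l - D]: the difference between the averages over the window of length
   [l] and over the last [m] terms of it, when the window grows by one term [x]. *)
Lemma window_growth (l D m T Ta s x mu : R) : 0 < m -> 0 <= D -> l = m + D ->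
  0 <= mu -> `|T| <= Ta -> Ta <= l * mu ->
  `|(T / l - (T - s) / m) - ((T + x) / (l + 1) - (T + x - s) / (m + 1))| <=
  (`|s| / m + 4 * mu * D / m - Ta * (m^-1 - l^-1)) -
  (`|s| / (m + 1) + 4 * mu * D / (m + 1) - (Ta + `|x|) * ((m + 1)^-1 - (l + 1)^-1)).
Proof.
move=> m0 D0 lE mu0 TTa Tal.
have l0 : 0 < l by rewrite lE ltr_wpDr.
pose al := m^-1 - (m + 1)^-1.
pose ga := (m + 1)^-1 - (l + 1)^-1.
pose be := (m^-1 - l^-1) - ga.
have m1 : 0 < m + 1 by lra.
have l1 : 0 < l + 1 by lra.
have alE : al = (m * (m + 1))^-1 by rewrite /al; field; rewrite !gt_eqF.
have al0 : 0 <= al by rewrite alE invr_ge0 mulr_ge0 // ltW.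
have ga0 : 0 <= ga by rewrite subr_ge0 lef_pV2 ?posrE //; lra.
have beE : l * be = D * al * ((l + m + 1) / (l + 1)).
  by rewrite alE /be /ga lE; field; rewrite -lE !gt_eqF.
have be2 : l * be <= 2 * D * al.
  rewrite beE [2 * D]mulrC -!mulrA ler_wpM2l // mulrC ler_wpM2r //.
  by rewrite ler_pdivrMr //; lra.
have be0 : 0 <= be.
  rewrite -(pmulr_rge0 _ l0) beE !mulr_ge0 ?invr_ge0 //; lra.
have -> : (T / l - (T - s) / m) - ((T + x) / (l + 1) - (T + x - s) / (m + 1)) =
   - (T * be) + s * al + x * ga by rewrite /be /al /ga; ring.
have -> : (`|s| / m + 4 * mu * D / m - Ta * (m^-1 - l^-1)) -
  (`|s| / (m + 1) + 4 * mu * D / (m + 1) - (Ta + `|x|) * ((m + 1)^-1 - (l + 1)^-1)) =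
  `|s| * al + 4 * mu * D * al - Ta * be + `|x| * ga by rewrite /be /al /ga; ring.
apply: le_trans (ler_normD _ _) _; apply: le_trans (lerD (ler_normD _ _) (lexx _)) _.
rewrite normrN !normrM (ger0_norm be0) (ger0_norm al0) (ger0_norm ga0) lerD2r.
have : `|T| * be <= Ta * be by rewrite ler_wpM2r.
have : Ta * be <= mu * (2 * D * al).
  apply: (@le_trans _ _ (l * mu * be)); first by rewrite ler_wpM2r.
  by rewrite mulrAC mulrC ler_wpM2l.
lra.
Qed.

(** Windows from [k] and from [b] with the same right end differ by the [D] terms before [b]. By
    [window_growth] the difference [c] of their averages has the decreasing potential [Psi], whose
    initial value is at most [mu + 4 * mu]; so [c] has variation at most [lam], and so has the
    family starting at [b]. *)
Lemma wvar_far q f k b d L lam mu : 1 <= q -> (k < b)%N -> (b - k <= d)%N ->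
  (b - k + d <= L)%N -> 0 < lam -> 0 <= mu -> 5 * mu <= lam ->
  (forall l, \sum_(0 <= i < l) `|f (k + i)%N| <= l%:R * mu) ->
  wvar q f L b <= lam `^ q ->
  vq q (fun N => wavg f k (maxn N (b - k + d).-1).+1) L <= (4 * lam) `^ q.
Proof.
move=> q1 kb Dd dL l0 mu0 mul Hmu Vb; set D := (b - k)%N.
set N0 := (D + d).-1.
have d0 : (0 < d)%N by move: kb Dd; lia.
have N0E : N0.+1 = (D + d)%N by rewrite /N0 prednK // addn_gt0 d0 orbT.
pose c N := wavg f k N.+1 - wavg f b (N - D).+1.
rewrite leNgt; apply/negP.
rewrite (@eq_vq _ _ _ (fun N => wavg f b (maxn N N0 - D).+1 + c (maxn N N0))); last first.
  by move=> i _; rewrite addrC subrK.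
move=> /vqD_split -/(_ q1) []; first by rewrite mulr_gt0.
  have -> : 4 * lam / 4 = lam by field.
  apply/negP; rewrite -leNgt; apply: le_trans Vb.
  apply: (@vq_reparam _ q (fun N => wavg f b N.+1) (fun N => maxn N N0 - D)%N); first by lra.
    by move=> x y xy; rewrite leq_sub2r // geq_max leq_max xy leq_max leqnn orbT.
  by move: N0E dL; lia.
have -> : 4 * lam / 4 = lam by field.
apply/negP; rewrite -leNgt.
pose s := \sum_(0 <= i < D) f (k + i)%N.
pose Ta N : R := \sum_(0 <= i < N.+1) `|f (k + i)%N|.
pose Psi N : R := `|s| / (N - D).+1%:R + 4 * mu * D%:R / (N - D).+1%:R -
  Ta N * ((N - D).+1%:R^-1 - N.+1%:R^-1).
have sD : `|s| <= D%:R * mu by apply: le_trans (Hmu D); exact: ler_norm_sum.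
have Dr0 : 0 <= D%:R :> R by [].
have key N : (N0 <= N)%N -> `|c N - c N.+1| <= Psi N - Psi N.+1.
  move=> NN; have DN : (D <= N)%N by move: N0E d0 NN; lia.
  have := @window_growth N.+1%:R D%:R (N - D).+1%:R (\sum_(0 <= i < N.+1) f (k + i)%N) (Ta N)
    s (f (k + N.+1)%N) mu.
  rewrite ltr0n Dr0 mu0 => /(_ isT isT _ isT) W.
  have nE : N.+1%:R = (N - D).+1%:R + D%:R :> R by rewrite -natrD addSn subnK.
  have := W nE (ler_norm_sum _ _ _) (Hmu _).
  have bs n : (D <= n)%N -> \sum_(0 <= i < (n - D).+1) f (b + i)%N =
     \sum_(0 <= i < n.+1) f (k + i)%N - s.
    move=> Dn; rewrite /s (@big_cat_nat _ _ _ D 0 n.+1) ?leqW //= addrAC subrr add0r.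
    rewrite (eq_bigr (fun i => (fun j => f (k + j)%N) (D + i)%N)) => [|i _]; last first.
      by rewrite addnA subnKC // ltnW.
    have E := sum_addl (fun j => f (k + j)%N) D 0 (n - D).+1.
    rewrite addn0 addnS subnKC // in E; exact: E.
  have TE : \sum_(0 <= i < N.+2) f (k + i)%N = \sum_(0 <= i < N.+1) f (k + i)%N + f (k + N.+1)%N.
    by rewrite big_nat_recr.
  have TaE : Ta N.+1 = Ta N + `|f (k + N.+1)%N| by rewrite /Ta big_nat_recr.
  have e1 : (N.+1 - D).+1%:R = (N - D).+1%:R + 1 :> R by rewrite subSn // natr1.
  have e2 : N.+2%:R = N.+1%:R + 1 :> R by rewrite natr1.
  rewrite /c /Psi /wavg e1 e2 TaE !bs //; last exact: leqW.
  by rewrite TE.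
have Psi0 N : (N0 <= N)%N -> 0 <= Psi N.
  move=> NN; have DN : (D <= N)%N by move: N0E d0 NN; lia.
  have nE : N.+1%:R = (N - D).+1%:R + D%:R :> R by rewrite -natrD addSn subnK.
  have m0 : 0 < (N - D).+1%:R :> R by [].
  have n0 : 0 < N.+1%:R :> R by [].
  rewrite /Psi; set m := (N - D).+1%:R in nE m0 *; set l := N.+1%:R in nE n0 *.
  have := Hmu N.+1; rewrite -/(Ta N) -/l => Tl.
  have -> : m^-1 - l^-1 = D%:R / (l * m).
    have -> : D%:R = l - m by lra.
    by field; rewrite !gt_eqF.
  have : Ta N * (D%:R / (l * m)) <= mu * D%:R / m.
    have -> : mu * D%:R / m = l * mu * (D%:R / (l * m)) by field; rewrite !gt_eqF.
    by rewrite ler_wpM2r // divr_ge0 // mulr_ge0 // ltW.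
  have : 0 <= mu * D%:R / m by rewrite divr_ge0 ?mulr_ge0 // ltW.
  have : 0 <= `|s| / m by rewrite divr_ge0 // ltW.
  have -> : 4 * mu * D%:R / m = 4 * (mu * D%:R / m) by ring.
  move: (`|s| / m) (mu * D%:R / m) (Ta N * _) => x y z; lra.
have := @vq_potential q (fun N => c (maxn N N0)) (fun N => Psi (maxn N N0)) L q1.
move=> /(_ _ _)/wrap[N|N|H].
- by apply: Psi0; rewrite leq_maxr.
- case: (ltnP N N0) => NN; last by rewrite !(maxn_idPl _) ?key // leqW.
  by rewrite !(maxn_idPr _) ?(ltnW NN) // !subrr normr0.
apply: (le_trans H); apply: powR_le; [lra|by apply: Psi0; rewrite leq_maxr|].
rewrite max0n /Psi; have -> : (N0 - D).+1 = d by move: N0E d0; lia.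
have dr0 : 0 < d%:R :> R by rewrite ltr0n.
have Ddr : D%:R <= d%:R :> R by rewrite ler_nat.
have : `|s| / d%:R <= mu.
  by rewrite ler_pdivrMr //; apply: (le_trans sD); rewrite mulrC ler_wpM2l.
have : mu * D%:R / d%:R <= mu by rewrite ler_pdivrMr // ler_wpM2l.
have : 0 <= Ta N0 * (d%:R^-1 - N0.+1%:R^-1).
  rewrite mulr_ge0 ?sum_ge0_nat // subr_ge0 lef_pV2 ?posrE ?ltr0n //.
  by rewrite ler_nat N0E leq_addl.
have -> : 4 * mu * D%:R / d%:R = 4 * (mu * D%:R / d%:R) by ring.
move: mul; move: (`|s| / d%:R) (mu * D%:R / d%:R) (Ta N0 * _) => x y z; lra.
Qed.

(* The windows starting at [k] and contained in [k, b + d) only see [g], the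
   longer ones are compared with the windows starting at [b]. *)
Lemma wvar_local q f g k b d L lam mu : 1 <= q -> (k < b)%N -> (b - k <= d)%N ->
  0 < lam -> 0 <= mu -> 5 * mu <= lam ->
  (forall l, \sum_(0 <= i < l) `|f (k + i)%N| <= l%:R * mu) ->
  (forall i, (k <= i < b + d)%N -> f i = g i) ->
  wvar q f L b <= lam `^ q -> (16 * lam) `^ q < wvar q f L k ->
  lam `^ q < wvar q g L k.
Proof.
move=> q1 kb Dd l0 mu0 mul Hmu fg Vb Vk.
have avE l : (l <= b - k + d)%N -> wavg f k l = wavg g k l.
  move=> lb; rewrite /wavg; congr (_ / _); apply: eq_big_nat => i /andP[_ il].
  by apply: fg; move: kb il lb; lia.
have l16 : lam `^ q <= (16 * lam) `^ q by apply: powR_le; lra.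
have [Lb|bL] := ltnP L (b - k + d).
  apply: (le_lt_trans l16); rewrite (lt_le_trans Vk) // /wvar.
  rewrite (@eq_vq _ _ _ (fun N => wavg g k N.+1)) // => i iL.
  by apply: avE; exact: leq_ltn_trans Lb.
set N0 := (b - k + d).-1.
have N0E : N0.+1 = (b - k + d)%N by rewrite /N0 prednK // addn_gt0 subn_gt0 kb.
have l160 : 0 < 16 * lam by lra.
move: Vk; rewrite /wvar (@eq_vq _ _ _ (fun N => wavg f k (minn N N0).+1 +
  (wavg f k (maxn N N0).+1 - wavg f k N0.+1))); last first.
  move=> i _; case: (leqP i N0) => iN; first by rewrite subrr addr0.
  by rewrite addrC subrK.
move=> /(vqD_split q1 l160)[]; have -> : 16 * lam / 4 = 4 * lam by field.
  move=> H; apply: (@le_lt_trans _ _ ((4 * lam) `^ q)); first by apply: powR_le; lra.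
  apply: (lt_le_trans H).
  rewrite (@eq_vq _ _ _ (fun N => wavg g k (minn N N0).+1)); last first.
    by move=> i _; apply: avE; rewrite -N0E ltnS geq_minr.
  apply: (@vq_reparam _ q (fun N => wavg g k N.+1) (fun N => minn N N0)); first by lra.
    by move=> x y xy; rewrite leq_min !geq_min xy leqnn !orbT.
  exact: geq_minl.
rewrite (_ : vq q _ L = vq q (fun N => wavg f k (maxn N N0).+1) L).
  by rewrite ltNge (wvar_far q1 kb Dd bL l0 mu0 mul Hmu Vb).
apply: vq_shift.
Qed.

End good_lambda.

(** * The good-lambda inequality and the weighted bound for the variation *)

Section weighted_variation.
Context {R : realType}.
Implicit Types (w f g : nat -> R) (e K q lam gam mu eps : R).

Lemma sum_cut (F : nat -> R) a c b : (a <= c <= b)%N ->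
  (forall k, (c <= k < b)%N -> F k = 0) ->
  \sum_(a <= k < b) F k = \sum_(a <= k < c) F k.
Proof.
move=> /andP[ac cb] F0; rewrite (big_cat_nat ac cb) /=.
have -> : \sum_(c <= k < b) F k = 0 by rewrite big_nat_cond big1 // => k /andP[/F0].
by rewrite addr0.
Qed.

Lemma sum_indic_eq_le N j : \sum_(0 <= i < N) (j == i)%:R <= 1 :> R.
Proof.
have [jN|Nj] := ltnP j N.
  by rewrite (sum_single jN) ?eqxx // => i; rewrite eq_sym => /negbTE->.
rewrite big_nat_cond big1 // => i /andP[/andP[_ iN] _].
by rewrite gtn_eqF // (leq_trans iN).
Qed.

(* [Om] is cut into its maximal intervals [_, b) and each of them into the
   pieces at distance [2 ^ i, 2 ^ i.+1) from [b]; the piece [i] is compared with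
   the pieces [i] and [i - 1], whence the factor [2]. *)
Lemma group_sum n w (Om Bad : pred nat) eps : (forall k, 0 < w k) -> 0 <= eps ->
  ~~ Om n -> (forall k, Bad k -> Om k) ->
  (forall k0 b i, Bad k0 -> (k0 < b <= n)%N -> ~~ Om b ->
     (forall m, (k0 <= m < b)%N -> Om m) -> (2 ^ i <= b - k0 < 2 ^ i.+1)%N ->
     \sum_(k0 <= k < b) (Bad k && (2 ^ i <= b - k)%N)%:R * w k <=
     eps * \sum_(k0 <= k < b) (2 ^ i.-1 <= b - k)%N%:R * w k) ->
  \sum_(0 <= k < n) (Bad k)%:R * w k <= 2 * eps * \sum_(0 <= k < n) (Om k)%:R * w k.
Proof.
move=> w0 eps0 Omn BO H.
have /choice[nb Hnb] : forall k, exists b, (k < n)%N -> Om k ->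
    [/\ (k < b <= n)%N, ~~ Om b & forall m, (k <= m < b)%N -> Om m].
  move=> k; have [kn|nk] := ltnP k n; last by exists 0%N.
  have [Ok|] := boolP (Om k); last by exists 0%N.
  have exb : exists b, (k < b <= n)%N && ~~ Om b by exists n; rewrite kn leqnn.
  case: (ex_minnP exb) => b /andP[kb Ob] minb; exists b => _ _; split => // m /andP[km mb].
  have [<-//|km'] := eqVneq k m.
  apply/negPn/negP => Om'; have : (k < m <= n)%N && ~~ Om m.
    by rewrite Om' ltn_neqAle km' km (leq_trans (ltnW mb)) //; case/andP: kb.
  by move=> /minb; rewrite leqNgt mb.
pose lv k := trunc_log 2 (nb k - k).
have w0' k : 0 <= w k by exact: ltW.
have group b i : \sum_(0 <= k < n) [&& Bad k, nb k == b & lv k == i]%:R * w k <=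
    eps * \sum_(0 <= k < n) (Om k && (nb k == b))%:R *
      ((lv k == i)%:R + ((lv k).+1 == i)%:R) * w k.
  pose Q k := (k < n)%N && [&& Bad k, nb k == b & lv k == i].
  have R0 k : 0 <= (Om k && (nb k == b))%:R * ((lv k == i)%:R + ((lv k).+1 == i)%:R) * w k.
    by rewrite mulr_ge0 // mulr_ge0 // addr_ge0.
  case: (pselect (exists k, Q k)) => [exQ|noQ]; last first.
    rewrite big_nat_cond big1 ?mulr_ge0 ?sum_ge0_nat // => k /andP[/andP[_ kn] _].
    case E : [&& _, _ & _]; last by rewrite mul0r.
    by exfalso; apply: noQ; exists k; rewrite /Q kn E.
  case: (ex_minnP exQ) => k0 /andP[k0n /and3P[Bk0 /eqP nk0 /eqP lk0]] mink0.
  have [k0b Ob Omk] := Hnb k0 k0n (BO _ Bk0); rewrite nk0 in k0b Ob Omk.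
  have /andP[k0b' bn] := k0b.
  have bk0 : (0 < b - k0)%N by rewrite subn_gt0.
  have i2 : (2 ^ i <= b - k0 < 2 ^ i.+1)%N by rewrite -lk0 /lv nk0; exact: trunc_log_bounds.
  have := H k0 b i Bk0 k0b Ob Omk i2 => Hk.
  apply: (@le_trans _ _ (\sum_(k0 <= k < b) (Bad k && (2 ^ i <= b - k)%N)%:R * w k)).
    rewrite (@big_cat_nat _ _ _ k0 0 n) ?(ltnW k0n) //= big_nat_cond big1 ?add0r; last first.
      move=> k /andP[/andP[_ kk0] _]; case E : [&& _, _ & _]; last by rewrite mul0r.
      have : Q k by rewrite /Q E (ltn_trans kk0).
      by move=> /mink0; rewrite leqNgt kk0.
    rewrite (@sum_cut _ k0 b n); last 2 first.
    - by rewrite (ltnW k0b').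
    - move=> k /andP[bk kn]; case E : [&& _, _ & _]; last by rewrite mul0r.
      case/and3P: E => /BO Ok /eqP nk _.
      by have [] := Hnb k kn Ok; rewrite nk ltnNge bk.
    apply: ler_sum_nat => k /andP[k0k kb]; rewrite ler_wpM2r //.
    case E : [&& _, _ & _] => //; case/and3P: E => -> /eqP nk /eqP lk /=.
    rewrite -lk /lv nk; have : (0 < b - k)%N by rewrite subn_gt0.
    by move=> /(@trunc_log_bounds 2 _ isT)/andP[->].
  apply: (le_trans Hk); rewrite ler_wpM2l //.
  apply: (@le_trans _ _ (\sum_(k0 <= k < b) (Om k && (nb k == b))%:R *
      ((lv k == i)%:R + ((lv k).+1 == i)%:R) * w k)); last exact: le_sum_nat_sub.
  apply: ler_sum_nat => k /andP[k0k kb]; rewrite ler_wpM2r //.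
  have Ok : Om k by apply: Omk; rewrite k0k.
  have [/andP[kn1 nbn] On nO] := Hnb k (leq_trans kb bn) Ok.
  have nkb : nb k = b.
    case: (ltngtP (nb k) b) => // h.
      by move: On; rewrite Omk // h (leq_trans k0k (ltnW kn1)).
    by move: Ob; rewrite nO // h (ltnW kb).
  rewrite Ok nkb eqxx mul1r; case: (leqP (2 ^ i.-1) (b - k)) => h; last by rewrite addr_ge0.
  case: (leqP (2 ^ i) (b - k)) => h'.
    have -> : lv k = i.
      apply: trunc_log_eq => //; rewrite nkb h' /=; case/andP: i2 => _.
      by apply: leq_ltn_trans; rewrite leq_sub2l.
    by rewrite eqxx lerDl.
  have i0 : (0 < i)%N.
    by rewrite lt0n; apply/eqP => i0; move: h'; rewrite i0 expn0 ltnS leqn0 subn_eq0 leqNgt kb.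
  have -> : lv k = i.-1 by apply: trunc_log_eq => //; rewrite nkb h prednK.
  by rewrite prednK // eqxx lerDr.
have ind_le k : (k < n)%N -> (Bad k)%:R * w k <= \sum_(0 <= b < n.+1) \sum_(0 <= i < n.+1)
    [&& Bad k, nb k == b & lv k == i]%:R * w k.
  move=> kn; have [Bk|] := boolP (Bad k); last first.
    move=> _; rewrite [leLHS]mul0r; apply: sum_ge0_nat => b; apply: sum_ge0_nat => i.
    exact: mulr_ge0.
  have [/andP[_ nkn] _ _] := Hnb k kn (BO _ Bk).
  have lkn : (lv k < n.+1)%N.
    rewrite ltnS (leq_trans _ (leq_trans (leq_subr k _) nkn)) // /lv.
    have := @trunc_log_ltn; case: (nb k - k)%N => [|m]; first by rewrite trunc_log0.
    by move=> _; apply: ltnW; apply: leq_trans (ltn_expl _ (isT : 1 < 2)%N) _; apply: trunc_logP.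
  have s0 b : 0 <= \sum_(0 <= i < n.+1) [&& true, nb k == b & lv k == i]%:R * w k.
    by apply: sum_ge0_nat => i; rewrite mulr_ge0.
  apply: le_trans (@le_sum_term _ _ 0 n.+1 (nb k) s0 _); last by rewrite ltnS.
  apply: le_trans (@le_sum_term _ _ 0 n.+1 (lv k) _ _); rewrite ?eqxx //.
  by move=> i; rewrite mulr_ge0.
apply: (@le_trans _ _ (\sum_(0 <= k < n) \sum_(0 <= b < n.+1) \sum_(0 <= i < n.+1)
    [&& Bad k, nb k == b & lv k == i]%:R * w k)).
  by apply: ler_sum_nat => k /andP[_ kn]; exact: ind_le.
rewrite exchange_big /=; under eq_bigr do rewrite exchange_big /=.
apply: (@le_trans _ _ (\sum_(0 <= b < n.+1) \sum_(0 <= i < n.+1)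
   eps * \sum_(0 <= k < n) (Om k && (nb k == b))%:R *
      ((lv k == i)%:R + ((lv k).+1 == i)%:R) * w k)).
  by apply: ler_sum => b _; apply: ler_sum => i _; exact: group.
rewrite (eq_bigr (fun b => eps * \sum_(0 <= k < n) \sum_(0 <= i < n.+1)
   (Om k && (nb k == b))%:R * ((lv k == i)%:R + ((lv k).+1 == i)%:R) * w k)) => [|b _]; last first.
  by rewrite -mulr_sumr exchange_big.
rewrite -mulr_sumr exchange_big /= [2 * eps]mulrC -mulrA ler_wpM2l // mulr_sumr.
apply: ler_sum => k _.
apply: (@le_trans _ _ (\sum_(0 <= b < n.+1) (nb k == b)%:R * (2 * ((Om k)%:R * w k)))).
  apply: ler_sum => b _; rewrite -mulr_suml -mulr_sumr big_split /=.
  have [/= Ok|] := boolP (Om k); last by rewrite /= !mul0r !mulr0.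
  rewrite mul1r -!mulrA ler_wpM2l // ler_wpM2r //.
  have := sum_indic_eq_le n.+1 (lv k); have := sum_indic_eq_le n.+1 (lv k).+1; lra.
rewrite -mulr_suml -[leRHS]mul1r ler_wpM2r ?sum_indic_eq_le //.
by rewrite mulr_ge0 // mulr_ge0.
Qed.

Lemma wvar_eq0 q f L k : 1 <= q -> (forall i, (k <= i)%N -> f i = 0) -> wvar q f L k = 0.
Proof.
move=> q1 f0; apply/le_anti; rewrite vq_ge0 andbT.
rewrite /wvar (@eq_vq _ _ _ (fun=> 0)) => [|N _]; last first.
  by rewrite /wavg big1 ?mul0r // => i _; rewrite f0 // leq_addr.
have := @vq_potential _ q (fun=> 0) (fun=> 0) L q1; rewrite powR0; last by rewrite gt_eqF //; lra.
by apply => // N; rewrite subrr normr0.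
Qed.

Lemma sum_le_maxav f n k l : (k < n)%N -> (forall i, (n <= i)%N -> f i = 0) ->
  \sum_(0 <= i < l) `|f (k + i)%N| <= l%:R * maxav (fun=> 1) (fun i => `|f i|) n k.
Proof.
move=> kn fn; set M := maxav _ _ _ _.
have M0 : 0 <= M := maxav_ge0 _ _ _ _.
have H m : (k + m < n)%N -> \sum_(0 <= i < m.+1) `|f (k + i)%N| <= m.+1%:R * M.
  move=> kmn; rewrite (sum_addl (fun i => `|f i|)) addn0 addnS.
  have := @le_maxav _ (fun=> 1) (fun i => `|f i|) n k (k + m); rewrite leq_addr kmn => /(_ isT).
  under [X in X / _]eq_bigr do rewrite mulr1.
  rewrite sumr_const_nat -addnS addKn ler_pdivrMr ?ltr0n // addnS mulrC.
  exact.
case: l => [|l]; first by rewrite big_geq // mul0r.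
have [kl|nkl] := ltnP (k + l) n; first exact: H.
rewrite (@sum_cut _ 0 (n - k) l.+1); last 2 first.
- by rewrite leqW // leq_subLR.
- by move=> i /andP[ni _]; rewrite fn ?normr0 // -leq_subLR.
have nk0 : (0 < n - k)%N by rewrite subn_gt0.
have E : (n - k)%N = (n - k).-1.+1 by rewrite prednK.
rewrite E; apply: le_trans (H _ _) _; first by rewrite -addnS -?E; move: kn nk0; clear; lia.
by rewrite ler_wpM2r // ler_nat -E leqW // leq_subLR.
Qed.

(** In each piece of a component, the exceptional points also have large variation for the
    truncation [g] of [f], whose sum is small since the maximal function is small at [k0]. The weak
    type (1,1) bound makes them few in number, and [Aplus_inf] turns this into a small weight. *)
Lemma good_lambda e K q eps : 0 < e -> 0 < K -> 2 < q -> 0 < eps ->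
  exists2 gam : R, 0 < gam & forall n w f L lam, (forall i, 0 < w i) -> Aplus e K n w ->
  (forall i, (n <= i)%N -> f i = 0) -> 0 < lam ->
  \sum_(0 <= k < n) (((16 * lam) `^ q < wvar q f L k) &&
     (maxav (fun=> 1) (fun i => `|f i|) n k <= gam * lam))%:R * w k <=
  2 * eps * \sum_(0 <= k < n) (lam `^ q < wvar q f L k)%R%:R * w k.
Proof.
move=> e0 K0 q2 eps0; have q1 : 1 <= q by lra.
have [C1 C10 W11] := variation_weak11 q2.
have [del del0 Ainf] := Aplus_inf e0 K0 eps0.
(* The three bounds serve [wvar_local], the pieces next to the right endpoint ([i = 0]), and the
   density required by [Aplus_inf]. *)
pose gam := Num.min (5^-1) (Num.min ((8 * C1)^-1) (del / (8 * C1))).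
have c0 : 0 < 8 * C1 by rewrite mulr_gt0.
have gam0 : 0 < gam by rewrite !lt_min !invr_gt0 divr_gt0 // c0 ltr0n.
exists gam => // n w f L lam w0 A fn l0.
have g1 : gam <= 5^-1 by rewrite ge_min lexx.
have g2 : 8 * C1 * gam <= 1.
  by rewrite mulrC -ler_pdivlMr // mul1r !ge_min lexx orbT.
have g3 : 8 * C1 * gam <= del.
  by rewrite mulrC -ler_pdivlMr // !ge_min lexx !orbT.
have mu0 : 0 <= gam * lam by rewrite mulr_ge0 // ltW.
have mu5 : 5 * (gam * lam) <= lam.
  have : 5 * gam <= 1 by lra.
  by move=> /(ler_wpM2r (ltW l0)); rewrite mul1r mulrA.
pose Bad k := ((16 * lam) `^ q < wvar q f L k) &&
  (maxav (fun=> 1) (fun i => `|f i|) n k <= gam * lam).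
apply: (@group_sum _ _ (fun k => lam `^ q < wvar q f L k) Bad eps w0 (ltW eps0)).
- by rewrite wvar_eq0 // -leNgt powR_ge0.
- move=> k /andP[H _]; apply: le_lt_trans H; apply: powR_le; lra.
move=> k0 b i Bk0 /andP[k0b bn] Ob Ok /andP[ib bi].
(* [d] is larger than [b - k0], as [wvar_local] requires, so the support of [g] has length at most
   [2 * d]. *)
pose d := (2 ^ i.+1)%N; pose g k := (k0 <= k < b + d)%N%:R * f k.
pose M := (n + b + d + L).+1.
have M2 : (n + b + d + L < 2 ^ M)%N by apply: (ltn_trans (ltnSn _)); exact: ltn_expl.
have gM k : (2 ^ M <= k)%N -> g k = 0.
  by move=> Mk; rewrite /g fn ?mulr0 //; move: M2 Mk; clear; lia.
have LM : (L.+1 < 2 ^ M)%N.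
  have : (0 < d)%N by rewrite expn_gt0.
  by move: M2 k0b; clear; lia.
have local k : (k0 <= k < b)%N -> Bad k -> lam `^ q < wvar q g L k.
  move=> /andP[k0k kb] /andP[Vk Mk].
  apply: (@wvar_local _ q f g k b d L lam (gam * lam)) => //.
  - by apply: leq_trans (ltnW bi); rewrite leq_sub2l.
  - move=> l; apply: le_trans (sum_le_maxav l (leq_trans kb bn) fn) _.
    by rewrite ler_wpM2l.
  - by move=> j /andP[kj jb]; rewrite /g (leq_trans k0k kj) jb mul1r.
  by rewrite leNgt.
have gsum : \sum_(0 <= k < 2 ^ M) `|g k| <= (2 * d)%:R * (gam * lam).
  have k0d : (k0 <= b + d <= 2 ^ M)%N by move: M2 k0b; clear; lia.
  rewrite (@sum_cut _ 0 (b + d) (2 ^ M)); last 2 first.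
  - by case/andP: k0d.
  - by move=> k /andP[bk _]; rewrite /g ltnNge bk andbF mul0r normr0.
  have k0d' : (k0 <= b + d)%N by case/andP: k0d.
  rewrite (@big_cat_nat _ _ _ k0 0) //= big_nat_cond big1 ?add0r; last first.
    by move=> k /andP[/andP[_ kk0] _]; rewrite /g leqNgt kk0 mul0r normr0.
  rewrite (eq_big_nat _ _ (F2 := fun k => `|f k|)); last by move=> k kk; rewrite /g kk mul1r.
  rewrite -(subnKC k0d') sum_from.
  apply: le_trans (sum_le_maxav _ (leq_trans k0b bn) fn) _.
  case/andP: Bk0 => _ Mk0; apply: ler_pM => //; first exact: maxav_ge0.
  by rewrite ler_nat; move: bi; rewrite -/d; clear; lia.
have cnt : \sum_(k0 <= k < b) (Bad k)%:R <= 4 * C1 * gam * (2 ^ i)%:R.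
  apply: (@le_trans _ _ (\sum_(0 <= k < 2 ^ M) (lam `^ q < wvar q g L k)%R%:R)).
    apply: (@le_trans _ _ (\sum_(k0 <= k < b) (lam `^ q < wvar q g L k)%R%:R)).
      apply: ler_sum_nat => k kb; have [Bk|//] := boolP (Bad k).
      by rewrite local.
    by apply: le_sum_nat_sub => //; move: M2; clear; lia.
  rewrite -(ler_pM2l l0); apply: le_trans (W11 _ _ _ _ gM LM l0) _.
  have -> : lam * (4 * C1 * gam * (2 ^ i)%:R) = C1 * ((2 * d)%:R * (gam * lam)).
    by rewrite /d expnS !natrM; ring.
  by rewrite ler_wpM2l // ltW.
have b2 : (0 < 2 ^ i)%N by rewrite expn_gt0.
have cut j : (j <= i)%N -> (0 < 2 ^ j <= b - k0)%N.
  by move=> ji; rewrite expn_gt0 (leq_trans _ ib) // leq_exp2l.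
have cutE j F : (j <= i)%N -> \sum_(k0 <= k < b) (F k && (2 ^ j <= b - k)%N)%:R * w k =
    \sum_(k0 <= k < (b - 2 ^ j).+1) (F k)%:R * w k.
  move=> /cut/andP[j0 jb]; rewrite (@sum_cut _ k0 (b - 2 ^ j).+1 b); last 2 first.
  - by move: j0 jb k0b; clear; lia.
  - move=> k /andP[bk kb]; rewrite leqNgt (_ : (b - k < 2 ^ j)%N) ?andbF ?mul0r //.
    by move: bk kb; clear; lia.
  apply: eq_big_nat => k /andP[k0k kb]; rewrite (_ : (2 ^ j <= b - k)%N) ?andbT //.
  by move: kb j0 jb k0b; clear; lia.
(* For [i = 0] there is no room to the right for [Aplus_inf]; but then the count of exceptional
   points is below 1, against [Bad k0]. *)
case: i b2 d M M2 g gM LM local gsum cnt cut cutE ib bi => [|i] b2 d M M2 g gM LM local gsum cnt cut cutE ib bi.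
  exfalso; move: cnt; rewrite mulr1 => cnt.
  have : (Bad k0)%:R <= \sum_(k0 <= k < b) (Bad k)%:R :> R.
    by apply: (@le_sum_term _ (fun k => (Bad k)%:R)) => //; rewrite leqnn.
  rewrite Bk0 -[true%:R]/(1 : R); lra.
have -> : \sum_(k0 <= k < b) (2 ^ i.+1.-1 <= b - k)%:R * w k =
    \sum_(k0 <= k < (b - 2 ^ i).+1) w k.
  rewrite -[LHS]/(\sum_(k0 <= k < b) (predT k && (2 ^ i <= b - k)%N)%:R * w k) cutE //.
  by apply: eq_bigr => k _; exact: mul1r.
rewrite cutE //.
have e2 : (2 ^ i.+1 = 2 ^ i + 2 ^ i)%N by rewrite expnS mul2n addnn.
have i0 : (0 < 2 ^ i)%N by rewrite expn_gt0.
apply: (Ainf n w w0 A).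
- by move: ib i0 e2 k0b; clear; lia.
- by move: i0 k0b bn ib e2; clear; lia.
apply: (@le_trans _ _ (\sum_(k0 <= k < b) (Bad k)%:R)).
  by apply: le_sum_nat_sub => //; move: ib i0 e2 k0b; clear; lia.
apply: (le_trans cnt); have -> : (b - 2 ^ i - (b - 2 ^ i.+1) = 2 ^ i)%N.
  by move: ib e2 i0 k0b; clear; lia.
by rewrite e2 natrD; have := ler_wpM2r (ler0n R (2 ^ i)) g3; lra.
Qed.

Theorem weighted_variation p q K : 1 < p -> 2 < q -> 0 < K -> exists2 C : R, 0 < C &
  forall n w f L, (forall i, 0 < w i) -> Aplus (p - 1) K n w ->
  (forall i, (n <= i)%N -> f i = 0) ->
  \sum_(0 <= k < n) wvar q f L k `^ (p / q) * w k <= C * \sum_(0 <= k < n) `|f k| `^ p * w k.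
Proof.
move=> p1 q2 K0; have e0 : 0 < p - 1 by lra.
pose B : R := 16 `^ p.
have p0 : 0 < p by lra.
have B1 : 1 < B by have := @powR_lt _ 1 16 p p0 ler01; rewrite powR1 ltr1n => ->.
have B0 : 0 < B by lra.
have eps0 : 0 < (4 * B)^-1 by rewrite invr_gt0 mulr_gt0.
have [gam gam0 GL] := good_lambda e0 K0 q2 eps0.
have [C1 C10 MX] := maxav_weighted p1 K0.
pose D : R := B / (B - 1).
have D0 : 0 < D by rewrite divr_gt0 //; lra.
have gp0 : 0 < gam^-1 `^ p by rewrite powR_gt0 // invr_gt0.
exists (B * (2 * (B * (gam^-1 `^ p * D * C1)))).
  by rewrite (mulr_gt0 B0) // (mulr_gt0 _ (mulr_gt0 B0 (mulr_gt0 (mulr_gt0 gp0 D0) C10))).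
move=> n w f L w0 A fn; set M := maxav (fun=> 1) (fun i => `|f i|) n.
pose F k := wvar q f L k `^ q^-1.
have q0 : 0 < q by lra.
have FE k : F k `^ q = wvar q f L k by rewrite /F -powRrM mulVf ?gt_eqF // powRr1 ?vq_ge0.
have FE' k : wvar q f L k `^ (p / q) = F k `^ p by rewrite /F -powRrM mulrC.
have Flt lam k : 0 < lam -> (lam `^ q < wvar q f L k) = (lam < F k).
  move=> l0; rewrite -FE; case: (ltP lam (F k)) => h; first by rewrite powR_lt // ltW.
  by apply/negbTE; rewrite -leNgt; apply: powR_le; rewrite ?powR_ge0 // ltW.
under eq_bigr do rewrite FE'.
pose W lam := \sum_(0 <= k < n) (lam < F k)%R%:R * w k.
have wf0 k : 0 <= w k by exact: ltW.
have M0 k : 0 <= M k := maxav_ge0 _ _ _ _.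
have Wtot0 : 0 <= \sum_(0 <= k < n) w k by exact: sum_ge0_nat.
have S0 : 0 <= \sum_(0 <= k < n) M k `^ p * w k.
  by apply: sum_ge0_nat => k; rewrite mulr_ge0 ?powR_ge0.
pose Z := B * (gam^-1 `^ p * D * \sum_(0 <= k < n) M k `^ p * w k).
have Z0 : 0 <= Z := mulr_ge0 (ltW B0) (mulr_ge0 (mulr_ge0 (ltW gp0) (ltW D0)) S0).
have WGL lam : 0 < lam -> W (16 * lam) <= (2 * B)^-1 * W lam +
    \sum_(0 <= k < n) (lam < M k / gam)%R%:R * w k.
  move=> l0; have := GL n w f L lam w0 A fn l0.
  have l16 : 0 < 16 * lam by rewrite mulr_gt0.
  under eq_bigr do rewrite Flt //.
  under [X in _ <= 2 * _ * X]eq_bigr do rewrite Flt //.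
  rewrite -/(W lam) => G; apply: (@le_trans _ _ (\sum_(0 <= k < n)
     ((16 * lam < F k) && (M k <= gam * lam))%:R * w k +
     \sum_(0 <= k < n) (lam < M k / gam)%R%:R * w k)); last first.
    rewrite lerD2r; apply: (le_trans G); rewrite le_eqVlt; apply/orP; left; apply/eqP.
    by congr (_ * _); field; rewrite gt_eqF.
  rewrite -big_split /=; apply: ler_sum => k _; rewrite -mulrDl ler_wpM2r //.
  rewrite ltr_pdivlMr // [lam * gam]mulrC [M k <= _]leNgt.
  by case: (16 * lam < F k); case: (gam * lam < M k) => //=; rewrite ?addr0 ?add0r.
apply: (@le_trans _ _ (16 `^ p * (2 * Z))); last first.
  have := ler_wpM2l (ltW D0) (MX n w _ w0 (fun i => normr_ge0 (f i)) A).
  rewrite -/M /Z -/B -(ler_pM2l gp0) -(ler_pM2l B0) => H.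
  have c2 : 0 <= 2 * B by rewrite mulr_ge0 // ltW.
  by have := ler_wpM2l c2 H; rewrite /Z; lra.
have WW lam : 0 < lam -> W lam <= \sum_(0 <= k < n) w k.
  by move=> l0; apply: ler_sum => k _; case: (_ < _); rewrite ?mul1r ?mul0r.
apply: (@layer_cake _ _ _ _ _ _ (2 * \sum_(0 <= k < n) w k)) => //; first by rewrite ltr1n.
- by move=> k; exact: powR_ge0.
- by rewrite mulr_ge0.
- by rewrite mulr_ge0.
move=> eta m /andP[eta0 _]; pose lam j : R := eta * 16 ^+ j.
have lam0 j : 0 < lam j by rewrite mulr_gt0 // exprn_gt0.
have lamS j : lam j.+1 = 16 * lam j by rewrite /lam exprS mulrCA.
pose S m := \sum_(0 <= j < m) lam j `^ p * W (lam j).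
rewrite -/(S m).
have t0 j : 0 <= lam j `^ p * W (lam j).
  by rewrite mulr_ge0 ?powR_ge0 // sum_ge0_nat // => k; rewrite mulr_ge0.
have SS : S m <= S m.+1 by apply: le_sum_nat_sub.
(* The lowest level has no predecessor and is bounded by the total weight; every other level is
   compared with the one below it. *)
suff : S m.+1 <= eta `^ p * (\sum_(0 <= k < n) w k) + S m / 2 + Z by lra.
rewrite /S big_nat_recl //= -addrA; apply: lerD.
  by rewrite {1}/lam expr0 mulr1 ler_wpM2l ?powR_ge0 // WW.
apply: (@le_trans _ _ (\sum_(0 <= j < m) (2^-1 * (lam j `^ p * W (lam j)) +
   B * (lam j `^ p * \sum_(0 <= k < n) (lam j < M k / gam)%R%:R * w k)))).
  apply: ler_sum => j _; rewrite lamS powRM ?(ltW (lam0 j)) // -/B.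
  apply: le_trans (ler_wpM2l _ (WGL _ (lam0 j))) _; first by rewrite mulr_ge0 ?powR_ge0 // ltW.
  rewrite le_eqVlt; apply/orP; left; apply/eqP.
  by field; rewrite gt_eqF.
rewrite big_split /= -!mulr_sumr [2^-1 * _]mulrC lerD2l ler_pM2l //.
under eq_bigr do rewrite mulr_sumr.
rewrite exchange_big /= mulr_sumr; apply: ler_sum => k _.
have := @geo_levels_le _ (eta `^ p) B ((M k / gam) `^ p) m (powR_gt0 _ eta0) B1 (powR_ge0 _ _).
have Mg0 : 0 <= M k / gam by rewrite divr_ge0 // ltW.
have -> : \sum_(0 <= j < m) lam j `^ p * ((lam j < M k / gam)%R%:R * w k) =
   w k * \sum_(0 <= j < m) (eta `^ p * B ^+ j < (M k / gam) `^ p)%R%:R * (eta `^ p * B ^+ j).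
  rewrite mulr_sumr; apply: eq_bigr => j _.
  have -> : eta `^ p * B ^+ j = lam j `^ p.
    rewrite /lam powRM ?exprn_ge0 ?(ltW eta0) //; congr (_ * _).
    by rewrite -powR_mulrn ?powR_ge0 // -powRrM [p * _]mulrC powRrM powR_mulrn.
  have -> : (lam j `^ p < (M k / gam) `^ p) = (lam j < M k / gam).
    case: (ltP (lam j) (M k / gam)) => h; first by rewrite powR_lt // ltW.
    by apply/negbTE; rewrite -leNgt; apply: powR_le => //; exact: ltW.
  ring.
move=> /(ler_wpM2l (wf0 k)) /le_trans; apply.
rewrite powRM // ?invr_ge0 ?(ltW gam0) // -/D.
by rewrite le_eqVlt; apply/orP; left; apply/eqP; ring.
Qed.

End weighted_variation.

Local Open Scope classical_set_scope.
Local Open Scope ring_scope.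

(** * Positive operators on L^p *)

Section theta.
Context {R : realType}.
Implicit Types (a b r s w : R).

Definition theta r a b : R := (a `^ r + b `^ r) `^ r^-1.

Lemma theta_ge0 r a b : 0 <= theta r a b.
Proof. exact: powR_ge0. Qed.

Lemma powR_theta r a b : r != 0 -> theta r a b `^ r = a `^ r + b `^ r.
Proof. by move=> r0; rewrite /theta -powRrM mulVf // powRr1 // addr_ge0 ?powR_ge0. Qed.

Lemma powRK_inv r a : r != 0 -> 0 <= a -> (a `^ r) `^ r^-1 = a.
Proof. by move=> r0 a0; rewrite -powRrM divff // powRr1. Qed.

Lemma powR_le_inv r a b : 0 < r -> 0 <= b -> a `^ r <= b `^ r -> a <= b.
Proof.
move=> r0 b0; rewrite leNgt => ab; rewrite leNgt; apply/negP => ba.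
by move: ab; rewrite powR_lt.
Qed.

Lemma theta_le r a b a' b' : 0 < r -> 0 <= a -> 0 <= b -> a <= a' -> b <= b' ->
  theta r a b <= theta r a' b'.
Proof.
move=> r0 a0 b0 aa bb; apply: powR_le; first by rewrite invr_ge0 ltW.
  by rewrite addr_ge0 ?powR_ge0.
by apply: lerD; apply: powR_le => //; exact: ltW.
Qed.

Lemma le_theta r a b : 0 < r -> 0 <= a -> a <= theta r a b.
Proof.
move=> r0 a0; rewrite -{1}(@powRK_inv r a) ?gt_eqF //; apply: powR_le.
- by rewrite invr_ge0 ltW.
- exact: powR_ge0.
- by rewrite lerDl powR_ge0.
Qed.

Lemma theta_leD r a b : 1 <= r -> 0 <= a -> 0 <= b -> theta r a b <= 2 * (a + b).
Proof.
move=> r1 a0 b0; have r0 : 0 < r by lra.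
apply: (@powR_le_inv r) => //; first by rewrite mulr_ge0 // addr_ge0.
rewrite powR_theta ?gt_eqF // powRM ?addr_ge0 //.
have ar : a `^ r <= (a + b) `^ r by apply: powR_le; lra.
have br : b `^ r <= (a + b) `^ r by apply: powR_le; lra.
have r2 : 2 <= 2 `^ r :> R.
  have := @mulr_powRB1 R 2 r; rewrite ler0n r0 => /(_ isT isT) <-.
  have : 2 `^ 0 <= 2 `^ (r - 1) :> R by rewrite ler_powR // ?subr_ge0 // ler1n.
  by rewrite powRr0; lra.
have : 0 <= (a + b) `^ r by exact: powR_ge0.
nra.
Qed.

Lemma theta_lin_le r s a b : 1 < r -> 0 <= s -> 0 <= a -> 0 <= b ->
  s * a + b <= (s `^ (r / (r - 1)) + 1) `^ ((r - 1) / r) * theta r a b.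
Proof.
move=> r1 s0 a0 b0; have e0 : 0 < r - 1 by lra.
have r0 : 0 < r by lra.
have := @hoelder2 R s 1 a b (r / (r - 1)) r s0 ler01 a0 b0.
rewrite divr_gt0 // r0 => /(_ isT isT).
rewrite powR1 mul1r invf_div; apply.
by field; rewrite gt_eqF.
Qed.

(* [theta r a b] is the supremum of the linear functions of [(a, b)] in
   [theta_lin_le], already for rational [s]. *)
Lemma theta_sup r a b w : 1 < r -> 0 <= a -> 0 <= b -> a <= w ->
  (forall t : rat, 0 <= t -> ratr t * a + b <=
     (ratr t `^ (r / (r - 1)) + 1) `^ ((r - 1) / r) * w) ->
  theta r a b <= w.
Proof.
move=> r1 a0 b0 aw H; have e0 : 0 < r - 1 by lra.
have r0 : 0 < r by lra.
have w0 : 0 <= w by exact: le_trans aw.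
have rr0 : 0 < r / (r - 1) by rewrite divr_gt0.
have [b1|b1] := leP b 0.
  have -> : b = 0 by apply/le_anti; rewrite b1.
  by rewrite /theta powR0 ?gt_eqF // addr0 powRK_inv // gt_eqF.
have Hs s : 0 < s -> s * a + b <= (s `^ (r / (r - 1)) + 1) `^ ((r - 1) / r) * w.
  move=> s0; set k := (_ + 1) `^ _.
  have k0 : 0 < k by apply: powR_gt0; rewrite ltr_wpDl // powR_ge0.
  apply/ler_addgt0Pr => eps eps0.
  (* A rational [t] between [s] and [s * (1 + del)] increases the constant at most by the factor
     [1 + del]. *)
  pose del := eps / (k * w + 1).
  have kw : 0 < k * w + 1 by rewrite ltr_wpDl // mulr_ge0 // ltW.
  have del0 : 0 < del by rewrite divr_gt0.
  have : s < s * (1 + del) by rewrite ltr_pMr //; lra.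
  move=> /rat_in_itvoo[t]; rewrite in_itv /= => /andP[st ts].
  have t0 : 0 < ratr t :> R by exact: lt_trans st.
  have := H t; rewrite -(ler0q R) (ltW t0) => /(_ isT) Ht.
  apply: (@le_trans _ _ (ratr t * a + b)); first by rewrite lerD2r ler_wpM2r // ltW.
  apply: (le_trans Ht); apply: (@le_trans _ _ ((1 + del) * k * w)).
    rewrite ler_wpM2r //.
    have d1 : 0 <= 1 + del by lra.
    have E : (1 + del) = ((1 + del) `^ (r / (r - 1))) `^ ((r - 1) / r).
      by rewrite -[(r - 1) / r]invf_div powRK_inv // gt_eqF.
    rewrite {1}E /k -powRM ?powR_ge0 ?addr_ge0 ?powR_ge0 //.
    apply: powR_le; first by rewrite divr_ge0 // ltW.
      by rewrite addr_ge0 ?powR_ge0.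
    rewrite mulrDr mulr1 -powRM ?(ltW s0) //; apply: lerD.
      by apply: powR_le; [exact: ltW|exact: ltW|rewrite mulrC ltW].
    have := @powR_le R 1 (1 + del) (r / (r - 1)) (ltW rr0) ler01.
    by rewrite powR1; apply; lra.
  have -> : (1 + del) * k * w = k * w + del * (k * w) by ring.
  rewrite lerD2l.
  have : del * (k * w + 1) = eps by rewrite /del divfK // gt_eqF.
  by rewrite mulrDr mulr1; lra.
have [a1|a1] := leP a 0.
  have -> : a = 0 by apply/le_anti; rewrite a1.
  rewrite /theta powR0 ?gt_eqF // add0r powRK_inv ?gt_eqF //.
  have := H 0 (lexx 0); rewrite rmorph0 mul0r add0r powR0 ?gt_eqF // add0r powR1 mul1r.
  exact.
(* The equality case of Hölder's inequality. *)
have := Hs ((a / b) `^ (r - 1)) (powR_gt0 _ (divr_gt0 a1 b1)).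
have ab0 : 0 < a / b by rewrite divr_gt0.
rewrite -powRrM [(r - 1) * _]mulrC divfK ?gt_eqF //.
have -> : (a / b) `^ (r - 1) * a + b = b * ((a / b) `^ r + 1).
  rewrite -(mulr_powRB1 (p := r) (ltW ab0)) // mulrDr mulr1; congr (_ + _).
  rewrite mulrA [b * _]mulrC divfK ?gt_eqF // mulrC; congr (_ * _).
set X := (a / b) `^ r + 1.
have X0 : 0 < X by rewrite ltr_wpDl // powR_ge0.
have -> : theta r a b = b * X `^ r^-1.
  rewrite /theta; have -> : a `^ r + b `^ r = b `^ r * X.
    rewrite /X mulrDr mulr1 -powRM ?(ltW ab0) // mulrC divfK // gt_eqF //.
  by rewrite powRM ?powR_ge0 ?(ltW X0) // powRK_inv ?gt_eqF.
have Xe : 0 < X `^ ((r - 1) / r) by exact: powR_gt0.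
move=> HX; rewrite -(ler_pM2l Xe); have -> : X `^ ((r - 1) / r) * (b * X `^ r^-1) = b * X.
  rewrite mulrCA -powRD_gt0 //; have -> : (r - 1) / r + r^-1 = 1 by field; rewrite gt_eqF.
  by rewrite powRr1 // ltW.
exact: HX.
Qed.

End theta.

Section positive_operators.
Context d (X : measurableType d) (R : realType).
Variables (mu : {measure set X -> \bar R}) (p : R).
Hypothesis p1 : 1 < p.
Implicit Types (f g h : X -> R) (U W : (X -> R) -> X -> R).

Let p0 : 0 < p. Proof. exact: lt_trans ltr01 p1. Qed.

Definition Ip g : \bar R := \int[mu]_x (`|g x| `^ p)%:E.

Definition rLp g := measurable_fun [set: X] g /\ (Ip g < +oo)%E.

Lemma measurable_norm_powR r g : measurable_fun [set: X] g ->
  measurable_fun [set: X] (fun x => `|g x| `^ r).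
Proof.
move=> mg; apply: (measurableT_comp (measurable_powR r)).
exact: measurableT_comp.
Qed.

Lemma measurable_Ip g : measurable_fun [set: X] g ->
  measurable_fun [set: X] (fun x => (`|g x| `^ p)%:E).
Proof. by move=> mg; apply/measurable_EFinP; exact: measurable_norm_powR. Qed.

Lemma Ip_pt_ge0 g x : (0 <= (`|g x| `^ p)%:E)%E.
Proof. by rewrite lee_fin powR_ge0. Qed.

Lemma Ip_ge0 g : (0 <= Ip g)%E.
Proof. by apply: integral_ge0 => x _; rewrite lee_fin powR_ge0. Qed.

Lemma Ip_le f g : measurable_fun [set: X] f -> measurable_fun [set: X] g ->
  {ae mu, forall x, `|f x| <= `|g x|} -> (Ip f <= Ip g)%E.
Proof.
move=> mf mg fg; apply: ae_ge0_le_integral => //.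
- exact: measurable_Ip.
- exact: measurable_Ip.
- by apply: filterS fg => x fgx _; rewrite lee_fin powR_le // ltW.
Qed.

Lemma Ip_ae_eq f g : measurable_fun [set: X] f -> measurable_fun [set: X] g ->
  {ae mu, forall x, f x = g x} -> Ip f = Ip g.
Proof.
move=> mf mg fg; apply/le_anti/andP; split; apply: Ip_le => //;
  by apply: filterS fg => x ->.
Qed.

Lemma rLp_dom f g : measurable_fun [set: X] f -> rLp g ->
  {ae mu, forall x, `|f x| <= `|g x|} -> rLp f.
Proof.
move=> mf [mg gfin] fg; split; first exact: mf.
apply: le_lt_trans gfin.
exact: Ip_le.
Qed.

Lemma IpZ a f : measurable_fun [set: X] f ->
  Ip (fun x => a * f x) = ((`|a| `^ p)%:E * Ip f)%E.
Proof.
move=> mf; rewrite /Ip -ge0_integralZl_EFin;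
  [|exact: measurableT|by move=> x _; exact: Ip_pt_ge0|exact: measurable_Ip|exact: powR_ge0].
by apply: eq_integral => x _; rewrite normrM powRM.
Qed.

Lemma IpD_le f g : measurable_fun [set: X] f -> measurable_fun [set: X] g ->
  (Ip (fun x => (f x + g x)%R) <= (2 `^ p)%:E * (Ip f + Ip g))%E.
Proof.
move=> mf mg; rewrite /Ip -ge0_integralD;
  [|exact: measurableT|by move=> x _; exact: Ip_pt_ge0|exact: measurable_Ip
   |by move=> x _; exact: Ip_pt_ge0|exact: measurable_Ip].
rewrite -ge0_integralZl_EFin; [|exact: measurableT
  |by move=> x _; rewrite adde_ge0 ?Ip_pt_ge0
  |by apply: emeasurable_funD; exact: measurable_Ip|exact: powR_ge0].
apply: ge0_le_integral; [exact: measurableT|by move=> x _; rewrite lee_fin powR_ge0| | |].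
- by apply: measurable_Ip; exact: measurable_funD.
- by apply: emeasurable_funM; [exact: measurable_cst|apply: emeasurable_funD; exact: measurable_Ip].
move=> x _; rewrite -EFinD -EFinM lee_fin.
apply: le_trans (powRD_le (ltW p0) (normr_ge0 _) (normr_ge0 _)).
by apply: powR_le; [exact: ltW|by []|exact: ler_normD].
Qed.

Lemma rLpZ a f : rLp f -> rLp (fun x => a * f x).
Proof.
move=> [mf fin]; split; first exact: measurable_funM.
rewrite IpZ; last exact: mf.
by apply: lte_mul_pinfty; [rewrite lee_fin powR_ge0| |exact: fin].
Qed.

Lemma rLpD f g : rLp f -> rLp g -> rLp (fun x => f x + g x).
Proof.
move=> [mf ffin] [mg gfin]; split; first exact: measurable_funD.
apply: le_lt_trans (IpD_le mf mg) _.
apply: lte_mul_pinfty; [by rewrite lee_fin powR_ge0|by rewrite fin_numE|exact (lte_add_pinfty ffin gfin)].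
Qed.

Lemma rLp0 : rLp (fun=> 0).
Proof.
split => //; rewrite /Ip (eq_integral (fun=> 0%E)) ?integral0 ?ltry // => x _.
by rewrite normr0 powR0 // gt_eqF.
Qed.

Lemma rLpB f g : rLp f -> rLp g -> rLp (fun x => f x - g x).
Proof.
move=> Lf Lg; have := rLpD Lf (rLpZ (-1) Lg); congr rLp.
by apply/funext => x; rewrite mulN1r.
Qed.

Lemma rLp_norm f : rLp f -> rLp (fun x => `|f x|).
Proof.
move=> /[dup] Lf [mf _]; apply: (rLp_dom _ Lf); first exact: measurableT_comp.
by apply: aeW => x; rewrite normr_id.
Qed.

Lemma rLp_sum n (a : nat -> R) (f : nat -> X -> R) : (forall i, (i < n)%N -> rLp (f i)) ->
  rLp (fun x => \sum_(0 <= i < n) a i * f i x).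
Proof.
elim: n => [|n IH] Lf.
  by have := rLp0; congr rLp; apply/funext => x; rewrite big_geq.
have -> : (fun x => \sum_(0 <= i < n.+1) a i * f i x) =
    (fun x => \sum_(0 <= i < n) a i * f i x + a n * f n x).
  by apply/funext => x; rewrite big_nat_recr.
by apply: rLpD; [apply: IH => i ?; apply: Lf; exact: ltnW|apply: rLpZ; exact: Lf].
Qed.

Lemma measurable_theta r f g : measurable_fun [set: X] f -> measurable_fun [set: X] g ->
  measurable_fun [set: X] (fun x => theta r (f x) (g x)).
Proof.
move=> mf mg; apply: (measurableT_comp (measurable_powR r^-1)).
by apply: measurable_funD; apply: (measurableT_comp (measurable_powR r)).
Qed.

Lemma rLp_theta r f g : 1 <= r -> (forall x, 0 <= f x) -> (forall x, 0 <= g x) ->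
  rLp f -> rLp g -> rLp (fun x => theta r (f x) (g x)).
Proof.
move=> r1 f0 g0 Lf Lg; apply: (rLp_dom _ (rLpZ 2 (rLpD Lf Lg))).
  by apply: measurable_theta; [case: Lf|case: Lg].
apply: aeW => x; rewrite ger0_norm ?theta_ge0 // ger0_norm ?theta_leD //.
by rewrite mulr_ge0 // addr_ge0.
Qed.

Lemma Ip_theta f g : measurable_fun [set: X] f -> measurable_fun [set: X] g ->
  (forall x, 0 <= f x) -> (forall x, 0 <= g x) ->
  Ip (fun x => theta p (f x) (g x)) = (Ip f + Ip g)%E.
Proof.
move=> mf mg f0 g0; rewrite /Ip -ge0_integralD;
  [|exact: measurableT|by move=> x _; exact: Ip_pt_ge0|exact: measurable_Ip
   |by move=> x _; exact: Ip_pt_ge0|exact: measurable_Ip].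
apply: eq_integral => x _; rewrite -EFinD; congr _%:E.
by rewrite !ger0_norm ?theta_ge0 // powR_theta // gt_eqF.
Qed.

Record posop U : Prop := Posop {
  op_Lp : forall g, rLp g -> rLp (U g);
  op_ext : forall g h, rLp g -> rLp h -> {ae mu, forall x, g x = h x} ->
    {ae mu, forall x, U g x = U h x};
  op_lin : forall a g h, rLp g -> rLp h ->
    {ae mu, forall x, U (fun y => a * g y + h y) x = a * U g x + U h x};
  op_pos : forall g, rLp g -> {ae mu, forall x, 0 <= g x} -> {ae mu, forall x, 0 <= U g x};
  op_bnd : exists2 M : R, 0 <= M & forall g, rLp g -> (Ip (U g) <= M%:E * Ip g)%E }.

Lemma posop_id : posop id.
Proof.
split => //; first by move=> a g h _ _; exact: aeW.
by exists 1 => // g _; rewrite mul1e.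
Qed.

Lemma posop_comp U W : posop U -> posop W -> posop (U \o W).
Proof.
move=> PU PW; split => /=.
- by move=> g Lg; exact (op_Lp PU (op_Lp PW Lg)).
- move=> g h Lg Lh gh.
  exact (op_ext PU (op_Lp PW Lg) (op_Lp PW Lh) (op_ext PW Lg Lh gh)).
- move=> a g h Lg Lh; have La := rLpD (rLpZ a Lg) Lh.
  have LWa := rLpD (rLpZ a (op_Lp PW Lg)) (op_Lp PW Lh).
  apply: filterS2 (op_lin PU a (op_Lp PW Lg) (op_Lp PW Lh))
    (op_ext PU (op_Lp PW La) LWa (op_lin PW a Lg Lh)) => x.
  by move=> E1 E2; rewrite E2 E1.
- by move=> g Lg g0; exact (op_pos PU (op_Lp PW Lg) (op_pos PW Lg g0)).
- have [M M0 HM] := op_bnd PU; have [N N0 HN] := op_bnd PW.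
  exists (M * N) => [|g Lg]; first by rewrite mulr_ge0.
  apply: le_trans (HM _ (op_Lp PW Lg)) _; rewrite EFinM -muleA lee_wpmul2l ?lee_fin //.
  exact: HN.
Qed.

Lemma posop_iter n U : posop U -> posop (iter n U).
Proof.
move=> PU; elim: n => [|n IH]; first exact: posop_id.
exact: (posop_comp PU IH).
Qed.

Section one_operator.
Variable U : (X -> R) -> X -> R.
Hypothesis PU : posop U.

Lemma posop0 : {ae mu, forall x, U (fun=> 0) x = 0}.
Proof.
have := op_lin PU (-1) rLp0 rLp0; apply: filterS => x.
have -> : (fun y : X => -1 * 0 + 0) = (fun=> 0 : R) by apply/funext => y; rewrite mulr0 addr0.
by rewrite mulN1r addNr.
Qed.

Lemma posopZ a g : rLp g -> {ae mu, forall x, U (fun y => a * g y) x = a * U g x}.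
Proof.
move=> Lg; apply: filterS2 (op_lin PU a Lg rLp0) posop0 => x.
have -> : (fun y => a * g y + 0) = (fun y => a * g y) by apply/funext => y; rewrite addr0.
by move=> -> ->; rewrite addr0.
Qed.

Lemma posopD g h : rLp g -> rLp h ->
  {ae mu, forall x, U (fun y => g y + h y) x = U g x + U h x}.
Proof.
move=> Lg Lh; apply: filterS (op_lin PU 1 Lg Lh) => x.
have -> : (fun y => 1 * g y + h y) = (fun y => g y + h y) by apply/funext => y; rewrite mul1r.
by rewrite mul1r.
Qed.

Lemma posopB g h : rLp g -> rLp h ->
  {ae mu, forall x, U (fun y => g y - h y) x = U g x - U h x}.
Proof.
move=> Lg Lh; apply: filterS (op_lin PU (-1) Lh Lg) => x.
have -> : (fun y => -1 * h y + g y) = (fun y => g y - h y).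
  by apply/funext => y; rewrite mulN1r addrC.
by move=> ->; rewrite mulN1r addrC.
Qed.

Lemma posop_sum n (a : nat -> R) (f : nat -> X -> R) : (forall i, (i < n)%N -> rLp (f i)) ->
  {ae mu, forall x, U (fun y => \sum_(0 <= i < n) a i * f i y) x =
     \sum_(0 <= i < n) a i * U (f i) x}.
Proof.
elim: n => [|n IH] Lf.
  apply: filterS posop0 => x.
  have -> : (fun y => \sum_(0 <= i < 0) a i * f i y) = (fun=> 0).
    by apply/funext => y; rewrite big_geq.
  by rewrite big_geq.
have Lf' i : (i < n)%N -> rLp (f i) by move=> ?; apply: Lf; exact: ltnW.
have Ln : rLp (f n) by exact: Lf.
apply: filterS3 (posopD (rLp_sum a Lf') (rLpZ (a n) Ln)) (IH Lf') (posopZ (a n) Ln) => x.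
have -> : (fun y => \sum_(0 <= i < n) a i * f i y + a n * f n y) =
    (fun y => \sum_(0 <= i < n.+1) a i * f i y).
  by apply/funext => y; rewrite big_nat_recr.
by move=> -> -> ->; rewrite big_nat_recr.
Qed.

Lemma posop_le g h : rLp g -> rLp h -> {ae mu, forall x, g x <= h x} ->
  {ae mu, forall x, U g x <= U h x}.
Proof.
move=> Lg Lh gh; have gh0 : {ae mu, forall x, 0 <= h x - g x}.
  by apply: filterS gh => x; rewrite subr_ge0.
apply: filterS2 (op_pos PU (rLpB Lh Lg) gh0) (posopB Lh Lg) => x.
by move=> + E; rewrite E subr_ge0.
Qed.

Lemma posop_norm_le g : rLp g -> {ae mu, forall x, `|U g x| <= U (fun y => `|g y|) x}.
Proof.
move=> Lg; have Ln := rLp_norm Lg; have Lm := rLpZ (-1) Lg.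
have H1 : {ae mu, forall x, U g x <= U (fun y => `|g y|) x}.
  by apply: (posop_le Lg Ln); apply: aeW => x; exact: ler_norm.
have H2 : {ae mu, forall x, U (fun y => -1 * g y) x <= U (fun y => `|g y|) x}.
  by apply: (posop_le Lm Ln); apply: aeW => x; rewrite mulN1r -normrN; exact: ler_norm.
apply: filterS3 H1 H2 (posopZ (-1) Lg) => x h1 h2 e.
by rewrite ler_norml h1 andbT; move: h2; rewrite e mulN1r lerNl.
Qed.

Lemma posop_theta r f g : 1 < r -> (forall x, 0 <= f x) -> (forall x, 0 <= g x) ->
  rLp f -> rLp g ->
  {ae mu, forall x, theta r (U f x) (U g x) <= U (fun y => theta r (f y) (g y)) x}.
Proof.
move=> r1 f0 g0 Lf Lg; have r0 : 0 < r by lra.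
have Lt := rLp_theta (ltW r1) f0 g0 Lf Lg.
pose k (s : R) := (s `^ (r / (r - 1)) + 1) `^ ((r - 1) / r).
have Hs : {ae mu, forall x, forall n : nat, forall t : rat, unpickle n = Some t -> 0 <= t ->
    ratr t * U f x + U g x <= k (ratr t) * U (fun y => theta r (f y) (g y)) x}.
  apply: ae_foralln => n; case: (unpickle n) => [t|]; last by apply: aeW.
  have [t0|t0] := leP 0 t; last first.
    by apply: aeW => x t' [<-]; rewrite leNgt t0.
  have H : {ae mu, forall x, U (fun y => ratr t * f y + g y) x <=
      U (fun y => k (ratr t) * theta r (f y) (g y)) x}.
    apply: posop_le; [exact: rLpD (rLpZ _ Lf) Lg|exact: rLpZ|].
    by apply: aeW => x; apply: theta_lin_le => //; rewrite ler0q.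
  apply: filterS3 H (op_lin PU (ratr t) Lf Lg) (posopZ (k (ratr t)) Lt) => x.
  by move=> h e1 e2 t' [<-] _; rewrite -e1 -e2.
have Hf : {ae mu, forall x, U f x <= U (fun y => theta r (f y) (g y)) x}.
  by apply: (posop_le Lf Lt); apply: aeW => x; exact: le_theta.
have Uf0 := op_pos PU Lf (aeW _ f0); have Ug0 := op_pos PU Lg (aeW _ g0).
apply: filterS2 (filterI Uf0 Ug0) (filterI Hs Hf) => x [uf ug] [hs hf].
apply: theta_sup => // t t0; apply: (hs (pickle t)) => //.
exact: pickleK.
Qed.

End one_operator.

End positive_operators.

(** * Weights of an invertible positive operator *)

Section L1_functional.
Context d (X : measurableType d) (R : realType).
Implicit Types (phi psi v : X -> R) (mu : {measure set X -> \bar R}).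

Definition L1pos mu phi := [/\ measurable_fun [set: X] phi, forall x, 0 <= phi x &
  (\int[mu]_x (phi x)%:E < +oo)%E].

(** Indicators of a countable cover by sets of finite measure are summed with coefficients that make
    both the sum and its integral converge geometrically. *)
Lemma sigma_finite_weight (mu : {sigma_finite_measure set X -> \bar R}) :
  exists2 v, L1pos mu v & forall x, 0 < v x.
Proof.
have [F FT mF] := sigma_finiteT mu.
have Ffin i : mu (F i) \is a fin_num by rewrite ge0_fin_numE ?(mF i).2.
pose c i : R := (1 / 2 ^+ i.+1) / (1 + fine (mu (F i))).
have m1 i : 0 < 1 + fine (mu (F i)) by rewrite ltr_wpDr // fine_ge0.
have c0 i : 0 < c i by rewrite divr_gt0 // divr_gt0 // exprn_gt0.
pose t i x : \bar R := (c i * \1_(F i) x)%:E.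
have t0 i x : (0 <= t i x)%E by rewrite lee_fin mulr_ge0 // ltW.
have mt i : measurable_fun [set: X] (t i).
  by apply/measurable_EFinP; apply: measurable_funM => //; apply: measurable_indic; exact: (mF i).1.
pose s x : \bar R := (\sum_(0 <= i <oo) t i x)%E.
have half : (\sum_(0 <= i <oo) ((1 : R) / 2 ^+ i.+1)%:E <= 1%:E)%E.
  have := @epsilon_trick0 R 1 xpredT ler01.
  by under eq_eseriesr do rewrite natrX.
have ci1 i : c i <= 1 / 2 ^+ i.+1.
  rewrite /c ler_pdivrMr // ler_peMr ?divr_ge0 ?exprn_ge0 //.
  by rewrite lerDl fine_ge0.
have s1 x : (s x <= 1%:E)%E.
  apply: le_trans half; apply: lee_nneseries => [i _ _|i _]; first exact: t0.
  rewrite lee_fin; apply: le_trans (ci1 i); by rewrite ler_piMr ?(ltW (c0 i)).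
have s0 x : (0 <= s x)%E by apply: nneseries_ge0 => i _ _; exact: t0.
have sfin x : s x \is a fin_num by rewrite ge0_fin_numE // (le_lt_trans (s1 x)) // ltry.
have ms : measurable_fun [set: X] s.
  have := @ge0_emeasurable_sum _ X R setT t xpredT (fun i x _ _ => t0 i x) (fun i _ => mt i).
  by congr measurable_fun; apply/funext => x; apply: eq_eseriesl => i; rewrite inE.
exists (fun x => fine (s x)); first split.
- by apply: measurableT_comp ms; exact: fine_measurable.
- by move=> x; rewrite fine_ge0.
- under eq_integral do rewrite fineK //.
  rewrite /s integral_nneseries //.
  apply: le_lt_trans (ltry 1); apply: le_trans half.
  apply: lee_nneseries => [i _ _|i _]; first by apply: integral_ge0.
  rewrite /t (eq_integral (fun x => ((c i)%:E * (\1_(F i) x)%:E)%E)) => [|x _]; last by rewrite EFinM.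
  rewrite ge0_integralZl_EFin ?(ltW (c0 i)) //; last first.
    by apply/measurable_EFinP; apply: measurable_indic; exact: (mF i).1.
  rewrite integral_indic ?setIT //; last exact: (mF i).1.
  rewrite -[X in (_ * X <= _)%E](fineK (Ffin i)) -EFinM lee_fin /c -[leLHS]mulrA.
  rewrite ler_piMr ?divr_ge0 ?exprn_ge0 //.
  by rewrite mulrC ler_pdivrMr // mul1r lerDr.
move=> x; have [i _ Fix] : (\bigcup_i F i) x by rewrite -FT.
apply: fine_gt0; rewrite (le_lt_trans (s1 x)) ?ltry // andbT.
apply: (@lt_le_trans _ _ (t i x)).
  by rewrite /t lte_fin indicE mem_set // mulr1.
apply: le_trans (nneseries_lim_ge i.+1 _) => //.
by rewrite big_nat_recr //= leeDr // sume_ge0.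
Qed.

Lemma L1_cvg mu (phi : nat -> X -> R) psi :
  (forall k, measurable_fun [set: X] (phi k)) -> (forall k x, 0 <= phi k x) ->
  (forall x, {homo (fun k => phi k x) : n m / (n <= m)%N >-> n <= m}) ->
  (forall x, (fun k => (phi k x)%:E) @ \oo --> (psi x)%:E) ->
  (fun k => \int[mu]_x (phi k x)%:E)%E @ \oo --> (\int[mu]_x (psi x)%:E)%E.
Proof.
move=> mphi phi0 nd cv.
have -> : (\int[mu]_x (psi x)%:E)%E = (\int[mu]_x limn (fun k => (phi k x)%:E))%E.
  by apply: eq_integral => x _; apply/esym/cvg_lim => //; exact: cv.
apply: (@cvg_monotone_convergence _ _ _ mu setT measurableT (fun k x => (phi k x)%:E)).
- by move=> n; apply/measurable_EFinP.
- by move=> n x _; rewrite lee_fin.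
- by move=> x _ n m nm; rewrite lee_fin nd.
Qed.

Section density.
Variables (mu : {sigma_finite_measure set X -> \bar R}) (Lam : (X -> R) -> \bar R) (M : R).
Hypotheses (M0 : 0 <= M) (Lam_ge0 : forall phi, (0 <= Lam phi)%E).
Hypothesis LamD : forall phi psi, L1pos mu phi -> L1pos mu psi ->
  Lam (fun x => phi x + psi x) = (Lam phi + Lam psi)%E.
Hypothesis LamZ : forall a phi, 0 <= a -> L1pos mu phi ->
  Lam (fun x => a * phi x) = (a%:E * Lam phi)%E.
Hypothesis Lam_le : forall phi, L1pos mu phi -> (Lam phi <= M%:E * \int[mu]_x (phi x)%:E)%E.

Lemma L1pos_fin phi : L1pos mu phi -> (\int[mu]_x (phi x)%:E)%E \is a fin_num.
Proof.
move=> [mphi phi0 fin]; rewrite ge0_fin_numE //.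
by apply: integral_ge0 => x _; rewrite lee_fin.
Qed.

Lemma L1pos_le phi psi : measurable_fun [set: X] phi -> (forall x, 0 <= phi x <= psi x) ->
  L1pos mu psi -> L1pos mu phi.
Proof.
move=> mphi H [mpsi psi0 fin]; split => //; first by move=> x; case/andP: (H x).
apply: le_lt_trans fin; apply: ge0_le_integral => //.
- by move=> x _; rewrite lee_fin; case/andP: (H x).
- exact/measurable_EFinP.
- exact/measurable_EFinP.
- by move=> x _; rewrite lee_fin; case/andP: (H x).
Qed.

Lemma Lam_fin phi : L1pos mu phi -> Lam phi \is a fin_num.
Proof.
move=> Lphi; rewrite ge0_fin_numE //; apply: le_lt_trans (Lam_le Lphi) _.
by apply: lte_mul_pinfty; [rewrite lee_fin|rewrite fin_numE|case: Lphi].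
Qed.

Lemma L1pos_indic v (E : set X) : measurable E -> L1pos mu v ->
  L1pos mu (fun x => \1_E x * v x).
Proof.
move=> mE /[dup] Lv [mv v0 _]; apply: (L1pos_le _ _ Lv).
  by apply: measurable_funM => //; exact: measurable_indic.
move=> x; rewrite indicE; case: (_ \in _); first by rewrite mul1r v0 lexx.
by rewrite mul0r lexx v0.
Qed.

(** Additivity and boundedness control the defect: it is at most [M] times the integral of
    [psi - phi k], which tends to 0 by monotone convergence. *)
Lemma Lam_cvg (phi : nat -> X -> R) psi :
  (forall k, measurable_fun [set: X] (phi k)) -> (forall k x, 0 <= phi k x) ->
  (forall k x, phi k x <= psi x) ->
  (forall x, {homo (fun k => phi k x) : n m / (n <= m)%N >-> n <= m}) ->
  (forall x, (fun k => (phi k x)%:E) @ \oo --> (psi x)%:E) -> L1pos mu psi ->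
  (fun k => Lam (phi k)) @ \oo --> Lam psi.
Proof.
move=> mphi phi0 le nd cv Lpsi; have [mpsi psi0 _] := Lpsi.
have Lphi k : L1pos mu (phi k).
  by apply: (L1pos_le (mphi k) _ Lpsi) => x; rewrite phi0 le.
have Lr k : L1pos mu (fun x => psi x - phi k x).
  apply: (L1pos_le _ _ Lpsi) => [|x]; first exact: measurable_funB.
  by rewrite subr_ge0 le /= gerBl phi0.
pose I := (\int[mu]_x (psi x)%:E)%E; pose Ik k := (\int[mu]_x (phi k x)%:E)%E.
have IE k : I = (Ik k + \int[mu]_x (psi x - phi k x)%:E)%E.
  rewrite /I /Ik -ge0_integralD //.
  - by apply: eq_integral => x _; rewrite -EFinD addrC subrK.
  - by move=> x _; rewrite lee_fin.
  - exact/measurable_EFinP.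
  - by move=> x _; rewrite lee_fin; case: (Lr k).
  - by apply/measurable_EFinP; case: (Lr k).
have Ifin := L1pos_fin Lpsi; have Ikfin k := L1pos_fin (Lphi k).
have LE k : Lam psi = (Lam (phi k) + Lam (fun x => psi x - phi k x)%R)%E.
  rewrite -LamD //; congr Lam; apply/funext => x; by rewrite addrC subrK.
apply: (@squeeze_cvge _ _ _ _ (fun k => Lam psi - M%:E * (I - Ik k))%E _ (fun=> Lam psi)).
- near=> k; apply/andP; split; last by rewrite (LE k) leeDl.
  rewrite leeBlDr; last by rewrite fin_numM // fin_numB Ifin Ikfin.
  rewrite (LE k) leeD2lE ?Lam_fin //.
  apply: le_trans (Lam_le (Lr k)) _; rewrite lee_wpmul2l ?lee_fin //.
  by rewrite {1}(IE k) addeAC subee ?Ikfin // add0e.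
- have E0 : (Lam psi - M%:E * (I - I))%E = Lam psi by rewrite subee // mule0 sube0.
  rewrite -[X in _ --> X]E0.
  apply: cvgeB; [by rewrite fin_num_adde_defr // Lam_fin|exact: cvg_cst|].
  apply: cvgeZl => //; apply: cvgeB; [by rewrite fin_num_adde_defr|exact: cvg_cst|].
  exact: L1_cvg.
- exact: cvg_cst.
Unshelve. all: by end_near.
Qed.

Lemma Lam0 : Lam (fun=> 0) = 0%E.
Proof.
have L0 : L1pos mu (fun=> 0) by split => //; rewrite integral0 ltry.
have := LamZ (lexx 0) L0; rewrite mul0e => <-.
by congr Lam; apply/funext => x; rewrite mul0r.
Qed.

Lemma Lam_sum (I : eqType) (s : seq I) (a : I -> R) (phi : I -> X -> R) :
  (forall i, i \in s -> 0 <= a i) -> (forall i, L1pos mu (phi i)) ->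
  Lam (fun x => \sum_(i <- s) a i * phi i x) = (\sum_(i <- s) (a i)%:E * Lam (phi i))%E.
Proof.
move=> a0 Lphi.
suff [] : L1pos mu (fun x => \sum_(i <- s) a i * phi i x) /\
  Lam (fun x => \sum_(i <- s) a i * phi i x) = (\sum_(i <- s) (a i)%:E * Lam (phi i))%E by [].
elim: s a0 => [|i s IH] a0.
  rewrite big_nil; under eq_fun do rewrite big_nil.
  by rewrite Lam0; split => //; split => //; rewrite integral0 ltry.
have a0' j : j \in s -> 0 <= a j by move=> js; apply: a0; rewrite inE js orbT.
have ai : 0 <= a i by apply: a0; rewrite mem_head.
have [Ls Es] := IH a0'.
have [mi pi0 fi] := Lphi i.
have Li : L1pos mu (fun x => a i * phi i x).
  split; [exact: measurable_funM|by move=> x; rewrite mulr_ge0|].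
  rewrite (eq_integral (fun x => ((a i)%:E * (phi i x)%:E)%E)) => [|x _]; last by rewrite EFinM.
  rewrite ge0_integralZl_EFin //.
  - by apply: lte_mul_pinfty; [rewrite lee_fin|rewrite fin_numE|].
  - by move=> x _; rewrite lee_fin.
  - exact/measurable_EFinP.
rewrite big_cons -Es -LamZ // -LamD //; under eq_fun do rewrite big_cons.
split => //; have [ms s0 fs] := Ls; have [mi' i0' fi'] := Li; split.
- exact: measurable_funD.
- by move=> x; rewrite addr_ge0.
- rewrite (eq_integral (fun x => ((a i * phi i x)%:E + (\sum_(j <- s) a j * phi j x)%:E)%E)) => [|x _]; last by rewrite EFinD.
  rewrite ge0_integralD //.
  + exact: lte_add_pinfty.
  + by move=> x _; rewrite lee_fin.
  + exact/measurable_EFinP.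
  + by move=> x _; rewrite lee_fin.
  + exact/measurable_EFinP.
Qed.

Variable v : X -> R.
Hypotheses (Lv : L1pos mu v) (v0 : forall x, 0 < v x).

Let nu (E : set X) : \bar R := Lam (fun x => \1_E x * v x).

Let nu0 : nu set0 = 0%E.
Proof. by rewrite /nu -Lam0; congr Lam; apply/funext => x; rewrite indic0 mul0r. Qed.

Let nu_ge0 E : (0 <= nu E)%E. Proof. exact: Lam_ge0. Qed.

Let nu_sigma_additive : semi_sigma_additive nu.
Proof.
move=> F mF tF mUF.
have E n : (\sum_(0 <= i < n) nu (F i))%E = nu (\big[setU/set0]_(i < n) F i).
  elim: n => [|n IH]; first by rewrite big_geq // big_ord0 nu0.
  rewrite big_nat_recr //= IH big_ord_recr /= /nu -LamD; last 2 first.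
  - by apply: L1pos_indic => //; apply: bigsetU_measurable.
  - exact: L1pos_indic.
  congr Lam; apply/funext => x; rewrite -mulrDl; congr (_ * _).
  rewrite !indicE in_setU; case: (boolP (x \in F n)) => Fn; last by rewrite orbF addr0.
  rewrite memNset ?add0r // -bigcup_mkord => -[i /= ilt Fi].
  have /(_ _)/wrap[|E] := @tF i n Logic.I Logic.I; first by exists x; split => //; exact: set_mem.
  by move: ilt; rewrite E ltnn.
rewrite (_ : (fun n => _) = (fun n => nu (\big[setU/set0]_(i < n) F i))); last exact/funext.
have i01 (A : set X) x : 0 <= \1_A x * v x.
  by rewrite mulr_ge0 ?(ltW (v0 x)).
have iS (A B : set X) x : A `<=` B -> \1_A x * v x <= \1_B x * v x.
  by move=> AB; rewrite ler_pM2r // !indicE ler_nat; case: (boolP (x \in A)) => // /set_mem /AB /mem_set ->.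
apply: Lam_cvg.
- by move=> k; case: (@L1pos_indic v (\big[setU/set0]_(i < k) F i)) => //; exact: bigsetU_measurable.
- by move=> k x; exact: i01.
- by move=> k x; apply: iS; exact: bigsetU_bigcup.
- by move=> x n m nm; apply: iS; exact: subset_bigsetU.
- move=> x; case: (pselect ((\bigcup_n F n) x)) => [[i _ Fix]|nF].
    apply: cvg_near_cst; exists i.+1 => // n /= ni.
    rewrite !indicE !mem_set //; first by exists i.
    by rewrite -bigcup_mkord; exists i.
  apply: cvg_near_cst; exists 0%N => // n _ /=.
  by rewrite !indicE !memNset //; apply: contra_not nF; exact: bigsetU_bigcup.
- exact: L1pos_indic.
Qed.

HB.instance Definition _ := isMeasure.Build d X R nu nu0 nu_ge0 nu_sigma_additive.

Let nu_fin : fin_num_fun nu.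
Proof. by move=> E mE; apply: Lam_fin; exact: L1pos_indic. Qed.

HB.instance Definition _ := @Measure_isFinite.Build d X R nu nu_fin.

Let nu_ac : nu `<< mu.
Proof.
move=> N mN A mA AN; have muA : mu A = 0%E by exact: mN.
apply/le_anti; rewrite nu_ge0 andbT; apply: le_trans (Lam_le (L1pos_indic mA Lv)) _.
rewrite (_ : (\int[mu]_x (\1_A x * v x)%:E)%E = 0%E) ?mule0 //.
have [mv _ _] := Lv.
rewrite (@ge0_ae_eq_integral _ _ _ mu setT _ (fun=> 0%E)) ?integral0 //.
- by apply/measurable_EFinP; apply: measurable_funM => //; exact: measurable_indic.
- by move=> x _; rewrite lee_fin mulr_ge0 // ltW.
- exists A; split => // x /= nAx; apply: contrapT => Ax; apply: nAx => _.
  by rewrite indicE memNset // mul0r.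
Qed.

Import HBNNSimple.

Let Lam_nnsfun (s : {nnsfun X >-> R}) :
  Lam (fun x => s x * v x) = (\int[nu]_x (s x)%:E)%E.
Proof.
rewrite integralT_nnsfun sintegralE fsbig_finite; last exact: fimfunP.
have -> : (fun x => s x * v x) = (fun x => \sum_(y <- finmap.enum_fset (fset_set (range s)))
    y * (\1_(s @^-1` [set y]) x * v x)).
  apply/funext => x; rewrite [in LHS]fimfunE fsbig_finite; last exact: fimfunP.
  by rewrite mulr_suml; apply: eq_bigr => y _; rewrite mulrA.
rewrite Lam_sum // => [y|y]; last exact: L1pos_indic.
by rewrite in_fset_set; [move=> /set_mem[x _ <-]|exact: fimfunP].
Qed.

(** Indicators need not be integrable, so the measure is built on indicators times the positive
    integrable [v]. It is finite and absolutely continuous; its Radon-Nikodym density divided by [v]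
    is [rho], and simple functions extend the formula. *)
Lemma L1_density : exists2 rho : X -> R, measurable_fun [set: X] rho /\ (forall x, 0 <= rho x) &
  forall phi, L1pos mu phi -> Lam phi = (\int[mu]_x (phi x * rho x)%:E)%E.
Proof.
pose f := Radon_Nikodym_SigmaFinite.f nu mu.
have f0 x : (0 <= f x)%E := Radon_Nikodym_SigmaFinite.f_ge0 nu_ac x.
have ffin x : f x \is a fin_num := Radon_Nikodym_SigmaFinite.f_fin_num nu_ac x.
have mf : measurable_fun [set: X] f.
  exact: measurable_int (Radon_Nikodym_SigmaFinite.f_integrable nu_ac).
have [mv _ _] := Lv.
have mvi : measurable_fun [set: X] (fun x => (v x)^-1).
  have -> : (fun x => (v x)^-1) = (fun x => v x `^ (-1)).
    by apply/funext => x; rewrite powR_inv1 // ltW.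
  exact: (measurableT_comp (measurable_powR (-1))).
exists (fun x => fine (f x) / v x); first split.
- apply: measurable_funM => //.
  by apply: measurableT_comp mf; exact: fine_measurable.
- by move=> x; rewrite divr_ge0 ?fine_ge0 // ltW.
move=> phi /[dup] Lphi [mphi phi0 _]; pose psi x : \bar R := (phi x / v x)%:E.
have psi0 x : (0 <= psi x)%E by rewrite lee_fin divr_ge0 // ltW.
have mpsi : measurable_fun [set: X] psi.
  by apply/measurable_EFinP; exact: measurable_funM.
have -> : (\int[mu]_x (phi x * (fine (f x) / v x))%:E)%E = (\int[nu]_x psi x)%E.
  rewrite -(Radon_Nikodym_SigmaFinite.change_of_variables nu_ac) //.
  apply: eq_integral => x _; rewrite /psi -[X in _ = (_ * X)%E](fineK (ffin x)) -EFinM.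
  by congr _%:E; rewrite mulrA mulrAC.
pose s k := nnsfun_approx measurableT mpsi k.
have cvs x : (fun k => (s k x)%:E) @ \oo --> psi x.
  by apply: cvg_nnsfun_approx => // y _; exact: psi0.
have nds x : {homo (fun k => s k x) : n m / (n <= m)%N >-> n <= m}.
  by move=> n m nm; exact/lefP/nd_nnsfun_approx.
have cv1 : (fun k => \int[nu]_x (s k x)%:E)%E @ \oo --> (\int[nu]_x psi x)%E.
  exact: L1_cvg.
have cv2 : (fun k => Lam (fun x => s k x * v x)) @ \oo --> Lam phi.
  have sle k x : s k x * v x <= phi x.
    rewrite -ler_pdivlMr // -lee_fin -/(psi x).
    have nd' : {homo (fun k => (s k x)%:E) : n m / (n <= m)%N >-> (n <= m)%E}.
      by move=> n m nm; rewrite lee_fin nds.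
    have -> : psi x = ereal_sup (range (fun k => (s k x)%:E)).
      exact: cvg_unique (cvs x) (ereal_nondecreasing_cvgn nd').
    by apply: ereal_sup_ubound; exists k.
  apply: Lam_cvg => //.
  - by move=> k; apply: measurable_funM => //; exact: measurable_funP.
  - by move=> k x; rewrite mulr_ge0 // ltW.
  - by move=> x n m nm; rewrite ler_pM2r // nds.
  - move=> x; have -> : (phi x)%:E = (psi x * (v x)%:E)%E by rewrite -EFinM divfK // gt_eqF.
    have -> : (fun k => (s k x * v x)%:E) = (fun k => (s k x)%:E * (v x)%:E)%E.
      by apply/funext => k; rewrite EFinM.
    by apply: cvgeZr => //; exact: cvs.
move: cv2; rewrite (_ : (fun k => _) = (fun k => \int[nu]_x (s k x)%:E)%E); last first.
  by apply/funext => k; exact: Lam_nnsfun.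
by move=> cv2; exact: cvg_unique cv2 cv1.
Qed.

End density.

End L1_functional.

(** * Variations of sequences of functions under a positive operator *)

Section variation_of_functions.
Context d (X : measurableType d) (R : realType).
Variables (mu : {measure set X -> \bar R}) (p : R).
Hypothesis p1 : 1 < p.
Implicit Types (f g h : X -> R) (U W : (X -> R) -> X -> R) (q : R) (c : nat -> X -> R).

Lemma Ip_norm f : Ip mu p (fun x => `|f x|) = Ip mu p f.
Proof. by rewrite /Ip; under eq_integral do rewrite normr_id. Qed.

(** The root of a path sum is an iterated [theta], so that properties of positive operators carry
    over by induction on the path. *)
Lemma vsum_root q (a : nat -> R) y z l : 0 < q ->
  vsum q a y (z :: l) `^ q^-1 = theta q `|a y - a z| (vsum q a z l `^ q^-1).
Proof.
move=> q0; rewrite /theta /= -powRrM mulVf ?gt_eqF // powRr1 //.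
exact: vsum_ge0.
Qed.

Lemma rLp_vsum q c y l : 1 < q -> (forall i, rLp mu p (c i)) ->
  rLp mu p (fun x => vsum q (c^~ x) y l `^ q^-1).
Proof.
move=> q1 Lc; have q0 : 0 < q by lra.
elim: l y => [|z l IH] y /=.
  have -> : (fun x : X => 0 `^ q^-1) = (fun=> 0 : R).
    by apply/funext => x; rewrite powR0 // invr_eq0 gt_eqF.
  exact: rLp0.
have -> : (fun x => (`|c y x - c z x| `^ q + vsum q (c^~ x) z l) `^ q^-1) =
    (fun x => theta q `|c y x - c z x| (vsum q (c^~ x) z l `^ q^-1)).
  by apply/funext => x; rewrite -(@vsum_root q (c^~ x)).
apply: (rLp_theta p1 (ltW q1)) => //; first by move=> x; exact: powR_ge0.
exact: (rLp_norm p1 (rLpB p1 (Lc y) (Lc z))).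
Qed.

Lemma posop_vsum U q c y l : posop mu p U -> 1 < q -> (forall i, rLp mu p (c i)) ->
  {ae mu, forall x, vsum q (fun i => U (c i) x) y l `^ q^-1 <=
     U (fun x => vsum q (c^~ x) y l `^ q^-1) x}.
Proof.
move=> PU q1 Lc; have q0 : 0 < q by lra.
elim: l y => [|z l IH] y /=.
  have -> : (fun x : X => 0 `^ q^-1) = (fun=> 0 : R).
    by apply/funext => x; rewrite powR0 // invr_eq0 gt_eqF.
  by apply: filterS (posop0 p1 PU) => x ->; rewrite powR0 // invr_eq0 gt_eqF.
have -> : (fun x => (`|c y x - c z x| `^ q + vsum q (c^~ x) z l) `^ q^-1) =
    (fun x => theta q `|c y x - c z x| (vsum q (c^~ x) z l `^ q^-1)).
  by apply/funext => x; rewrite -(@vsum_root q (c^~ x)).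
have Ld := rLpB p1 (Lc y) (Lc z).
have d0 x : 0 <= `|c y x - c z x| by [].
have v0 x : 0 <= vsum q (c^~ x) z l `^ q^-1 by exact: powR_ge0.
have H := posop_theta p1 PU q1 d0 v0 (rLp_norm p1 Ld) (rLp_vsum z l q1 Lc).
have H3 := posop_norm_le p1 PU Ld; have H4 := posopB PU (Lc y) (Lc z).
apply: filterS2 (filterI H (IH z)) (filterI H3 H4).
move=> x [h1 h2] [h3 h4]; apply: le_trans h1.
have -> := @vsum_root q (fun i => U (c i) x) y z l q0.
by apply: theta_le => //; [exact: powR_ge0|rewrite -h4].
Qed.

Definition vvar q c L x : R := vq q (c^~ x) L `^ q^-1.

Lemma vvar_le q (a : nat -> R) L : 1 < q ->
  vq q a L `^ q^-1 <= \sum_(0 <= i < L) `|a i - a i.+1|.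
Proof.
move=> q1; have q0 : 0 < q by lra.
apply: (@powR_le_inv _ q) => //; first exact: sum_ge0_nat.
rewrite -powRrM mulVf ?gt_eqF // powRr1 ?vq_ge0 //.
apply: (@vq_control _ q q a (fun i => `|a i - a i.+1|)) => //; first exact: ltW.
move=> x y /andP[xy _]; apply: powR_le => //; first exact: ltW.
elim: y xy => // y IH; rewrite ltnS leq_eqVlt => /orP[/eqP<-|xy].
  by rewrite big_nat1.
rewrite big_nat_recr ?(ltnW xy) //=.
have := ler_normD (a x - a y) (a y - a y.+1); rewrite subrKA => /le_trans; apply.
by rewrite lerD2r; exact: IH.
Qed.

Lemma measurable_vq q c L : (forall i, measurable_fun [set: X] (c i)) ->
  measurable_fun [set: X] (fun x => vq q (c^~ x) L).
Proof.
move=> mc; have mvsum y l : measurable_fun [set: X] (fun x => vsum q (c^~ x) y l).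
  elim: l y => [|z l IH] y //=; apply: measurable_funD => //.
  by apply: measurable_norm_powR; exact: measurable_funB.
rewrite /vq; elim: (index_enum _) => [|m s IH].
  rewrite (_ : (fun x => _) = (fun=> 0 : R)); first exact: measurable_cst.
  by apply/funext => x; rewrite big_nil.
rewrite (_ : (fun x => _) = (fun x => Num.max (vlist q (c^~ x) (mask m (iota 0 L.+1)))
   (\big[Num.max/0]_(j <- s) vlist q (c^~ x) (mask j (iota 0 L.+1))))); last first.
  by apply/funext => x; rewrite big_cons.
apply: measurable_maxr => //; rewrite /vlist.
by case: (mask _ _) => // y l; exact: mvsum.
Qed.

Lemma rLp_vvar q c L : 1 < q -> (forall i, rLp mu p (c i)) -> rLp mu p (vvar q c L).
Proof.
move=> q1 Lc.
have Ls : rLp mu p (fun x => \sum_(0 <= i < L) 1 * `|c i x - c i.+1 x|).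
  by apply: (rLp_sum p1 (fun=> 1)) => i _; exact: (rLp_norm p1 (rLpB p1 (Lc i) (Lc i.+1))).
apply: (rLp_dom p1 _ Ls).
  apply: (measurableT_comp (measurable_powR q^-1)).
  by apply: measurable_vq => i; case: (Lc i).
apply: aeW => x; rewrite !ger0_norm ?powR_ge0 //; last first.
  by apply: sum_ge0_nat => i; rewrite mul1r.
apply: le_trans (vvar_le _ _ q1) _.
by rewrite le_eqVlt; apply/orP; left; apply/eqP; apply: eq_bigr => i _; rewrite mul1r.
Qed.

(** Paths are enumerated by [pickle] in order to unite countably many null sets; each path sum is
    below the variation, and [U] is monotone. *)
Lemma posop_vvar U q c L : posop mu p U -> 1 < q -> (forall i, rLp mu p (c i)) ->
  {ae mu, forall x, vvar q (fun i => U (c i)) L x <= U (vvar q c L) x}.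
Proof.
move=> PU q1 Lc; have q0 : 0 < q by lra.
have Lv := rLp_vvar L q1 Lc.
have H : {ae mu, forall x, forall n : nat, forall yl : nat * seq nat, unpickle n = Some yl ->
    path ltn yl.1 yl.2 -> (last yl.1 yl.2 <= L)%N ->
    vsum q (fun i => U (c i) x) yl.1 yl.2 `^ q^-1 <= U (vvar q c L) x}.
  apply: ae_foralln => n; case: (unpickle n) => [[y l]|]; last exact: aeW.
  have [pl|npl] := boolP (path ltn y l); last first.
    by apply: aeW => x yl [<-] /=; rewrite (negbTE npl).
  have [lL|Ll] := leqP (last y l) L; last first.
    by apply: aeW => x yl [<-] _ /=; rewrite leqNgt Ll.
  have H : {ae mu, forall x, U (fun x => vsum q (c^~ x) y l `^ q^-1) x <= U (vvar q c L) x}.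
    apply: (posop_le p1 PU (rLp_vsum y l q1 Lc) Lv); apply: aeW => x.
    apply: powR_le; first by rewrite invr_ge0 ltW.
      exact: vsum_ge0.
    exact: le_vq.
  apply: filterS2 H (posop_vsum y l PU q1 Lc) => x h1 h2 yl [<-] _ _ /=.
  exact: le_trans h1.
have U0 : {ae mu, forall x, 0 <= U (vvar q c L) x}.
  by apply: (op_pos PU Lv); apply: aeW => x; exact: powR_ge0.
apply: filterS2 H U0 => x h u0.
apply: (@powR_le_inv _ q) => //.
rewrite /vvar -powRrM mulVf ?gt_eqF // powRr1 ?vq_ge0 //.
apply: vq_le => [|y l pl lL]; first exact: powR_ge0.
have := h (pickle (y, l)) (y, l) (pickleK _) pl lL.
move=> /(powR_le (ltW q0) (powR_ge0 _ _)).
by rewrite -powRrM mulVf ?gt_eqF // powRr1 ?vsum_ge0.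
Qed.

End variation_of_functions.

(** * The density attached to a positive operator with positive inverse *)

Section weights.
Context d (X : measurableType d) (R : realType).
Variables (mu : {sigma_finite_measure set X -> \bar R}) (p : R).
Hypothesis p1 : 1 < p.
Variables U W : (X -> R) -> X -> R.
Hypotheses (PU : posop mu p U) (PW : posop mu p W).
Hypothesis WU : forall g, rLp mu p g -> {ae mu, forall x, W (U g) x = g x}.
Hypothesis UW : forall g, rLp mu p g -> {ae mu, forall x, U (W g) x = g x}.
Implicit Types (f g : X -> R).

Let p0 : 0 < p. Proof. exact: lt_trans ltr01 p1. Qed.

Lemma posop_ge0_norm g : rLp mu p g -> (forall x, 0 <= g x) ->
  {ae mu, forall x, `|U g x| = U g x}.
Proof.
by move=> Lg g0; apply: filterS (op_pos PU Lg (aeW _ g0)) => x h; rewrite ger0_norm.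
Qed.

(** [posop_theta] for [U] is one inequality. The other is [posop_theta] for [W] at the images [U f]
    and [U g], to which [U] is then applied. *)
Lemma posop_theta_eq r f g : 1 < r -> (forall x, 0 <= f x) -> (forall x, 0 <= g x) ->
  rLp mu p f -> rLp mu p g ->
  {ae mu, forall x, U (fun y => theta r (f y) (g y)) x = theta r `|U f x| `|U g x|}.
Proof.
move=> r1 f0 g0 Lf Lg.
have Lt := rLp_theta p1 (ltW r1) f0 g0 Lf Lg.
have Uf0 := posop_ge0_norm Lf f0; have Ug0 := posop_ge0_norm Lg g0.
have LUf := rLp_norm p1 (op_Lp PU Lf); have LUg := rLp_norm p1 (op_Lp PU Lg).
have n0 h (x : X) : 0 <= `|U h x| by [].
have LT := rLp_theta p1 (ltW r1) (n0 f) (n0 g) LUf LUg.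
have Wf : {ae mu, forall x, W (fun y => `|U f y|) x = f x}.
  by apply: filterS2 (op_ext PW LUf (op_Lp PU Lf) Uf0) (WU Lf) => x -> ->.
have Wg : {ae mu, forall x, W (fun y => `|U g y|) x = g x}.
  by apply: filterS2 (op_ext PW LUg (op_Lp PU Lg) Ug0) (WU Lg) => x -> ->.
have H1 : {ae mu, forall x, theta r (f x) (g x) <=
    W (fun y => theta r `|U f y| `|U g y|) x}.
  by apply: filterS3 (posop_theta p1 PW r1 (n0 f) (n0 g) LUf LUg) Wf Wg => x h <- <-.
have H2 := posop_le p1 PU Lt (op_Lp PW LT) H1.
apply: filterS2 (filterI H2 (UW LT)) (filterI (filterI Uf0 Ug0)
  (posop_theta p1 PU r1 f0 g0 Lf Lg)) => x [h2 h3] [[uf ug] h4].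
by apply/le_anti; rewrite -{1}h3 h2 uf ug h4.
Qed.

Let root (phi : X -> R) x := phi x `^ p^-1.

Let powR_root phi x : 0 <= phi x -> root phi x `^ p = phi x.
Proof. by move=> h; rewrite /root -powRrM mulVf ?gt_eqF // powRr1. Qed.

Lemma Ip_root phi : (forall x, 0 <= phi x) -> Ip mu p (root phi) = (\int[mu]_x (phi x)%:E)%E.
Proof.
move=> h; apply: eq_integral => x _.
by rewrite ger0_norm ?powR_ge0 // powR_root.
Qed.

Lemma rLp_root phi : L1pos mu phi -> rLp mu p (root phi).
Proof.
move=> [mphi phi0 fin]; split; first exact: (measurableT_comp (measurable_powR p^-1)).
by rewrite Ip_root.
Qed.

Lemma L1pos_powR g : rLp mu p g -> L1pos mu (fun x => `|g x| `^ p).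
Proof.
by move=> [mg gfin]; split => //; exact: measurable_norm_powR.
Qed.

Let Lam phi := Ip mu p (U (root phi)).

(* [U], having a positive inverse, commutes with [theta p]. *)
Let LamD phi psi : L1pos mu phi -> L1pos mu psi ->
  Lam (fun x => phi x + psi x) = (Lam phi + Lam psi)%E.
Proof.
move=> Lphi Lpsi; have [_ phi0 _] := Lphi; have [_ psi0 _] := Lpsi.
have L1 := rLp_root Lphi; have L2 := rLp_root Lpsi.
have r0 h (x : X) : 0 <= root h x by exact: powR_ge0.
have -> : Lam (fun x => phi x + psi x) =
    Ip mu p (U (fun x => theta p (root phi x) (root psi x))).
  congr (Ip _ _ (U _)); apply/funext => x.
  by rewrite /theta !powR_root.
have Lt := rLp_theta p1 (ltW p1) (r0 phi) (r0 psi) L1 L2.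
have [m1 _] := op_Lp PU L1; have [m2 _] := op_Lp PU L2.
have n1 : measurable_fun [set: X] (fun x => `|U (root phi) x|) by exact: measurableT_comp.
have n2 : measurable_fun [set: X] (fun x => `|U (root psi) x|) by exact: measurableT_comp.
rewrite (Ip_ae_eq p1 _ _ (posop_theta_eq p1 (r0 phi) (r0 psi) L1 L2)); last 2 first.
- by case: (op_Lp PU Lt).
- exact: measurable_theta.
have n0 h (x : X) : 0 <= `|U h x| by [].
by rewrite (Ip_theta mu p1 n1 n2 (n0 _) (n0 _)) !Ip_norm.
Qed.

Let LamZ a phi : 0 <= a -> L1pos mu phi -> Lam (fun x => a * phi x) = (a%:E * Lam phi)%E.
Proof.
move=> a0 Lphi; have [_ phi0 _] := Lphi; have L1 := rLp_root Lphi.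
have [m1 _] := op_Lp PU L1.
have -> : Lam (fun x => a * phi x) = Ip mu p (U (fun x => a `^ p^-1 * root phi x)).
  by congr (Ip _ _ (U _)); apply/funext => x; rewrite /root powRM.
rewrite (Ip_ae_eq p1 _ _ (posopZ p1 PU (a `^ p^-1) L1)); last 2 first.
- by case: (op_Lp PU (rLpZ (a `^ p^-1) L1)).
- exact: measurable_funM.
by rewrite IpZ // ger0_norm ?powR_ge0 // -powRrM mulVf ?gt_eqF // powRr1.
Qed.

(** As [U] commutes with [theta p], the integral of [|U g| ^ p] is additive in [g ^ p], hence given
    by a density. *)
Theorem posop_weight : exists2 om : X -> R,
  measurable_fun [set: X] om /\ (forall x, 0 < om x) &
  forall g, rLp mu p g -> (forall x, 0 <= g x) ->
    Ip mu p (U g) = (\int[mu]_x (g x `^ p * om x)%:E)%E.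
Proof.
have [M M0 HM] := op_bnd PU.
have Lam_le phi : L1pos mu phi -> (Lam phi <= M%:E * \int[mu]_x (phi x)%:E)%E.
  move=> Lphi; have [_ phi0 _] := Lphi; rewrite -Ip_root //.
  by apply: HM; exact: rLp_root.
have [v Lv v0] := sigma_finite_weight mu.
have [rho [mrho rho0] Hrho] := L1_density M0 (fun=> Ip_ge0 _ _ _) LamD LamZ Lam_le Lv v0.
have Hg g : rLp mu p g -> (forall x, 0 <= g x) ->
    Ip mu p (U g) = (\int[mu]_x (g x `^ p * rho x)%:E)%E.
  move=> Lg g0; have -> : Ip mu p (U g) = Lam (fun x => `|g x| `^ p).
    by congr (Ip _ _ (U _)); apply/funext => x; rewrite /root powRK_inv ?gt_eqF // ger0_norm.
  rewrite /Lam Hrho; last exact: L1pos_powR.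
  by apply: eq_integral => x _; rewrite ger0_norm.
pose Z := [set x | rho x = 0].
have mZ : measurable Z.
  by rewrite -[Z]setTI -[Z]/(rho @^-1` [set 0]); exact: mrho.
(* A positive function supported where the density vanishes is sent to 0 by [U], hence is itself
   null as [W] inverts [U]. *)
have Z0 : {ae mu, forall x, rho x != 0}.
  pose g x := \1_Z x * root v x.
  have [mv _ _] := Lv.
  have Lr := rLp_root Lv.
  have g0 x : 0 <= g x by rewrite mulr_ge0 ?powR_ge0.
  have Lg : rLp mu p g.
    apply: (rLp_dom p1 _ Lr).
      by apply: measurable_funM; [exact: measurable_indic|case: Lr].
    apply: aeW => x; rewrite /g indicE; case: (_ \in _); first by rewrite mul1r.
    by rewrite mul0r normr0.
  have I0 : Ip mu p (U g) = 0%E.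
    rewrite Hg // (eq_integral (fun=> 0%E)) ?integral0 // => x _; congr _%:E.
    rewrite /g indicE; case: (boolP (x \in Z)) => [/set_mem ->|_]; first by rewrite mulr0.
    by rewrite mul0r powR0 ?mul0r // gt_eqF.
  have [mUg _] := op_Lp PU Lg.
  have Ug0 : {ae mu, forall x, U g x = 0}.
    have := (ae_eq_integral_abs mu measurableT (measurable_Ip p mUg)).1.
    have -> : (\int[mu]_x `|(`|U g x| `^ p)%:E|)%E = Ip mu p (U g).
      by apply: eq_integral => x _; rewrite gee0_abs // lee_fin powR_ge0.
    move=> /(_ I0); apply: filterS => x /(_ Logic.I) [] /eqP.
    by rewrite powR_eq0 normr_eq0 => /andP[/eqP].
  have := op_ext PW (op_Lp PU Lg) (rLp0 mu p1) Ug0.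
  move=> H; apply: filterS3 H (posop0 p1 PW) (WU Lg) => x -> -> /esym.
  move=> gx0; apply/negP => /eqP rx0; move: gx0; rewrite /g indicE mem_set // mul1r.
  by move/eqP; rewrite gt_eqF // powR_gt0.
(* Changing the density on the null set [Z] makes it positive everywhere, as the integer results
   demand. *)
exists (fun x => rho x + \1_Z x); first split.
- by apply: measurable_funD => //; exact: measurable_indic.
- move=> x; rewrite indicE; case: (boolP (x \in Z)) => [_|/negP xZ].
    by rewrite ltr_wpDl.
  rewrite addr0 lt_neqAle rho0 andbT; apply/eqP => /esym rx; apply: xZ.
  exact: mem_set.
move=> g Lg g0; rewrite Hg //; have [mg _] := Lg.
have mgp : measurable_fun [set: X] (fun x => g x `^ p).
  exact: (measurableT_comp (measurable_powR p)).
apply: ge0_ae_eq_integral => //.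
- by apply/measurable_EFinP; exact: measurable_funM.
- by apply/measurable_EFinP; apply: measurable_funM => //; exact: measurable_funD.
- by move=> x _; rewrite lee_fin mulr_ge0 ?powR_ge0.
- by move=> x _; rewrite lee_fin mulr_ge0 ?powR_ge0 // addr_ge0.
- apply: filterS Z0 => x /negP xZ _; congr (_ * _)%:E.
  rewrite indicE memNset ?addr0 // => rx; apply: xZ; exact/eqP.
Qed.

End weights.

(** * The one-sided A_p condition and transference *)

(* Locked: comparing two values by unfolding real powers is very slow. *)
HB.lock Definition lsum {R : realType} (p : R) (m : nat) (x : nat -> R) : R :=
  (\sum_(0 <= i < m) x i `^ p) `^ p^-1.

(** * Minkowski's inequality for finite sequences *)

Section finite_minkowski.
Context {R : realType}.
Implicit Types (p t : R) (x y : nat -> R) (a : nat -> nat -> R).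

Lemma powR_convex p t (u v : R) : 1 <= p -> 0 <= t <= 1 -> 0 <= u -> 0 <= v ->
  (t * u + (1 - t) * v) `^ p <= t * u `^ p + (1 - t) * v `^ p.
Proof.
move=> p1 /andP[t0 t1] u0 v0; have := @convex_powR R p p1 (Itv01 t0 t1) u v.
rewrite !inE /= !in_itv /= !andbT => /(_ u0 v0); rewrite !convRE /=.
by rewrite /unstable.onem.
Qed.

Lemma lsumE p m x : lsum p m x = (\sum_(0 <= i < m) x i `^ p) `^ p^-1.
Proof. by rewrite lsum.unlock. Qed.

Lemma lsum_ge0 p m x : 0 <= lsum p m x. Proof. by rewrite lsumE powR_ge0. Qed.

Lemma lsum_powR p m x : p != 0 -> lsum p m x `^ p = \sum_(0 <= i < m) x i `^ p.
Proof.
move=> p0; rewrite lsumE -powRrM mulVf // powRr1 // sum_ge0_nat // => i.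
exact: powR_ge0.
Qed.

Let sum_powR_eq0 p m x : 0 < p -> \sum_(0 <= i < m) x i `^ p <= 0 ->
  forall i, (i < m)%N -> x i = 0.
Proof.
move=> p0 S0 i im.
have : x i `^ p <= 0.
  apply: le_trans S0; apply: (@le_sum_term _ (fun i => x i `^ p)) => // j; exact: powR_ge0.
move=> h; have /eqP : x i `^ p = 0 by apply/le_anti; rewrite h powR_ge0.
by rewrite powR_eq0 => /andP[/eqP].
Qed.

Lemma minkowski_powR p m x y (A B : R) : 1 < p ->
  (forall i, 0 <= x i) -> (forall i, 0 <= y i) -> 0 <= A -> 0 <= B ->
  \sum_(0 <= i < m) x i `^ p <= A `^ p -> \sum_(0 <= i < m) y i `^ p <= B `^ p ->
  \sum_(0 <= i < m) (x i + y i) `^ p <= (A + B) `^ p.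
Proof.
move=> p1 x0 y0; have p0 : 0 < p by lra.
rewrite le_eqVlt => /orP[/eqP<- _|A0].
  rewrite powR0 ?gt_eqF // => /(sum_powR_eq0 p0) xz yB; rewrite add0r.
  by rewrite (eq_big_nat _ _ (F2 := fun i => y i `^ p)) => [//|i /andP[_ /xz ->]]; rewrite add0r.
rewrite le_eqVlt => /orP[/eqP<- xA|B0 xA yB].
  rewrite powR0 ?gt_eqF // => /(sum_powR_eq0 p0) yz; rewrite addr0.
  by rewrite (eq_big_nat _ _ (F2 := fun i => x i `^ p)) => [//|i /andP[_ /yz ->]]; rewrite addr0.
have AB : 0 < A + B by rewrite addr_gt0.
pose t := A / (A + B).
have t01 : 0 <= t <= 1.
  by rewrite divr_ge0 ?(ltW A0) ?(ltW AB) //= ler_pdivrMr // mul1r lerDl ltW.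
have t1 : 1 - t = B / (A + B) by rewrite /t; field; rewrite gt_eqF.
have t1' : 0 <= 1 - t by case/andP: t01 => _; rewrite subr_ge0.
have t0' : 0 <= t by case/andP: t01.
apply: (@le_trans _ _ (\sum_(0 <= i < m) (A + B) `^ p *
    (t * (x i / A) `^ p + (1 - t) * (y i / B) `^ p))).
  apply: ler_sum => i _.
  have -> : x i + y i = (A + B) * (t * (x i / A) + (1 - t) * (y i / B)).
    by rewrite t1 /t; field; rewrite !gt_eqF.
  have xA0 : 0 <= x i / A by rewrite divr_ge0 // ltW.
  have yB0 : 0 <= y i / B by rewrite divr_ge0 // ltW.
  rewrite (powRM p (ltW AB) (addr_ge0 (mulr_ge0 t0' xA0) (mulr_ge0 t1' yB0))).
  rewrite ler_wpM2l ?powR_ge0 //.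
  by apply: powR_convex => //; exact: ltW.
rewrite -mulr_sumr -[leRHS]mulr1 ler_wpM2l ?powR_ge0 //.
rewrite big_split /= -!mulr_sumr.
have S z (c : R) : (forall i, 0 <= z i) -> 0 < c -> \sum_(0 <= i < m) z i `^ p <= c `^ p ->
    \sum_(0 <= i < m) (z i / c) `^ p <= 1.
  move=> z0 c0 zc; under eq_bigr => i _ do rewrite powRM ?invr_ge0 ?(ltW c0) // powR_inv.
  by rewrite -mulr_suml ler_pdivrMr ?powR_gt0 // mul1r.
have := ler_wpM2l t0' (S x A x0 A0 xA); have := ler_wpM2l t1' (S y B y0 B0 yB).
lra.
Qed.

Lemma lsumD p m x y : 1 < p -> (forall i, 0 <= x i) -> (forall i, 0 <= y i) ->
  lsum p m (fun i => x i + y i) <= lsum p m x + lsum p m y.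
Proof.
move=> p1 x0 y0; have p0 : 0 < p by lra.
apply: (@powR_le_inv _ p); [exact: p0|by rewrite addr_ge0 ?lsum_ge0|].
rewrite lsum_powR ?gt_eqF //.
apply: (minkowski_powR p1 x0 y0 (lsum_ge0 _ _ _) (lsum_ge0 _ _ _));
  rewrite lsum_powR ?gt_eqF //.
Qed.

Lemma lsum_sum p m N (b : nat -> nat -> R) : 1 < p -> (forall n i, 0 <= b n i) ->
  lsum p m (fun i => \sum_(0 <= n < N) b n i) <= \sum_(0 <= n < N) lsum p m (b n).
Proof.
move=> p1 b0; elim: N => [|N IH].
  rewrite big_geq // lsumE big1 ?powR0 ?invr_eq0 ?gt_eqF //; first lra.
  by move=> i _; rewrite big_geq // powR0 // gt_eqF //; lra.
rewrite big_nat_recr //=.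
have -> : lsum p m (fun i => \sum_(0 <= n < N.+1) b n i) =
    lsum p m (fun i => \sum_(0 <= n < N) b n i + b N i).
  by rewrite !lsumE; congr (_ `^ _); apply: eq_bigr => i _; rewrite big_nat_recr.
apply: le_trans (lsumD _ p1 _ _) _ => [i|i|]; first exact: sum_ge0_nat.
  exact: b0.
by rewrite lerD2r.
Qed.

(** The inner sum is regrouped by [n = k' - k]. For fixed [n] the summand is a translate of [a n],
    with the same norm, and Minkowski's inequality is applied to the sum over [n]. *)
Lemma diagonal_minkowski p m N a : 1 < p -> (m <= N)%N -> (forall n k, 0 <= a n k) ->
  \sum_(m <= k' < N.+1) (\sum_(0 <= k < m.+1) a (k' - k)%N k) `^ p <=
  (\sum_(0 <= n < N.+1) lsum p m.+1 (a n)) `^ p.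
Proof.
move=> p1 mN a0; have p0 : 0 < p by lra.
pose b n k' := if (n <= k' <= n + m)%N then a n (k' - n)%N else 0.
have b0 n k' : 0 <= b n k' by rewrite /b; case: ifP.
have diag k' : (m <= k' <= N)%N ->
    \sum_(0 <= k < m.+1) a (k' - k)%N k <= \sum_(0 <= n < N.+1) b n k'.
  move=> /andP[mk kN].
  apply: (@le_trans _ _ (\sum_(k' - m <= n < (k' - m) + m.+1) b n k')); last first.
    by apply: le_sum_nat_sub => //; move: mk kN; clear; lia.
  rewrite sum_from big_nat_rev /= le_eqVlt; apply/orP; left; apply/eqP.
  apply: eq_big_nat => k /andP[_ km]; rewrite /b add0n subSS.
  have -> : (k' - m + k <= k' <= k' - m + k + m)%N by move: mk km; clear; lia.
  by congr a; move: mk km; clear; lia.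
apply: (@le_trans _ _ (\sum_(m <= k' < N.+1) (\sum_(0 <= n < N.+1) b n k') `^ p)).
  apply: ler_sum_nat => k' kk; apply: powR_le; [exact: ltW|exact: sum_ge0_nat|exact: diag].
apply: (@le_trans _ _ (lsum p N.+1 (fun k' => \sum_(0 <= n < N.+1) b n k') `^ p)).
  rewrite lsum_powR ?gt_eqF //; apply: le_sum_nat_sub => // i; exact: powR_ge0.
apply: powR_le; [exact: ltW|exact: lsum_ge0|].
apply: le_trans (lsum_sum _ _ p1 b0) _; apply: ler_sum => n _.
apply: (powR_le_inv p0 (lsum_ge0 _ _ _)).
rewrite (lsum_powR N.+1 (b n) (lt0r_neq0 p0)) (lsum_powR m.+1 (a n) (lt0r_neq0 p0)).
have bz k' : ~~ (n <= k' <= n + m)%N -> b n k' `^ p = 0.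
  by move=> /negbTE h; rewrite /b h powR0 // gt_eqF.
have bp0 k' : 0 <= b n k' `^ p by exact: powR_ge0.
apply: (@le_trans _ _ (\sum_(0 <= k' < n + m.+1 + N.+1) b n k' `^ p)).
  by apply: le_sum_nat_sub => //; rewrite leq_addl.
rewrite (@sum_cut _ _ 0 (n + m.+1)); last 2 first.
- by rewrite leq_addr.
- by move=> k /andP[nk _]; apply: bz; rewrite negb_and -!ltnNge -addnS nk orbT.
rewrite (@big_cat_nat _ _ _ n) ?leq_addr //=.
have -> : \sum_(0 <= k' < n) b n k' `^ p = 0.
  rewrite big_nat_cond big1 // => k /andP[/andP[_ kn] _]; apply: bz.
  by rewrite negb_and -ltnNge kn.
rewrite add0r sum_from le_eqVlt; apply/orP; left; apply/eqP.
apply: eq_big_nat => k /andP[_ km]; rewrite /b leq_addr leq_add2l -ltnS km.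
by rewrite addKn.
Qed.

End finite_minkowski.

(** * From the mean bound to a condition on almost every sequence of weights *)

Section Ap_condition.
Context d (X : measurableType d) (R : realType).
Variables (mu : {sigma_finite_measure set X -> \bar R}) (p : R).
Hypothesis p1 : 1 < p.
Implicit Types (f g : X -> R).

Let p0 : 0 < p. Proof. exact: lt_trans ltr01 p1. Qed.

Lemma lsum_theta m (K : nat -> R) : lsum p m.+1 K = theta p (lsum p m K) (K m).
Proof. by rewrite /theta lsum_powR ?gt_eqF // lsumE big_nat_recr. Qed.

Lemma rLp_lsum m (K : nat -> X -> R) : (forall k x, 0 <= K k x) ->
  (forall k, rLp mu p (K k)) -> rLp mu p (fun x => lsum p m (K^~ x)).
Proof.
move=> K0 LK; elim: m => [|m IH].
  have -> : (fun x => lsum p 0 (K^~ x)) = (fun=> 0).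
    by apply/funext => x; rewrite lsumE big_geq // powR0 // invr_eq0 gt_eqF.
  exact: rLp0.
have -> : (fun x => lsum p m.+1 (K^~ x)) = (fun x => theta p (lsum p m (K^~ x)) (K m x)).
  by apply/funext => x; rewrite lsum_theta.
by apply: (rLp_theta p1 (ltW p1) _ (K0 m) IH (LK m)) => x; exact: lsum_ge0.
Qed.

Lemma Ip_lsum m (K : nat -> X -> R) : (forall k x, 0 <= K k x) ->
  (forall k, rLp mu p (K k)) ->
  Ip mu p (fun x => lsum p m (K^~ x)) = (\sum_(0 <= k < m) Ip mu p (K k))%E.
Proof.
move=> K0 LK; elim: m => [|m IH].
  rewrite big_geq // /Ip (eq_integral (fun=> 0%E)) ?integral0 // => x _.
  by rewrite lsumE big_geq // powR0 ?invr_eq0 ?gt_eqF // normr0 powR0 // gt_eqF.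
have -> : (fun x => lsum p m.+1 (K^~ x)) = (fun x => theta p (lsum p m (K^~ x)) (K m x)).
  by apply/funext => x; rewrite lsum_theta.
have [m1 _] := rLp_lsum m K0 LK; have [m2 _] := LK m.
rewrite (Ip_theta mu p1 m1 m2 _ (K0 m)) ?IH ?big_nat_recr // => x; exact: lsum_ge0.
Qed.

Lemma posop_lsum V m (K : nat -> X -> R) : posop mu p V -> (forall k x, 0 <= K k x) ->
  (forall k, rLp mu p (K k)) ->
  {ae mu, forall x, lsum p m (fun k => `|V (K k) x|) <= V (fun y => lsum p m (K^~ y)) x}.
Proof.
move=> PV K0 LK; elim: m => [|m IH].
  have -> : (fun x => lsum p 0 (K^~ x)) = (fun=> 0).
    by apply/funext => x; rewrite lsumE big_geq // powR0 // invr_eq0 gt_eqF.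
  apply: filterS (posop0 p1 PV) => x ->.
  by rewrite lsumE big_geq // powR0 // invr_eq0 gt_eqF.
have -> : (fun x => lsum p m.+1 (K^~ x)) = (fun x => theta p (lsum p m (K^~ x)) (K m x)).
  by apply/funext => x; rewrite lsum_theta.
have Ll := rLp_lsum m K0 LK.
have l0 x : 0 <= lsum p m (K^~ x) by exact: lsum_ge0.
have H := posop_theta p1 PV p1 l0 (K0 m) Ll (LK m).
apply: filterS3 H IH (posop_ge0_norm PV (LK m) (K0 m)) => x h1 h2 h3.
rewrite lsum_theta; apply: le_trans h1; apply: (theta_le p0 (lsum_ge0 _ _ _) (normr_ge0 _) h2).
by rewrite h3.
Qed.

Lemma ge0_ae_eq_of_le (F G : X -> R) : measurable_fun [set: X] F ->
  measurable_fun [set: X] G -> (forall x, 0 <= G x <= F x) ->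
  (\int[mu]_x (F x)%:E <= \int[mu]_x (G x)%:E)%E -> (\int[mu]_x (G x)%:E < +oo)%E ->
  {ae mu, forall x, F x = G x}.
Proof.
move=> mF mG GF le fin.
have G0 x : 0 <= G x by case/andP: (GF x).
have D0 x : 0 <= F x - G x by rewrite subr_ge0; case/andP: (GF x).
have mD : measurable_fun [set: X] (fun x => (F x - G x)%:E).
  by apply/measurable_EFinP; exact: measurable_funB.
have E : (\int[mu]_x (F x)%:E)%E = (\int[mu]_x (G x)%:E + \int[mu]_x (F x - G x)%:E)%E.
  rewrite -ge0_integralD //.
  - by apply: eq_integral => x _; rewrite -EFinD addrC subrK.
  - by move=> x _; rewrite lee_fin.
  - exact/measurable_EFinP.
  - by move=> x _; rewrite lee_fin.
have Gfin : (\int[mu]_x (G x)%:E)%E \is a fin_num.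
  by rewrite ge0_fin_numE //; apply: integral_ge0 => x _; rewrite lee_fin.
have I0 : (\int[mu]_x `|(F x - G x)%:E|)%E = 0%E.
  under eq_integral do rewrite gee0_abs ?lee_fin //.
  apply/le_anti/andP; split; last by apply: integral_ge0 => x _; rewrite lee_fin.
  by move: le; rewrite E -[leRHS]adde0 leeD2lE.
have := (ae_eq_integral_abs mu measurableT mD).1 I0.
by apply: filterS => x /(_ Logic.I) [] /eqP; rewrite subr_eq0 => /eqP.
Qed.

Variables U W : (X -> R) -> X -> R.
Hypotheses (PU : posop mu p U) (PW : posop mu p W).

Definition avg N f x : R := N.+1%:R^-1 * \sum_(0 <= n < N.+1) iter n U f x.

Lemma avgE N f : avg N f = (fun x => \sum_(0 <= n < N.+1) N.+1%:R^-1 * iter n U f x).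
Proof. by apply/funext => x; rewrite /avg mulr_sumr. Qed.

Lemma rLp_iter n f : rLp mu p f -> rLp mu p (iter n U f).
Proof. by move=> Lf; exact (op_Lp (posop_iter p1 n PU) Lf). Qed.

Lemma rLp_avg N f : rLp mu p f -> rLp mu p (avg N f).
Proof.
move=> Lf; rewrite avgE; apply: (rLp_sum p1 (fun=> N.+1%:R^-1)) => i _.
exact: rLp_iter.
Qed.

Variable C : R.
Hypothesis C0 : 0 < C.
Hypothesis mean : forall N f, rLp mu p f -> (Ip mu p (avg N f) <= C%:E * Ip mu p f)%E.

Variable om : nat -> X -> R.
Hypothesis mom : forall i, measurable_fun [set: X] (om i).
Hypothesis om0 : forall i x, 0 < om i x.
Hypothesis omE : forall i g, rLp mu p g -> (forall x, 0 <= g x) ->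
  Ip mu p (iter i U g) = (\int[mu]_x (g x `^ p * om i x)%:E)%E.

(* Test the mean bound on the l^p combination [h] of the [U ^ (i0 + k) (H k)]. *)
Lemma Ap_integral i0 m N (H : nat -> X -> R) : (m <= N)%N -> (forall k x, 0 <= H k x) ->
  (forall k, rLp mu p (H k)) ->
  (\int[mu]_x ((\sum_(0 <= k < m.+1) H k x) `^ p * \sum_(m <= k' < N.+1) om (i0 + k')%N x)%:E <=
   (C * N.+1%:R `^ p)%:E *
   \int[mu]_x (\sum_(0 <= k < m.+1) H k x `^ p * om (i0 + k)%N x)%:E)%E.
Proof.
move=> mN H0 LH.
pose K k x : R := `|iter (i0 + k) U (H k) x|.
have K0 k x : 0 <= K k x by exact: normr_ge0.
have LI k := rLp_iter (i0 + k) (LH k).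
have LK k : rLp mu p (K k) by exact: (rLp_norm p1 (LI k)).
have KE k : {ae mu, forall x, K k x = iter (i0 + k) U (H k) x}.
  by exact: (posop_ge0_norm (posop_iter p1 (i0 + k) PU) (LH k) (H0 k)).
pose h x := lsum p m.+1 (K^~ x).
have Lh : rLp mu p h by exact: rLp_lsum.
pose G x := \sum_(0 <= k < m.+1) 1 * H k x.
have LG : rLp mu p G by apply: (rLp_sum p1 (fun=> 1)) => i _; exact: LH.
have G0 x : 0 <= G x by apply: sum_ge0_nat => k; rewrite mul1r.
have GE k' : (m <= k')%N -> {ae mu, forall x, iter (i0 + k') U G x =
    \sum_(0 <= k < m.+1) `|iter (k' - k) U (K k) x|}.
  move=> mk'; have P := posop_iter p1 (i0 + k') PU.
  have HK : {ae mu, forall x, forall k, (k < m.+1)%N ->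
      iter (i0 + k') U (H k) x = `|iter (k' - k) U (K k) x|}.
    apply: ae_foralln => k; have [km|] := ltnP k m.+1; last by move=> _; exact: aeW.
    have Pk := posop_iter p1 (k' - k) PU.
    apply: filterS2 (op_ext Pk (LK k) (LI k) (KE k)) (posop_ge0_norm Pk (LK k) (K0 k)).
    move=> x h1 h2 _; rewrite h2 h1 -iterD; congr (iter _ U (H k) x).
    by move: mk' km; clear; lia.
  apply: filterS2 (posop_sum p1 P (fun=> 1) (fun k (_ : (k < m.+1)%N) => LH k)) HK => x -> hk.
  by apply: eq_big_nat => k /andP[_ km]; rewrite mul1r hk.
(* The image of [G] under the power [i0 + k'] is a sum over [k] of the images of [K k] under the
   power [k' - k], a diagonal of an array. By [diagonal_minkowski] only the norms over [k] of the
   images under [n] iterations remain, and these are below the iterates of [h] by positivity. *)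
have main : {ae mu, forall x, \sum_(m <= k' < N.+1) `|iter (i0 + k') U G x| `^ p <=
    `|N.+1%:R * avg N h x| `^ p}.
  have H1 : {ae mu, forall x, forall k', (m <= k')%N -> iter (i0 + k') U G x =
      \sum_(0 <= k < m.+1) `|iter (k' - k) U (K k) x|}.
    by apply: ae_foralln => k'; have [mk|] := leqP m k';
      [apply: filterS (GE _ mk)|move=> _; exact: aeW].
  have H2 : {ae mu, forall x, forall n, lsum p m.+1 (fun k => `|iter n U (K k) x|) <=
      iter n U h x}.
    apply: ae_foralln => n; exact: (posop_lsum m.+1 (posop_iter p1 n PU) K0 LK).
  apply: filterS2 H1 H2 => x h1 h2.
  have -> : \sum_(m <= k' < N.+1) `|iter (i0 + k') U G x| `^ p =
      \sum_(m <= k' < N.+1) (\sum_(0 <= k < m.+1) `|iter (k' - k) U (K k) x|) `^ p.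
    apply: eq_big_nat => k' /andP[mk _]; rewrite h1 // ger0_norm //.
    exact: sum_ge0_nat.
  apply: le_trans (@diagonal_minkowski _ p m N (fun n k => `|iter n U (K k) x|) p1 mN _) _ => //.
  have Nr : N.+1%:R * avg N h x = \sum_(0 <= n < N.+1) iter n U h x.
    by rewrite /avg mulrA divff ?mul1r // pnatr_eq0.
  have L0 : 0 <= \sum_(0 <= n < N.+1) lsum p m.+1 (fun k => `|iter n U (K k) x|).
    by apply: sum_ge0_nat => n; exact: lsum_ge0.
  have LL : \sum_(0 <= n < N.+1) lsum p m.+1 (fun k => `|iter n U (K k) x|) <=
      \sum_(0 <= n < N.+1) iter n U h x by apply: ler_sum => n _; exact: h2.
  rewrite Nr ger0_norm ?(le_trans L0 LL) //.
  by apply: powR_le => //; exact: ltW.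
have mG k' : measurable_fun [set: X] (fun x => (`|iter (i0 + k') U G x| `^ p)%:E).
  by apply: measurable_Ip; case: (rLp_iter (i0 + k') LG).
have [mGG _] := LG.
have mGp : measurable_fun [set: X] (fun x => G x `^ p).
  exact: (measurableT_comp (measurable_powR p)).
have mHp k : measurable_fun [set: X] (fun x => H k x `^ p).
  by apply: (measurableT_comp (measurable_powR p)); case: (LH k).
have lhs : (\int[mu]_x ((\sum_(0 <= k < m.+1) H k x) `^ p *
      \sum_(m <= k' < N.+1) om (i0 + k')%N x)%:E)%E =
    (\int[mu]_x (\sum_(m <= k' < N.+1) `|iter (i0 + k') U G x| `^ p)%:E)%E.
  transitivity (\sum_(m <= k' < N.+1) Ip mu p (iter (i0 + k') U G))%E.
    rewrite (eq_integral (fun x => (\sum_(m <= k' < N.+1) (G x `^ p * om (i0 + k')%N x)%:E)%E)).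
      rewrite ge0_integral_sum //.
      - by apply: eq_bigr => k' _; rewrite omE.
      - by move=> k'; apply/measurable_EFinP; exact: measurable_funM.
      - by move=> k' x _; rewrite lee_fin mulr_ge0 ?powR_ge0 // ltW.
    move=> x _; rewrite mulr_sumr -sumEFin; apply: eq_bigr => k' _.
    by congr (_ `^ _ * _)%:E; apply: eq_bigr => k _; rewrite mul1r.
  under [RHS]eq_integral do rewrite -sumEFin.
  rewrite ge0_integral_sum // => k' x _; exact: Ip_pt_ge0.
have rhs : Ip mu p h = (\int[mu]_x (\sum_(0 <= k < m.+1) H k x `^ p * om (i0 + k)%N x)%:E)%E.
  rewrite Ip_lsum //; under [RHS]eq_integral do rewrite -sumEFin.
  rewrite ge0_integral_sum //.
  - by apply: eq_bigr => k _; rewrite -(omE (i0 + k) (LH k) (H0 k)); exact: Ip_norm.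
  - by move=> k; apply/measurable_EFinP; exact: measurable_funM.
  - by move=> k x _; rewrite lee_fin mulr_ge0 ?powR_ge0 // ltW.
have La := rLp_avg N Lh; have [ma _] := La.
rewrite lhs -rhs; apply: (@le_trans _ _ (Ip mu p (fun x => N.+1%:R * avg N h x))).
  apply: ae_ge0_le_integral; first exact: measurableT.
  - by move=> x _; rewrite lee_fin; apply: sum_ge0_nat => k; exact: powR_ge0.
  - apply/measurable_EFinP; apply: measurable_sum => k.
    by apply: measurable_norm_powR; case: (rLp_iter (i0 + k) LG).
  - by move=> x _; rewrite lee_fin powR_ge0.
  - by apply: measurable_Ip; exact: measurable_funM.
  - by apply: filterS main => x hx _; rewrite lee_fin.
rewrite IpZ // ger0_norm // [(C * _)%R]mulrC EFinM -muleA lee_wpmul2l ?lee_fin ?powR_ge0 //.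
exact: mean.
Qed.

(* Take [H k] proportional to [om (i0 + k) ^ (-1/(p-1))] on the exceptional set. *)
Lemma Ap_ae i0 m N : (m <= N)%N ->
  {ae mu, forall x, (\sum_(m <= k' < N.+1) om (i0 + k')%N x) *
    (\sum_(0 <= k < m.+1) om (i0 + k)%N x `^ (- (p - 1)^-1)) `^ (p - 1) <= C * N.+1%:R `^ p}.
Proof.
move=> mN; have e0 : 0 < p - 1 by rewrite subr_gt0.
pose sg k x := om (i0 + k)%N x `^ (- (p - 1)^-1).
pose s x := \sum_(0 <= k < m.+1) sg k x.
pose Om x := \sum_(m <= k' < N.+1) om (i0 + k')%N x.
have sg0 k x : 0 < sg k x by exact: powR_gt0.
have s0 x : 0 < s x.
  by rewrite /s big_ltn // ltr_wpDr // sum_ge0_nat // => k; exact: ltW.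
have msg k : measurable_fun [set: X] (sg k) by exact: (measurableT_comp (measurable_powR _)).
have ms : measurable_fun [set: X] s by exact: measurable_sum.
have mOm : measurable_fun [set: X] Om by exact: measurable_sum.
pose D x := C * N.+1%:R `^ p * s x `^ (- (p - 1)).
have mD : measurable_fun [set: X] D.
  by apply: measurable_funM => //; exact: (measurableT_comp (measurable_powR _)).
pose E := [set x | D x < Om x].
have mE : measurable E.
  have := measurable_fun_ltr mD mOm.
  move=> /(_ measurableT [set true] I); rewrite setTI.
  by congr measurable; apply/seteqP; split => x /=; rewrite /E /=.
have [v Lv v0] := sigma_finite_weight mu.
pose u x := v x `^ p^-1.
have u0 x : 0 < u x by exact: powR_gt0.
have Lu : rLp mu p u by exact: rLp_root.
have [mu' _] := Lu.
(* Among nonnegative functions with sum [\1_E * u], this choice minimises the weighted sum of p-th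
   powers, whose value becomes [(\1_E * u)]^ p * s [^ (- (p - 1))]; the factor [u] keeps [H k] in
   the space. The integral bound then contradicts [D < Om] unless [E] is null. *)
pose H k x := \1_E x * u x * (sg k x / s x).
have i01 x : (0 : R) <= (\1_E x : R) <= 1.
  by rewrite indicE; case: (x \in E); rewrite ?lexx ?ler01.
have iE x : 0 <= (\1_E x : R) by case/andP: (i01 x).
have H0 k x : 0 <= H k x by rewrite !mulr_ge0 ?invr_ge0 // ltW.
have msi : measurable_fun [set: X] (fun x => (s x)^-1).
  have -> : (fun x => (s x)^-1) = (fun x => s x `^ (-1)).
    by apply/funext => x; rewrite powR_inv1 // ltW.
  exact: (measurableT_comp (measurable_powR (-1))).
have mi : measurable_fun [set: X] (\1_E : X -> R) by exact: measurable_indic.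
have mH k : measurable_fun [set: X] (H k).
  by do 2!apply: measurable_funM => //; exact: measurable_funM.
have sgs k x : (k < m.+1)%N -> sg k x <= s x.
  by move=> km; apply: (@le_sum_term _ (fun k => sg k x)) => // j; exact: ltW.
have LH k : (k < m.+1)%N -> rLp mu p (H k).
  move=> km; apply: (rLp_dom p1 (mH k) Lu); apply: aeW => x.
  rewrite !ger0_norm ?(ltW (u0 x)) // /H.
  have q1 : sg k x / s x <= 1 by rewrite ler_pdivrMr // mul1r sgs.
  have q0 : 0 <= sg k x / s x by rewrite divr_ge0 // ltW.
  have [a0 a1] := andP (i01 x); have ux := ltW (u0 x).
  rewrite -[leRHS]mulr1; apply: ler_pM => //; first exact: mulr_ge0.
  by rewrite -[leRHS]mul1r; exact: ler_wpM2r.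
pose H' k := if (k < m.+1)%N then H k else fun=> 0.
have LH' k : rLp mu p (H' k) by rewrite /H'; case: ifP => [/LH //|_]; exact: rLp0.
have H0' k x : 0 <= H' k x by rewrite /H'; case: ifP.
have HS x : \sum_(0 <= k < m.+1) H' k x = \1_E x * u x.
  rewrite (eq_big_nat _ _ (F2 := fun k => H k x)) => [|k /andP[_ km]]; last by rewrite /H' km.
  rewrite /H -mulr_sumr -mulr_suml -/(s x) divff ?mulr1 //.
  exact: lt0r_neq0 (s0 x).
have HP x : \sum_(0 <= k < m.+1) H' k x `^ p * om (i0 + k)%N x =
    (\1_E x * u x) `^ p * s x `^ (- (p - 1)).
  rewrite (eq_big_nat _ _ (F2 := fun k => (\1_E x * u x) `^ p * (s x `^ (- p) * sg k x))).
    rewrite -!mulr_sumr -/(s x); congr (_ * _).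
    rewrite -[X in _ * X = _](powRr1 (ltW (s0 x))) -powRD_gt0 //; congr (_ `^ _); ring.
  move=> k /andP[_ km]; rewrite /H' km /H powRM ?mulr_ge0 ?invr_ge0 ?(ltW (u0 x)) ?(ltW (s0 x)) ?(ltW (sg0 k x)) //.
  rewrite -mulrA; congr (_ * _).
  rewrite powRM ?invr_ge0 ?(ltW (s0 x)) ?(ltW (sg0 k x)) // powR_inv -powRN mulrAC mulrC.
  congr (_ * _); rewrite /sg -powRrM -[X in _ * X = _](powRr1 (ltW (om0 (i0 + k) x))) -powRD_gt0 //.
  by congr (_ `^ _); field; rewrite gt_eqF.
have := Ap_integral i0 mN H0' LH'.
rewrite (eq_integral (fun x => ((\1_E x * u x) `^ p * Om x)%:E)) => [|x _]; last by rewrite HS.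
have intE : ((C * N.+1%:R `^ p)%:E *
    \int[mu]_x (\sum_(0 <= k < m.+1) H' k x `^ p * om (i0 + k)%N x)%:E =
    \int[mu]_x ((\1_E x * u x) `^ p * D x)%:E)%E.
  rewrite -ge0_integralZl_EFin //.
  - by apply: eq_integral => x _; rewrite -EFinM HP /D; congr _%:E; ring.
  - by move=> x _; rewrite lee_fin sum_ge0_nat // => k; rewrite mulr_ge0 ?powR_ge0 // ltW.
  - apply/measurable_EFinP; apply: measurable_sum => k; apply: measurable_funM => //.
    by apply: (measurableT_comp (measurable_powR p)); case: (LH' k).
  - by rewrite mulr_ge0 ?powR_ge0 // ltW.
have Ifin : (\int[mu]_x (\sum_(0 <= k < m.+1) H' k x `^ p * om (i0 + k)%N x)%:E < +oo)%E.
  under eq_integral do rewrite -sumEFin.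
  rewrite ge0_integral_sum //.
  - apply: lte_sum_pinfty => k _; rewrite -(omE (i0 + k) (LH' k) (H0' k)).
    by case: (rLp_iter (i0 + k) (LH' k)).
  - move=> k; apply/measurable_EFinP; apply: measurable_funM => //.
    by apply: (measurableT_comp (measurable_powR p)); case: (LH' k).
  - by move=> k x _; rewrite lee_fin mulr_ge0 ?powR_ge0 // ltW.
rewrite intE => le.
have miu : measurable_fun [set: X] (fun x => (\1_E x * u x) `^ p).
  by apply: (measurableT_comp (measurable_powR p)); exact: measurable_funM.
have D0 x : 0 <= D x by rewrite /D !mulr_ge0 ?powR_ge0 // ltW.
have mA : measurable_fun [set: X] (fun x => (\1_E x * u x) `^ p * Om x).
  exact: measurable_funM.
have mB : measurable_fun [set: X] (fun x => (\1_E x * u x) `^ p * D x).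
  exact: measurable_funM.
have BA x : 0 <= (\1_E x * u x) `^ p * D x <= (\1_E x * u x) `^ p * Om x.
  apply/andP; split; first by rewrite mulr_ge0 ?powR_ge0.
  rewrite indicE; case: (boolP (x \in E)) => [/set_mem Ex|_].
    by rewrite ler_wpM2l ?powR_ge0 // ltW.
  by rewrite mul0r powR0 ?mul0r // gt_eqF // (lt_trans ltr01 p1).
have Bfin : (\int[mu]_x ((\1_E x * u x) `^ p * D x)%:E < +oo)%E.
  rewrite -intE; apply: lte_mul_pinfty => //.
  by rewrite lee_fin mulr_ge0 ?powR_ge0 // ltW.
apply: filterS (ge0_ae_eq_of_le mA mB BA le Bfin) => x Ex.
have nE : Om x <= D x.
  rewrite leNgt; apply/negP => lt; move: Ex; rewrite indicE mem_set // mul1r.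
  have up : 0 < u x `^ p by exact: powR_gt0.
  by move=> /(mulfI (lt0r_neq0 up)) eq; move: lt; rewrite eq ltxx.
have spos : 0 < s x `^ (p - 1) by exact: powR_gt0.
rewrite -/(s x) -/(Om x); move: nE; by rewrite /D powRN -ler_pdivlMr.
Qed.

End Ap_condition.

Lemma sume_cst (R : realType) n (a : \bar R) : (0 <= a)%E ->
  (\sum_(0 <= j < n) a = n%:R%:E * a)%E.
Proof.
move=> a0; elim: n => [|n IH]; first by rewrite big_nil mul0e.
by rewrite big_nat_recr //= IH -natr1 EFinD ge0_muleDl ?lee_fin ?ler0n // mul1e.
Qed.

(** * Transference from the integers *)

Section transference.
Context d (X : measurableType d) (R : realType).
Variables (mu : {sigma_finite_measure set X -> \bar R}) (p : R).
Hypothesis p1 : 1 < p.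
Implicit Types (U W : (X -> R) -> X -> R) (f g : X -> R).

Lemma iter_inverse U W n g : posop mu p U -> posop mu p W ->
  (forall h, rLp mu p h -> {ae mu, forall x, W (U h) x = h x}) -> rLp mu p g ->
  {ae mu, forall x, iter n W (iter n U g) x = g x}.
Proof.
move=> PU PW WU Lg; elim: n => [|n IH]; first exact: aeW.
have Ln := rLp_iter p1 PU n Lg.
have LUn := op_Lp PU Ln; have LWU := op_Lp PW LUn.
have E := op_ext (posop_iter p1 n PW) LWU Ln (WU _ Ln).
rewrite iterSr /=.
by apply: filterS2 E IH => x -> ->.
Qed.

Variables U W : (X -> R) -> X -> R.
Hypotheses (PU : posop mu p U) (PW : posop mu p W).
Hypothesis WU : forall g, rLp mu p g -> {ae mu, forall x, W (U g) x = g x}.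
Hypothesis UW : forall g, rLp mu p g -> {ae mu, forall x, U (W g) x = g x}.

Lemma iter_sub_inverse m i g : (m <= i)%N -> rLp mu p g ->
  {ae mu, forall x, iter i U (iter (i - m) W g) x = iter m U g x}.
Proof.
move=> mi Lg.
have LW := rLp_iter p1 PW (i - m) Lg.
apply: filterS (op_ext (posop_iter p1 m PU) (rLp_iter p1 PU (i - m) LW) Lg
  (iter_inverse (i - m) PW PU UW Lg)) => x.
by rewrite -iterD subnKC.
Qed.

Lemma iter_weights : exists om : nat -> X -> R,
  [/\ forall i, measurable_fun [set: X] (om i), forall i x, 0 < om i x
    & forall i g, rLp mu p g -> (forall x, 0 <= g x) ->
      Ip mu p (iter i U g) = (\int[mu]_x (g x `^ p * om i x)%:E)%E].
Proof.
have ex i : exists om : X -> R, [/\ measurable_fun [set: X] om, forall x, 0 < om x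
    & forall g, rLp mu p g -> (forall x, 0 <= g x) ->
      Ip mu p (iter i U g) = (\int[mu]_x (g x `^ p * om x)%:E)%E].
  have [om [m0 om0] omE] := posop_weight p1 (posop_iter p1 i PU) (posop_iter p1 i PW)
    (fun g Lg => iter_inverse i PU PW WU Lg) (fun g Lg => iter_inverse i PW PU UW Lg).
  by exists om.
by have [om omP] := choice ex; exists om; split => i; case: (omP i).
Qed.

Variable C : R.
Hypothesis C0 : 0 < C.
Hypothesis mean : forall N f, rLp mu p f -> (Ip mu p (avg U N f) <= C%:E * Ip mu p f)%E.

(** Reversing the indices by [K - j] exchanges the two factors of [Ap_ae]: the triple [a, b, c]
    corresponds to [i0 = K - c], [m = c - b] and [N = c - a]. *)
Lemma Aplus_ae (om : nat -> X -> R) K :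
  (forall i, measurable_fun [set: X] (om i)) -> (forall i x, 0 < om i x) ->
  (forall i g, rLp mu p g -> (forall x, 0 <= g x) ->
    Ip mu p (iter i U g) = (\int[mu]_x (g x `^ p * om i x)%:E)%E) ->
  {ae mu, forall x, Aplus (p - 1) C K.+1 (fun j => om (K - j)%N x)}.
Proof.
move=> mom om0 omE.
have ae i0 m N : {ae mu, forall x, (m <= N)%N -> (\sum_(m <= k' < N.+1) om (i0 + k')%N x) *
    (\sum_(0 <= k < m.+1) om (i0 + k)%N x `^ (- (p - 1)^-1)) `^ (p - 1) <= C * N.+1%:R `^ p}.
  have [mN|mN] := boolP (m <= N)%N; last by apply: aeW.
  by apply: filterS (Ap_ae p1 PU C0 mean mom om0 omE i0 mN) => x + _.
have ae3 := ae_foralln (fun i0 => ae_foralln (fun m => ae_foralln (ae i0 m))).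
apply: filterS ae3 => x H a b c /andP[ab bc] cK.
have := H (K - c)%N (c - b)%N (c - a)%N.
have -> : (c - b <= c - a)%N by lia.
move=> /(_ isT).
have -> : \sum_(c - b <= k' < (c - a).+1) om (K - c + k')%N x =
    \sum_(a <= i < b.+1) om (K - i)%N x.
  rewrite big_nat_rev [RHS](big_addn 0 _ a) [LHS](big_addn 0 _ (c - b)) /=.
  have -> : ((c - a).+1 - (c - b) = b.+1 - a)%N by move: ab bc; clear; lia.
  apply: eq_big_nat => i /andP[_ ib]; congr (om _ x).
  by move: ab bc cK ib; clear; lia.
have -> : \sum_(0 <= k < (c - b).+1) om (K - c + k)%N x `^ (- (p - 1)^-1) =
    \sum_(b <= i < c.+1) dualw (p - 1) (fun j => om (K - j)%N x) i.
  rewrite big_nat_rev [RHS](big_addn 0 _ b) /= subSn //.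
  apply: eq_big_nat => i /andP[_ ib]; rewrite /dualw; congr (om _ x `^ _).
  by move: ab bc cK ib; clear; lia.
rewrite -subSn; last by move: ab bc; clear; lia.
by rewrite mulr_powRB1 // (lt_trans ltr01 p1).
Qed.

Variable q : R.
Hypothesis q2 : 2 < q.

Lemma variation_avg_bounded : exists2 D : R, 0 < D & forall L f, rLp mu p f ->
  (Ip mu p (vvar q (fun N => avg U N f) L) <= D%:E * Ip mu p f)%E.
Proof.
have [D D0 HD] := weighted_variation p1 q2 C0.
exists (2 * D); first by rewrite mulr_gt0.
have q1 : 1 < q by apply: lt_trans q2; rewrite ltr1n.
have p0 : 0 < p := lt_trans ltr01 p1.
have [om [mom om0 omE]] := iter_weights.
move=> L f Lf; pose K := (2 * L)%N.
pose g := vvar q (fun N => avg U N f) L.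
have Lg : rLp mu p g := rLp_vvar p1 L q1 (fun N => rLp_avg p1 PU N Lf).
have [mg _] := Lg.
(* The reversed orbit, cut off so that the result on the integers applies. Averages with [j <= L]
   and [N <= L] do not see the cut, since [j + N <= 2 * L]. *)
pose F (j : nat) (x : X) : R := if (j <= K)%N then iter (K - j) W f x else 0.
have LF j : rLp mu p (F j).
  rewrite /F; case: (j <= K)%N; first exact (rLp_iter p1 PW (K - j) Lf).
  exact (rLp0 mu p1).
pose A (j N : nat) (x : X) : R := wavg (F^~ x) j N.+1.
have AE j N : A j N = (fun x => \sum_(0 <= i < N.+1) N.+1%:R^-1 * F (j + i)%N x).
  by apply/funext => x; rewrite /A /wavg mulrC mulr_sumr.
have LA j N : rLp mu p (A j N).
  rewrite AE.
  exact (rLp_sum p1 (fun=> N.+1%:R^-1) (fun i (_ : (i < N.+1)%N) => LF (j + i)%N)).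
(* Here [i = K - j] and [U ^ i (A_N (W ^ i f)) = A_N f], so that [g <= U ^ i (h j)]
   for [j <= L]; summing over these [j] costs a factor 2 since [K = 2 L]. *)
pose h j := vvar q (A j) L.
have Lh j : rLp mu p (h j) := rLp_vvar p1 L q1 (LA j).
have h0 j x : 0 <= h j x by exact: powR_ge0.
have hE j x : h j x `^ p = wvar q (F^~ x) L j `^ (p / q).
  by rewrite /h /vvar -powRrM mulrC.
have UA j N : (j <= L)%N ->
    {ae mu, forall x, (N <= L)%N -> iter (K - j) U (A j N) x = avg U N f x}.
  move=> jL; have [NL|NL] := boolP (N <= L)%N; last by apply: aeW.
  have S := posop_sum p1 (posop_iter p1 (K - j) PU) (fun=> N.+1%:R^-1)
    (fun i (_ : (i < N.+1)%N) => LF (j + i)%N).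
  have T i : {ae mu, forall x, (i < N.+1)%N -> iter (K - j) U (F (j + i)%N) x = iter i U f x}.
    have [iN|iN] := boolP (i < N.+1)%N; last by apply: aeW.
    have -> : F (j + i)%N = iter (K - j - i) W f.
      apply/funext => x; rewrite /F subnDA.
      by have -> : (j + i <= K)%N by rewrite /K; move: iN NL jL; clear; lia.
    have iK : (i <= K - j)%N by rewrite /K; move: iN NL jL; clear; lia.
    by apply: filterS (iter_sub_inverse iK Lf) => x + _.
  rewrite AE; apply: filterS2 S (ae_foralln T) => x -> Tx _.
  rewrite /avg mulr_sumr; apply: eq_big_nat => i /andP[_ iN].
  by rewrite Tx.
have gh j : (j <= L)%N -> {ae mu, forall x, `|g x| <= `|iter (K - j) U (h j) x|}.
  move=> jL.
  have V := posop_vvar p1 L (posop_iter p1 (K - j) PU) q1 (LA j).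
  have N := posop_ge0_norm (posop_iter p1 (K - j) PU) (Lh j) (h0 j).
  have E := ae_foralln (fun N => UA j N jL).
  apply: filterS3 V N E => x Vx Nx Ex.
  rewrite Nx (ger0_norm (powR_ge0 _ _)); apply: le_trans Vx.
  by rewrite /g /vvar (eq_vq q (c' := fun N => iter (K - j) U (A j N) x)) // => N /Ex.
pose w j x := om (K - j)%N x.
have Ig j : (j <= L)%N -> (Ip mu p g <= \int[mu]_x (h j x `^ p * w j x)%:E)%E.
  move=> jL; rewrite -(omE (K - j)%N (h j) (Lh j) (h0 j)).
  by case: (rLp_iter p1 (PU) (K - j) (Lh j)) => mUh _; apply: (Ip_le p1 mg mUh (gh j jL)).
have mhw j : measurable_fun [set: X] (fun x => h j x `^ p * w j x).
  apply: measurable_funM; last exact: mom.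
  by apply: (measurableT_comp (measurable_powR p)); case: (Lh j).
have hw0 j x : 0 <= h j x `^ p * w j x by rewrite mulr_ge0 ?powR_ge0 // ltW ?om0.
have mFw j : measurable_fun [set: X] (fun x => `|F j x| `^ p * w j x).
  apply: measurable_funM; last exact: mom.
  by apply: measurable_norm_powR; case: (LF j).
have Fw0 j x : 0 <= `|F j x| `^ p * w j x by rewrite mulr_ge0 ?powR_ge0 // ltW ?om0.
(* By positivity [|F j|] is at most the image of [|f|] under [i] iterations of [W], which the same
   number of iterations of [U] sends back to [|f|]. *)
have IF j : (j <= K)%N -> (\int[mu]_x (`|F j x| `^ p * w j x)%:E <= Ip mu p f)%E.
  move=> jK; set i := (K - j)%N.
  have FE : F j = iter i W f by apply/funext => x; rewrite /F jK.
  have LFn := rLp_norm p1 (LF j).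
  rewrite -(omE i _ LFn (fun x => normr_ge0 _)).
  have PUi := posop_iter p1 i PU; have PWi := posop_iter p1 i PW.
  have Ln := rLp_norm p1 Lf; have LWn := op_Lp PWi Ln.
  have [mUF _] := op_Lp PUi LFn; have [mf _] := Lf.
  have W_le : {ae mu, forall x, `|F j x| <= iter i W (fun y => `|f y|) x}.
    by rewrite FE; exact (posop_norm_le p1 PWi Lf).
  apply: (Ip_le p1 mUF mf).
  apply: filterS3 (posop_ge0_norm PUi LFn (fun x => normr_ge0 _))
    (posop_le p1 PUi LFn LWn W_le) (iter_inverse i PW PU UW Ln) => x -> le eq.
  by rewrite -eq.
have one : {ae mu, forall x, \sum_(0 <= j < K.+1) h j x `^ p * w j x <=
    D * \sum_(0 <= j < K.+1) `|F j x| `^ p * w j x}.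
  apply: filterS (Aplus_ae K mom om0 omE) => x Ax.
  have := HD K.+1 (fun j => w j x) (F^~ x) L (fun j => om0 _ x) Ax.
  under eq_bigr do rewrite -hE.
  by apply => i; rewrite /F ltnNge => /negbTE ->.
have Ipf0 : (0 <= D%:E * Ip mu p f)%E by apply: mule_ge0; [rewrite lee_fin ltW|exact: Ip_ge0].
have sum1 : (\sum_(0 <= j < L.+1) Ip mu p g <= \sum_(0 <= j < K.+1) D%:E * Ip mu p f)%E.
  apply: (@le_trans _ _ (\sum_(0 <= j < K.+1) \int[mu]_x (h j x `^ p * w j x)%:E)%E).
    rewrite [leRHS](@big_cat_nat _ _ _ L.+1) /=; [|by []|by rewrite /K; clear; lia].
    rewrite -[leLHS]adde0; apply: leeD.
      by rewrite !big_nat; apply: lee_sum => j /andP[_ jL]; exact: Ig.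
    by apply: sume_ge0 => j _; apply: integral_ge0 => x _; rewrite lee_fin.
  rewrite -ge0_integral_sum //; last 2 first.
  - by move=> j; apply/measurable_EFinP.
  - by move=> j x _; rewrite lee_fin.
  apply: (@le_trans _ _ (\int[mu]_x (D * \sum_(0 <= j < K.+1) `|F j x| `^ p * w j x)%:E)%E).
    apply: ae_ge0_le_integral; first exact: measurableT.
    - by move=> x _; apply: sume_ge0 => j _; rewrite lee_fin.
    - by apply: emeasurable_sum => j; apply/measurable_EFinP.
    - by move=> x _; rewrite lee_fin mulr_ge0 ?sumr_ge0 // ltW.
    - by apply/measurable_EFinP; apply: measurable_funM => //; apply: measurable_sum.
    - by apply: filterS one => x ox _; rewrite sumEFin lee_fin.
  under eq_integral do rewrite EFinM -sumEFin.
  rewrite ge0_integralZl_EFin //; last 3 first.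
  - by move=> x _; apply: sume_ge0 => j _; rewrite lee_fin.
  - by apply: emeasurable_sum => j; apply/measurable_EFinP.
  - exact: ltW.
  rewrite ge0_integral_sum //; last 2 first.
  - by move=> j; apply/measurable_EFinP.
  - by move=> j x _; rewrite lee_fin.
  rewrite -ge0_sume_distrr => [|j _]; last exact: Ip_ge0.
  apply: lee_wpmul2l; first by rewrite lee_fin ltW.
  by rewrite !big_nat; apply: lee_sum => j /andP[_ jK]; exact: IF.
rewrite sume_cst ?Ip_ge0 // sume_cst // in sum1.
have L0 : (0 : R) < L.+1%:R by rewrite ltr0n.
rewrite -(@lee_pmul2l _ L.+1%:R%:E) //; apply: (le_trans sum1).
rewrite [((2 * D)%:E)%E]EFinM -(muleA 2%:E) (muleA L.+1%:R%:E) -EFinM.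
apply: lee_wpmul2r; first exact: Ipf0.
by rewrite lee_fin -natrM ler_nat /K; clear; lia.
Qed.

End transference.

Import ComplexField.

(** * Complex L^p and the main equivalence *)

Section complex_numbers.
Variable R : realType.
Implicit Types (z w : R[i]).
Local Notation Re := complex.Re.
Local Notation Im := complex.Im.
Local Notation normc := Normc.normc.

Lemma ReD z w : Re (z + w) = Re z + Re w. Proof. by case: z; case: w. Qed.
Lemma ImD z w : Im (z + w) = Im z + Im w. Proof. by case: z; case: w. Qed.
Lemma ReB z w : Re (z - w) = Re z - Re w. Proof. by case: z; case: w. Qed.
Lemma ImB z w : Im (z - w) = Im z - Im w. Proof. by case: z; case: w. Qed.
Lemma ReM z w : Re (z * w) = Re z * Re w - Im z * Im w.
Proof. by case: z; case: w. Qed.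
Lemma ImM z w : Im (z * w) = Re z * Im w + Im z * Re w.
Proof. by case: z => a b; case: w => c d /=. Qed.

Lemma complex_ext z w : Re z = Re w -> Im z = Im w -> z = w.
Proof. by case: z => a b; case: w => c d /= -> ->. Qed.

Lemma Re_sum n (F : nat -> R[i]) :
  Re (\sum_(0 <= i < n) F i) = \sum_(0 <= i < n) Re (F i).
Proof.
elim: n => [|n IH]; first by rewrite !big_nil.
by rewrite !big_nat_recr //= ReD IH.
Qed.

Lemma Im_sum n (F : nat -> R[i]) :
  Im (\sum_(0 <= i < n) F i) = \sum_(0 <= i < n) Im (F i).
Proof.
elim: n => [|n IH]; first by rewrite !big_nil.
by rewrite !big_nat_recr //= ImD IH.
Qed.

Lemma complex_natV n : (n.+1%:R^-1 : R[i]) = Complex n.+1%:R^-1 0.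
Proof.
have -> : (n.+1%:R : R[i]) = Complex n.+1%:R 0.
  elim: n => [//|n IH]; rewrite -[in LHS]natr1 IH -[in RHS]natr1.
  by apply: complex_ext => /=; rewrite ?addr0.
have n0 : (n.+1%:R : R) != 0 by rewrite pnatr_eq0.
apply: complex_ext => /=; first by rewrite expr0n addr0 expr2 invfM mulrA divff ?mul1r.
by rewrite ?mul0r ?oppr0 ?mul0r.
Qed.

Lemma normc_ge0 z : 0 <= normc z. Proof. by case: z => a b; exact: sqrtr_ge0. Qed.

Lemma Re_le_normc z : `|Re z| <= normc z.
Proof.
case: z => a b /=; rewrite -sqrtr_sqr; apply: ler_wsqrtr.
by rewrite lerDl sqr_ge0.
Qed.

Lemma Im_le_normc z : `|Im z| <= normc z.
Proof.
case: z => a b /=; rewrite -sqrtr_sqr; apply: ler_wsqrtr.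
by rewrite lerDr sqr_ge0.
Qed.

Lemma normc_le_ReIm z : normc z <= `|Re z| + `|Im z|.
Proof.
case: z => a b /=; have s0 : 0 <= `|a| + `|b| by rewrite addr_ge0.
rewrite -[leRHS](ger0_norm s0) -sqrtr_sqr; apply: ler_wsqrtr.
have ab : 0 <= `|a| * `|b| by rewrite mulr_ge0.
rewrite -(real_normK (num_real a)) -(real_normK (num_real b)).
by move: ab; nra.
Qed.

Lemma normc_leB z w : normc w - normc z <= normc (z - w).
Proof.
rewrite lerBlDr -(normcN (z - w)) opprB.
by have := le_normcD (w - z) z; rewrite subrK.
Qed.

Lemma normc_real (a : R) : normc (Complex a 0) = `|a|.
Proof. by rewrite /= expr0n addr0 sqrtr_sqr. Qed.

End complex_numbers.

Section complex_Lp_theory.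
Context d (X : measurableType d) (R : realType).
Variables (mu : {sigma_finite_measure set X -> \bar R}) (p : R).
Hypothesis p1 : 1 < p.
Implicit Types (f g : X -> R[i]) (u v : X -> R).
Local Notation Re := complex.Re.
Local Notation Im := complex.Im.

Definition of_real u x : R[i] := Complex (u x) 0.
Definition re f x : R := Re (f x).
Definition im f x : R := Im (f x).

Lemma measurable_cmod f : measurable_fun [set: X] (re f) ->
  measurable_fun [set: X] (im f) -> measurable_fun [set: X] (cmod f).
Proof.
move=> mr mi.
have -> : cmod f = (fun x => (re f x ^+ 2 + im f x ^+ 2) `^ 2^-1).
  apply/funext => x; rewrite /cmod /re /im; case: (f x) => a b /=.
  by rewrite powR12_sqrt // addr_ge0 ?sqr_ge0.
apply: (measurableT_comp (measurable_powR _)).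
by apply: measurable_funD; exact: measurable_funX.
Qed.

Lemma cLp_norm_powR f : (cLp_norm mu p f `^ p = Ip mu p (cmod f))%E.
Proof.
have p0 : p != 0 by rewrite gt_eqF // (lt_trans ltr01 p1).
by rewrite /cLp_norm poweR_Lnorm.
Qed.

Lemma finite_norm_Ip f : finite_norm mu p%:E (cmod f) = (Ip mu p (cmod f) < +oo)%E.
Proof.
have p0 : p != 0 by rewrite gt_eqF // (lt_trans ltr01 p1).
rewrite -cLp_norm_powR /finite_norm -/(cLp_norm mu p f).
by apply/idP/idP => [/poweR_lty//|]; exact: lty_poweRy.
Qed.

Lemma re_le_cmod f x : `|re f x| <= `|cmod f x|.
Proof. by rewrite (ger0_norm (normc_ge0 (f x))); exact: Re_le_normc. Qed.

Lemma im_le_cmod f x : `|im f x| <= `|cmod f x|.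
Proof. by rewrite (ger0_norm (normc_ge0 (f x))); exact: Im_le_normc. Qed.

Lemma cLp_cmod f : cLp mu p f -> rLp mu p (cmod f).
Proof.
case=> mr mi; rewrite finite_norm_Ip => fin.
exact (conj (measurable_cmod mr mi) fin).
Qed.

Lemma cLp_re f : cLp mu p f -> rLp mu p (re f).
Proof.
move=> Lf; have [mr _ _] := Lf.
exact (rLp_dom p1 mr (cLp_cmod Lf) (aeW mu (re_le_cmod f))).
Qed.

Lemma cLp_im f : cLp mu p f -> rLp mu p (im f).
Proof.
move=> Lf; have [_ mi _] := Lf.
exact (rLp_dom p1 mi (cLp_cmod Lf) (aeW mu (im_le_cmod f))).
Qed.

Lemma cLpI f : rLp mu p (re f) -> rLp mu p (im f) -> cLp mu p f.
Proof.
move=> Lr Li; have [mr _] := Lr; have [mi _] := Li.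
have mc := measurable_cmod mr mi.
have LS := rLpD p1 (rLp_norm p1 Lr) (rLp_norm p1 Li).
have dom : {ae mu, forall x, `|cmod f x| <= `| `|re f x| + `|im f x| |}.
  apply: aeW => x; rewrite (ger0_norm (normc_ge0 (f x))).
  exact: le_trans (normc_le_ReIm _) (ler_norm _).
have [_ fin] := rLp_dom p1 mc LS dom.
split; [exact mr|exact mi|by rewrite finite_norm_Ip].
Qed.

Lemma cLp_of_real u : rLp mu p u -> cLp mu p (of_real u).
Proof. by move=> Lu; apply: cLpI; [exact Lu|exact (rLp0 mu p1)]. Qed.

Section real_part.
Variable T : (X -> R[i]) -> (X -> R[i]).
Hypothesis opT : Lp_operator mu p T.

Definition realop u : X -> R := re (T (of_real u)).

Lemma operator_bound : exists2 M : R, 0 <= M & forall f, cLp mu p f ->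
  (Ip mu p (cmod (T f)) <= M%:E * Ip mu p (cmod f))%E.
Proof.
have [_ _ _ [M HM]] := opT; have p0 := lt_trans ltr01 p1.
have M0 : 0 <= Num.max M 0 by rewrite le_max lexx orbT.
exists (Num.max M 0 `^ p); first exact: powR_ge0.
move=> f Lf; rewrite -!cLp_norm_powR -poweR_EFin -poweRM ?lee_fin ?Lnorm_ge0 //.
have N0 : (0 <= cLp_norm mu p f)%E by exact: Lnorm_ge0.
have H : (cLp_norm mu p (T f) <= (Num.max M 0)%:E * cLp_norm mu p f)%E.
  apply: (le_trans (HM f Lf)); apply: lee_wpmul2r => //.
  by rewrite lee_fin le_max lexx.
apply: gt0_ler_poweR H; first exact: ltW.
- by rewrite in_itv /= leey andbT Lnorm_ge0.
- by rewrite in_itv /= leey andbT mule_ge0 // lee_fin.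
Qed.

Lemma T_lin (a : R[i]) f g : cLp mu p f -> cLp mu p g ->
  {ae mu, forall x, T (fun y => a * f y + g y) x = a * T f x + T g x}.
Proof. by case: opT => _ _ lin _; exact: lin. Qed.

Lemma T_cLp f : cLp mu p f -> cLp mu p (T f).
Proof. by case: opT => h _ _ _; exact: h. Qed.

Lemma T_ext f g : cLp mu p f -> cLp mu p g -> {ae mu, forall x, f x = g x} ->
  {ae mu, forall x, T f x = T g x}.
Proof. by case: opT => _ h _ _; exact: h. Qed.

Hypothesis posT : Lp_positive mu p T.

Lemma posop_realop : posop mu p realop.
Proof.
have [M M0 HM] := operator_bound.
split.
- by move=> u Lu; exact (cLp_re (T_cLp (cLp_of_real Lu))).
- move=> u v Lu Lv uv.
  apply: filterS (T_ext (cLp_of_real Lu) (cLp_of_real Lv) _) => [x|].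
    by rewrite /realop /re => ->.
  by apply: filterS uv => x; rewrite /of_real => ->.
- move=> a u v Lu Lv.
  have := T_lin (Complex a 0) (cLp_of_real Lu) (cLp_of_real Lv).
  have -> : (fun y => Complex a 0 * of_real u y + of_real v y) =
      of_real (fun y => a * u y + v y).
    apply/funext => y; apply: complex_ext; rewrite ?ReD ?ImD ?ReM ?ImM /=; ring.
  by apply: filterS => x; rewrite /realop /re => ->; rewrite ReD ReM /= mul0r subr0.
- move=> u Lu u0.
  apply: filterS (posT (cLp_of_real Lu) _) => [x|].
    by rewrite lecE => /andP[].
  by apply: filterS u0 => x ux; rewrite lecE /= eqxx.
- exists M => // u Lu; have Lc := cLp_of_real Lu.
  have [mr _] := cLp_re (T_cLp Lc); have [mc _] := cLp_cmod (T_cLp Lc).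
  apply: (le_trans (Ip_le p1 mr mc (aeW mu (re_le_cmod _)))).
  have := HM _ Lc; congr (_ <= _ * _)%E.
  by rewrite -(Ip_norm mu p u); congr Ip; apply/funext => x; exact: normc_real.
Qed.

Lemma T_nonneg_real u : rLp mu p u -> (forall x, 0 <= u x) ->
  {ae mu, forall x, im (T (of_real u)) x = 0}.
Proof.
move=> Lu u0.
apply: filterS (posT (cLp_of_real Lu) _) => [x|].
  by rewrite lecE => /andP[/eqP].
by apply: aeW => x; rewrite lecE /= eqxx u0.
Qed.

(** Positivity makes the images of the positive and the negative part of [u] real. Thus [T] acts
    separately on real and imaginary parts through [realop]. *)
Lemma T_of_real u : rLp mu p u ->
  {ae mu, forall x, T (of_real u) x = Complex (realop u x) 0}.
Proof.
move=> Lu; have Ln := rLp_norm p1 Lu.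
have Lp := rLpZ 2^-1 (rLpD p1 Ln Lu).
have Lm := rLpZ 2^-1 (rLpD p1 Ln (rLpZ (-1) Lu)).
have p0 x : 0 <= 2^-1 * (`|u x| + u x).
  by rewrite mulr_ge0 ?invr_ge0 ?ler0n // -lerBlDr sub0r ler_normr lexx orbT.
have m0 x : 0 <= 2^-1 * (`|u x| + -1 * u x).
  by rewrite mulr_ge0 ?invr_ge0 ?ler0n // mulN1r subr_ge0 ler_norm.
have := T_lin (Complex (-1) 0) (cLp_of_real Lm) (cLp_of_real Lp).
set g := (X in T X).
have -> : g = of_real u.
  by apply/funext => y; apply: complex_ext; rewrite /g ?ReD ?ImD ?ReM ?ImM /=; field.
apply: filterS3 (T_nonneg_real Lp p0) (T_nonneg_real Lm m0) => x ip im' E.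
apply: complex_ext => //=; rewrite E ImD ImM; move: ip im'; rewrite /im => -> ->.
by rewrite /= mulr0 mul0r !addr0.
Qed.

Lemma T_re_im f : cLp mu p f ->
  {ae mu, forall x, T f x = Complex (realop (re f) x) (realop (im f) x)}.
Proof.
move=> Lf; have Lr := cLp_re Lf; have Li := cLp_im Lf.
have := T_lin (Complex 0 1) (cLp_of_real Li) (cLp_of_real Lr).
set g := (X in T X).
have -> : g = f.
  apply/funext => y; apply: complex_ext; rewrite /g /re /im ?ReD ?ImD ?ReM ?ImM /=; ring.
apply: filterS3 (T_of_real Lr) (T_of_real Li) => x r i ->.
by rewrite r i; apply: complex_ext; rewrite ?ReD ?ImD ?ReM ?ImM /=; ring.
Qed.

Lemma cLp_iter n f : cLp mu p f -> cLp mu p (iter n T f).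
Proof. by move=> Lf; elim: n => //= n; exact: T_cLp. Qed.

Lemma iter_re_im n f : cLp mu p f -> {ae mu, forall x,
  re (iter n T f) x = iter n realop (re f) x /\
  im (iter n T f) x = iter n realop (im f) x}.
Proof.
move=> Lf; have PR := posop_realop; elim: n => [|n IH]; first exact: aeW.
have Ln := cLp_iter n Lf.
have Ir : {ae mu, forall x, re (iter n T f) x = iter n realop (re f) x}.
  by apply: filterS IH => x [].
have Ii : {ae mu, forall x, im (iter n T f) x = iter n realop (im f) x}.
  by apply: filterS IH => x [].
have er := op_ext PR (cLp_re Ln) (rLp_iter p1 PR n (cLp_re Lf)) Ir.
have ei := op_ext PR (cLp_im Ln) (rLp_iter p1 PR n (cLp_im Lf)) Ii.
apply: filterS3 (T_re_im Ln) er ei => x E r i.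
by rewrite /re /im /= E /= -r -i.
Qed.

Lemma re_ergodic_avg N f :
  re (ergodic_avg T N f) = (fun x => \sum_(0 <= n < N.+1) N.+1%:R^-1 * re (iter n T f) x).
Proof.
by apply/funext => x; rewrite /re /ergodic_avg complex_natV ReM /= mul0r subr0 Re_sum mulr_sumr.
Qed.

Lemma im_ergodic_avg N f :
  im (ergodic_avg T N f) = (fun x => \sum_(0 <= n < N.+1) N.+1%:R^-1 * im (iter n T f) x).
Proof.
by apply/funext => x; rewrite /im /ergodic_avg complex_natV ImM /= mul0r addr0 Im_sum mulr_sumr.
Qed.

Lemma cLp_ergodic_avg N f : cLp mu p f -> cLp mu p (ergodic_avg T N f).
Proof.
move=> Lf; apply: cLpI; [rewrite re_ergodic_avg|rewrite im_ergodic_avg].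
  exact (rLp_sum p1 (fun=> N.+1%:R^-1) (fun i (_ : (i < N.+1)%N) => cLp_re (cLp_iter i Lf))).
exact (rLp_sum p1 (fun=> N.+1%:R^-1) (fun i (_ : (i < N.+1)%N) => cLp_im (cLp_iter i Lf))).
Qed.

Lemma ergodic_avg_re_im N f : cLp mu p f -> {ae mu, forall x,
  re (ergodic_avg T N f) x = avg realop N (re f) x /\
  im (ergodic_avg T N f) x = avg realop N (im f) x}.
Proof.
move=> Lf; apply: filterS (ae_foralln (fun n => iter_re_im n Lf)) => x H.
rewrite re_ergodic_avg im_ergodic_avg !avgE.
by split; apply: eq_bigr => n _; have [rn in'] := H n; rewrite ?rn ?in'.
Qed.

Lemma mean_bounded_realop : mean_bounded mu p T -> exists2 C : R, 0 < C &
  forall N u, rLp mu p u -> (Ip mu p (avg realop N u) <= C%:E * Ip mu p u)%E.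
Proof.
move=> [C C0 HC]; exists C => // N u Lu; have Lc := cLp_of_real Lu.
have La := cLp_ergodic_avg N Lc.
have [ma _] := rLp_avg p1 posop_realop N Lu.
have [mc _] := cLp_cmod La.
have le : {ae mu, forall x, `|avg realop N u x| <= `|cmod (ergodic_avg T N (of_real u)) x|}.
  by apply: filterS (ergodic_avg_re_im N Lc) => x [<- _]; exact: re_le_cmod.
apply: (le_trans (Ip_le p1 ma mc le)).
have IpE f : (\int[mu]_x (cmod f x `^ p)%:E = Ip mu p (cmod f))%E.
  by apply: eq_integral => x _; rewrite (ger0_norm (normc_ge0 (f x))).
have := HC _ Lc; rewrite IpE => H.
have -> : Ip mu p u = Ip mu p (cmod (of_real u)).
  by rewrite -(Ip_norm mu p u); congr Ip; apply/funext => x; rewrite -normc_real.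
apply: le_trans H; rewrite -IpE; apply: ereal_sup_ubound.
by exists N.
Qed.
End real_part.

Lemma realop_inverse T S : Lp_operator mu p T -> Lp_positive mu p T -> Lp_operator mu p S ->
  (forall f, cLp mu p f -> {ae mu, forall x, S (T f) x = f x}) ->
  forall u, rLp mu p u -> {ae mu, forall x, realop S (realop T u) x = u x}.
Proof.
move=> opT posT opS ST u Lu; have Lc := cLp_of_real Lu; have LT := T_cLp opT Lc.
have E : {ae mu, forall x, of_real (realop T u) x = T (of_real u) x}.
  by apply: filterS (T_of_real opT posT Lu) => x ->.
have LR : cLp mu p (of_real (realop T u)) := cLp_of_real (cLp_re LT).
apply: filterS2 (T_ext opS LR LT E) (ST _ Lc) => x.
by rewrite /realop /re => -> ->.
Qed.

End complex_Lp_theory.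

(** * Infinite sequences of indices against finite variations *)

Section vnorm_bounds.
Variable R : realType.
Implicit Types (q p : R) (a : nat -> R[i]) (c : nat -> R).

Lemma vq_homo q c L L' : (L <= L')%N -> vq q c L <= vq q c L'.
Proof.
move=> LL; apply: vq_le => [|x l xl lL]; first exact: vq_ge0.
by apply: le_vq => //; exact: leq_trans lL LL.
Qed.

Lemma sum_le_vq q c (N : nat -> nat) n : {homo N : i j / (i < j)%N} ->
  \sum_(0 <= j < n) `|c (N j) - c (N j.+1)| `^ q <= vq q c (N n).
Proof.
move=> N_lt.
have vs i : vsum q c (N i) (map N (iota i.+1 n)) =
    \sum_(i <= j < i + n) `|c (N j) - c (N j.+1)| `^ q.
  elim: n i => [|n IH] i; first by rewrite addn0 big_geq.
  by rewrite /= IH big_ltn ?addSnnS // addnS ltnS leq_addr.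
rewrite -{1}[n]add0n -vs; apply: le_vq.
  have pth i m : path ltn (N i) (map N (iota i.+1 m)).
    by elim: m i => [//|m IH] i /=; rewrite IH N_lt.
  exact: pth.
have lst i m : last (N i) (map N (iota i.+1 m)) = N (i + m)%N.
  by elim: m i => [|m IH] i /=; rewrite ?addn0 // IH addSnnS.
by rewrite lst.
Qed.

Lemma vnorm_ge0 q a : (0 <= vnorm q a)%E.
Proof.
apply: (@le_trans _ _ ((\sum_(0 <= j <oo)
    (Normc.normc (a (id j) - a (id j.+1)) `^ q)%:E) `^ q^-1)%E); first exact: poweR_ge0.
by apply: ereal_sup_ubound; exists id.
Qed.

Lemma normc_le_vnorm q a N : 0 < q ->
  ((Normc.normc (a 0%N - a N.+1))%:E <= vnorm q a)%E.
Proof.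
(* The sequence [0, N.+1, N.+2, ...]; its first term alone gives the bound. *)
move=> q0; pose K j := if j is j'.+1 then (N.+1 + j')%N else 0%N.
have K_lt : {homo K : i j / (i < j)%N}.
  by move=> [|i] [|j] //=; rewrite ?ltn_add2l // => _; rewrite addSn.
have KE : ((\sum_(0 <= j <oo) (Normc.normc (a (K j) - a (K j.+1)) `^ q)%:E) `^ q^-1 <=
    vnorm q a)%E by apply: ereal_sup_ubound; exists K.
apply: le_trans KE.
have s0 j : (0 <= (Normc.normc (a (K j) - a (K j.+1)) `^ q)%:E)%E.
  by rewrite lee_fin powR_ge0.
have -> : (Normc.normc (a 0%N - a N.+1))%:E =
    ((\sum_(0 <= j < 1) (Normc.normc (a (K j) - a (K j.+1)) `^ q)%:E) `^ q^-1)%E.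
  rewrite big_nat1 poweR_EFin /= addn0 -powRrM divff ?gt_eqF // powRr1 //.
  exact: normc_ge0.
apply: gt0_ler_poweR; first by rewrite invr_ge0 ltW.
- by rewrite in_itv /= leey andbT sume_ge0.
- by rewrite in_itv /= leey andbT; apply: nneseries_ge0 => j _ _; exact: s0.
- by apply: nneseries_lim_ge => j _ _; exact: s0.
Qed.

(** A partial sum along an index sequence only sees finitely many indices. The bound [M] is an
    extended real because it will be a pointwise limit of finite variations. *)
Lemma vnorm_powR_le q p a (M : \bar R) : 0 < q -> 0 < p ->
  (forall L, ((2 `^ p * 2 `^ (p / q) *
     (vq q (fun N => complex.Re (a N)) L `^ (p / q) +
      vq q (fun N => complex.Im (a N)) L `^ (p / q)))%:E <= M)%E) ->
  (vnorm q a `^ p <= M)%E.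
Proof.
move=> q0 p0 HM.
have M0 : (0 <= M)%E.
  by apply: le_trans (HM 0%N); rewrite lee_fin !mulr_ge0 ?addr_ge0 ?powR_ge0.
have -> : M = ((M `^ p^-1) `^ p)%E by rewrite -poweRrM mulVf ?gt_eqF // poweRe1.
apply: gt0_ler_poweR; first exact: ltW.
- by rewrite in_itv /= leey andbT vnorm_ge0.
- by rewrite in_itv /= leey andbT poweR_ge0.
apply: ge_ereal_sup => _ [N N_lt <-].
have -> : (p^-1 = (q / p) * q^-1)%R by rewrite mulrAC divff ?mul1r // gt_eqF.
rewrite poweRrM; apply: gt0_ler_poweR; first by rewrite invr_ge0 ltW.
- by rewrite in_itv /= leey andbT; apply: nneseries_ge0 => j _ _; rewrite lee_fin powR_ge0.
- by rewrite in_itv /= leey andbT poweR_ge0.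
apply: lime_le; first by apply: is_cvg_nneseries => j _ _; rewrite lee_fin powR_ge0.
apply: nearW => n.
pose A := vq q (fun N => complex.Re (a N)) (N n).
pose B := vq q (fun N => complex.Im (a N)) (N n).
have A0 : 0 <= A by exact: vq_ge0.
have B0 : 0 <= B by exact: vq_ge0.
apply: (@le_trans _ _ (2 `^ q * (A + B))%:E).
  rewrite sumEFin lee_fin; apply: (@le_trans _ _ (\sum_(0 <= j < n) 2 `^ q *
      (`|complex.Re (a (N j)) - complex.Re (a (N j.+1))| `^ q +
       `|complex.Im (a (N j)) - complex.Im (a (N j.+1))| `^ q))).
    apply: ler_sum => j _; rewrite -ReB -ImB.
    apply: (le_trans (powR_le (ltW q0) (normc_ge0 _) (normc_le_ReIm _))).
    exact: powRD_le (ltW q0) (normr_ge0 _) (normr_ge0 _).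
  rewrite -mulr_sumr big_split /=; apply: ler_wpM2l; first exact: powR_ge0.
  by apply: lerD; [exact: (sum_le_vq q (fun N => complex.Re (a N)) n N_lt)|
    exact: (sum_le_vq q (fun N => complex.Im (a N)) n N_lt)].
have -> : ((2 `^ q * (A + B))%:E =
    ((2 `^ q * (A + B)) `^ (p / q))%:E `^ (q / p))%E.
  rewrite poweR_EFin -powRrM mulrA mulfVK ?gt_eqF // divff ?gt_eqF // powRr1 //.
  by rewrite mulr_ge0 ?powR_ge0 ?addr_ge0.
apply: gt0_ler_poweR; first by rewrite divr_ge0 // ltW.
- by rewrite in_itv /= leey andbT lee_fin powR_ge0.
- by rewrite in_itv /= leey andbT.
apply: le_trans (HM (N n)); rewrite lee_fin.
have pq0 : 0 <= p / q by rewrite divr_ge0 // ltW.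
rewrite powRM ?powR_ge0 ?addr_ge0 // -powRrM mulrCA divff ?gt_eqF // mulr1 -mulrA.
apply: ler_wpM2l; first exact: powR_ge0.
exact: powRD_le pq0 A0 B0.
Qed.

End vnorm_bounds.

Section nonmeasurable_integrand.
Context d (X : measurableType d) (R : realType).
Variable mu : {measure set X -> \bar R}.
Local Open Scope ereal_scope.

(* The integral of a nonnegative [f] is the supremum of the integrals of the simple
   functions below [f], even if [f] is not measurable. *)
Lemma le_integral_nonneg (f g : X -> \bar R) : (forall x, 0 <= f x) ->
  (forall x, f x <= g x) -> \int[mu]_x f x <= \int[mu]_x g x.
Proof.
move=> f0 fg; have g0 x : 0 <= g x := le_trans (f0 x) (fg x).
rewrite !ge0_integralTE //; apply: ereal_sup_le => _ [h hf <-].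
by exists h => // x; exact: le_trans (hf x) (fg x).
Qed.

(** Setting [g] to [+oo] on the exceptional null set keeps its integral and makes the inequality
    hold everywhere, so [f] may stay nonmeasurable. *)
Lemma ae_le_integral_nonneg (f g : X -> \bar R) : (forall x, 0 <= f x) ->
  (forall x, 0 <= g x) -> measurable_fun [set: X] g ->
  {ae mu, forall x, f x <= g x} -> \int[mu]_x f x <= \int[mu]_x g x.
Proof.
move=> f0 g0 mg [A [mA A0 NA]].
pose g' x := if x \in A then +oo else g x.
have mg' : measurable_fun [set: X] g'.
  apply: measurable_fun_ifT => //.
  apply: (measurable_fun_bool true); rewrite setTI.
  by have -> : (in_mem^~ (mem A)) @^-1` [set true] = A by apply/seteqP; split=> x /=; [exact: set_mem|exact: mem_set].
have -> : \int[mu]_x g x = \int[mu]_x g' x.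
  apply: ae_eq_integral => //.
  exists A; split=> // x /=; rewrite /g'; case: (boolP (x \in A)) => [/set_mem//|_ []//].
apply: le_integral_nonneg => // x; rewrite /g'.
case: (boolP (x \in A)) => [_|xA]; first exact: leey.
apply: contrapT => nfg; move/negP: xA; apply; apply/mem_set; exact: NA.
Qed.

End nonmeasurable_integrand.

Section main_implications.
Context d (X : measurableType d) (R : realType).
Variables (mu : {sigma_finite_measure set X -> \bar R}) (p : R).
Hypothesis p1 : 1 < p.
Variables T S : (X -> R[i]) -> (X -> R[i]).
Hypotheses (opT : Lp_operator mu p T) (posT : Lp_positive mu p T).
Hypotheses (invS : Lp_inverse mu p T S) (posS : Lp_positive mu p S).

Lemma Ip_cmod (f : X -> R[i]) : (\int[mu]_x (cmod f x `^ p)%:E)%E = Ip mu p (cmod f).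
Proof. by apply: eq_integral => x _; rewrite (ger0_norm (normc_ge0 (f x))). Qed.

(** The variation is dominated almost everywhere by the increasing limit of the measurable functions
    [G L], built from finite variations of the real and imaginary parts; the bounds uniform in [L]
    pass to the limit by monotone convergence. *)
Lemma mean_to_variation q : 2 < q -> mean_bounded mu p T -> variation_bounded mu p T q.
Proof.
move=> q2 mb; have p0 : 0 < p := lt_trans ltr01 p1.
have q1 : 1 < q by apply: lt_trans q2; rewrite ltr1n.
have q0 : 0 < q := lt_trans ltr01 q1.
have [opS ST TS] := invS.
have [C C0 HC] := mean_bounded_realop p1 opT posT mb.
have PU := posop_realop p1 opT posT; have PW := posop_realop p1 opS posS.
have WU := realop_inverse p1 opT posT opS ST; have UW := realop_inverse p1 opS posS opT TS.
have [D D0 HD] := variation_avg_bounded p1 PU PW WU UW C0 HC q2.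
pose c0 : R := 2 `^ p * 2 `^ (p / q).
have c00 : 0 < c0 by rewrite mulr_gt0 ?powR_gt0.
exists (c0 * (2 * D)); first by rewrite !mulr_gt0.
move=> f Lf; have Lr := cLp_re p1 Lf; have Li := cLp_im p1 Lf.
have [mc _] := cLp_cmod p1 Lf.
pose v L u := vvar q (fun N => avg (realop T) N u) L.
have Lv L u : rLp mu p u -> rLp mu p (v L u).
  by move=> Lu; exact (rLp_vvar p1 L q1 (fun N => rLp_avg p1 PU N Lu)).
pose G L x : \bar R := (c0 * (`|v L (re f) x| `^ p + `|v L (im f) x| `^ p))%:E.
have mG L : measurable_fun [set: X] (G L).
  apply/measurable_EFinP; apply: measurable_funM => //; apply: measurable_funD.
    by apply: measurable_norm_powR; case: (Lv L _ Lr).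
  by apply: measurable_norm_powR; case: (Lv L _ Li).
have G0 L x : (0 <= G L x)%E by rewrite lee_fin mulr_ge0 ?addr_ge0 ?powR_ge0 // ltW.
have v_homo u x L L' : (L <= L')%N -> `|v L u x| `^ p <= `|v L' u x| `^ p.
  move=> LL; apply: (powR_le (ltW p0)); first exact: normr_ge0.
  rewrite !(ger0_norm (powR_ge0 _ _)); apply: powR_le; last exact: vq_homo.
    by rewrite invr_ge0 ltW.
  exact: vq_ge0.
have G_homo x : {homo G^~ x : L L' / (L <= L')%N >-> (L <= L')%E}.
  move=> L L' LL; rewrite lee_fin.
  exact (ler_wpM2l (ltW c00) (lerD (v_homo _ x _ _ LL) (v_homo _ x _ _ LL))).
have Gcvg x : (G L x @[L --> \oo] --> ereal_sup (range (G^~ x)))%E.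
  exact: ereal_nondecreasing_cvgn.
have Glim x L : (G L x <= limn (G^~ x))%E.
  by rewrite (cvg_lim _ (Gcvg x)) //; apply: ereal_sup_ubound; exists L.
have vE u L x : vq q (fun N => avg (realop T) N u x) L `^ (p / q) = `|v L u x| `^ p.
  by rewrite (ger0_norm (powR_ge0 _ _)) /v /vvar -powRrM mulrC.
have dom : {ae mu, forall x, (ergodic_variation q T f x `^ p <= limn (G^~ x))%E}.
  apply: filterS (ae_foralln (fun N => ergodic_avg_re_im p1 opT posT N Lf)) => x Ex.
  apply: (vnorm_powR_le q0 p0) => L; apply: le_trans (Glim x L).
  have er : vq q (fun N => complex.Re (ergodic_avg T N f x)) L =
      vq q (fun N => avg (realop T) N (re f) x) L by apply: eq_vq => N _; case: (Ex N).
  have ei : vq q (fun N => complex.Im (ergodic_avg T N f x)) L =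
      vq q (fun N => avg (realop T) N (im f) x) L by apply: eq_vq => N _; case: (Ex N).
  by rewrite er ei !vE.
have mlim : measurable_fun [set: X] (fun x => limn (G^~ x)).
  apply: (emeasurable_fun_cvg G _ mG) => x _.
  by rewrite (cvg_lim _ (Gcvg x)).
have lim0 x : (0 <= limn (G^~ x))%E := le_trans (G0 0%N x) (Glim x 0%N).
apply: (le_trans (ae_le_integral_nonneg (fun x => poweR_ge0 _ _) lim0 mlim dom)).
rewrite (monotone_convergence mu measurableT mG (fun L x _ => G0 L x) (fun x _ => G_homo x)).
apply: lime_le.
  apply: ereal_nondecreasing_is_cvgn => L L' LL.
  exact (le_integral_nonneg mu (G0 L) (fun x => G_homo x L L' LL)).
apply: nearW => L; rewrite Ip_cmod.
have mv u : rLp mu p u -> measurable_fun [set: X] (fun x => (`|v L u x| `^ p)%:E).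
  by move=> Lu; apply: measurable_Ip; case: (Lv L u Lu).
have -> : (\int[mu]_x G L x = c0%:E * (Ip mu p (v L (re f)) + Ip mu p (v L (im f))))%E.
  rewrite /Ip -(ge0_integralD mu measurableT (fun x _ => Ip_pt_ge0 p _ x) (mv _ Lr)
    (fun x _ => Ip_pt_ge0 p _ x) (mv _ Li)).
  rewrite -ge0_integralZl_EFin //.
  - by move=> x _; apply: adde_ge0; exact: Ip_pt_ge0.
  - by apply: emeasurable_funD; apply: mv.
  - exact: ltW.
have [mr _] := Lr; have [mi _] := Li.
have ler := Ip_le p1 mr mc (aeW mu (re_le_cmod f)).
have lei := Ip_le p1 mi mc (aeW mu (im_le_cmod f)).
rewrite [((c0 * (2 * D))%:E)%E]EFinM -muleA.
apply: lee_wpmul2l; first by rewrite lee_fin ltW.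
rewrite mulr_natl mulr2n EFinD ge0_muleDl ?lee_fin ?(ltW D0) //.
by apply: leeD; [apply: (le_trans (HD L _ Lr))|apply: (le_trans (HD L _ Li))];
  apply: lee_wpmul2l; rewrite ?lee_fin ?(ltW D0).
Qed.

Lemma variation_to_mean q : 2 < q -> variation_bounded mu p T q -> mean_bounded mu p T.
Proof.
move=> q2 [C C0 HC]; have p0 : 0 < p := lt_trans ltr01 p1.
have q0 : 0 < q by apply: lt_trans q2; rewrite ltr0n.
pose c0 : R := 2 `^ p.
have c00 : 0 < c0 by rewrite powR_gt0.
exists (c0 * (1 + C)); first by rewrite mulr_gt0 // addr_gt0.
move=> f Lf; apply: ge_ereal_sup => _ [N _ <-].
have La := cLp_ergodic_avg p1 opT N Lf.
have [mf _] := cLp_cmod p1 Lf; have [ma _] := cLp_cmod p1 La.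
(* A measurable function below the variation: it replaces the variation so that the integral of a
   sum can be split. *)
pose W x := Num.max (cmod (ergodic_avg T N f) x - cmod f x) 0.
have mW : measurable_fun [set: X] W.
  by apply: measurable_maxr => //; exact: measurable_funB.
have W0 x : 0 <= W x by rewrite /W le_max lexx orbT.
have avg0 : ergodic_avg T 0 f = f.
  by apply/funext => x; rewrite /ergodic_avg big_nat1 invr1 mul1r.
have WV x : ((W x)%:E <= ergodic_variation q T f x)%E.
  have V0 : (0 <= ergodic_variation q T f x)%E by exact: vnorm_ge0.
  rewrite /W /Num.max; case: ifP => // _.
  case: N @W mW W0 La ma => [|N] _ _ _ _ _; first by rewrite avg0 subrr.
  apply: le_trans (normc_le_vnorm (fun N => ergodic_avg T N f x) N q0).
  by rewrite lee_fin avg0; exact: normc_leB.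
have IW : (\int[mu]_x (W x `^ p)%:E <= C%:E * Ip mu p (cmod f))%E.
  rewrite -Ip_cmod; apply: le_trans (HC f Lf).
  apply: le_integral_nonneg => x; first by rewrite lee_fin powR_ge0.
  rewrite -poweR_EFin; apply: gt0_ler_poweR (WV x); first exact: ltW.
  - by rewrite in_itv /= leey andbT lee_fin.
  - by rewrite in_itv /= leey andbT; exact: vnorm_ge0.
rewrite !Ip_cmod.
have mcp : measurable_fun [set: X] (fun x => (`|cmod f x| `^ p)%:E) by exact: measurable_Ip.
have mWp : measurable_fun [set: X] (fun x => (W x `^ p)%:E).
  by apply/measurable_EFinP; exact: (measurableT_comp (measurable_powR p)).
have W_ge0 x : (0 <= (W x `^ p)%:E)%E by rewrite lee_fin powR_ge0.
apply: (@le_trans _ _ (\int[mu]_x (c0%:E * ((`|cmod f x| `^ p)%:E + (W x `^ p)%:E)))%E).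
  apply: le_integral_nonneg => x; first exact: Ip_pt_ge0.
  rewrite -EFinD -EFinM lee_fin.
  apply: (@le_trans _ _ ((`|cmod f x| + W x) `^ p)).
    apply: (powR_le (ltW p0)); first exact: normr_ge0.
    rewrite !(ger0_norm (normc_ge0 _)) -lerBlDl.
    by rewrite /W le_max lexx.
  exact: powRD_le (ltW p0) (normr_ge0 _) (W0 x).
rewrite ge0_integralZl_EFin //; last 3 first.
- by move=> x _; apply: adde_ge0; [exact: Ip_pt_ge0|exact: W_ge0].
- exact: emeasurable_funD.
- exact: ltW.
rewrite (ge0_integralD mu measurableT (fun x _ => Ip_pt_ge0 p _ x) mcp (fun x _ => W_ge0 x) mWp).
rewrite [((c0 * (1 + C))%:E)%E]EFinM -muleA.
apply: lee_wpmul2l; first by rewrite lee_fin ltW.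
rewrite EFinD ge0_muleDl ?lee_fin ?ler01 ?(ltW C0) // mul1e.
exact: leeD2l.
Qed.

End main_implications.

Theorem proposition5p2 (R : realType) (d : measure_display)
    (X : measurableType d) (mu : {sigma_finite_measure set X -> \bar R})
    (p : R) (T : (X -> R[i]) -> (X -> R[i]))
    (p_gt1 : 1 < p)
    (T_bounded : Lp_operator mu p T)
    (T_positive : Lp_positive mu p T)
    (T_invertible : exists2 S : (X -> R[i]) -> (X -> R[i]),
       Lp_inverse mu p T S & Lp_positive mu p S) :
  (mean_bounded mu p T <->
     (forall q : R, 2 < q -> variation_bounded mu p T q)) /\
  (mean_bounded mu p T <->
     (exists2 q : R, 2 < q & variation_bounded mu p T q)).
Proof.
have [S invS posS] := T_invertible.
(* Any exponent above 2 would serve as the witness. *)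
have q3 : (2 : R) < 3 by rewrite ltr_nat.
have mv q (q2 : 2 < q) := mean_to_variation p_gt1 T_bounded T_positive invS posS q2.
have vm q (q2 : 2 < q) := variation_to_mean p_gt1 T_bounded q2.
split; split.
- by move=> mb q q2; exact: mv.
- by move=> H; exact: (vm _ q3 (H _ q3)).
- by move=> mb; exists 3 => //; exact: mv.
- by move=> [q q2 H]; exact: (vm _ q2 H).
Qed.
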